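(* Suppose that $\xi,\eta\in\mathbb{C}$ satisfy $|\Im\eta|<\Re\xi$ and $|\Im\xi|<\Re\eta$. Let $\sigma\in\mathbb{C}$ be such that $|\Re\sigma|<\frac34$. Then $$J_1\left(\tfrac12(\xi^2+\eta^2)\right)=\frac{i\,2^{1/2}(\xi^2+\eta^2)}{\pi^2\xi\eta}\int_{\sigma-i\infty}^{\sigma+i\infty}\Gamma\left(\tfrac34-s\right)\Gamma\left(\tfrac34+s\right)\left[D_{2s-\frac12}((1-i)\xi)D_{-2s-\frac12}((1-i)\eta)+D_{2s-\frac12}((1+i)\xi)D_{-2s-\frac12}((1+i)\eta)\right]ds .$$
   Context: $\Gamma$ is Euler's gamma function and $J_\nu$ is the Bessel function of the first kind, $J_\nu=\frac12\left(H_\nu^{(1)}+H_\nu^{(2)}\right)$ with $H_\nu^{(1)},H_\nu^{(2)}$ the Hankel functions. The parabolic cylinder function is $D_\nu(z)=2^{\nu/2}e^{-z^2/4}U\left(-\frac{\nu}{2},\frac12,\frac12z^2\right)$ (with $\arg(z^2)=2\arg z$, extended analytically), which is analytic for all $\nu,z\in\mathbb{C}$; here $U(a,b,z)$ is the confluent hypergeometric function of the second kind, the solution of $z w''+(b-z)w'-aw=0$ with $U(a,b,z)\sim z^{-a}$ as $z\to\infty$ in $|\arg z|\le\frac32\pi-\delta$ ($\delta>0$). The integral is along the vertical line through $\sigma$. *)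

(* Defs.v *)
(* Stdlib world: the classical reals with Coquelicot's complex numbers C. *)
From Stdlib Require Export Reals Factorial.
From Stdlib Require Import ClassicalEpsilon.
From Coquelicot Require Export Coquelicot.

Open Scope R_scope.
Open Scope C_scope.

Definition Cexp (z : C) : C :=
  RtoC (exp (Re z)) * (cos (Im z), sin (Im z)).

(* Principal argument, in (-PI, PI], and principal logarithm, for z <> 0. *)
Definition Carg (z : C) : R :=
  if Rlt_dec (Im z) 0
  then Ropp (acos (Re z / Cmod z)%R)
  else acos (Re z / Cmod z)%R.

Definition Clog (z : C) : C := (ln (Cmod z), Carg z).

Definition CSeries (a : nat -> C) : C :=
  (Series (fun k => Re (a k)), Series (fun k => Im (a k))).

(* Euler's integral, convergent for 0 < Re z. *)
Definition GammaInt (z : C) : C :=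
  RInt_gen (V := C_R_CompleteNormedModule)
    (fun t : R => Cexp ((z - 1) * RtoC (ln t)) * RtoC (exp (- t)))
    (at_right 0) (Rbar_locally p_infty).

(* z (z + 1) ... (z + n - 1) *)
Fixpoint Crising (z : C) (n : nat) : C :=
  match n with
  | O => 1
  | S m => Crising z m * (z + RtoC (INR m))
  end.

(* Continued to the left by Gamma z = Gamma (z + n) / (z (z+1) ... (z+n-1)),
   where n is the least natural number with 0 < Re (z + n); thus n = 0 when
   0 < Re z.  At the poles z = 0, -1, -2, ... the value is 0 by the convention
   for division. *)
Definition Gamma (z : C) : C :=
  let n := Z.to_nat (up (Ropp (Re z))) in
  GammaInt (z + RtoC (INR n)) / Crising z n.

(* Bessel function of the first kind of integer order n >= 0 (entire in z). *)
Definition BesselJ (n : nat) (z : C) : C :=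
  CSeries (fun k =>
    RtoC (((-1) ^ k) / (INR (fact k) * INR (fact (n + k))))%R
      * (z / 2) ^ (2 * k + n)).

(* The confluent hypergeometric function U(a, b, z) is multivalued in z, with
   branches indexed by arg z; it is represented by the function u of
   x = log z, i.e. z = exp x and arg z = Im x ranges over all of R.
   Since d/dx = z d/dz, the functions w1 and w2 below are the first and second
   derivatives of u with respect to z, so the third clause is
   z w'' + (b - z) w' - a w = 0.  The last clause is u ~ z^(-a) as z tends to
   infinity, uniformly in |arg z| <= 3 PI / 2 - delta. *)
Definition is_confluentU (a b : C) (u : C -> C) : Prop :=
  (exists w1 w2 : C -> C, forall x : C,
      is_derive (K := C_AbsRing) (V := C_NormedModule) u x (Cexp x * w1 x) /\
      is_derive (K := C_AbsRing) (V := C_NormedModule) w1 x (Cexp x * w2 x) /\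
      Cexp x * w2 x + (b - Cexp x) * w1 x - a * u x = 0) /\
  (forall delta : R, (0 < delta)%R ->
   forall eps : R, (0 < eps)%R ->
   exists M : R, forall x : C,
      (M < Re x)%R -> (Rabs (Im x) <= 3 * PI / 2 - delta)%R ->
      (Cmod (u x / Cexp (- a * x) - 1) < eps)%R).

(* confluentU a b x is U(a, b, exp x) on the branch arg (exp x) = Im x. *)
Definition confluentU (a b : C) : C -> C :=
  epsilon (inhabits (fun _ : C => RtoC 0)) (is_confluentU a b).

(* 2^(nu/2) e^(-z^2/4) U(-nu/2, 1/2, z^2/2) for z <> 0, the branch of U being
   given by arg (z^2) = 2 arg z: the logarithm of z^2/2 is 2 log z - ln 2. *)
Definition pcfD_nonzero (nu z : C) : C :=
  Cexp (nu / 2 * RtoC (ln 2)) * Cexp (- (z ^ 2) / 4)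
    * confluentU (- nu / 2) (1 / 2) (2 * Clog z - RtoC (ln 2)).

(* The parabolic cylinder function, z = 0 being a removable singularity. *)
Definition pcfD (nu z : C) : C :=
  if excluded_middle_informative (z = 0)
  then C_lim (pcfD_nonzero nu) 0
  else pcfD_nonzero nu z.

(* The integral of f along the vertical line through sigma, upwards, with
   s = sigma + i t and ds = i dt; it is improper at both ends. *)
Definition ex_vertical_integral (f : C -> C) (sigma : C) : Prop :=
  ex_RInt_gen (V := C_R_NormedModule)
    (fun t : R => f (sigma + Ci * RtoC t) * Ci)
    (Rbar_locally m_infty) (Rbar_locally p_infty).

Definition vertical_integral (f : C -> C) (sigma : C) : C :=
  RInt_gen (V := C_R_CompleteNormedModule)
    (fun t : R => f (sigma + Ci * RtoC t) * Ci)
    (Rbar_locally m_infty) (Rbar_locally p_infty).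

(* Main.v *)
Require Import Defs.
From Stdlib Require Import Lra Lia ClassicalEpsilon FunctionalExtensionality.

(** For the first of the two products of the integrand, put A(s, xi) = Gamma(3/4 - s) D_(2s-1/2)((1-i) xi)
    ([AA]), so that this product is A(s, xi) A(-s, eta) ([FF]). The second product is its complex
    conjugate, taken at the conjugates of s, xi and eta. Hence everything reduces to the integral I of
    A(s, xi) A(-s, eta) along a vertical line.

    When xi and eta lie in the open first quadrant, both factors are Laplace transforms, in which
    t = Im s enters only through a phase: A(s, xi) is an elementary factor times the integral of
    a(v) e^(i t p(v)) dv, where p(v) = log (1 + e^(-v)) ([AA_laplace]). Parseval's formula in the variable
    p ([parseval]) leaves a single integral, which is a multiple of
      xi eta int_1^oo e^(izx) sqrt (x^2 - 1) dx,   z = (xi^2 + eta^2) / 2   ([FF_quadrant]).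
    Turning the path of integration to [1, 0] and [0, i oo) ([NN_quadrant]) gives
      - i int_0^(pi/2) e^(iz cos p) sin^2 p dp - int_0^oo e^(-zu) sqrt (1 + u^2) du,
    which is holomorphic for Re z > 0. In the sum of both products the second integrals cancel and the
    first ones give int cos (z cos p) sin^2 p dp ([two_ray_value]), which is Poisson's integral for
    J_1(z) ([BesselJ1_SS]).

    The remaining xi and eta are reached by analytic continuation ([FF_value]), for which I must
    converge locally uniformly. As a function of xi, A solves A'' = (4 i s - xi^2) A. With
    w = sqrt (1 + |t|), energy estimates in the direction of Im xi and the maximum principle in that of
    Re xi show that A grows at most like e^(2 w |Im xi|), and decreases like e^(-2 w Re xi) when t < 0
    ([AA_growth], [AA_decay]). The product therefore decreases exponentially in w as soon as
    |Im xi| < Re eta and |Im eta| < Re xi, and these are the hypotheses of the theorem. Unique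
    continuation is derived from Cauchy's formula, itself a case of Green's formula ([green],
    [vanish_on_disc]).

    The function U is given by its differential equation and its behaviour at infinity, so that
    existence and uniqueness have to come first. It is constructed from the integral of
    exp (- z t - t^2/2) t^(m-1) ([is_confluentU_UE]), whose behaviour in the whole sector is found by
    turning the path ([E_asymptotic]). It is unique because another solution with the same behaviour
    would produce a Wronskian growing like e^z ([ksys_recessive]). *)

(** * Complex numbers and derivatives *)

Lemma C_ext (z w : C) : Re z = Re w -> Im z = Im w -> z = w.
Proof. destruct z, w; simpl; intros; subst; reflexivity. Qed.

Ltac ceq := apply C_ext; simpl.
Ltac dring := cbv beta; ring.
Ltac reim := unfold Re, Im; simpl; ring.
Ltac triangle := eapply Rle_trans; [apply Cmod_triangle|].
Lemma Re_plus z w : Re (z + w) = (Re z + Re w)%R. Proof. reflexivity. Qed.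
Lemma Im_plus z w : Im (z + w) = (Im z + Im w)%R. Proof. reflexivity. Qed.
Lemma Re_le_Cmod z : Re z <= Cmod z.
Proof. eapply Rle_trans; [apply Rle_abs | apply re_le_Cmod]. Qed.

Lemma Im_le_Cmod z : Rabs (Im z) <= Cmod z.
Proof. eapply Rle_trans; [|apply Rmax_Cmod]. apply Rmax_r. Qed.

Lemma Cmod_le_sum z : Cmod z <= Rabs (Re z) + Rabs (Im z).
Proof.
  replace z with (RtoC (Re z) + Ci * RtoC (Im z)) at 1 by (ceq; ring).
  triangle.
  rewrite Cmod_mult, Cmod_Ci, !Cmod_R. lra.
Qed.

Lemma Cmod_minus_sym z w : Cmod (z - w) = Cmod (w - z).
Proof. rewrite <- Cmod_opp. f_equal. ring. Qed.

Lemma Cmod_triangle_inv z w : Cmod z - Cmod w <= Cmod (z - w).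
Proof.
  assert (H := Cmod_triangle (z - w) w).
  replace (z - w + w) with z in H by ring. lra.
Qed.

Lemma Cmod_sqr z : (Cmod z * Cmod z = Re z * Re z + Im z * Im z)%R.
Proof. assert (H := Cmod2_alt z). simpl in H. lra. Qed.

Lemma Cplus_minus_cancel (z w : C) : z + (w - z) = w.
Proof. ring. Qed.

Lemma Cexp_plus z w : Cexp (z + w) = Cexp z * Cexp w.
Proof.
  unfold Cexp. rewrite Re_plus, Im_plus, exp_plus.
  ceq; [rewrite cos_plus | rewrite sin_plus]; ring.
Qed.

Lemma Cexp_0 : Cexp 0 = 1.
Proof. unfold Cexp. simpl. rewrite exp_0, cos_0, sin_0. ceq; ring. Qed.

Lemma Cexp_R r : Cexp (RtoC r) = RtoC (exp r).
Proof. unfold Cexp. simpl. rewrite cos_0, sin_0. ceq; ring. Qed.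

Lemma Cexp_opp z : Cexp (- z) * Cexp z = 1.
Proof. rewrite <- Cexp_plus. replace (- z + z) with (RtoC 0) by ring. apply Cexp_0. Qed.

Lemma Cmod_Cexp z : Cmod (Cexp z) = exp (Re z).
Proof.
  unfold Cexp. rewrite Cmod_mult, Cmod_R, (Rabs_pos_eq (exp _)) by (left; apply exp_pos).
  replace (Cmod (cos (Im z), sin (Im z))) with 1%R; [ring|].
  unfold Cmod. symmetry. transitivity (sqrt 1); [|apply sqrt_1]. f_equal. simpl.
  generalize (sin2_cos2 (Im z)). unfold Rsqr, Im. lra.
Qed.

Lemma Cexp_neq_0 z : Cexp z <> 0.
Proof. apply Cmod_gt_0. rewrite Cmod_Cexp. apply exp_pos. Qed.

Lemma Cexp_conj z : Cconj (Cexp z) = Cexp (Cconj z).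
Proof.
  unfold Cexp. rewrite re_conj, im_conj, cos_neg, sin_neg. ceq; ring.
Qed.

(** ** Derivatives along the real line and in the complex plane *)

Definition dR (f : R -> C) (t : R) (l : C) : Prop :=
  is_derive (K := R_AbsRing) (V := C_R_NormedModule) f t l.

Definition dC (f : C -> C) (z l : C) : Prop :=
  is_derive (K := C_AbsRing) (V := C_NormedModule) f z l.

Lemma normR (z : C) : norm (V := C_R_NormedModule) z = Cmod z.
Proof. symmetry. apply Cmod_norm. Qed.

Lemma dR_intro f t l :
  is_derive (fun x => Re (f x)) t (Re l) -> is_derive (fun x => Im (f x)) t (Im l) ->
  dR f t l.
Proof.
  intros [_ H1] [_ H2]. split; [apply is_linear_scal_l|].
  intros x Hx. specialize (H1 x Hx). specialize (H2 x Hx).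
  intros eps.
  assert (e2 : 0 < eps / 2) by (generalize (cond_pos eps); lra).
  generalize (filter_and _ _ (H1 (mkposreal _ e2)) (H2 (mkposreal _ e2))).
  apply filter_imp. intros y [A B]. simpl in A, B.
  rewrite normR. refine (Rle_trans _ _ _ (Cmod_le_sum (minus (minus (f y) (f x)) (scal (V := C_R_NormedModule) (minus y x) l))) _).
  refine (Rle_trans _ _ _ (Rplus_le_compat _ _ _ _ A B) _).
  assert (Q : forall n, eps / 2 * n + eps / 2 * n <= eps * n) by (intros; lra). apply Q.
Qed.

Lemma dR_eps (f : R -> C) (t : R) (l : C) : dR f t l -> forall eps, 0 < eps -> exists d, 0 < d /\
  forall h, Rabs h < d -> Cmod (f (t + h)%R - f t - RtoC h * l) <= eps * Rabs h.
Proof.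
  intros [_ H] eps He. specialize (H t (fun P HP => HP) (mkposreal eps He)).
  destruct H as [d Hd]. exists d. split; [apply cond_pos|]. intros h Hh.
  specialize (Hd (t + h)%R). 
  rewrite <- normR.
  replace (f (t+h)%R - f t - RtoC h * l) with (minus (minus (f (t+h)%R) (f t)) (scal (minus (t+h)%R t) l)).
  - replace (Rabs h) with (norm (minus (t+h) t))%R.
    + apply Hd. change (Rabs ((t + h) - t) < d). replace (t + h - t)%R with h by ring. exact Hh.
    + change (Rabs ((t + h) - t) = Rabs h)%R. f_equal. ring.
  - apply C_ext; cbn; ring.
Qed.

Lemma dC_eps (f : C -> C) (z l : C) : dC f z l -> forall eps, 0 < eps -> exists d, 0 < d /\
  forall h, Cmod h < d -> Cmod (f (z + h)%C - f z - h * l) <= eps * Cmod h.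
Proof.
  intros [_ H] eps He. specialize (H z (fun P HP => HP) (mkposreal eps He)).
  apply locally_C in H.
  destruct H as [d Hd]. exists d. split; [apply cond_pos|]. intros h Hh.
  specialize (Hd (z + h)). 
  replace (f (z+h) - f z - h * l) with (f (z+h) - f z - (z + h - z) * l) by ring.
  change (f (z+h) - f z - (z + h - z) * l) with (minus (minus (f (z+h)) (f z)) (scal (minus (z+h) z) l)).
  replace (Cmod h) with (Cmod (z + h - z)) by (f_equal; ring).
  apply Hd. apply (C_NormedModule_mixin_compat1 z (z+h) d).
  change (Cmod (z + h - z) < d). replace (z + h - z) with h by ring. exact Hh.
Qed.

Lemma dR_Re f t l : dR f t l -> is_derive (fun x => Re (f x)) t (Re l).
Proof.
  intros H. split; [apply is_linear_scal_l|].
  intros x Hx. destruct H as [_ H]. specialize (H x Hx).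
  intros eps. specialize (H eps). revert H. apply filter_imp. intros y Hy.
  eapply Rle_trans; [|exact Hy]. rewrite normR.
  exact (re_le_Cmod (minus (minus (f y) (f x)) (scal (minus y x) l))).
Qed.

Lemma dR_Im f t l : dR f t l -> is_derive (fun x => Im (f x)) t (Im l).
Proof.
  intros H. split; [apply is_linear_scal_l|].
  intros x Hx. destruct H as [_ H]. specialize (H x Hx).
  intros eps. specialize (H eps). revert H. apply filter_imp. intros y Hy.
  eapply Rle_trans; [|exact Hy]. rewrite normR.
  exact (Im_le_Cmod (minus (minus (f y) (f x)) (scal (minus y x) l))).
Qed.

Lemma dC_intro_eps (f : C -> C) (z l : C) : (forall eps, 0 < eps -> exists d, 0 < d /\
  forall h, Cmod h < d -> Cmod (f (z + h)%C - f z - h * l) <= eps * Cmod h) -> dC f z l.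
Proof.
  intros H. split; [apply is_linear_scal_l|].
  intros x Hx. rewrite <- (is_filter_lim_locally_unique _ _ Hx) by idtac.
  intros eps. destruct (H eps (cond_pos eps)) as [d [Hd Hh]].
  apply locally_C. 
  assert (d2 : 0 < d / sqrt 2) by (apply Rdiv_lt_0_compat; [lra|apply Rlt_sqrt2_0]).
  exists (mkposreal _ d2). intros y Hy.
  apply (C_NormedModule_mixin_compat2 z y) in Hy. simpl in Hy.
  replace (sqrt 2 * (d / sqrt 2))%R with d in Hy by (field; apply Rgt_not_eq, Rlt_sqrt2_0).
  specialize (Hh (y - z) Hy). rewrite (Cplus_minus_cancel z y) in Hh. exact Hh.
Qed.

(** For functions given by integrals, holomorphy is established through such a quadratic
    remainder. *)
Lemma dC_quad (f : C -> C) (z l : C) (K r : R) : 0 < r ->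
  (forall h, Cmod h <= r -> Cmod (f (z + h)%C - f z - h * l) <= K * (Cmod h * Cmod h)) ->
  dC f z l.
Proof.
  intros Hr H. apply dC_intro_eps. intros eps He.
  exists (Rmin r (eps / (Rabs K + 1)))%R.
  assert (HK : 0 < Rabs K + 1) by (generalize (Rabs_pos K); lra).
  split. { apply Rmin_pos; [lra|]. apply Rdiv_lt_0_compat; lra. }
  intros h Hh. 
  assert (h1 : Cmod h < r) by (eapply Rlt_le_trans; [exact Hh|apply Rmin_l]).
  assert (h2 : Cmod h < eps / (Rabs K + 1)) by (eapply Rlt_le_trans; [exact Hh|apply Rmin_r]).
  eapply Rle_trans; [apply H; lra|].
  assert (h0 := Cmod_ge_0 h).
  rewrite <- Rmult_assoc. apply Rmult_le_compat_r; [lra|].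
  apply Rle_trans with ((Rabs K + 1) * Cmod h)%R.
  - apply Rmult_le_compat_r; [lra|]. generalize (Rle_abs K); lra.
  - apply Rmult_lt_compat_l with (r := (Rabs K + 1)%R) in h2; [|lra].
    replace ((Rabs K + 1) * (eps / (Rabs K + 1)))%R with eps in h2 by (field; lra). lra.
Qed.

Lemma dR_ext f g t l : (forall x, f x = g x) -> dR f t l -> dR g t l.
Proof. intros H. apply is_derive_ext. exact H. Qed.

Lemma dR_eq f t l l' : dR f t l -> l = l' -> dR f t l'.
Proof. intros H <-. exact H. Qed.

Lemma dC_ext f g t l : (forall x, f x = g x) -> dC f t l -> dC g t l.
Proof. intros H. apply is_derive_ext. exact H. Qed.

Lemma dC_eq f t l l' : dC f t l -> l = l' -> dC f t l'.
Proof. intros H <-. exact H. Qed.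

Lemma dR_const c t : dR (fun _ => c) t 0.
Proof. apply (is_derive_const (V := C_R_NormedModule)). Qed.

Lemma dR_RtoC f t l : is_derive f t l -> dR (fun x => RtoC (f x)) t (RtoC l).
Proof. intros H. apply dR_intro; simpl; [exact H|]. apply (is_derive_const (V:=R_NormedModule)). Qed.

Lemma dR_id t : dR (fun x => RtoC x) t 1.
Proof. apply dR_RtoC. apply (is_derive_id (K:=R_AbsRing)). Qed.

Lemma dR_plus f g t a b : dR f t a -> dR g t b -> dR (fun x => f x + g x) t (a + b).
Proof. apply (is_derive_plus (V := C_R_NormedModule)). Qed.

Lemma dR_opp f t a : dR f t a -> dR (fun x => - f x) t (- a).
Proof. apply (is_derive_opp (V := C_R_NormedModule)). Qed.

Lemma dR_minus f g t a b : dR f t a -> dR g t b -> dR (fun x => f x - g x) t (a - b).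
Proof. apply (is_derive_minus (V := C_R_NormedModule)). Qed.

Lemma Rd_mult (f g : R -> R) t a b : is_derive f t a -> is_derive g t b ->
  is_derive (fun x => f x * g x)%R t (a * g t + f t * b)%R.
Proof. intros H1 H2. exact (is_derive_mult (K:=R_AbsRing) f g t a b H1 H2 Rmult_comm). Qed.

Lemma Rd_exp (f : R -> R) t a : is_derive f t a -> is_derive (fun x => exp (f x)) t (a * exp (f t))%R.
Proof. intros H. apply (is_derive_comp exp f t _ _ (is_derive_exp _) H). Qed.

Lemma Rd_cos (f : R -> R) t a : is_derive f t a -> is_derive (fun x => cos (f x)) t (- (a * sin (f t)))%R.
Proof.
  intros H. replace (- (a * sin (f t)))%R with (a * - sin (f t))%R by ring.
  apply (is_derive_comp cos f t _ _ (is_derive_cos _) H).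
Qed.

Lemma Rd_sin (f : R -> R) t a : is_derive f t a -> is_derive (fun x => sin (f x)) t (a * cos (f t))%R.
Proof. intros H. apply (is_derive_comp sin f t _ _ (is_derive_sin _) H). Qed.

Lemma dR_mult f g t a b : dR f t a -> dR g t b ->
  dR (fun x => f x * g x) t (a * g t + f t * b).
Proof.
  intros Hf Hg.
  assert (H1 := dR_Re _ _ _ Hf). assert (H2 := dR_Im _ _ _ Hf).
  assert (H3 := dR_Re _ _ _ Hg). assert (H4 := dR_Im _ _ _ Hg).
  apply dR_intro.
  - replace (Re (a * g t + f t * b)) with
      ((Re a * Re (g t) + Re (f t) * Re b) - (Im a * Im (g t) + Im (f t) * Im b))%R
      by reim.
    exact (is_derive_minus _ _ _ _ _ (Rd_mult _ _ _ _ _ H1 H3) (Rd_mult _ _ _ _ _ H2 H4)).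
  - replace (Im (a * g t + f t * b)) with
      ((Re a * Im (g t) + Re (f t) * Im b) + (Im a * Re (g t) + Im (f t) * Re b))%R
      by reim.
    exact (is_derive_plus _ _ _ _ _ (Rd_mult _ _ _ _ _ H1 H4) (Rd_mult _ _ _ _ _ H2 H3)).
Qed.

Lemma dR_Cexp f t a : dR f t a -> dR (fun x => Cexp (f x)) t (a * Cexp (f t)).
Proof.
  intros Hf. assert (H1 := dR_Re _ _ _ Hf). assert (H2 := dR_Im _ _ _ Hf).
  apply dR_intro.
  - apply (is_derive_ext (fun x => exp (Re (f x)) * cos (Im (f x)))%R).
    { intros x. unfold Cexp. simpl. ring. }
    replace (Re (a * Cexp (f t))) with
      (Re a * exp (Re (f t)) * cos (Im (f t)) + exp (Re (f t)) * - (Im a * sin (Im (f t))))%R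
      by (unfold Cexp, Re, Im; simpl; ring).
    exact (Rd_mult _ _ _ _ _ (Rd_exp _ _ _ H1) (Rd_cos _ _ _ H2)).
  - apply (is_derive_ext (fun x => exp (Re (f x)) * sin (Im (f x)))%R).
    { intros x. unfold Cexp. simpl. ring. }
    replace (Im (a * Cexp (f t))) with
      (Re a * exp (Re (f t)) * sin (Im (f t)) + exp (Re (f t)) * (Im a * cos (Im (f t))))%R
      by (unfold Cexp, Re, Im; simpl; ring).
    exact (Rd_mult _ _ _ _ _ (Rd_exp _ _ _ H1) (Rd_sin _ _ _ H2)).
Qed.

Lemma dR_comp_R (f : R -> C) (g : R -> R) t l g' :
  dR f (g t) l -> is_derive g t g' -> dR (fun x => f (g x)) t (RtoC g' * l).
Proof.
  intros Hf Hg. eapply dR_eq; [exact (is_derive_comp f g t l g' Hf Hg)|].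
  apply C_ext; cbn; ring.
Qed.

Lemma minus_scal_real (a b : C) (r : R) (l : C) :
  a - b - RtoC r * l = minus (minus a b) (scal (V := C_R_NormedModule) r l).
Proof. apply C_ext; cbn; ring. Qed.

Lemma Rplus_minus_cancel (t y : R) : (t + (y - t))%R = y.
Proof. ring. Qed.

Lemma dR_comp (f : C -> C) (g : R -> C) t l g' :
  dC f (g t) l -> dR g t g' -> dR (fun x => f (g x)) t (g' * l).
Proof.
  intros Hf Hg. 
  assert (E : forall eps, 0 < eps -> exists d, 0 < d /\ forall h, Rabs h < d ->
    (Cmod (f (g (t + h)%R) - f (g t) - RtoC h * (g' * l)) <= eps * Rabs h)).
  { intros eps He.
    assert (P1 : 0 < Cmod g' + 1) by (generalize (Cmod_ge_0 g'); lra).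
    assert (P2 : 0 < Cmod l + 1) by (generalize (Cmod_ge_0 l); lra).
    destruct (dC_eps _ _ _ Hf (eps / 2 / (Cmod g' + 1))%R) as [d1 [Hd1 H1]].
    { repeat apply Rdiv_lt_0_compat; lra. }
    destruct (dR_eps _ _ _ Hg (Rmin 1 (eps / 2 / (Cmod l + 1)))%R) as [d2 [Hd2 H2]].
    { apply Rmin_pos; [lra|]. repeat apply Rdiv_lt_0_compat; lra. }
    exists (Rmin d2 (d1 / (Cmod g' + 1)))%R. split.
    { apply Rmin_pos; [lra|]. apply Rdiv_lt_0_compat; lra. }
    intros h Hh.
    assert (h1 : Rabs h < d2) by (eapply Rlt_le_trans; [exact Hh|apply Rmin_l]).
    assert (h2 : Rabs h < d1 / (Cmod g' + 1)) by (eapply Rlt_le_trans; [exact Hh|apply Rmin_r]).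
    specialize (H2 h h1). set (k := g (t + h)%R - g t) in *.
    assert (hp := Rabs_pos h).
    assert (Hk : Cmod k <= (Cmod g' + 1) * Rabs h).
    { replace k with ((k - RtoC h * g') + RtoC h * g') by ring.
      triangle. rewrite (Cmod_mult (RtoC h)), Cmod_R.
      assert (Cmod (k - RtoC h * g') <= 1 * Rabs h).
      { eapply Rle_trans; [exact H2|]. apply Rmult_le_compat_r; [lra|apply Rmin_l]. }
      lra. }
    assert (Hk2 : Cmod k < d1).
    { eapply Rle_lt_trans; [exact Hk|]. apply Rmult_lt_compat_l with (r := (Cmod g' + 1)%R) in h2; [|lra].
      replace ((Cmod g' + 1) * (d1 / (Cmod g' + 1)))%R with d1 in h2 by (field; lra). exact h2. }
    specialize (H1 k Hk2). replace (g t + k) with (g (t+h)%R) in H1 by (unfold k; ring).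
    replace (f (g (t + h)%R) - f (g t) - RtoC h * (g' * l))
      with ((f (g (t + h)%R) - f (g t) - k * l) + (k - RtoC h * g') * l) by ring.
    triangle.
    rewrite Cmod_mult.
    assert (A : Cmod (f (g (t + h)%R) - f (g t) - k * l) <= eps / 2 * Rabs h).
    { eapply Rle_trans; [exact H1|].
      apply Rle_trans with (eps / 2 / (Cmod g' + 1) * ((Cmod g' + 1) * Rabs h))%R.
      - apply Rmult_le_compat_l; [left; repeat apply Rdiv_lt_0_compat; lra|exact Hk].
      - right. field. lra. }
    assert (B : Cmod (k - RtoC h * g') * Cmod l <= eps / 2 * Rabs h).
    { apply Rle_trans with ((eps / 2 / (Cmod l + 1)) * Rabs h * (Cmod l + 1))%R.
      - apply Rmult_le_compat; try apply Cmod_ge_0; [|lra].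
        eapply Rle_trans; [exact H2|]. apply Rmult_le_compat_r; [lra|apply Rmin_r].
      - right. field. lra. }
    lra. }
  split; [apply is_linear_scal_l|].
  intros x Hx. rewrite <- (is_filter_lim_locally_unique _ _ Hx) by idtac.
  intros eps. destruct (E eps (cond_pos eps)) as [d [Hd H]].
  exists (mkposreal d Hd). intros y Hy. specialize (H (y - t)%R Hy).
  rewrite (Rplus_minus_cancel t y) in H.
  rewrite normR.
  match goal with |- (Cmod ?x <= _) => replace x with (f (g y) - f (g t) - RtoC (y - t)%R * (g' * l)) end.
  exact H. apply (minus_scal_real (f (g y)) (f (g t)) (y - t)%R (g' * l)).
Qed.

Lemma Rderiv_nonpos (f f' : R -> R) (a b : R) : a <= b ->
  (forall t, a <= t <= b -> is_derive f t (f' t)) ->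
  (forall t, a <= t <= b -> f' t <= 0) -> f b <= f a.
Proof.
  intros Hab Hd Hn.
  destruct (MVT_gen f a b f') as [c [Hc E]].
  - intros x. rewrite Rmin_left, Rmax_right by lra. intros Hx. apply Hd; lra.
  - intros x. rewrite Rmin_left, Rmax_right by lra. intros Hx.
    apply continuity_pt_filterlim. apply (ex_derive_continuous (V:=R_NormedModule)). eexists. apply Hd; lra.
  - rewrite Rmin_left, Rmax_right in Hc by lra.
    assert (f' c * (b - a) <= 0); [|lra].
    specialize (Hn c Hc). nra.
Qed.

(** Mean value inequality against a real majorant: project on the direction of
    the increment and apply the real mean value theorem. *)
Lemma mean_value_ineq (f f' : R -> C) (g g' : R -> R) (a b : R) : a <= b ->
  (forall t, a <= t <= b -> dR f t (f' t)) ->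
  (forall t, a <= t <= b -> is_derive g t (g' t)) ->
  (forall t, a <= t <= b -> Cmod (f' t) <= g' t) ->
  Cmod (f b - f a) <= g b - g a.
Proof.
  intros Hab Hf Hg Hb. set (w := f b - f a).
  destruct (Req_dec (Cmod w) 0) as [E|E].
  { rewrite E. assert (- g b <= - g a); [|lra].
    apply (Rderiv_nonpos (fun t => - g t)%R (fun t => - g' t)%R a b Hab).
    - intros t Ht. apply (is_derive_opp (V:=R_NormedModule)). auto.
    - intros t Ht. specialize (Hb t Ht). generalize (Cmod_ge_0 (f' t)). lra. }
  assert (Hw : 0 < Cmod w) by (generalize (Cmod_ge_0 w); lra).
  assert (H : Re (Cconj w * f b) - Cmod w * g b <= Re (Cconj w * f a) - Cmod w * g a).
  { apply (Rderiv_nonpos (fun t => Re (Cconj w * f t) - Cmod w * g t)%R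
      (fun t => Re (Cconj w * f' t) - Cmod w * g' t)%R a b Hab).
    - intros t Ht. apply (is_derive_minus (V:=R_NormedModule)).
      + apply (dR_Re (fun t => Cconj w * f t)). eapply dR_eq; [apply dR_mult; [apply dR_const|apply Hf; auto]|dring].
      + apply (is_derive_scal g). auto.
    - intros t Ht. assert (Re (Cconj w * f' t) <= Cmod w * Cmod (f' t)).
      { eapply Rle_trans; [apply Re_le_Cmod|]. rewrite Cmod_mult, Cmod_conj. lra. }
      specialize (Hb t Ht). nra. }
  assert (E2 : (Re (Cconj w * f b) - Re (Cconj w * f a) = Cmod w * Cmod w)%R).
  { rewrite Cmod_sqr. unfold w. simpl. unfold Re, Im. simpl. ring. }
  apply Rmult_le_reg_l with (Cmod w); [exact Hw|]. lra.
Qed.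

Lemma mean_value_const (f f' : R -> C) (K : R) (a b : R) : a <= b ->
  (forall t, a <= t <= b -> dR f t (f' t)) ->
  (forall t, a <= t <= b -> Cmod (f' t) <= K) ->
  Cmod (f b - f a) <= K * (b - a).
Proof.
  intros Hab Hf Hb. 
  replace (K * (b - a))%R with (K * b - K * a)%R by ring.
  apply (mean_value_ineq f f' (fun t => K * t)%R (fun _ => K)); auto.
  intros t _. auto_derive; [trivial|dring].
Qed.

Lemma taylor2 (f f1 f2 : R -> C) (K : R) :
  (forall t, 0 <= t <= 1 -> dR f t (f1 t)) ->
  (forall t, 0 <= t <= 1 -> dR f1 t (f2 t)) ->
  (forall t, 0 <= t <= 1 -> Cmod (f2 t) <= K) ->
  Cmod (f 1 - f 0 - f1 0) <= K.
Proof.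
  intros H1 H2 HK.
  assert (B : forall t, 0 <= t <= 1 -> Cmod (f1 t - f1 0%R) <= K).
  { intros t Ht. apply Rle_trans with (K * (t - 0))%R.
    - apply (mean_value_const f1 f2); try lra; intros; [apply H2|apply HK]; lra.
    - specialize (HK 0%R ltac:(lra)). generalize (Cmod_ge_0 (f2 0%R)). nra. }
  replace (f 1%R - f 0%R - f1 0%R) with ((f 1%R - RtoC 1 * f1 0%R) - (f 0%R - RtoC 0 * f1 0%R)) by ring.
  replace K with (K * (1 - 0))%R by ring.
  apply (mean_value_const (fun t => f t - RtoC t * f1 0%R) (fun t => f1 t - f1 0%R)); try lra; auto.
  intros t Ht. eapply dR_eq; [apply dR_minus; [apply H1; lra|apply dR_mult; [apply dR_id|apply dR_const]]|dring].
Qed.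

Lemma Cexp_taylor1 h : Cmod (Cexp h - 1) <= Cmod h * exp (Rmax 0 (Re h)).
Proof.
  assert (D : forall t, dR (fun t => Cexp (RtoC t * h)) t (h * Cexp (RtoC t * h))).
  { intros t. eapply dR_eq; [apply dR_Cexp; apply dR_mult; [apply dR_id|apply dR_const]|dring]. }
  assert (H := mean_value_const (fun t => Cexp (RtoC t * h)) _ (Cmod h * exp (Rmax 0 (Re h))) 0 1
    ltac:(lra) (fun t _ => D t)).
  cbv beta in H. rewrite Cmult_1_l, Cmult_0_l, Cexp_0 in H.
  rewrite Rminus_0_r, Rmult_1_r in H. apply H.
  intros t Ht. rewrite Cmod_mult, Cmod_Cexp. apply Rmult_le_compat_l; [apply Cmod_ge_0|].
  assert (E : Re (RtoC t * h) <= Rmax 0 (Re h)).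
  { simpl. generalize (Rmax_l 0 (Re h)) (Rmax_r 0 (Re h)). unfold Re. nra. }
  destruct E as [E|E]; [left; apply exp_increasing; exact E|right; rewrite E; reflexivity].
Qed.

Lemma exp_le a b : a <= b -> exp a <= exp b.
Proof. intros [H|H]; [left; apply exp_increasing; exact H|right; rewrite H; reflexivity]. Qed.

Lemma Cexp_taylor2 h : Cmod (Cexp h - 1 - h) <= Cmod h * Cmod h * exp (Rmax 0 (Re h)).
Proof.
  assert (D : forall t, dR (fun t => Cexp (RtoC t * h)) t (h * Cexp (RtoC t * h))).
  { intros t. eapply dR_eq; [apply dR_Cexp; apply dR_mult; [apply dR_id|apply dR_const]|dring]. }
  assert (H := taylor2 (fun t => Cexp (RtoC t * h)) (fun t => h * Cexp (RtoC t * h))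
    (fun t => h * (h * Cexp (RtoC t * h))) (Cmod h * Cmod h * exp (Rmax 0 (Re h))) (fun t _ => D t)).
  cbv beta in H. rewrite Cmult_1_l, Cmult_0_l, Cexp_0, Cmult_1_r in H. apply H.
  - intros t _. eapply dR_eq; [apply dR_mult; [apply dR_const|apply D]|dring].
  - intros t Ht. rewrite !Cmod_mult, Cmod_Cexp, Rmult_assoc.
    repeat (apply Rmult_le_compat_l; [apply Cmod_ge_0|]).
    apply exp_le. simpl. generalize (Rmax_l 0 (Re h)) (Rmax_r 0 (Re h)). unfold Re. nra.
Qed.

Lemma dC_alt f z l :
  dC f z l <-> is_derive (K:=C_AbsRing) (V:=AbsRing_NormedModule C_AbsRing) f z l.
Proof. split; intros [_ H]; (split; [apply is_linear_scal_l|exact H]). Qed.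

Lemma dC_const c z : dC (fun _ => c) z 0.
Proof. apply (is_derive_const (K:=C_AbsRing) (V := C_NormedModule)). Qed.

Lemma dC_id z : dC (fun x => x) z 1.
Proof. apply dC_alt. apply (is_derive_id (K:=C_AbsRing)). Qed.

Lemma dC_plus f g t a b : dC f t a -> dC g t b -> dC (fun x => f x + g x) t (a + b).
Proof. apply (is_derive_plus (K:=C_AbsRing) (V := C_NormedModule)). Qed.

Lemma dC_opp f t a : dC f t a -> dC (fun x => - f x) t (- a).
Proof. apply (is_derive_opp (K:=C_AbsRing) (V := C_NormedModule)). Qed.

Lemma dC_minus f g t a b : dC f t a -> dC g t b -> dC (fun x => f x - g x) t (a - b).
Proof. apply (is_derive_minus (K:=C_AbsRing) (V := C_NormedModule)). Qed.

Lemma dC_mult f g t a b : dC f t a -> dC g t b ->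
  dC (fun x => f x * g x) t (a * g t + f t * b).
Proof.
  intros Hf Hg. apply dC_alt. apply dC_alt in Hf. apply dC_alt in Hg.
  exact (is_derive_mult (K:=C_AbsRing) f g t a b Hf Hg Cmult_comm).
Qed.

Lemma dC_comp (f g : C -> C) z l g' : dC f (g z) l -> dC g z g' -> dC (fun x => f (g x)) z (g' * l).
Proof.
  intros Hf Hg. apply dC_alt in Hg.
  exact (is_derive_comp (K:=C_AbsRing) (V:=C_NormedModule) f g z l g' Hf Hg).
Qed.

Lemma dC_exp z : dC Cexp z (Cexp z).
Proof.
  apply (dC_quad _ _ _ (Cmod (Cexp z) * exp 1) 1); [lra|].
  intros h Hh. rewrite Cexp_plus.
  replace (Cexp z * Cexp h - Cexp z - h * Cexp z) with (Cexp z * (Cexp h - 1 - h)) by ring.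
  rewrite Cmod_mult, Rmult_assoc. apply Rmult_le_compat_l; [apply Cmod_ge_0|].
  eapply Rle_trans; [apply Cexp_taylor2|]. rewrite Rmult_comm.
  apply Rmult_le_compat_r. { generalize (Cmod_ge_0 h); nra. }
  apply exp_le. apply Rmax_lub; [lra|]. generalize (Re_le_Cmod h); lra.
Qed.

Lemma dC_Cexp f z a : dC f z a -> dC (fun x => Cexp (f x)) z (a * Cexp (f z)).
Proof. intros H. apply (dC_comp Cexp f); [apply dC_exp|exact H]. Qed.

Lemma dR_continuous f t l : dR f t l -> continuous f t.
Proof. intros H. apply (ex_derive_continuous (V:=C_R_NormedModule)). eexists; exact H. Qed.

Lemma continuous_C_eps {T : UniformSpace} (f : T -> C) (x : T) :
  continuous f x <-> (forall eps, 0 < eps -> locally x (fun y => (Cmod (f y - f x) < eps))).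
Proof.
  split.
  - intros H eps He. 
    assert (e2 : 0 < eps / sqrt 2) by (apply Rdiv_lt_0_compat; [lra|apply Rlt_sqrt2_0]).
    assert (H' := proj1 (filterlim_locally f (f x)) H (mkposreal _ e2)).
    revert H'. apply filter_imp. intros y Hy.
    apply (C_NormedModule_mixin_compat2 (f x) (f y)) in Hy. simpl in Hy.
    replace (sqrt 2 * (eps / sqrt 2))%R with eps in Hy by (field; apply Rgt_not_eq, Rlt_sqrt2_0).
    exact Hy.
  - intros H. apply filterlim_locally. intros eps. specialize (H eps (cond_pos eps)).
    revert H. apply filter_imp. intros y Hy. apply C_NormedModule_mixin_compat1. exact Hy.
Qed.

Lemma dC_continuous f z l : dC f z l -> continuous f z.
Proof.
  intros H. apply continuous_C_eps. intros eps He.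
  destruct (dC_eps _ _ _ H 1%R Rlt_0_1) as [d [Hd Hh]].
  assert (P2 : 0 < Cmod l + 1) by (generalize (Cmod_ge_0 l); lra).
  assert (d2 : 0 < Rmin d (eps / (Cmod l + 1)) / sqrt 2).
  { apply Rdiv_lt_0_compat; [|apply Rlt_sqrt2_0]. apply Rmin_pos; [lra|]. apply Rdiv_lt_0_compat; lra. }
  exists (mkposreal _ d2). intros y Hy. apply (C_NormedModule_mixin_compat2 z y) in Hy. simpl in Hy.
  match type of Hy with (_ < sqrt 2 * (?m / sqrt 2)) =>
    replace (sqrt 2 * (m / sqrt 2))%R with m in Hy by (field; apply Rgt_not_eq, Rlt_sqrt2_0) end.
  change (minus y z) with (y - z) in Hy.
  set (h := y - z) in *. replace y with (z + h) by (unfold h; ring).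
  assert (h1 : Cmod h < d) by (eapply Rlt_le_trans; [exact Hy|apply Rmin_l]).
  assert (h2 : Cmod h < eps / (Cmod l + 1)) by (eapply Rlt_le_trans; [exact Hy|apply Rmin_r]).
  specialize (Hh h h1).
  replace (f (z + h) - f z) with ((f (z + h) - f z - h * l) + h * l) by ring.
  eapply Rle_lt_trans; [apply Cmod_triangle|]. rewrite (Cmod_mult h).
  apply Rmult_lt_compat_l with (r := (Cmod l + 1)%R) in h2; [|lra].
  replace ((Cmod l + 1) * (eps / (Cmod l + 1)))%R with eps in h2 by (field; lra). lra.
Qed.

(** ** Continuity *)

Section Continuity.

Context {T : UniformSpace}.

Implicit Types (x : T).

Lemma cR_const (c : R) x : continuous (fun _ : T => c) x.
Proof. apply continuous_const. Qed.

Lemma cR_plus (f g : T -> R) x : continuous f x -> continuous g x -> continuous (fun y => f y + g y)%R x.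
Proof. apply (continuous_plus (V := R_NormedModule)). Qed.

Lemma cR_minus (f g : T -> R) x : continuous f x -> continuous g x -> continuous (fun y => f y - g y)%R x.
Proof. apply (continuous_minus (V := R_NormedModule)). Qed.

Lemma cR_opp (f : T -> R) x : continuous f x -> continuous (fun y => - f y)%R x.
Proof. apply (continuous_opp (V := R_NormedModule)). Qed.

Lemma cR_mult (f g : T -> R) x : continuous f x -> continuous g x -> continuous (fun y => f y * g y)%R x.
Proof. apply (continuous_mult (K := R_AbsRing)). Qed.

Lemma cR_comp (h : R -> R) (f : T -> R) x : continuous f x -> continuous h (f x) -> continuous (fun y => h (f y)) x.
Proof. apply (continuous_comp f h). Qed.

Lemma cR_exp (f : T -> R) x : continuous f x -> continuous (fun y => exp (f y)) x.
Proof. intros H. apply (cR_comp exp); auto. apply continuous_exp. Qed.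

Lemma cR_cos (f : T -> R) x : continuous f x -> continuous (fun y => cos (f y)) x.
Proof. intros H. apply (cR_comp cos); auto. apply continuous_cos. Qed.

Lemma cR_sin (f : T -> R) x : continuous f x -> continuous (fun y => sin (f y)) x.
Proof. intros H. apply (cR_comp sin); auto. apply continuous_sin. Qed.

Lemma cR_abs (f : T -> R) x : continuous f x -> continuous (fun y => Rabs (f y)) x.
Proof. intros H. apply (cR_comp Rabs); auto. apply continuous_Rabs. Qed.

Lemma cR_ln (f : T -> R) x : continuous f x -> 0 < f x -> continuous (fun y => ln (f y)) x.
Proof. intros H P. apply (cR_comp ln); auto. apply (continuous_ln (f x) P). Qed.

Lemma cR_inv (f : T -> R) x : continuous f x -> f x <> 0%R -> continuous (fun y => / f y)%R x.
Proof. intros H P. apply (cR_comp Rinv); auto. apply (continuous_Rinv (f x) P). Qed.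

Lemma cR_div (f g : T -> R) x : continuous f x -> continuous g x -> g x <> 0%R -> continuous (fun y => f y / g y)%R x.
Proof. intros H1 H2 P. apply cR_mult; auto. apply cR_inv; auto. Qed.

Lemma cC_intro (f : T -> C) x : continuous (fun y => Re (f y)) x -> continuous (fun y => Im (f y)) x -> continuous f x.
Proof.
  intros H1 H2. apply continuous_C_eps. intros eps He.
  assert (e2 : 0 < eps / 2) by lra.
  assert (A := proj1 (filterlim_locally _ _) H1 (mkposreal _ e2)).
  assert (B := proj1 (filterlim_locally _ _) H2 (mkposreal _ e2)).
  generalize (filter_and _ _ A B). apply filter_imp. intros y [P Q].
  eapply Rle_lt_trans; [apply Cmod_le_sum|].
  apply Rlt_le_trans with (eps / 2 + eps / 2)%R; [|lra].
  apply Rplus_lt_compat; [exact P|exact Q].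
Qed.

Lemma cC_Re (f : T -> C) x : continuous f x -> continuous (fun y => Re (f y)) x.
Proof. intros H. apply (continuous_comp f (fun z : C => Re z)); auto. apply continuous_fst. Qed.

Lemma cC_Im (f : T -> C) x : continuous f x -> continuous (fun y => Im (f y)) x.
Proof. intros H. apply (continuous_comp f (fun z : C => Im z)); auto. apply continuous_snd. Qed.

Lemma cC_const (c : C) x : continuous (fun _ : T => c) x.
Proof. apply continuous_const. Qed.

Lemma cC_RtoC (f : T -> R) x : continuous f x -> continuous (fun y => RtoC (f y)) x.
Proof. intros H. apply cC_intro; simpl; auto. apply cR_const. Qed.

Lemma cC_plus (f g : T -> C) x : continuous f x -> continuous g x -> continuous (fun y => f y + g y) x.
Proof. apply (continuous_plus (V := C_R_NormedModule)). Qed.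

Lemma cC_minus (f g : T -> C) x : continuous f x -> continuous g x -> continuous (fun y => f y - g y) x.
Proof. apply (continuous_minus (V := C_R_NormedModule)). Qed.

Lemma cC_opp (f : T -> C) x : continuous f x -> continuous (fun y => - f y) x.
Proof. apply (continuous_opp (V := C_R_NormedModule)). Qed.

Lemma cC_mult (f g : T -> C) x : continuous f x -> continuous g x -> continuous (fun y => f y * g y) x.
Proof.
  intros Hf Hg. apply cC_intro.
  - apply (cR_minus (fun y => Re (f y) * Re (g y))%R (fun y => Im (f y) * Im (g y))%R); apply cR_mult;
      auto using cC_Re, cC_Im.
  - apply (cR_plus (fun y => Re (f y) * Im (g y))%R (fun y => Im (f y) * Re (g y))%R); apply cR_mult;
      auto using cC_Re, cC_Im.
Qed.

Lemma cC_comp (h : C -> C) (f : T -> C) x : continuous f x -> continuous h (f x) -> continuous (fun y => h (f y)) x.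
Proof. apply (continuous_comp f h). Qed.

Lemma cC_compR (h : R -> C) (f : T -> R) x : continuous f x -> continuous h (f x) -> continuous (fun y => h (f y)) x.
Proof. apply (continuous_comp f h). Qed.

Lemma cC_Cexp (f : T -> C) x : continuous f x -> continuous (fun y => Cexp (f y)) x.
Proof. intros H. apply (cC_comp Cexp); auto. eapply dC_continuous, dC_exp. Qed.

Lemma cC_inv (f : T -> C) x : continuous f x -> f x <> 0 -> continuous (fun y => / f y) x.
Proof.
  intros H P.
  assert (N : (Re (f x) ^ 2 + Im (f x) ^ 2 <> 0)%R).
  { intros E. apply P. apply Cmod_eq_0. apply Rsqr_0_uniq. unfold Rsqr. rewrite Cmod_sqr. simpl in E. lra. }
  apply cC_intro.
  - apply (cR_div (fun y => Re (f y)) (fun y => Re (f y) ^ 2 + Im (f y) ^ 2)%R); auto using cC_Re.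
    simpl. apply cR_plus; apply cR_mult; auto using cC_Re, cC_Im; apply cR_mult; auto using cC_Re, cC_Im, cR_const.
  - apply (cR_div (fun y => - Im (f y))%R (fun y => Re (f y) ^ 2 + Im (f y) ^ 2)%R); auto using cC_Im, cR_opp.
    simpl. apply cR_plus; apply cR_mult; auto using cC_Re, cC_Im; apply cR_mult; auto using cC_Re, cC_Im, cR_const.
Qed.

Lemma cC_div (f g : T -> C) x : continuous f x -> continuous g x -> g x <> 0 -> continuous (fun y => f y / g y) x.
Proof. intros. apply cC_mult; auto. apply cC_inv; auto. Qed.

Lemma cC_Cmod (f : T -> C) x : continuous f x -> continuous (fun y => Cmod (f y)) x.
Proof.
  intros H. apply filterlim_locally. intros eps.
  generalize (proj1 (continuous_C_eps f x) H eps (cond_pos eps)).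
  apply filter_imp. intros y Hy. change (Rabs (Cmod (f y) - Cmod (f x)) < eps).
  eapply Rle_lt_trans; [|exact Hy]. apply Rabs_le.
  generalize (Cmod_triangle_inv (f y) (f x)) (Cmod_triangle_inv (f x) (f y)).
  rewrite (Cmod_minus_sym (f x) (f y)). lra.
Qed.

Lemma cC_pow (f : T -> C) n x : continuous f x -> continuous (fun y => f y ^ n) x.
Proof. intros H. induction n; simpl; [apply cC_const|apply cC_mult; auto]. Qed.

Lemma cC_conj (f : T -> C) x : continuous f x -> continuous (fun y => Cconj (f y)) x.
Proof. intros H. apply cC_intro; simpl; [exact (cC_Re _ _ H)|]. exact (cR_opp _ _ (cC_Im _ _ H)). Qed.

End Continuity.

Lemma cR_fst (p : R * R) : continuous (fun p : R * R => fst p) p.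
Proof. destruct p. apply continuous_fst. Qed.

Lemma cR_snd (p : R * R) : continuous (fun p : R * R => snd p) p.
Proof. destruct p. apply continuous_snd. Qed.

(** Decomposes a continuity goal along the structure of the function. *)
Ltac cc1 := first [ assumption | lazymatch goal with
  | |- continuous (fun _ => ?c) ?x => apply (continuous_const c x)
  | |- continuous (fun y => y) ?x => apply (continuous_id x)
  | |- continuous (fun y => fst y) ?x => apply (cR_fst x)
  | |- continuous (fun y => snd y) ?x => apply (cR_snd x)
  | |- continuous (fun y => Cpow (@?f y) ?n) ?x => apply (cC_pow f n x)
  | |- continuous (fun y => Cplus (@?f y) (@?g y)) ?x => apply (cC_plus f g x)
  | |- continuous (fun y => Cminus (@?f y) (@?g y)) ?x => apply (cC_minus f g x)
  | |- continuous (fun y => Copp (@?f y)) ?x => apply (cC_opp f x)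
  | |- continuous (fun y => Cdiv (@?f y) (@?g y)) ?x => apply (cC_div f g x)
  | |- continuous (fun y => Cmult (@?f y) (@?g y)) ?x => apply (cC_mult f g x)
  | |- continuous (fun y => Cexp (@?f y)) ?x => apply (cC_Cexp f x)
  | |- continuous (fun y => Cconj (@?f y)) ?x => apply (cC_conj f x)
  | |- continuous (fun y => Cmod (@?f y)) ?x => apply (cC_Cmod f x)
  | |- continuous (fun y => RtoC (@?f y)) ?x => apply (cC_RtoC f x)
  | |- continuous (fun y => Cinv (@?f y)) ?x => apply (cC_inv f x)
  | |- continuous (fun y => Rplus (@?f y) (@?g y)) ?x => apply (cR_plus f g x)
  | |- continuous (fun y => Rminus (@?f y) (@?g y)) ?x => apply (cR_minus f g x)
  | |- continuous (fun y => Ropp (@?f y)) ?x => apply (cR_opp f x)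
  | |- continuous (fun y => Rdiv (@?f y) (@?g y)) ?x => apply (cR_div f g x)
  | |- continuous (fun y => Rmult (@?f y) (@?g y)) ?x => apply (cR_mult f g x)
  | |- continuous (fun y => exp (@?f y)) ?x => apply (cR_exp f x)
  | |- continuous (fun y => cos (@?f y)) ?x => apply (cR_cos f x)
  | |- continuous (fun y => sin (@?f y)) ?x => apply (cR_sin f x)
  | |- continuous (fun y => Rabs (@?f y)) ?x => apply (cR_abs f x)
  | |- continuous (fun y => ln (@?f y)) ?x => apply (cR_ln f x)
  | |- continuous (fun y => Rinv (@?f y)) ?x => apply (cR_inv f x)
  | |- continuous Ropp ?x => apply (cR_opp (fun y => y) x)
  | |- continuous RtoC ?x => apply (cC_RtoC (fun y => y) x)
  | |- continuous exp ?x => apply (cR_exp (fun y => y) x)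
  | |- continuous Cexp ?x => apply (cC_Cexp (fun y => y) x)
  | |- continuous Rabs ?x => apply (cR_abs (fun y => y) x)
  | |- continuous cos ?x => apply (cR_cos (fun y => y) x)
  | |- continuous sin ?x => apply (cR_sin (fun y => y) x)
  | |- continuous Cmod ?x => apply (cC_Cmod (fun y => y) x)
  | |- continuous Cconj ?x => apply (cC_conj (fun y => y) x)
  end ].

Ltac cc := repeat (cbv beta; cc1).
(** ** Integrals over segments *)

Definition CI (f : R -> C) (a b : R) : C := RInt (V := C_R_CompleteNormedModule) f a b.
Implicit Types (f : R -> C) (l : C).

Lemma CI_ex (f : R -> C) a b : (forall v, Rmin a b <= v <= Rmax a b -> continuous f v) ->
  is_RInt (V := C_R_CompleteNormedModule) f a b (CI f a b).
Proof. intros H. apply (RInt_correct (V := C_R_CompleteNormedModule)). apply (ex_RInt_continuous (V := C_R_CompleteNormedModule)). exact H. Qed.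

Lemma CI_unique f a b l : is_RInt (V := C_R_CompleteNormedModule) f a b l -> CI f a b = l.
Proof. apply (is_RInt_unique (V := C_R_CompleteNormedModule)). Qed.

Lemma CI_ext f g a b : (forall v, Rmin a b < v < Rmax a b -> f v = g v) -> CI f a b = CI g a b.
Proof. apply (RInt_ext (V := C_R_CompleteNormedModule)). Qed.

Definition cont (f : R -> C) := forall v, continuous f v.
Lemma CI_correct f a b : cont f -> is_RInt (V := C_R_CompleteNormedModule) f a b (CI f a b).
Proof. intros H. apply CI_ex. intros; apply H. Qed.

Lemma CI_plus f g a b : cont f -> cont g -> CI (fun v => f v + g v) a b = CI f a b + CI g a b.
Proof. intros Hf Hg. apply CI_unique. apply (is_RInt_plus (V := C_R_CompleteNormedModule)); apply CI_correct; auto. Qed.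

Lemma CI_opp f a b : cont f -> CI (fun v => - f v) a b = - CI f a b.
Proof. intros Hf. apply CI_unique. apply (is_RInt_opp (V := C_R_CompleteNormedModule)); apply CI_correct; auto. Qed.

Lemma CI_minus f g a b : cont f -> cont g -> CI (fun v => f v - g v) a b = CI f a b - CI g a b.
Proof. intros Hf Hg. apply CI_unique. apply (is_RInt_minus (V := C_R_CompleteNormedModule)); apply CI_correct; auto. Qed.

Lemma CI_Chasles f a b c : cont f -> CI f a b + CI f b c = CI f a c.
Proof. intros Hf. symmetry. apply CI_unique. apply (is_RInt_Chasles (V := C_R_CompleteNormedModule)) with b; apply CI_correct; auto. Qed.

Lemma CI_swap f a b : cont f -> CI f b a = - CI f a b.
Proof. intros Hf. apply CI_unique. apply (is_RInt_swap (V := C_R_CompleteNormedModule)). apply CI_correct; auto. Qed.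

Lemma is_RInt_Re f a b l : is_RInt (V := C_R_CompleteNormedModule) f a b l ->
  is_RInt (fun v => Re (f v)) a b (Re l).
Proof. apply (is_RInt_fct_extend_fst (U := R_NormedModule) (V := R_NormedModule)). Qed.

Lemma is_RInt_Im f a b l : is_RInt (V := C_R_CompleteNormedModule) f a b l ->
  is_RInt (fun v => Im (f v)) a b (Im l).
Proof. apply (is_RInt_fct_extend_snd (U := R_NormedModule) (V := R_NormedModule)). Qed.

Lemma is_RInt_C f a b l : is_RInt (fun v => Re (f v)) a b (Re l) -> is_RInt (fun v => Im (f v)) a b (Im l) ->
  is_RInt (V := C_R_CompleteNormedModule) f a b l.
Proof.
  intros H1 H2. rewrite (surjective_pairing l).
  exact (is_RInt_fct_extend_pair (U := R_NormedModule) (V := R_NormedModule) f a b _ _ H1 H2).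
Qed.

Lemma CI_Re f a b : cont f -> Re (CI f a b) = RInt (fun v => Re (f v)) a b.
Proof. intros Hf. symmetry. apply is_RInt_unique. apply is_RInt_Re. apply CI_correct; auto. Qed.

Lemma CI_Im f a b : cont f -> Im (CI f a b) = RInt (fun v => Im (f v)) a b.
Proof. intros Hf. symmetry. apply is_RInt_unique. apply is_RInt_Im. apply CI_correct; auto. Qed.

Lemma is_RInt_Cscal f a b l c : is_RInt (V := C_R_CompleteNormedModule) f a b l ->
  is_RInt (V := C_R_CompleteNormedModule) (fun v => c * f v) a b (c * l).
Proof.
  intros H. assert (H1 := is_RInt_Re _ _ _ _ H). assert (H2 := is_RInt_Im _ _ _ _ H).
  apply is_RInt_C.
  - exact (is_RInt_minus _ _ _ _ _ _ (is_RInt_scal _ _ _ (Re c) _ H1) (is_RInt_scal _ _ _ (Im c) _ H2)).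
  - exact (is_RInt_plus _ _ _ _ _ _ (is_RInt_scal _ _ _ (Re c) _ H2) (is_RInt_scal _ _ _ (Im c) _ H1)).
Qed.

Lemma CI_scal f a b c : cont f -> CI (fun v => c * f v) a b = c * CI f a b.
Proof. intros Hf. apply CI_unique, is_RInt_Cscal, CI_correct; auto. Qed.

Lemma CI_conj f a b : cont f -> CI (fun v => Cconj (f v)) a b = Cconj (CI f a b).
Proof.
  intros Hf. assert (H := CI_correct f a b Hf). apply CI_unique. apply is_RInt_C.
  - exact (is_RInt_Re _ _ _ _ H).
  - exact (is_RInt_opp _ _ _ _ (is_RInt_Im _ _ _ _ H)).
Qed.

Lemma CI_zero a b : CI (fun _ => 0) a b = 0.
Proof.
  apply CI_unique. assert (H := is_RInt_const (V := C_R_CompleteNormedModule) a b (RtoC 0)).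
  refine (eq_ind _ (fun l => is_RInt (V := C_R_CompleteNormedModule) (fun _ => RtoC 0) a b l) H _ _).
  apply C_ext; cbn; ring.
Qed.

Lemma CI_FTC_loc (F f : R -> C) a b : a <= b ->
  (forall v, a <= v <= b -> dR F v (f v)) -> (forall v, a <= v <= b -> continuous f v) ->
  is_RInt (V := C_R_CompleteNormedModule) f a b (F b - F a).
Proof.
  intros Hab H1 H2. apply (is_RInt_derive (V := C_R_CompleteNormedModule)); intros x;
  rewrite Rmin_left, Rmax_right by lra; [apply H1|apply H2].
Qed.

Lemma CI_FTC (F f : R -> C) a b : (forall v, dR F v (f v)) -> cont f -> CI f a b = F b - F a.
Proof.
  intros H1 H2. apply CI_unique. apply (is_RInt_derive (V := C_R_CompleteNormedModule)); intros x _; [apply H1|apply H2].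
Qed.

Lemma is_RInt_norm_le (f : R -> C) (g : R -> R) a b l lg : a <= b ->
  is_RInt (V := C_R_CompleteNormedModule) f a b l -> is_RInt g a b lg ->
  (forall v, a <= v <= b -> Cmod (f v) <= g v) -> Cmod l <= lg.
Proof.
  intros Hab H1 H2 H. rewrite <- normR.
  apply (norm_RInt_le (V := C_R_NormedModule) f g a b l lg Hab); auto.
  intros x Hx. rewrite normR. auto.
Qed.

Lemma CI_norm_primitive (f : R -> C) (G g : R -> R) a b : a <= b -> cont f ->
  (forall v, is_derive G v (g v)) -> (forall v, continuous g v) ->
  (forall v, a <= v <= b -> Cmod (f v) <= g v) -> Cmod (CI f a b) <= G b - G a.
Proof.
  intros Hab Hf HG Hg H. apply (is_RInt_norm_le f g a b); auto.
  - apply CI_correct; auto.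
  - apply (is_RInt_derive (V := R_CompleteNormedModule)); intros; auto.
Qed.

Lemma CI_norm_const (f : R -> C) K a b : a <= b -> cont f ->
  (forall v, a <= v <= b -> Cmod (f v) <= K) -> Cmod (CI f a b) <= K * (b - a).
Proof.
  intros Hab Hf H. replace (K * (b - a))%R with (K * b - K * a)%R by ring.
  apply (CI_norm_primitive f (fun v => K * v)%R (fun _ => K)); auto.
  - intros v. auto_derive; [trivial|ring].
  - intros; apply cR_const.
Qed.

(** ** Integrals over the whole line *)

Definition is_II (f : R -> C) (l : C) : Prop :=
  is_RInt_gen (V := C_R_CompleteNormedModule) f (Rbar_locally m_infty) (Rbar_locally p_infty) l.

Definition II (f : R -> C) : C :=
  RInt_gen (V := C_R_CompleteNormedModule) f (Rbar_locally m_infty) (Rbar_locally p_infty).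

Lemma is_II_unique f l : is_II f l -> II f = l.
Proof.
  unfold is_II, II. intros H.
  exact (is_RInt_gen_unique (V := C_R_CompleteNormedModule) (Fa := Rbar_locally m_infty)
    (Fb := Rbar_locally p_infty) f l H).
Qed.

Lemma is_II_intro f l : cont f ->
  (forall eps, 0 < eps -> exists N, forall a b, a < - N -> N < b -> Cmod (CI f a b - l) < eps) ->
  is_II f l.
Proof.
  intros Hf H P [d HP]. destruct (H d (cond_pos d)) as [N HN].
  exists (fun a => (a < - N)) (fun b => (N < b)).
  - exists (- N)%R. auto.
  - exists N. auto.
  - intros a b Ha Hb. exists (CI f a b). split; [apply CI_correct; auto|].
    apply HP. apply C_NormedModule_mixin_compat1. apply HN; auto.
Qed.

Lemma is_II_eps f l : cont f -> is_II f l ->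
  forall eps, 0 < eps -> exists N, forall a b, a < - N -> N < b -> Cmod (CI f a b - l) < eps.
Proof.
  intros Hf H eps He.
  assert (e2 : 0 < eps / sqrt 2) by (apply Rdiv_lt_0_compat; [lra|apply Rlt_sqrt2_0]).
  destruct (H (ball l (mkposreal _ e2)) (locally_ball _ _)) as [P Q [A HA] [B HB] HPQ].
  exists (Rmax (- A) B). intros a b Ha Hb.
  destruct (HPQ a b) as [y [Hy1 Hy2]].
  - apply HA. generalize (Rmax_l (-A) B). lra.
  - apply HB. generalize (Rmax_r (-A) B). lra.
  - apply CI_unique in Hy1. simpl in Hy1. rewrite Hy1.
    apply (C_NormedModule_mixin_compat2 l y) in Hy2. simpl in Hy2.
    replace (sqrt 2 * (eps / sqrt 2))%R with eps in Hy2 by (field; apply Rgt_not_eq, Rlt_sqrt2_0).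
    exact Hy2.
Qed.

(** One majorant for all integrals over the line: it is stable under sums, and its square in two
    variables gives Fubini. *)
Definition dom (f : R -> C) (M : R) : Prop := cont f /\ forall v, Cmod (f v) <= M / (1 + v * v).

Lemma dom_pos f M : dom f M -> 0 <= M.
Proof. intros [_ H]. specialize (H 0%R). generalize (Cmod_ge_0 (f 0%R)). replace (M / (1 + 0 * 0))%R with M in H by field. lra. Qed.

Lemma sqr1_pos v : 0 < 1 + v * v.
Proof. nra. Qed.

Lemma dom_le f M M' : dom f M -> M <= M' -> dom f M'.
Proof.
  intros [H1 H2] L. split; auto. intros v. eapply Rle_trans; [apply H2|].
  apply Rmult_le_compat_r; [left; apply Rinv_0_lt_compat, sqr1_pos|lra].
Qed.

Lemma dom_CI_atan f M a b : dom f M -> a <= b -> Cmod (CI f a b) <= M * (atan b - atan a).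
Proof.
  intros [H1 H2] Hab. replace (M * (atan b - atan a))%R with (M * atan b - M * atan a)%R by ring.
  apply (CI_norm_primitive f (fun v => M * atan v)%R (fun v => M / (1 + v * v))%R); auto.
  - intros v. auto_derive; [trivial|]. unfold Rsqr. field. generalize (sqr1_pos v); lra.
  - intros v. cc. generalize (sqr1_pos v); lra.
Qed.

Lemma atan_near eps : 0 < eps -> exists N, 0 < N /\ PI / 2 - atan N < eps.
Proof.
  intros He. assert (HP := PI_RGT_0).
  set (d := Rmin (eps / 2) (PI / 4)).
  assert (d0 : 0 < d) by (apply Rmin_pos; lra).
  assert (d1 : d <= eps / 2) by apply Rmin_l. assert (d2 : d <= PI / 4) by apply Rmin_r.
  exists (tan (PI / 2 - d)). split.
  - apply tan_gt_0; lra.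
  - rewrite atan_tan by lra. lra.
Qed.

Lemma dom_tail f M N a b a' b' : dom f M -> 0 < N -> a < - N -> N < b -> a' < - N -> N < b' ->
  Cmod (CI f a b - CI f a' b') <= 4 * M * (PI / 2 - atan N).
Proof.
  intros H HN Ha Hb Ha' Hb'.
  assert (Hf : cont f) by apply H. assert (HM := dom_pos _ _ H).
  assert (K : forall c, c < - N -> Cmod (CI f c (-N)) <= M * (PI / 2 - atan N)).
  { intros c Hc. eapply Rle_trans; [apply (dom_CI_atan f M); auto; lra|].
    rewrite atan_opp. apply Rmult_le_compat_l; auto. generalize (atan_bound c). lra. }
  assert (K' : forall c, N < c -> Cmod (CI f N c) <= M * (PI / 2 - atan N)).
  { intros c Hc. eapply Rle_trans; [apply (dom_CI_atan f M); auto; lra|].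
    apply Rmult_le_compat_l; auto. generalize (atan_bound c). lra. }
  rewrite <- (CI_Chasles f a (-N) b Hf), <- (CI_Chasles f (-N) N b Hf).
  rewrite <- (CI_Chasles f a' (-N) b' Hf), <- (CI_Chasles f (-N) N b' Hf).
  match goal with |- (Cmod ?x <= _) => replace x with
    ((CI f a (-N) + CI f N b) + - (CI f a' (-N) + CI f N b')) by ring end.
  triangle. rewrite Cmod_opp.
  assert (T1 := Cmod_triangle (CI f a (-N)) (CI f N b)).
  assert (T2 := Cmod_triangle (CI f a' (-N)) (CI f N b')).
  generalize (K a Ha) (K a' Ha') (K' b Hb) (K' b' Hb'). lra.
Qed.

Lemma dom_is_II f M : dom f M -> is_II f (II f).
Proof.
  intros H. assert (Hf : cont f) by apply H. assert (HM := dom_pos _ _ H).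
  assert (Tn : forall eps, 0 < eps -> exists N, 0 < N /\ 4 * M * (PI / 2 - atan N) < eps).
  { intros eps He. destruct (atan_near (eps / (4 * M + 1))) as [N [HN1 HN2]].
    { apply Rdiv_lt_0_compat; lra. }
    exists N. split; auto. apply Rmult_lt_compat_l with (r := (4 * M + 1)%R) in HN2; [|lra].
    replace ((4 * M + 1) * (eps / (4 * M + 1)))%R with eps in HN2 by (field; lra).
    generalize (atan_bound N). nra. }
  assert (E : exists l : C, filterlim (fun n => CI f (- INR n) (INR n) : C_R_CompleteNormedModule) eventually (locally (T:=C_R_CompleteNormedModule) l)).
  { apply (filterlim_locally_cauchy (U := C_R_CompleteNormedModule) (F := eventually)).
    intros eps. destruct (Tn eps (cond_pos eps)) as [N [HN1 HN2]].
    exists (fun n => (N < INR n)). split.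
    - destruct (nfloor_ex N ltac:(lra)) as [n0 Hn0]. exists (S n0). intros n Hn.
      apply le_INR in Hn. rewrite S_INR in Hn. lra.
    - intros u v Hu Hv. apply C_NormedModule_mixin_compat1.
      eapply Rle_lt_trans; [|exact HN2]. 
      apply (dom_tail f M N); auto; lra. }
  destruct E as [l Hl].
  assert (L : is_II f l).
  { apply is_II_intro; auto. intros eps He.
    destruct (Tn (eps/2)%R ltac:(lra)) as [N [HN1 HN2]].
    exists N. intros a b Ha Hb.
    assert (e2 : 0 < eps / 2 / sqrt 2) by (apply Rdiv_lt_0_compat; [lra|apply Rlt_sqrt2_0]).
    assert (Q := proj1 (filterlim_locally _ _) Hl (mkposreal _ e2)).
    destruct Q as [n0 Q]. destruct (nfloor_ex N ltac:(lra)) as [n1 Hn1].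
    set (n := max n0 (S n1)).
    assert (Hn : N < INR n).
    { assert (S n1 <= n)%nat by apply Nat.le_max_r. apply le_INR in H0. rewrite S_INR in H0. lra. }
    specialize (Q n (Nat.le_max_l _ _)).
    apply (C_NormedModule_mixin_compat2 l) in Q. simpl in Q.
    replace (sqrt 2 * (eps / 2 / sqrt 2))%R with (eps/2)%R in Q by (field; apply Rgt_not_eq, Rlt_sqrt2_0).
    change (minus (CI f (- INR n) (INR n)) l) with (CI f (- INR n) (INR n) - l) in Q.
    replace (CI f a b - l) with ((CI f a b - CI f (- INR n) (INR n)) + (CI f (- INR n) (INR n) - l)) by ring.
    eapply Rle_lt_trans; [apply Cmod_triangle|].
    assert (D := dom_tail f M N a b (- INR n) (INR n) H HN1 Ha Hb ltac:(lra) ltac:(lra)). lra. }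
  rewrite (is_II_unique _ _ L). exact L.
Qed.

Lemma Cmod_le_limit (z : C) K : (forall eps, 0 < eps -> Cmod z <= K + eps) -> Cmod z <= K.
Proof. intros H. apply le_epsilon. exact H. Qed.

Lemma II_CI_tail f M N : dom f M -> 0 < N -> Cmod (II f - CI f (- N) N) <= 4 * M * (PI / 2 - atan N).
Proof.
  intros H HN. apply Cmod_le_limit. intros eps He.
  destruct (is_II_eps _ _ (proj1 H) (dom_is_II _ _ H) eps He) as [N' HN'].
  assert (Hf := proj1 H). assert (HM := dom_pos _ _ H).
  set (b := (Rmax N N' + 1)%R). assert (N < b) by (unfold b; generalize (Rmax_l N N'); lra).
  assert (N' < b) by (unfold b; generalize (Rmax_r N N'); lra).
  specialize (HN' (- b)%R b ltac:(lra) ltac:(lra)).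
  rewrite <- (CI_Chasles f (-b) (-N) b Hf), <- (CI_Chasles f (-N) N b Hf) in HN'.
  match type of HN' with (Cmod ?x < _) => 
   replace (II f - CI f (- N) N) with (- x + (CI f (-b) (-N) + CI f N b)) by ring end.
  triangle. rewrite Cmod_opp.
  assert (T := Cmod_triangle (CI f (-b) (-N)) (CI f N b)).
  assert (K1 : Cmod (CI f (-b) (-N)) <= M * (PI / 2 - atan N)).
  { eapply Rle_trans; [apply (dom_CI_atan f M); auto; lra|].
    rewrite !atan_opp. apply Rmult_le_compat_l; auto. generalize (atan_bound b). lra. }
  assert (K2 : Cmod (CI f N b) <= M * (PI / 2 - atan N)).
  { eapply Rle_trans; [apply (dom_CI_atan f M); auto; lra|].
    apply Rmult_le_compat_l; auto. generalize (atan_bound b). lra. }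
  assert (0 <= M * (PI / 2 - atan N)) by (apply Rmult_le_pos; auto; generalize (atan_bound N); lra).
  lra.
Qed.

Lemma II_bound f M : dom f M -> Cmod (II f) <= M * PI.
Proof.
  intros H. apply Cmod_le_limit. intros eps He.
  destruct (is_II_eps _ _ (proj1 H) (dom_is_II _ _ H) eps He) as [N HN].
  set (b := (Rmax N 0 + 1)%R). assert (N < b) by (unfold b; generalize (Rmax_l N 0); lra).
  assert (0 < b) by (unfold b; generalize (Rmax_r N 0); lra).
  specialize (HN (- b)%R b ltac:(lra) ltac:(lra)).
  assert (D := dom_CI_atan f M (-b) b H ltac:(lra)).
  assert (HM := dom_pos _ _ H). generalize (atan_bound b) (atan_bound (-b)). intros A1 A2.
  replace (II f) with (- (CI f (-b) b - II f) + CI f (-b) b) by ring.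
  triangle. rewrite Cmod_opp. nra.
Qed.

Lemma is_II_ext f g l : (forall v, f v = g v) -> is_II f l -> is_II g l.
Proof. intros H Hf. replace g with f; auto. apply functional_extensionality. exact H. Qed.

Lemma II_ext f g : (forall v, f v = g v) -> II f = II g.
Proof. intros H. f_equal. apply functional_extensionality. exact H. Qed.

Lemma dom_ext f g M : (forall v, f v = g v) -> dom f M -> dom g M.
Proof. intros H Hf. replace g with f; auto. apply functional_extensionality. exact H. Qed.

Lemma dom_plus f g M M' : dom f M -> dom g M' -> dom (fun v => f v + g v) (M + M').
Proof.
  intros [H1 H2] [H3 H4]. split.
  - intros v. apply cC_plus; auto.
  - intros v. triangle.
    replace ((M + M') / (1 + v * v))%R with (M / (1 + v * v) + M' / (1 + v * v))%R by (field; generalize (sqr1_pos v); lra).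
    apply Rplus_le_compat; auto.
Qed.

Lemma dom_scal f c M : dom f M -> dom (fun v => c * f v) (Cmod c * M).
Proof.
  intros [H1 H2]. split.
  - intros v. apply cC_mult; [apply cC_const|auto].
  - intros v. rewrite Cmod_mult. unfold Rdiv. rewrite Rmult_assoc. apply Rmult_le_compat_l; [apply Cmod_ge_0|apply H2].
Qed.

Lemma dom_minus f g M M' : dom f M -> dom g M' -> dom (fun v => f v - g v) (M + M').
Proof.
  intros H1 H2. apply dom_plus; auto. 
  apply (dom_ext (fun v => (- (1)) * g v)). { intros; ring. }
  replace M' with (Cmod (- (1)) * M')%R by (rewrite Cmod_m1; ring). apply dom_scal; auto.
Qed.

Lemma II_plus f g M M' : dom f M -> dom g M' -> II (fun v => f v + g v) = II f + II g.
Proof.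
  intros H1 H2. apply is_II_unique.
  exact (is_RInt_gen_plus (V := C_R_CompleteNormedModule) (Fa := Rbar_locally m_infty)
    (Fb := Rbar_locally p_infty) f g _ _ (dom_is_II _ _ H1) (dom_is_II _ _ H2)).
Qed.

Lemma II_minus f g M M' : dom f M -> dom g M' -> II (fun v => f v - g v) = II f - II g.
Proof.
  intros H1 H2. apply is_II_unique.
  exact (is_RInt_gen_minus (V := C_R_CompleteNormedModule) (Fa := Rbar_locally m_infty)
    (Fb := Rbar_locally p_infty) f g _ _ (dom_is_II _ _ H1) (dom_is_II _ _ H2)).
Qed.

Lemma is_II_scal f c l : cont f -> is_II f l -> is_II (fun v => c * f v) (c * l).
Proof.
  intros Hf H. apply is_II_intro. { intros v; apply cC_mult; [apply cC_const|apply Hf]. }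
  intros eps He. assert (P : 0 < Cmod c + 1) by (generalize (Cmod_ge_0 c); lra).
  destruct (is_II_eps f l Hf H (eps / (Cmod c + 1))%R) as [N HN]. { apply Rdiv_lt_0_compat; lra. }
  exists N. intros a b Ha Hb. specialize (HN a b Ha Hb).
  rewrite CI_scal by auto. replace (c * CI f a b - c * l) with (c * (CI f a b - l)) by ring.
  rewrite Cmod_mult. apply Rmult_lt_compat_l with (r := (Cmod c + 1)%R) in HN; [|lra].
  replace ((Cmod c + 1) * (eps / (Cmod c + 1)))%R with eps in HN by (field; lra).
  generalize (Cmod_ge_0 (CI f a b - l)). lra.
Qed.

Lemma II_scal f c M : dom f M -> II (fun v => c * f v) = c * II f.
Proof. intros H. apply is_II_unique, is_II_scal; [apply H|]. eapply dom_is_II; eassumption. Qed.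

Lemma is_II_conj f l : cont f -> is_II f l -> is_II (fun v => Cconj (f v)) (Cconj l).
Proof.
  intros Hf H. apply is_II_intro. { intros v. apply cC_conj, Hf. }
  intros eps He. destruct (is_II_eps f l Hf H eps He) as [N HN]. exists N. intros a b Ha Hb.
  rewrite CI_conj, <- Cminus_conj, Cmod_conj by auto. auto.
Qed.

Lemma II_conj f M : dom f M -> II (fun v => Cconj (f v)) = Cconj (II f).
Proof. intros H. apply is_II_unique, is_II_conj; [apply H|]. eapply dom_is_II; eassumption. Qed.

Lemma CI_comp_affine f u v a b : cont f -> RtoC u * CI (fun y => f (u * y + v)%R) a b = CI f (u * a + v) (u * b + v).
Proof.
  intros Hf. rewrite <- CI_scal.
  - apply CI_unique.
    assert (H := is_RInt_comp_lin (V := C_R_CompleteNormedModule) f u v a b _ (CI_correct f (u*a+v) (u*b+v) Hf)).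
    refine (is_RInt_ext (V := C_R_CompleteNormedModule) _ _ _ _ _ _ H).
    intros x _. apply C_ext; cbn; ring.
  - intros y. apply (cC_compR f). { cc. } apply Hf.
Qed.

Lemma is_II_shift f l c : cont f -> is_II f l -> is_II (fun v => f (v + c)%R) l.
Proof.
  intros Hf H. apply is_II_intro.
  { intros y. apply (cC_compR f). { cc. } apply Hf. }
  intros eps He. destruct (is_II_eps f l Hf H eps He) as [N HN]. exists (N + Rabs c)%R. intros a b Ha Hb.
  replace (CI (fun v => f (v + c)%R) a b) with (CI f (a + c) (b + c)).
  - generalize (Rle_abs c) (Rle_abs (-c)). rewrite Rabs_Ropp. intros. apply HN; lra.
  - replace (a + c)%R with (1 * a + c)%R by ring. replace (b + c)%R with (1 * b + c)%R by ring.
    rewrite <- CI_comp_affine by auto. rewrite Cmult_1_l. apply CI_ext. intros x _. f_equal. ring.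
Qed.

Lemma II_shift f M c : dom f M -> II (fun v => f (v + c)%R) = II f.
Proof. intros H. apply is_II_unique, is_II_shift; [apply H|]. eapply dom_is_II; eassumption. Qed.

Lemma is_II_reflect f l : cont f -> is_II f l -> is_II (fun v => f (- v)%R) l.
Proof.
  intros Hf H. apply is_II_intro.
  { intros y. apply (cC_compR f). { cc. } apply Hf. }
  intros eps He. destruct (is_II_eps f l Hf H eps He) as [N HN]. exists N. intros a b Ha Hb.
  replace (CI (fun v => f (- v)%R) a b) with (CI f (- b) (- a)).
  - apply HN; lra.
  - replace (-b)%R with ((-1) * b + 0)%R by ring. replace (-a)%R with ((-1) * a + 0)%R by ring.
    rewrite CI_swap by auto.
    rewrite <- CI_comp_affine by auto. 
    rewrite (CI_ext (fun y => f (-1 * y + 0)%R) (fun v => f (- v)%R)). { ceq; ring. }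
    intros x _. f_equal. ring.
Qed.

Lemma inv_sqr_small M eps : 0 <= M -> 0 < eps -> exists N, 0 < N /\ forall b, N < Rabs b -> M / (1 + b * b) < eps.
Proof.
  intros HM He. exists (M / eps + 1)%R.
  assert (0 <= M / eps) by (apply Rmult_le_pos; [lra|left; apply Rinv_0_lt_compat; lra]).
  split; [lra|]. intros b Hb.
  apply Rmult_lt_reg_r with (1 + b * b)%R; [apply sqr1_pos|].
  replace (M / (1 + b * b) * (1 + b * b))%R with M by (field; generalize (sqr1_pos b); lra).
  assert (b * b = Rabs b * Rabs b)%R by (rewrite <- Rabs_mult, Rabs_pos_eq; nra).
  assert (M = eps * (M / eps))%R by (field; lra).
  rewrite H0. rewrite H1 at 1. apply Rmult_lt_compat_l; [lra|]. nra.
Qed.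

Lemma II_total_derivative (F f : R -> C) M M' : (forall v, dR F v (f v)) -> dom f M ->
  (forall v, Cmod (F v) <= M' / (1 + v * v)) -> II f = 0.
Proof.
  intros HF Hf HM. 
  assert (HM' : 0 <= M').
  { specialize (HM 0%R). generalize (Cmod_ge_0 (F 0%R)). replace (M' / (1 + 0 * 0))%R with M' in HM by field. lra. }
  apply is_II_unique. apply is_II_intro; [apply Hf|]. intros eps He.
  destruct (inv_sqr_small M' (eps / 2) HM' ltac:(lra)) as [N [HN0 HN]].
  exists N. intros a b Ha Hb. rewrite (CI_FTC F f a b HF (proj1 Hf)).
  replace (F b - F a - 0) with (F b + - F a) by ring.
  eapply Rle_lt_trans; [apply Cmod_triangle|]. rewrite Cmod_opp.
  assert (A := HN a ltac:(rewrite Rabs_left; lra)). assert (B := HN b ltac:(rewrite Rabs_pos_eq; lra)).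
  generalize (HM a) (HM b). lra.
Qed.

(** The remainders, integrated against 1 / (1 + v^2), add up to at most K pi |h|^2. *)
Lemma II_dC (F : C -> R -> C) (F' : R -> C) (z : C) (r K M M1 : R) : 0 < r ->
  (forall h, Cmod h <= r -> dom (F (z + h)%C) M) -> dom F' M1 ->
  (forall h v, Cmod h <= r ->
     (Cmod (F (z + h)%C v - F z v - h * F' v) <= K * (Cmod h * Cmod h) / (1 + v * v))) ->
  dC (fun z => II (F z)) z (II F').
Proof.
  intros Hr HF HF' HK.
  assert (HF0 : dom (F z) M). { replace z with (z + 0) by ring. apply HF. rewrite Cmod_0. lra. }
  apply (dC_quad _ _ _ (K * PI) r Hr).
  intros h Hh. specialize (HF h Hh).
  assert (D := dom_minus _ _ _ _ (dom_minus _ _ _ _ HF HF0) (dom_scal _ h _ HF')).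
  replace (II (F (z + h)) - II (F z) - h * II F') with (II (fun v => F (z + h)%C v - F z v - h * F' v)).
  - replace (K * PI * (Cmod h * Cmod h))%R with ((K * (Cmod h * Cmod h)) * PI)%R by ring.
    apply II_bound. split; [apply D|]. intros v. apply HK; auto.
  - rewrite (II_minus _ _ _ _ (dom_minus _ _ _ _ HF HF0) (dom_scal _ h _ HF')).
    rewrite (II_minus _ _ _ _ HF HF0), (II_scal _ _ _ HF'). reflexivity.
Qed.

Lemma II_diff_bound f g M M' K : dom f M -> dom g M' -> (forall v, Cmod (f v - g v) <= K / (1 + v * v)) ->
  Cmod (II f - II g) <= K * PI.
Proof.
  intros Hf Hg HK. rewrite <- (II_minus _ _ _ _ Hf Hg). apply II_bound. split; auto.
  apply (dom_minus _ _ _ _ Hf Hg).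
Qed.

(** ** Interchange of integrals *)

Definition cont2 (F : R -> R -> C) : Prop :=
  forall u v, continuous (fun p : R * R => F (fst p) (snd p)) (u, v).

Lemma cont2_comp F (a b : R -> R) v : cont2 F -> continuous a v -> continuous b v ->
  continuous (fun t => F (a t) (b t)) v.
Proof.
  intros HF Ha Hb.
  apply (continuous_comp_2 a b (fun x y => F x y)); [exact Ha|exact Hb|apply HF].
Qed.

Lemma cont2_r F u : cont2 F -> cont (F u).
Proof. intros H v. apply (cont2_comp F (fun _ => u) (fun v => v)); [exact H|cc|cc]. Qed.

Lemma cont2_l F v : cont2 F -> cont (fun u => F u v).
Proof. intros H u. apply (cont2_comp F (fun u => u) (fun _ => v)); [exact H|cc|cc]. Qed.

Lemma cont2_swap F : cont2 F -> cont2 (fun u v => F v u).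
Proof.
  intros H u v. apply (continuous_comp_2 (fun p : R * R => snd p) (fun p : R * R => fst p) (fun x y => F x y)).
  - apply cR_snd. - apply cR_fst. - apply H.
Qed.

Lemma c2d_row (g : R -> R -> R) x v : (forall u v, continuity_2d_pt g u v) -> continuous (g x) v.
Proof.
  intros Hg. apply filterlim_locally. intros eps.
  destruct (Hg x v eps) as [dl Hd]. exists dl.
  intros y Hy. apply (Hd x y); [rewrite Rminus_diag, Rabs_R0; apply cond_pos|exact Hy].
Qed.

Lemma c2d_swap (g : R -> R -> R) : (forall u v, continuity_2d_pt g u v) ->
  forall u v, continuity_2d_pt (fun x y => g y x) u v.
Proof.
  intros Hg u v eps. destruct (Hg v u eps) as [dl Hd]. exists dl. intros; apply Hd; auto.
Qed.

Lemma RInt_param_continuous (g : R -> R -> R) (c d x0 : R) :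
  (forall u v, continuity_2d_pt g u v) -> continuous (fun x => RInt (g x) c d) x0.
Proof.
  intros Hg.
  assert (X : forall x, ex_RInt (g x) c d).
  { intros x. apply (ex_RInt_continuous (V:=R_CompleteNormedModule)). intros; apply c2d_row; auto. }
  apply filterlim_locally. intros eps.
  set (L := (Rabs (d - c) + 1)%R). assert (HL : 0 < L) by (unfold L; generalize (Rabs_pos (d - c)); lra).
  assert (e1 : 0 < eps / L) by (apply Rdiv_lt_0_compat; [apply cond_pos|exact HL]).
  destruct (uniform_continuity_2d_1d' g (Rmin c d) (Rmax c d) x0 (fun x _ => Hg x0 x) (mkposreal _ e1)) as [dl Hd].
  exists dl. intros y Hy. change (Rabs (y - x0) < dl) in Hy. apply Rabs_def2 in Hy.
  change (Rabs (RInt (g y) c d - RInt (g x0) c d) < eps).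
  assert (D : is_RInt (fun v => g y v - g x0 v)%R c d (RInt (g y) c d - RInt (g x0) c d)%R).
  { apply (is_RInt_minus (V := R_NormedModule)); apply (RInt_correct (V:=R_CompleteNormedModule)); auto. }
  apply Rle_lt_trans with (Rabs (d - c) * (eps / L))%R.
  - refine (norm_RInt_le_const_abs (V := R_NormedModule) _ c d _ _ _ D).
    intros x Hx. left. generalize (cond_pos dl). intros. apply (Hd x x0 x y); auto; try lra.
    rewrite Rminus_diag, Rabs_R0; lra.
  - apply Rlt_le_trans with (L * (eps / L))%R.
    + apply Rmult_lt_compat_r; [exact e1|]. unfold L. lra.
    + right. field. lra.
Qed.

Lemma fubini_R (g : R -> R -> R) (a b c d : R) : (forall u v, continuity_2d_pt g u v) ->
  RInt (fun u => RInt (fun v => g u v) c d) a b = RInt (fun v => RInt (fun u => g u v) a b) c d.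
Proof.
  intros Hg. assert (Hs := c2d_swap g Hg).
  set (H := fun x : R => (RInt (fun v => RInt (fun u => g u v) a x) c d : R)).
  assert (X : forall v x, ex_RInt (fun u => g u v) a x).
  { intros v x. apply (ex_RInt_continuous (V:=R_CompleteNormedModule)). intros z _. exact (c2d_row (fun x y => g y x) v z Hs). }
  assert (D : forall x v, is_derive (fun z => RInt (fun u => g u v) a z) x (g x v)).
  { intros x v. apply (is_derive_RInt (V:=R_NormedModule) (fun u => g u v) (fun z => RInt (fun u => g u v) a z) a).
    - apply filter_forall. intros y. apply (RInt_correct (V:=R_CompleteNormedModule)). auto.
    - exact (c2d_row (fun x y => g y x) v x Hs). }
  assert (DH : forall x, is_derive H x (RInt (fun v => g x v) c d)).
  { intros x. unfold H.
    replace (RInt (fun v => g x v) c d) with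
      (RInt (fun t => Derive (fun u => RInt (fun z => g z t) a u) x) c d).
    - apply (is_derive_RInt_param (fun x v => RInt (fun u => g u v) a x)).
      + apply filter_forall. intros y t _. eexists; apply D.
      + intros t _. apply continuity_2d_pt_ext with g; [|apply Hg].
        intros u v. symmetry. apply is_derive_unique, D.
      + apply filter_forall. intros y. apply (ex_RInt_continuous (V:=R_CompleteNormedModule)).
        intros z _. exact (RInt_param_continuous (fun x y => g y x) a y z Hs).
    - apply RInt_ext. intros v _. apply is_derive_unique, D. }
  transitivity (H b - H a)%R.
  - apply is_RInt_unique. apply (is_RInt_derive (V := R_CompleteNormedModule)).
    + intros x _. apply DH.
    + intros x _. apply RInt_param_continuous; auto.
  - assert (E : H a = 0%R).
    { unfold H. rewrite (RInt_ext _ (fun _ => 0%R)).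
      - rewrite RInt_const. exact (Rmult_0_r (d - c)).
      - intros v _. apply (RInt_point (V := R_CompleteNormedModule)). }
    rewrite E, Rminus_0_r. reflexivity.
Qed.

Lemma cont2_Re F : cont2 F -> forall u v, continuity_2d_pt (fun u v => Re (F u v)) u v.
Proof.
  intros H u v. apply continuity_2d_pt_filterlim. 
  apply (cC_Re (fun p : R * R => F (fst p) (snd p)) (u, v)). apply H.
Qed.

Lemma cont2_Im F : cont2 F -> forall u v, continuity_2d_pt (fun u v => Im (F u v)) u v.
Proof.
  intros H u v. apply continuity_2d_pt_filterlim. 
  apply (cC_Im (fun p : R * R => F (fst p) (snd p)) (u, v)). apply H.
Qed.

Lemma CI_param_cont F c d : cont2 F -> cont (fun u => CI (F u) c d).
Proof.
  intros H x. apply cC_intro.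
  - apply (continuous_ext (fun u => RInt (fun v => Re (F u v)) c d)).
    { intros u. symmetry. apply CI_Re. apply cont2_r; auto. }
    apply (RInt_param_continuous (fun u v => Re (F u v))). apply cont2_Re; auto.
  - apply (continuous_ext (fun u => RInt (fun v => Im (F u v)) c d)).
    { intros u. symmetry. apply CI_Im. apply cont2_r; auto. }
    apply (RInt_param_continuous (fun u v => Im (F u v))). apply cont2_Im; auto.
Qed.

Lemma CI_fubini F a b c d : cont2 F ->
  CI (fun u => CI (fun v => F u v) c d) a b = CI (fun v => CI (fun u => F u v) a b) c d.
Proof.
  intros H. assert (H1 := CI_param_cont F c d H).
  assert (H2 := CI_param_cont _ a b (cont2_swap F H)).
  apply C_ext.
  - rewrite !CI_Re by assumption.
    rewrite (RInt_ext _ (fun u => RInt (fun v => Re (F u v)) c d)).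
    2:{ intros u _. apply CI_Re. apply cont2_r; auto. }
    rewrite fubini_R by (apply cont2_Re; auto).
    apply RInt_ext. intros v _. symmetry. apply CI_Re. apply cont2_l; auto.
  - rewrite !CI_Im by assumption.
    rewrite (RInt_ext _ (fun u => RInt (fun v => Im (F u v)) c d)).
    2:{ intros u _. apply CI_Im. apply cont2_r; auto. }
    rewrite fubini_R by (apply cont2_Im; auto).
    apply RInt_ext. intros v _. symmetry. apply CI_Im. apply cont2_l; auto.
Qed.

(** The projection onto [a, b] through absolute values, which makes its continuity evident. *)
Lemma clamp_abs (a b x : R) :
  (((a + (x + b - Rabs (x - b)) / 2) + Rabs (a - (x + b - Rabs (x - b)) / 2)) / 2)%R = Rmax a (Rmin x b).
Proof.
  unfold Rmax, Rmin. destruct (Rle_dec x b) as [L|L].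
  - rewrite (Rabs_left1 (x - b)) by lra. replace ((x + b - - (x - b)) / 2)%R with x by field.
    destruct (Rle_dec a x) as [L'|L']; [rewrite Rabs_left1 by lra|rewrite Rabs_pos_eq by lra]; field.
  - rewrite (Rabs_pos_eq (x - b)) by lra. replace ((x + b - (x - b)) / 2)%R with b by field.
    destruct (Rle_dec a b) as [L'|L']; [rewrite Rabs_left1 by lra|rewrite Rabs_pos_eq by lra]; field.
Qed.

(** Green's formula for a closed form P du dv = d(Phi) = d(Psi): when Phi_u = Psi_v,
    the u-variation of the v-integral of Phi is a boundary term. Only the band
    a <= u <= b matters; outside it the integrand is frozen at the nearest edge. *)
Lemma green (Phi Psi P : R -> R -> C) (a b c d : R) : a <= b -> c <= d ->
  (forall u v, a <= u <= b -> c <= v <= d -> dR (fun u => Phi u v) u (P u v)) ->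
  (forall u v, a <= u <= b -> c <= v <= d -> dR (fun v => Psi u v) v (P u v)) ->
  (forall u v, a <= u <= b -> continuous (fun p : R * R => P (fst p) (snd p)) (u, v)) ->
  CI (fun v => Phi b v - Phi a v) c d = CI (fun u => Psi u d - Psi u c) a b.
Proof.
  intros Hab Hcd H1 H2 HP.
  set (k := fun u => Rmax a (Rmin u b)).
  assert (kb : forall u, a <= k u <= b).
  { intros u. unfold k. generalize (Rmin_r u b) (Rmax_l a (Rmin u b)). intros.
    split; auto. apply Rmax_lub; auto. }
  assert (ki : forall u, a <= u <= b -> k u = u).
  { intros u Hu. unfold k. rewrite Rmin_left, Rmax_right; lra. }
  assert (kc : forall u, continuous k u).
  { intros u.
    apply (continuous_ext (fun u => ((a + (u + b - Rabs (u - b)) / 2) + Rabs (a - (u + b - Rabs (u - b)) / 2)) / 2)%R).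
    - exact (clamp_abs a b).
    - cc; lra. }
  assert (C2 : cont2 (fun u v => P (k u) v)).
  { intros u v.
    apply (continuous_comp_2 (fun p : R * R => k (fst p)) (fun p : R * R => snd p) (fun x y => P x y)).
    - apply (cR_comp k). apply cR_fst. apply kc.
    - apply cR_snd.
    - apply HP. apply kb. }
  transitivity (CI (fun v => CI (fun u => P (k u) v) a b) c d).
  - apply CI_ext. rewrite Rmin_left, Rmax_right by lra. intros v Hv. symmetry.
    rewrite (CI_ext _ (fun u => P u v)).
    2:{ rewrite Rmin_left, Rmax_right by lra. intros u Hu. rewrite ki by lra. reflexivity. }
    apply CI_unique. apply (CI_FTC_loc (fun u => Phi u v)); auto.
    + intros u Hu. apply H1; lra.
    + intros u Hu. apply (continuous_comp_2 (fun u => u) (fun _ => v) (fun x y => P x y)); cc. apply HP; auto.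
  - rewrite <- CI_fubini by exact C2.
    apply CI_ext. rewrite Rmin_left, Rmax_right by lra. intros u Hu.
    rewrite ki by lra. apply CI_unique. apply (CI_FTC_loc (fun v => Psi u v)); auto.
    + intros v Hv. apply H2; lra.
    + intros v Hv. apply (continuous_comp_2 (fun _ => u) (fun v => v) (fun x y => P x y)); cc. apply HP; lra.
Qed.

(** ** Interchange of integrals over the line *)

Definition dom2 (F : R -> R -> C) (M : R) : Prop :=
  cont2 F /\ forall u v, Cmod (F u v) <= M / ((1 + u * u) * (1 + v * v)).

Lemma dom2_row F M u : dom2 F M -> dom (F u) (M / (1 + u * u)).
Proof.
  intros [H1 H2]. split; [apply cont2_r; auto|]. intros v.
  eapply Rle_trans; [apply H2|]. right. field. split; generalize (sqr1_pos v) (sqr1_pos u); lra.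
Qed.

Lemma dom2_swap F M : dom2 F M -> dom2 (fun u v => F v u) M.
Proof.
  intros [H1 H2]. split; [apply cont2_swap; auto|]. intros u v. rewrite Rmult_comm. apply H2.
Qed.

Lemma dom2_pos F M : dom2 F M -> 0 <= M.
Proof.
  intros H. assert (D := dom_pos _ _ (dom2_row F M 0 H)). replace (M / (1 + 0 * 0))%R with M in D by field. exact D.
Qed.

Lemma tail_small K eps : 0 <= K -> 0 < eps ->
  exists N, 0 < N /\ K * (PI / 2 - atan N) < eps.
Proof.
  intros HK He. destruct (atan_near (eps / (K + 1))) as [N [HN1 HN2]]. { apply Rdiv_lt_0_compat; lra. }
  exists N. split; auto. apply Rmult_lt_compat_l with (r := (K + 1)%R) in HN2; [|lra].
  replace ((K + 1) * (eps / (K + 1)))%R with eps in HN2 by (field; lra).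
  generalize (atan_bound N). nra.
Qed.

Lemma dom2_II F M : dom2 F M -> dom (fun u => II (F u)) (M * PI).
Proof.
  intros H. assert (HM := dom2_pos _ _ H). split.
  - intros u. apply continuous_C_eps. intros eps He.
    destruct (tail_small (4 * M) (eps / 3)) as [N [HN1 HN2]]; try lra.
    assert (T : forall u, Cmod (II (F u) - CI (F u) (- N) N) < eps / 3).
    { intros x. eapply Rle_lt_trans; [apply (II_CI_tail _ _ _ (dom2_row F M x H) HN1)|].
      eapply Rle_lt_trans; [|exact HN2]. apply Rmult_le_compat_r.
      - generalize (atan_bound N); lra.
      - apply Rmult_le_compat_l; [lra|]. apply Rmult_le_reg_r with (1 + x * x)%R; [apply sqr1_pos|].
        unfold Rdiv. rewrite Rmult_assoc, Rinv_l by (generalize (sqr1_pos x); lra). nra. }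
    generalize (proj1 (continuous_C_eps _ _) (CI_param_cont F (-N) N (proj1 H) u) (eps/3)%R ltac:(lra)).
    apply filter_imp. intros y Hy.
    replace (II (F y) - II (F u)) with ((II (F y) - CI (F y) (-N) N) + ((CI (F y) (-N) N - CI (F u) (-N) N) + - (II (F u) - CI (F u) (-N) N))) by ring.
    eapply Rle_lt_trans; [apply Cmod_triangle|].
    assert (T2 := Cmod_triangle (CI (F y) (-N) N - CI (F u) (-N) N) (- (II (F u) - CI (F u) (-N) N))).
    rewrite Cmod_opp in T2. generalize (T y) (T u). lra.
  - intros u. eapply Rle_trans; [apply (II_bound _ _ (dom2_row F M u H))|]. right. field.
    generalize (sqr1_pos u); lra.
Qed.

Lemma II_square F M N : dom2 F M -> 0 < N ->
  Cmod (II (fun u => II (F u)) - CI (fun u => CI (F u) (- N) N) (- N) N) <= 8 * M * PI * (PI / 2 - atan N).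
Proof.
  intros H HN. assert (D := dom2_II F M H). assert (HM := dom2_pos _ _ H).
  assert (C1 := CI_param_cont F (-N) N (proj1 H)).
  set (t := (PI / 2 - atan N)%R). assert (Ht : 0 <= t) by (unfold t; generalize (atan_bound N); lra).
  assert (D2 : dom (fun u => II (F u) - CI (F u) (- N) N) (4 * M * t)).
  { split. { intros u. apply cC_minus; [apply D|apply C1]. }
    intros u. eapply Rle_trans; [apply (II_CI_tail _ _ _ (dom2_row F M u H) HN)|]. right. unfold t. field.
    generalize (sqr1_pos u); lra. }
  replace (II (fun u => II (F u)) - CI (fun u => CI (F u) (- N) N) (- N) N) with
    ((II (fun u => II (F u)) - CI (fun u => II (F u)) (-N) N) + CI (fun u => II (F u) - CI (F u) (- N) N) (-N) N).
  2:{ rewrite CI_minus; [ring|apply D|apply C1]. }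
  triangle.
  assert (A := II_CI_tail _ _ _ D HN). fold t in A.
  assert (B := dom_CI_atan _ _ (-N) N D2 ltac:(lra)).
  assert (0 <= M * t) by (apply Rmult_le_pos; auto).
  generalize (atan_bound N) (atan_bound (-N)). intros. nra.
Qed.

(** Both iterated integrals are close to the one over a large square. *)
Lemma II_fubini F M : dom2 F M -> II (fun u => II (fun v => F u v)) = II (fun v => II (fun u => F u v)).
Proof.
  intros H. assert (HM := dom2_pos _ _ H). assert (HPI := PI_RGT_0).
  assert (E : II (fun u => II (fun v => F u v)) - II (fun v => II (fun u => F u v)) = 0).
  { apply Cmod_eq_0. apply Rle_antisym; [|apply Cmod_ge_0]. apply Cmod_le_limit. intros eps He.
    destruct (tail_small (16 * M * PI) eps) as [N [HN1 HN2]]; [|lra|]. { assert (0 <= M * PI) by (apply Rmult_le_pos; lra). lra. }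
    assert (A := II_square F M N H HN1).
    assert (B := II_square _ M N (dom2_swap F M H) HN1). cbv beta in B.
    rewrite <- (CI_fubini F) in B by apply H.
    match goal with |- (Cmod (?x - ?y) <= _) => 
      replace (x - y) with ((x - CI (fun u => CI (F u) (- N) N) (- N) N) + - (y - CI (fun u => CI (F u) (- N) N) (- N) N)) by ring end.
    triangle. rewrite Cmod_opp. eapply Rle_trans; [apply Rplus_le_compat; [exact A|exact B]|lra]. }
  rewrite <- (Cplus_0_r (II (fun v => II (fun u => F u v)))), <- E. ring.
Qed.

(** An integrand holomorphic and dominated on a horizontal strip has the same integral on both
    edges: Green's formula on long rectangles, whose short sides contribute little. *)
Lemma II_contour_shift (f f' : C -> C) (p M : R) :
  (forall z, dC f z (f' z)) -> (forall z, continuous f' z) ->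
  (forall q v, Rmin 0 p <= q <= Rmax 0 p -> Cmod (f (RtoC v + Ci * RtoC q)%C) <= M / (1 + v * v)) ->
  II (fun v => f (RtoC v + Ci * RtoC p)) = II (fun v => f (RtoC v)).
Proof.
  intros Hf Hf' HM.
  assert (W : forall p0 p1, Rmin 0 p <= p0 -> p0 <= p1 -> p1 <= Rmax 0 p ->
    II (fun v => f (RtoC v + Ci * RtoC p1)) = II (fun v => f (RtoC v + Ci * RtoC p0))).
  { intros p0 p1 L0 L1 L2.
    assert (fc : forall z, continuous f z) by (intros z; eapply dC_continuous, Hf).
    assert (D : forall q, p0 <= q <= p1 -> dom (fun v => f (RtoC v + Ci * RtoC q)) M).
    { intros q Hq. split; [|intros; apply HM; lra]. intros v. apply (cC_comp f); [cc|apply fc]. }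
    assert (M0 := dom_pos _ _ (D p0 ltac:(lra))).
    assert (DD := dom_minus _ _ _ _ (D p1 ltac:(lra)) (D p0 ltac:(lra))).
    assert (Z : II (fun v => f (RtoC v + Ci * RtoC p1) - f (RtoC v + Ci * RtoC p0)) = 0).
    { apply is_II_unique. apply is_II_intro; [apply DD|]. intros eps He.
      destruct (inv_sqr_small M (eps / (2 * (p1 - p0) + 1)) M0) as [N [HN0 HN]].
      { apply Rdiv_lt_0_compat; lra. }
      exists N. intros a b Ha Hb.
      rewrite (green (fun q v => f (RtoC v + Ci * RtoC q)) (fun q v => Ci * f (RtoC v + Ci * RtoC q))
        (fun q v => Ci * f' (RtoC v + Ci * RtoC q)) p0 p1 a b L1 ltac:(lra)).
      - match goal with |- (Cmod (?x - _) < _) => replace (x - 0) with x by ring end.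
        set (m := (eps / (2 * (p1 - p0) + 1))%R) in *.
        apply Rle_lt_trans with (2 * m * (p1 - p0))%R.
        + apply CI_norm_const; auto.
          * intros q. apply cC_minus; apply cC_mult; try apply cC_const; apply (cC_comp f); cc; apply fc.
          * intros q Hq. triangle. rewrite Cmod_opp, !Cmod_mult, Cmod_Ci.
            generalize (HM q a ltac:(lra)) (HM q b ltac:(lra)) (HN a ltac:(rewrite Rabs_left; lra)) (HN b ltac:(rewrite Rabs_pos_eq; lra)). lra.
        + assert (eps = m * (2 * (p1 - p0) + 1))%R by (unfold m; field; lra).
          assert (0 < m) by (apply Rdiv_lt_0_compat; lra). rewrite H at 1. nra.
      - intros q v _ _. eapply dR_eq; [apply (dR_comp f (fun q => RtoC v + Ci * RtoC q)); [apply Hf|]|].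
        + apply dR_plus; [apply dR_const|apply dR_mult; [apply dR_const|apply dR_id]].
        + dring.
      - intros q v _ _. eapply dR_eq; [apply (dR_mult (fun _ => Ci)); [apply dR_const|apply (dR_comp f (fun v => RtoC v + Ci * RtoC q)); [apply Hf|]]|].
        + apply dR_plus; [apply dR_id|apply dR_const].
        + ring.
      - intros q v _. apply cC_mult; [apply cC_const|]. apply (cC_comp f'); [cc|apply Hf']. }
    rewrite (II_minus _ _ _ _ (D p1 ltac:(lra)) (D p0 ltac:(lra))) in Z.
    match goal with |- ?x = ?y => replace x with ((x - y) + y) by ring end. rewrite Z. ring. }
  transitivity (II (fun v => f (RtoC v + Ci * RtoC 0))).
  - destruct (Rle_dec 0 p) as [L|L].
    + apply W; rewrite ?Rmin_left, ?Rmax_right by lra; lra.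
    + symmetry. apply W; rewrite ?Rmin_right, ?Rmax_left by lra; lra.
  - apply II_ext. intros v. f_equal. ring.
Qed.

(** * Exponential integrals and the gamma function *)

Definition wt (c b v : R) : R := exp (- c * exp v + b * v).
Lemma wt_pos c b v : 0 < wt c b v. Proof. apply exp_pos. Qed.
Lemma exp_ge_sqr x : 0 <= x -> x * x / 2 <= exp x.
Proof.
  intros Hx.
  assert (A : 1 - exp x <= 0) by (generalize (exp_ineq1_le x); lra).
  assert (H : x * x / 2 - exp x <= 0 * 0 / 2 - exp 0).
  { apply (Rderiv_nonpos (fun t => t * t / 2 - exp t)%R (fun t => t - exp t)%R 0 x Hx).
    - intros t _. auto_derive; [trivial|field].
    - intros t _. generalize (exp_ineq1_le t); lra. }
  rewrite exp_0 in H. lra.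
Qed.

Lemma wt_dom c b : 0 < c -> 0 < b -> exists M, 0 <= M /\ forall v, wt c b v <= M / (1 + v * v).
Proof.
  intros Hc Hb.
  assert (P1 : 0 < / c) by (apply Rinv_0_lt_compat; lra).
  assert (P2 : 0 < / (b * b)) by (apply Rinv_0_lt_compat; nra).
  exists (exp (b * b / c) * (1 + 4 / c) + (1 + 2 / (b * b)))%R.
  assert (P3 := exp_pos (b * b / c)).
  assert (P4 : 0 <= exp (b * b / c) * (1 + 4 / c)) by (apply Rmult_le_pos; unfold Rdiv; lra).
  split. { unfold Rdiv in *. lra. }
  intros v. apply Rmult_le_reg_r with (1 + v * v)%R; [apply sqr1_pos|].
  replace (((exp (b * b / c) * (1 + 4 / c) + (1 + 2 / (b * b))) / (1 + v * v)) * (1 + v * v))%R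
    with (exp (b * b / c) * (1 + 4 / c) + (1 + 2 / (b * b)))%R by (field; generalize (sqr1_pos v); nra).
  unfold wt. destruct (Rle_dec 0 v) as [Hv|Hv].
  - apply Rle_trans with (exp (b * b / c) * (1 + 4 / c))%R; [|unfold Rdiv in *; lra].
    assert (E1 := exp_ge_sqr v Hv).
    assert (E2 : - c * exp v + b * v <= b * b / c - c * (v * v) / 4).
    { assert (b * v <= c * (v * v) / 4 + b * b / c); [|nra].
      assert (0 <= (c * v / 2 - b) * (c * v / 2 - b) / c).
      { apply Rmult_le_pos; [apply Rle_0_sqr|lra]. }
      replace ((c * v / 2 - b) * (c * v / 2 - b) / c)%R with (c * (v * v) / 4 + b * b / c - b * v)%R in H by (field; lra). lra. }
    apply Rle_trans with (exp (b * b / c - c * (v * v) / 4) * (1 + v * v))%R.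
    { apply Rmult_le_compat_r; [left; apply sqr1_pos|apply exp_le; exact E2]. }
    unfold Rminus. rewrite exp_plus, Rmult_assoc. apply Rmult_le_compat_l; [lra|].
    set (y := (c * (v * v) / 4)%R). assert (Hy : 0 <= y) by (unfold y; nra).
    replace (v * v)%R with (4 / c * y)%R by (unfold y; field; lra).
    rewrite exp_Ropp. apply Rmult_le_reg_l with (exp y); [apply exp_pos|].
    rewrite <- Rmult_assoc, Rinv_r, Rmult_1_l by (generalize (exp_pos y); lra).
    generalize (exp_ineq1_le y). intros. assert (0 < 4 / c) by (unfold Rdiv; lra). nra.
  - apply Rle_trans with (1 + 2 / (b * b))%R; [|lra].
    assert (Hbv : 0 <= - (b * v)) by nra.
    assert (E1 := exp_ge_sqr _ Hbv).
    apply Rle_trans with (exp (b * v) * (1 + v * v))%R.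
    { apply Rmult_le_compat_r; [left; apply sqr1_pos|apply exp_le]. generalize (exp_pos v); nra. }
    replace (b * v)%R with (- - (b * v))%R by ring. rewrite exp_Ropp. set (y := (- (b * v))%R) in *.
    apply Rmult_le_reg_l with (exp y); [apply exp_pos|].
    rewrite <- Rmult_assoc, Rinv_r, Rmult_1_l by (generalize (exp_pos y); lra).
    replace (v * v)%R with (y * y / (b * b))%R by (unfold y; field; lra).
    generalize (exp_ineq1_le y). intros. unfold Rdiv in *. nra.
Qed.

(** Uniform in the parameters: an intermediate exponent is bounded by the two extreme ones. *)
Lemma wt_dom2 c b b' : 0 < c -> 0 < b -> b <= b' -> exists M, 0 <= M /\ forall c1 b1 v,
  (c <= c1) -> b <= b1 <= b' -> wt c1 b1 v <= M / (1 + v * v).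
Proof.
  intros Hc Hb Hbb. destruct (wt_dom c b Hc Hb) as [M1 [HM1 H1]].
  destruct (wt_dom c b' Hc ltac:(lra)) as [M2 [HM2 H2]].
  exists (M1 + M2)%R. split; [lra|]. intros c1 b1 v Hc1 Hb1.
  replace ((M1 + M2) / (1 + v * v))%R with (M1 / (1 + v * v) + M2 / (1 + v * v))%R by (field; generalize (sqr1_pos v); lra).
  apply Rle_trans with (wt c b v + wt c b' v)%R; [|generalize (H1 v) (H2 v); lra].
  unfold wt. assert (Q := exp_pos v).
  destruct (Rle_dec 0 v) as [L|L].
  - apply Rle_trans with (exp (- c * exp v + b' * v)); [apply exp_le; nra|]. generalize (exp_pos (- c * exp v + b * v)); lra.
  - apply Rle_trans with (exp (- c * exp v + b * v)); [apply exp_le; nra|]. generalize (exp_pos (- c * exp v + b' * v)); lra.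
Qed.

(** In the variable t = e^w, z alone gives Euler and Laplace integrals, and k = 1/2 the
    integrals of the parabolic cylinder functions. *)
Definition ker (k z m w : C) : C := Cexp (- z * Cexp w - k * Cexp (2 * w) + m * w).

Lemma ker_dC k z m w : dC (ker k z m) w ((- z * Cexp w - 2 * k * Cexp (2 * w) + m) * ker k z m w).
Proof.
  unfold ker. eapply dC_eq.
  - apply dC_Cexp. apply dC_plus; [apply dC_minus|].
    + apply dC_mult; [apply dC_const|apply dC_exp].
    + apply dC_mult; [apply dC_const|apply dC_Cexp; apply dC_mult; [apply dC_const|apply dC_id]].
    + apply dC_mult; [apply dC_const|apply dC_id].
  - cbv beta. ring.
Qed.

Lemma ker_mod k z m w : Cmod (ker k z m w) = exp (Re (- z * Cexp w - k * Cexp (2 * w) + m * w)).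
Proof. apply Cmod_Cexp. Qed.

Lemma ker_cont k z m : cont (fun v => ker k z m (RtoC v)).
Proof. intros v. unfold ker. cc. Qed.

Lemma ker_shift_m k z m h w : ker k z (m + h) w = Cexp (h * w) * ker k z m w.
Proof. unfold ker. rewrite <- Cexp_plus. f_equal. ring. Qed.

Lemma ker_shift_z k z m h w : ker k (z + h) m w = Cexp (- h * Cexp w) * ker k z m w.
Proof. unfold ker. rewrite <- Cexp_plus. f_equal. ring. Qed.

(** The exponent of the kernel decreases at least like - c e^v, up to the constant K; this
    covers the Gaussian case k > 0 for all z and the Laplace case k = 0, Re z > 0. *)
Definition adm (k : R) (z : C) (c K : R) : Prop :=
  (0 < c) /\ forall y, 0 < y -> c * y - K <= Re z * y + k * (y * y).

Lemma adm_gauss k z R0 : 0 < k -> Cmod z <= R0 -> adm k z 1 ((1 + R0) * (1 + R0) / (4 * k)).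
Proof.
  intros Hk HR. split; [lra|]. intros y Hy.
  assert (A : - R0 <= Re z). { generalize (re_le_Cmod z). intros H. apply Rabs_le_between in H. lra. }
  assert (B : 0 <= (1 + R0 - 2 * k * y) * (1 + R0 - 2 * k * y) / (4 * k)).
  { apply Rmult_le_pos; [apply Rle_0_sqr|left; apply Rinv_0_lt_compat; lra]. }
  replace ((1 + R0 - 2 * k * y) * (1 + R0 - 2 * k * y) / (4 * k))%R with
    ((1 + R0) * (1 + R0) / (4 * k) - (1 + R0) * y + k * (y * y))%R in B by (field; lra).
  nra.
Qed.

Lemma adm_laplace z : 0 < Re z -> adm 0 z (Re z) 0.
Proof. intros H. split; auto. intros y Hy. lra. Qed.

Lemma adm_pert k z h c K : adm k z c K -> Cmod h <= c / 2 -> adm k (z + h) (c / 2) K.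
Proof.
  intros [Hc H] Hh. split; [lra|]. intros y Hy. specialize (H y Hy). rewrite Re_plus.
  generalize (re_le_Cmod h). intros Q. apply Rabs_le_between in Q. nra.
Qed.

Lemma exp_double v : exp (2 * v) = (exp v * exp v)%R.
Proof. rewrite <- exp_plus. f_equal. ring. Qed.

Lemma ker_bound (k : R) z m c K v : adm k z c K ->
  Cmod (ker (RtoC k) z m (RtoC v)) <= exp K * wt c (Re m) v.
Proof.
  intros [Hc H]. rewrite ker_mod. unfold wt. rewrite <- exp_plus. apply exp_le.
  rewrite <- RtoC_mult, !Cexp_R. 
  replace (Re (- z * RtoC (exp v) - RtoC k * RtoC (exp (2 * v)) + m * RtoC v))
    with (- (Re z * exp v) - k * exp (2 * v) + Re m * v)%R by reim.
  rewrite exp_double. specialize (H (exp v) (exp_pos v)). lra.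
Qed.

(** E 0 1 m is Gamma(m), and E (1/2) z m is Gamma(m) e^(z^2/4) D_(-m)(z). *)
Definition E (k : R) (z m : C) : C := II (fun v => ker (RtoC k) z m (RtoC v)).
Lemma ker_dom_unif k c K b b' : 0 < c -> 0 < b -> b <= b' -> exists M, 0 <= M /\
  forall c1 z m, adm k z c1 K -> c <= c1 -> b <= Re m <= b' -> dom (fun v => ker (RtoC k) z m (RtoC v)) M.
Proof.
  intros Hc Hb Hbb. destruct (wt_dom2 c b b' Hc Hb Hbb) as [M [HM H]].
  exists (exp K * M)%R. split. { apply Rmult_le_pos; [left; apply exp_pos|auto]. }
  intros c1 z m Ha Hc1 Hm. split; [apply ker_cont|]. intros v.
  eapply Rle_trans; [apply (ker_bound k z m c1 K v Ha)|].
  unfold Rdiv. rewrite Rmult_assoc. apply Rmult_le_compat_l; [left; apply exp_pos|]. apply H; auto.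
Qed.

Lemma ker_dom k z m c K : adm k z c K -> 0 < Re m -> exists M, dom (fun v => ker (RtoC k) z m (RtoC v)) M.
Proof.
  intros Ha Hm. destruct (ker_dom_unif k c K (Re m) (Re m)) as [M [_ H]]; try lra. { apply Ha. }
  exists M. apply (H c); auto; lra.
Qed.

Lemma E_dC k z m c K : adm k z c K -> 0 < Re m -> dC (fun z => E k z m) z (- E k z (m + 1)).
Proof.
  intros Ha Hm. assert (Hc : 0 < c) by apply Ha.
  destruct (ker_dom_unif k (c/2) K (Re m) (Re m)) as [M [HM H]]; try lra.
  destruct (ker_dom k z (m + 1) c K Ha) as [M1 H1]. { rewrite Re_plus; simpl; lra. }
  destruct (wt_dom (c/2) (Re m + 2)) as [M2 [HM2 H2]]; try lra.
  eapply dC_eq.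
  - apply (II_dC (fun z v => ker (RtoC k) z m (RtoC v)) (fun v => (- (1)) * ker (RtoC k) z (m + 1) (RtoC v)) z
      (c / 2)%R (exp K * M2)%R M (Cmod (- (1)) * M1)%R); [lra| | |].
    + intros h Hh. apply (H (c/2)%R); try lra. apply adm_pert; auto.
    + apply dom_scal. exact H1.
    + intros h v Hh. rewrite ker_shift_z, ker_shift_m, Cmult_1_l, Cexp_R.
      match goal with |- (Cmod ?x <= _) => replace x with
        ((Cexp (- h * RtoC (exp v)) - 1 - (- h * RtoC (exp v))) * ker (RtoC k) z m (RtoC v)) by ring end.
      rewrite Cmod_mult.
      apply Rle_trans with ((Cmod h * exp v) * (Cmod h * exp v) * exp (c / 2 * exp v) * (exp K * wt c (Re m) v))%R.
      * apply Rmult_le_compat; try apply Cmod_ge_0; [|apply ker_bound; auto].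
        eapply Rle_trans; [apply Cexp_taylor2|].
        rewrite Cmod_mult, Cmod_opp, Cmod_R, (Rabs_pos_eq (exp v)) by (left; apply exp_pos).
        apply Rmult_le_compat_l. { generalize (Cmod_ge_0 h) (exp_pos v). intros. assert (0 <= Cmod h * exp v) by (apply Rmult_le_pos; lra). nra. }
        apply exp_le. apply Rmax_lub. { generalize (exp_pos v); nra. }
        replace (Re (- h * RtoC (exp v))) with (- Re h * exp v)%R by reim.
        apply Rmult_le_compat_r; [left; apply exp_pos|]. generalize (re_le_Cmod h). intros Q. apply Rabs_le_between in Q. lra.
      * specialize (H2 v).
        replace (Cmod h * exp v * (Cmod h * exp v) * exp (c / 2 * exp v) * (exp K * wt c (Re m) v))%R
          with (exp K * (Cmod h * Cmod h) * wt (c/2) (Re m + 2) v)%R.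
        -- replace (exp K * M2 * (Cmod h * Cmod h) / (1 + v * v))%R with (exp K * (Cmod h * Cmod h) * (M2 / (1 + v * v)))%R by (field; generalize (sqr1_pos v); lra).
           apply Rmult_le_compat_l; auto. apply Rmult_le_pos; [left; apply exp_pos|]. generalize (Cmod_ge_0 h); nra.
        -- unfold wt. 
           replace (- (c / 2) * exp v + (Re m + 2) * v)%R with ((- c * exp v + Re m * v) + (c / 2 * exp v + (v + v)))%R by field.
           rewrite !exp_plus. ring.
  - rewrite (II_scal _ _ M1) by exact H1. unfold E. ring.
Qed.

(** Integrating the derivative of the kernel gives a three-term recurrence. *)
Lemma E_rec k z m c K : adm k z c K -> 0 < Re m ->
  m * E k z m = z * E k z (m + 1) + 2 * RtoC k * E k z (m + 2).
Proof.
  intros Ha Hm.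
  destruct (ker_dom k z m c K Ha Hm) as [M0 H0].
  destruct (ker_dom k z (m + 1) c K Ha) as [M1 H1]. { rewrite Re_plus; simpl; lra. }
  destruct (ker_dom k z (m + 2) c K Ha) as [M2 H2]. { rewrite Re_plus; simpl; lra. }
  assert (D1 := dom_scal _ z _ H1). assert (D2 := dom_scal _ (2 * RtoC k) _ H2).
  assert (D0 := dom_scal _ m _ H0). assert (D12 := dom_plus _ _ _ _ D1 D2).
  assert (Z := fun M => II_total_derivative (fun v => ker (RtoC k) z m (RtoC v)) _ M M0
    (fun v => dR_comp (ker (RtoC k) z m) (fun v => RtoC v) v _ _ (ker_dC _ _ _ _) (dR_id v))).
  cbv beta in D0, D1, D2, D12.
  assert (X : II (fun v => m * ker (RtoC k) z m (RtoC v) - (z * ker (RtoC k) z (m + 1) (RtoC v) + 2 * RtoC k * ker (RtoC k) z (m + 2) (RtoC v))) = 0).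
  { assert (EQ : forall v, 1 * ((- z * Cexp (RtoC v) - 2 * RtoC k * Cexp (2 * RtoC v) + m) * ker (RtoC k) z m (RtoC v)) =
      m * ker (RtoC k) z m (RtoC v) - (z * ker (RtoC k) z (m + 1) (RtoC v) + 2 * RtoC k * ker (RtoC k) z (m + 2) (RtoC v))).
    { intros v. rewrite !ker_shift_m, !Cmult_1_l. ring. }
    rewrite <- (II_ext _ _ EQ). eapply Z; [|apply H0].
    eapply dom_ext; [|apply (dom_minus _ _ _ _ D0 D12)]. intros v. symmetry. apply EQ. }
  rewrite (II_minus _ _ _ _ D0 D12), (II_plus _ _ _ _ D1 D2), (II_scal _ _ _ H0), (II_scal _ _ _ H1), (II_scal _ _ _ H2) in X.
  unfold E. rewrite <- (Cplus_0_r (z * _ + _)), <- X. ring.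
Qed.

Lemma abs_le_exp d v : 0 < d -> Rabs v <= / d * (exp (d * v) + exp (- d * v)).
Proof.
  intros Hd. apply Rmult_le_reg_l with d; auto. rewrite <- Rmult_assoc, Rinv_r, Rmult_1_l by lra.
  rewrite <- (Rabs_pos_eq d) at 1 by lra. rewrite <- Rabs_mult.
  replace (- d * v)%R with (- (d * v))%R by ring.
  generalize (exp_ineq1_le (d * v)) (exp_ineq1_le (- (d * v))) (exp_pos (d * v)) (exp_pos (- (d * v))).
  intros. apply Rabs_le. lra.
Qed.

Lemma exp_abs_le d v : exp (d * Rabs v) <= exp (d * v) + exp (- d * v).
Proof.
  destruct (Rle_dec 0 v) as [L|L].
  - rewrite Rabs_pos_eq by lra. generalize (exp_pos (- d * v)); lra.
  - rewrite Rabs_left by lra. replace (d * - v)%R with (- d * v)%R by ring. generalize (exp_pos (d * v)); lra.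
Qed.

Lemma E_cont_m k z c K m : adm k z c K -> 0 < Re m -> continuous (fun m => E k z m) m.
Proof.
  intros Ha Hm. set (d := (Re m / 4)%R). assert (Hd : 0 < d) by (unfold d; lra).
  assert (Hc : 0 < c) by apply Ha.
  destruct (ker_dom_unif k c K (Re m - d) (Re m + d)) as [M [HM H]]; try (unfold d; lra).
  destruct (wt_dom2 c (Re m - 2 * d) (Re m + 2 * d)) as [M2 [HM2 H2]]; try (unfold d; lra).
  set (L := (exp K * (/ d * (4 * M2)))%R).
  assert (HL : 0 <= L). { unfold L. apply Rmult_le_pos; [left; apply exp_pos|]. apply Rmult_le_pos; [left; apply Rinv_0_lt_compat; lra|lra]. }
  assert (Lip : forall h, Cmod h <= d -> Cmod (E k z (m + h) - E k z m) <= L * Cmod h * PI).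
  { intros h Hh. assert (Q := re_le_Cmod h). apply Rabs_le_between in Q.
    apply (II_diff_bound _ _ M M).
    - apply (H c); auto; try lra. rewrite Re_plus. lra.
    - apply (H c); auto; lra.
    - intros v. rewrite ker_shift_m.
      match goal with |- (Cmod ?x <= _) => replace x with ((Cexp (h * RtoC v) - 1) * ker (RtoC k) z m (RtoC v)) by ring end.
      rewrite Cmod_mult.
      apply Rle_trans with ((Cmod h * (/ d * (exp (d * v) + exp (- d * v))) * (exp (d * v) + exp (- d * v))) * (exp K * wt c (Re m) v))%R.
      + apply Rmult_le_compat; try apply Cmod_ge_0; [|apply ker_bound; auto].
        eapply Rle_trans; [apply Cexp_taylor1|]. rewrite Cmod_mult, Cmod_R.
        apply Rmult_le_compat.
        * apply Rmult_le_pos; [apply Cmod_ge_0|apply Rabs_pos].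
        * left; apply exp_pos.
        * apply Rmult_le_compat_l; [apply Cmod_ge_0|apply abs_le_exp; auto].
        * eapply Rle_trans; [|apply exp_abs_le]. apply exp_le.
          apply Rmax_lub. { generalize (Rabs_pos v); nra. }
          replace (Re (h * RtoC v)) with (Re h * v)%R by reim.
          eapply Rle_trans; [apply Rle_abs|]. rewrite Rabs_mult. apply Rmult_le_compat_r; [apply Rabs_pos|].
          generalize (re_le_Cmod h); lra.
      + replace (Cmod h * (/ d * (exp (d * v) + exp (- d * v))) * (exp (d * v) + exp (- d * v)) * (exp K * wt c (Re m) v))%R
         with (exp K * (/ d * (wt c (Re m + 2 * d) v + (wt c (Re m) v + wt c (Re m) v) + wt c (Re m - 2 * d) v)) * Cmod h)%R.
        * replace (L * Cmod h / (1 + v * v))%R with (exp K * (/ d * (4 * (M2 / (1 + v * v)))) * Cmod h)%R.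
          2:{ unfold L. field. generalize (sqr1_pos v); lra. }
          apply Rmult_le_compat_r; [apply Cmod_ge_0|]. apply Rmult_le_compat_l; [left; apply exp_pos|].
          apply Rmult_le_compat_l; [left; apply Rinv_0_lt_compat; lra|].
          generalize (H2 c (Re m + 2 * d)%R v ltac:(lra) ltac:(lra)) (H2 c (Re m) v ltac:(lra) ltac:(lra)) (H2 c (Re m - 2 * d)%R v ltac:(lra) ltac:(lra)). lra.
        * unfold wt. replace (- c * exp v + (Re m + 2 * d) * v)%R with ((- c * exp v + Re m * v) + (d * v + d * v))%R by ring.
          replace (- c * exp v + (Re m - 2 * d) * v)%R with ((- c * exp v + Re m * v) + (- d * v + - d * v))%R by ring.
          rewrite !exp_plus. 
          assert (U : (exp (d * v) * exp (- d * v) = 1)%R) by (rewrite <- exp_plus, <- exp_0; f_equal; ring).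
          set (a := exp (d * v)) in *. set (b := exp (- d * v)) in *. set (w := (exp (- c * exp v) * exp (Re m * v))%R).
          transitivity (exp K * (/ d * (w * (a * a) + 2 * (a * b) * w + w * (b * b))) * Cmod h)%R; [rewrite U; ring|ring]. }
  apply continuous_C_eps. intros eps He.
  assert (HPI := PI_RGT_0).
  assert (P : 0 < L * PI + 1) by nra.
  assert (d2 : 0 < Rmin d (eps / (L * PI + 1)) / sqrt 2).
  { apply Rdiv_lt_0_compat; [|apply Rlt_sqrt2_0]. apply Rmin_pos; [lra|]. apply Rdiv_lt_0_compat; lra. }
  exists (mkposreal _ d2). intros y Hy. apply (C_NormedModule_mixin_compat2 m y) in Hy. simpl in Hy.
  match type of Hy with (_ < sqrt 2 * (?m / sqrt 2)) =>
    replace (sqrt 2 * (m / sqrt 2))%R with m in Hy by (field; apply Rgt_not_eq, Rlt_sqrt2_0) end.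
  change (minus y m) with (y - m) in Hy.
  specialize (Lip (y - m)). rewrite Cplus_minus_cancel in Lip.
  assert (h1 : Cmod (y - m) < d) by (eapply Rlt_le_trans; [exact Hy|apply Rmin_l]).
  assert (h2 : Cmod (y - m) < eps / (L * PI + 1)) by (eapply Rlt_le_trans; [exact Hy|apply Rmin_r]).
  eapply Rle_lt_trans; [apply Lip; lra|].
  apply Rmult_lt_compat_l with (r := (L * PI + 1)%R) in h2; [|lra].
  replace ((L * PI + 1) * (eps / (L * PI + 1)))%R with eps in h2 by (field; lra).
  generalize (Cmod_ge_0 (y - m)). nra.
Qed.

Lemma E_conj k z m c K : adm k z c K -> 0 < Re m -> E k (Cconj z) (Cconj m) = Cconj (E k z m).
Proof.
  intros Ha Hm. destruct (ker_dom k z m c K Ha Hm) as [M H]. unfold E. rewrite <- (II_conj _ M H).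
  apply II_ext. intros v. unfold ker. rewrite Cexp_conj. f_equal. rewrite <- RtoC_mult, !Cexp_R. ceq; ring.
Qed.

Lemma II_norm_le f (g : R -> R) M M' : dom f M -> dom (fun v => RtoC (g v)) M' ->
  (forall v, Cmod (f v) <= g v) -> Cmod (II f) <= Re (II (fun v => RtoC (g v))).
Proof.
  intros Hf Hg H. apply Cmod_le_limit. intros eps He.
  destruct (is_II_eps _ _ (proj1 Hf) (dom_is_II _ _ Hf) (eps/2)%R ltac:(lra)) as [N1 H1].
  destruct (is_II_eps _ _ (proj1 Hg) (dom_is_II _ _ Hg) (eps/2)%R ltac:(lra)) as [N2 H2].
  set (b := (Rmax 0 (Rmax N1 N2) + 1)%R).
  assert (B : (0 < b /\ N1 < b /\ N2 < b)%R).
  { unfold b. generalize (Rmax_l 0 (Rmax N1 N2)) (Rmax_r 0 (Rmax N1 N2)) (Rmax_l N1 N2) (Rmax_r N1 N2). lra. }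
  specialize (H1 (-b)%R b ltac:(lra) ltac:(lra)). specialize (H2 (-b)%R b ltac:(lra) ltac:(lra)).
  assert (Q : Cmod (CI f (-b) b) <= Re (CI (fun v => RtoC (g v)) (-b) b)).
  { apply (is_RInt_norm_le f g (-b) b); auto; [lra|apply CI_correct, Hf|].
    exact (is_RInt_Re (fun v => RtoC (g v)) _ _ _ (CI_correct _ _ _ (proj1 Hg))). }
  assert (A := Re_le_Cmod (CI (fun v => RtoC (g v)) (-b) b - II (fun v => RtoC (g v)))).
  replace (Re (CI (fun v => RtoC (g v)) (- b) b - II (fun v => RtoC (g v)))) with
    (Re (CI (fun v => RtoC (g v)) (- b) b) - Re (II (fun v => RtoC (g v))))%R in A by reflexivity.
  assert (T := Cmod_triangle_inv (II f) (CI f (-b) b)). rewrite Cmod_minus_sym in T. lra.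
Qed.

Lemma is_RInt_constR a b c : is_RInt (fun _ => c) a b ((b - a) * c)%R.
Proof. exact (is_RInt_const (V := R_NormedModule) a b c). Qed.

Lemma II_pos (g : R -> R) M c : dom (fun v => RtoC (g v)) M -> (forall v, 0 <= g v) ->
  (forall v, 0 <= v <= 1 -> c <= g v) -> c <= Re (II (fun v => RtoC (g v))).
Proof.
  intros Hg H0 H1. apply le_epsilon. intros eps He.
  destruct (is_II_eps _ _ (proj1 Hg) (dom_is_II _ _ Hg) eps He) as [N H2].
  set (b := (Rmax 0 N + 2)%R).
  assert (B : (2 <= b /\ N < b)%R) by (unfold b; generalize (Rmax_l 0 N) (Rmax_r 0 N); lra).
  specialize (H2 (-b)%R b ltac:(lra) ltac:(lra)).
  assert (P : forall p q, p <= q -> is_RInt g p q (Re (CI (fun v => RtoC (g v)) p q))).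
  { intros p q _. exact (is_RInt_Re (fun v => RtoC (g v)) _ _ _ (CI_correct _ p q (proj1 Hg))). }
  assert (P0 : forall p q, p <= q -> 0 <= Re (CI (fun v => RtoC (g v)) p q)).
  { intros p q Hpq. apply (is_RInt_le (fun _ => 0%R) g p q); auto.
    assert (Q := is_RInt_constR p q 0). rewrite Rmult_0_r in Q. exact Q. }
  assert (P1 : c <= Re (CI (fun v => RtoC (g v)) 0 1)).
  { apply (is_RInt_le (fun _ => c) g 0 1); auto; try lra.
    - assert (Q := is_RInt_constR 0 1 c). replace ((1 - 0) * c)%R with c in Q by ring. exact Q.
    - apply P; lra.
    - intros; apply H1; lra. }
  assert (A := Re_le_Cmod (CI (fun v => RtoC (g v)) (-b) b - II (fun v => RtoC (g v)))).
  replace (Re (CI (fun v => RtoC (g v)) (- b) b - II (fun v => RtoC (g v)))) with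
    (Re (CI (fun v => RtoC (g v)) (- b) b) - Re (II (fun v => RtoC (g v))))%R in A by reflexivity.
  rewrite <- (CI_Chasles _ (-b) 0 b (proj1 Hg)), <- (CI_Chasles _ 0 1 b (proj1 Hg)), !Re_plus in A.
  rewrite <- (CI_Chasles _ (-b) 0 b (proj1 Hg)), <- (CI_Chasles _ 0 1 b (proj1 Hg)) in H2.
  generalize (P0 (-b) 0 ltac:(lra))%R (P0 1 b ltac:(lra))%R. lra.
Qed.

(** Substitution t = e^v in Euler's integral. *)
Lemma GammaInt_E m : 0 < Re m -> GammaInt m = E 0 1 m.
Proof.
  intros Hm. destruct (ker_dom 0 1 m 1 0) as [M H]; auto. { apply adm_laplace. simpl; lra. }
  unfold GammaInt.
  apply (is_RInt_gen_unique (V := C_R_CompleteNormedModule) (Fa := at_right 0) (Fb := Rbar_locally p_infty)).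
  assert (S : forall a b, 0 < a -> a <= b -> is_RInt (V := C_R_CompleteNormedModule)
     (fun t : R => Cexp ((m - 1) * RtoC (ln t)) * RtoC (exp (- t))) a b
     (CI (fun v => ker 0 1 m (RtoC v)) (ln a) (ln b))).
  { intros a b Ha Hab.
    assert (Q := is_RInt_comp (V := C_R_CompleteNormedModule) (fun v => ker 0 1 m (RtoC v)) ln Rinv a b).
    assert (Q' := Q (fun x _ => ker_cont 0 1 m (ln x))).
    assert (Q2 := Q' (fun x Hx => conj (is_derive_ln x ltac:(rewrite Rmin_left in Hx; lra)) (continuous_Rinv x ltac:(rewrite Rmin_left in Hx; lra)))).
    refine (is_RInt_ext (V := C_R_CompleteNormedModule) _ _ _ _ _ _ Q2).
    intros t. rewrite Rmin_left by lra. intros Ht. unfold ker.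
    rewrite Cexp_R, exp_ln by lra.
    replace (- (1) * RtoC t - 0 * Cexp (2 * RtoC (ln t)) + m * RtoC (ln t)) with
      ((m - 1) * RtoC (ln t) + (RtoC (ln t) + RtoC (- t))) by (rewrite RtoC_opp; ring).
    rewrite !Cexp_plus, !Cexp_R, exp_ln by lra.
    assert (t <> 0)%R by lra. apply C_ext; cbn; field; auto. }
  intros P [d HP]. destruct (is_II_eps _ _ (proj1 H) (dom_is_II _ _ H) d (cond_pos d)) as [N HN].
  exists (fun a => (0 < a < Rmin 1 (exp (- N)))) (fun b => (Rmax 1 (exp N) < b)).
  - assert (e1 : 0 < Rmin 1 (exp (- N))) by (apply Rmin_pos; [lra|apply exp_pos]).
    exists (mkposreal _ e1). intros y Hy Hy0. split; auto.
    change (Rabs (y - 0) < Rmin 1 (exp (- N))) in Hy. rewrite Rminus_0_r, Rabs_pos_eq in Hy by lra. exact Hy.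
  - exists (Rmax 1 (exp N)). auto.
  - intros a b [Ha1 Ha2] Hb.
    assert (A1 := Rmin_l 1 (exp (-N))). assert (A2 := Rmin_r 1 (exp (-N))).
    assert (B1 := Rmax_l 1 (exp N)). assert (B2 := Rmax_r 1 (exp N)).
    exists (CI (fun v => ker 0 1 m (RtoC v)) (ln a) (ln b)). split; [apply S; lra|].
    apply HP. apply C_NormedModule_mixin_compat1. apply HN.
    + rewrite <- (ln_exp (- N)). apply ln_increasing; lra.
    + rewrite <- (ln_exp N). apply ln_increasing; [apply exp_pos|lra].
Qed.

(** Bounds the second moment of the weight of Gamma(x) by Gamma(x+1) and Gamma(x-1). *)
Lemma sqr_le_cosh v : v * v <= exp v + exp (- v) - 2.
Proof.
  assert (P : forall t, 0 <= t -> t <= exp (t / 2) - exp (- (t / 2))).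
  { intros t Ht.
    assert (D : t - exp (t / 2) + exp (- (t / 2)) <= 0 - exp (0 / 2) + exp (- (0 / 2))).
    { apply (Rderiv_nonpos (fun t => t - exp (t / 2) + exp (- (t / 2)))%R
       (fun t => 1 - / 2 * (exp (t / 2) + exp (- (t / 2))))%R 0 t Ht).
      - intros x _. auto_derive; [trivial|]. unfold Rdiv. field.
      - intros x _. rewrite exp_Ropp. assert (Q := exp_pos (x / 2)). set (a := exp (x / 2)) in *.
        assert (a * / a = 1)%R by (field; lra). assert (0 < / a) by (apply Rinv_0_lt_compat; lra).
        assert (0 <= (a - / a) * (a - / a)) by apply Rle_0_sqr. nra. }
    replace (0 / 2)%R with 0%R in D by field. rewrite Ropp_0, exp_0 in D. lra. }
  assert (Q : forall t, 0 <= t -> t * t <= exp t + exp (- t) - 2).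
  { intros t Ht. specialize (P t Ht). 
    replace (exp t) with (exp (t / 2) * exp (t / 2))%R by (rewrite <- exp_plus; f_equal; field).
    replace (exp (- t)) with (exp (- (t / 2)) * exp (- (t / 2)))%R by (rewrite <- exp_plus; f_equal; field).
    assert (U : (exp (t / 2) * exp (- (t / 2)) = 1)%R) by (rewrite <- exp_plus, <- exp_0; f_equal; ring).
    nra. }
  destruct (Rle_dec 0 v) as [L|L]; [apply Q; auto|].
  specialize (Q (- v)%R ltac:(lra)). rewrite Ropp_involutive in Q. lra.
Qed.

Lemma adm01 : adm 0 1 1 0.
Proof. apply adm_laplace. simpl; lra. Qed.

Lemma Gamma_step m : 0 < Re m -> E 0 1 (m + 1) = m * E 0 1 m.
Proof.
  intros Hm. rewrite (E_rec 0 1 m 1 0 adm01 Hm). ring.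
Qed.

Lemma Gamma_zero_iter m n : 0 < Re m -> E 0 1 m = 0 -> E 0 1 (m + RtoC (INR n)) = 0.
Proof.
  intros Hm H0. induction n as [|n IH]. { simpl. rewrite Cplus_0_r. exact H0. }
  rewrite S_INR, RtoC_plus, Cplus_assoc. rewrite Gamma_step, IH; [ring|].
  rewrite Re_plus. simpl. generalize (pos_INR n). lra.
Qed.

Lemma gamma_weight_E x : 0 < x -> exists M, dom (fun v => RtoC (wt 1 x v)) M /\ II (fun v => RtoC (wt 1 x v)) = E 0 1 (RtoC x).
Proof.
  intros Hx. destruct (ker_dom 0 1 (RtoC x) 1 0 adm01) as [M H]; [simpl; lra|].
  assert (EQ : forall v, ker 0 1 (RtoC x) (RtoC v) = RtoC (wt 1 x v)).
  { intros v. unfold ker, wt. rewrite <- Cexp_R. f_equal. rewrite Cexp_R. ceq; ring. }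
  exists M. split. { eapply dom_ext; [exact EQ|exact H]. } unfold E. symmetry. apply II_ext. exact EQ.
Qed.

(** Euler's integral does not vanish: if it did at m, it would vanish at all m + n; but
    for large n the density t^(x-1) e^(-t), x = Re m + n, concentrates around t = x, where the
    oscillating factor t^(i Im m) is nearly constant. *)
Lemma Gamma_neq_0 m : 0 < Re m -> E 0 1 m <> 0.
Proof.
  intros Hm H0. set (y := Rabs (Im m)). assert (Hy : 0 <= y) by apply Rabs_pos.
  (* beyond y (y + 1) + 2 the spread of the weight around its peak is too small for y to matter *)
  destruct (nfloor_ex (y * (y + 1) + 2) ltac:(nra)) as [n0 Hn0].
  set (x := (Re m + INR (S n0))%R). 
  assert (Hx : y * (y + 1) + 2 < x) by (unfold x; rewrite S_INR; lra).
  assert (Hx1 : 1 < x) by nra.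
  assert (Z := Gamma_zero_iter m (S n0) Hm H0).
  destruct (gamma_weight_E x ltac:(lra)) as [M [D G]].
  destruct (gamma_weight_E (x + 1) ltac:(lra)) as [Mp [Dp Gp]].
  destruct (gamma_weight_E (x - 1) ltac:(lra)) as [Mm [Dm Gm]].
  assert (Ep : E 0 1 (RtoC (x + 1)) = RtoC x * E 0 1 (RtoC x)).
  { rewrite RtoC_plus. apply Gamma_step. simpl; lra. }
  assert (Em : E 0 1 (RtoC x) = RtoC (x - 1) * E 0 1 (RtoC (x - 1))).
  { replace (RtoC x) with (RtoC (x - 1) + 1) by (rewrite RtoC_minus; ring). apply Gamma_step. simpl; lra. }
  set (g := Re (E 0 1 (RtoC x))).
  assert (Hg : exp (- exp 1) <= g).
  { unfold g. rewrite <- G. apply (II_pos _ M); auto.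
    - intros v. left. apply wt_pos.
    - intros v Hv. unfold wt. apply exp_le. assert (exp v <= exp 1) by (apply exp_le; lra). nra. }
  assert (gm : (Re (E 0 1 (RtoC (x - 1))) = g / (x - 1))%R).
  { unfold g. rewrite Em. unfold Re; simpl. field. lra. }
  assert (gp : (Re (E 0 1 (RtoC (x + 1))) = x * g)%R).
  { unfold g. rewrite Ep. unfold Re; simpl. ring. }
  (* the oscillating factor of the integrand, frozen at the peak v = ln x of the weight *)
  set (a := Cexp (Ci * RtoC (Im m * ln x))).
  assert (Ha : Cmod a = 1%R). { unfold a. rewrite Cmod_Cexp. rewrite <- exp_0. f_equal. unfold Re; simpl; ring. }
  set (d := (/ (y + 1))%R). assert (Hd : 0 < d) by (apply Rinv_0_lt_compat; lra).
  assert (Hd' : (/ d = y + 1)%R) by (unfold d; apply Rinv_inv).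
  assert (Dz : exists Mz, dom (fun v => ker 0 1 (m + RtoC (INR (S n0))) (RtoC v)) Mz).
  { apply (ker_dom 0 1 _ 1 0 adm01). change (0 < x). lra. }
  destruct Dz as [Mz Dz].
  assert (Dg : dom (fun v => RtoC (y * (d / 2 * wt 1 x v + / d / 2 * (/ x * wt 1 (x + 1) v + x * wt 1 (x - 1) v - 2 * wt 1 x v))))
     (Cmod (RtoC (y * (d / 2))) * M + (Cmod (RtoC (y * (/ d / 2 * / x))) * Mp + (Cmod (RtoC (y * (/ d / 2 * x))) * Mm + Cmod (RtoC (y * - / d)) * M)))).
  { eapply dom_ext; [|exact (dom_plus _ _ _ _ (dom_scal _ (RtoC (y * (d/2))) _ D) (dom_plus _ _ _ _ (dom_scal _ (RtoC (y * (/ d / 2 * / x))) _ Dp) (dom_plus _ _ _ _ (dom_scal _ (RtoC (y * (/ d / 2 * x))) _ Dm) (dom_scal _ (RtoC (y * - / d)) _ D))))].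
    intros v. simpl. ceq; field; split; lra. }
  assert (Vg : II (fun v => RtoC (y * (d / 2 * wt 1 x v + / d / 2 * (/ x * wt 1 (x + 1) v + x * wt 1 (x - 1) v - 2 * wt 1 x v)))) =
     RtoC (y * (d/2)) * E 0 1 (RtoC x) + (RtoC (y * (/ d / 2 * / x)) * E 0 1 (RtoC (x + 1)) + (RtoC (y * (/ d / 2 * x)) * E 0 1 (RtoC (x - 1)) + RtoC (y * - / d) * E 0 1 (RtoC x)))).
  { rewrite <- G, <- Gp, <- Gm.
    rewrite <- (II_scal _ (RtoC (y * (d/2))) _ D), <- (II_scal _ (RtoC (y * (/ d / 2 * / x))) _ Dp), <- (II_scal _ (RtoC (y * (/ d / 2 * x))) _ Dm), <- (II_scal _ (RtoC (y * - / d)) _ D).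
    rewrite <- (II_plus _ _ _ _ (dom_scal _ (RtoC (y * (/ d / 2 * x))) _ Dm) (dom_scal _ (RtoC (y * - / d)) _ D)).
    rewrite <- (II_plus _ _ _ _ (dom_scal _ (RtoC (y * (/ d / 2 * / x))) _ Dp) (dom_plus _ _ _ _ (dom_scal _ (RtoC (y * (/ d / 2 * x))) _ Dm) (dom_scal _ (RtoC (y * - / d)) _ D))).
    rewrite <- (II_plus _ _ _ _ (dom_scal _ (RtoC (y * (d/2))) _ D) (dom_plus _ _ _ _ (dom_scal _ (RtoC (y * (/ d / 2 * / x))) _ Dp) (dom_plus _ _ _ _ (dom_scal _ (RtoC (y * (/ d / 2 * x))) _ Dm) (dom_scal _ (RtoC (y * - / d)) _ D)))).
    apply II_ext. intros v. ceq; field; split; lra. }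
  assert (K := II_norm_le _ _ _ _ (dom_minus _ _ _ _ Dz (dom_scal _ a _ D)) Dg).
  cbv beta in K.
  rewrite (II_minus _ _ _ _ Dz (dom_scal _ a _ D)), (II_scal _ a _ D), G, Vg in K.
  assert (K1 : Cmod (E 0 1 (m + RtoC (INR (S n0))) - a * E 0 1 (RtoC x)) <= Re
     (RtoC (y * (d / 2)) * E 0 1 (RtoC x) + (RtoC (y * (/ d / 2 * / x)) * E 0 1 (RtoC (x + 1)) +
      (RtoC (y * (/ d / 2 * x)) * E 0 1 (RtoC (x - 1)) + RtoC (y * - / d) * E 0 1 (RtoC x))))).
  { apply K. intros v. 
    replace (ker 0 1 (m + RtoC (INR (S n0))) (RtoC v) - a * RtoC (wt 1 x v)) with
      ((Cexp (Ci * RtoC (Im m * (v - ln x))) - 1) * (a * RtoC (wt 1 x v))).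
    - rewrite !Cmod_mult, Ha, Rmult_1_l, Cmod_R, (Rabs_pos_eq (wt 1 x v)) by (left; apply wt_pos).
      assert (A1 := Cexp_taylor1 (Ci * RtoC (Im m * (v - ln x)))).
      rewrite Cmod_mult, Cmod_Ci, Cmod_R, Rabs_mult, Rmult_1_l in A1. fold y in A1.
      replace (Re (Ci * RtoC (Im m * (v - ln x)))) with 0%R in A1 by reim.
      rewrite Rmax_left, exp_0, Rmult_1_r in A1 by lra.
      set (u := (v - ln x)%R) in *.
      assert (A2 : Rabs u <= d / 2 + / d / 2 * (u * u)).
      { assert (0 <= (Rabs u - d) * (Rabs u - d) * (/ d / 2)).
        { apply Rmult_le_pos; [apply Rle_0_sqr|]. rewrite Hd'; lra. }
        assert (Rabs u * Rabs u = u * u)%R by (rewrite <- Rabs_mult, Rabs_pos_eq; nra).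
        replace ((Rabs u - d) * (Rabs u - d) * (/ d / 2))%R with (/ d / 2 * (Rabs u * Rabs u) - Rabs u + d / 2)%R in H by (field; lra).
        rewrite H1 in H. lra. }
      assert (A3 : u * u <= exp v / x + x * exp (- v) - 2).
      { eapply Rle_trans; [apply sqr_le_cosh|]. right. unfold u.
        replace (exp (v - ln x)) with (exp v / x)%R. 2:{ unfold Rminus. rewrite exp_plus, exp_Ropp, exp_ln; lra. }
        replace (exp (- (v - ln x))) with (x * exp (- v))%R. 2:{ rewrite Ropp_minus_distr. unfold Rminus. rewrite exp_plus, exp_ln; lra. }
        reflexivity. }
      apply Rle_trans with (y * (d / 2 + / d / 2 * (exp v / x + x * exp (- v) - 2)) * wt 1 x v)%R.
      + apply Rmult_le_compat_r; [left; apply wt_pos|]. eapply Rle_trans; [exact A1|].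
        apply Rmult_le_compat_l; auto. eapply Rle_trans; [exact A2|]. apply Rplus_le_compat_l.
        apply Rmult_le_compat_l; [rewrite Hd'; lra|exact A3].
      + right. unfold wt.
        replace (- (1) * exp v + (x + 1) * v)%R with ((- (1) * exp v + x * v) + v)%R by ring.
        replace (- (1) * exp v + (x - 1) * v)%R with ((- (1) * exp v + x * v) + - v)%R by ring.
        rewrite (exp_plus _ v), (exp_plus _ (- v)). field. split; lra.
    - transitivity (Cexp (Ci * RtoC (Im m * (v - ln x))) * a * RtoC (wt 1 x v) - a * RtoC (wt 1 x v)); [ring|].
      f_equal. unfold a, wt. rewrite <- Cexp_R, <- !Cexp_plus. unfold ker. f_equal. rewrite Cexp_R.
      unfold x. ceq; unfold Re, Im; simpl; ring. }
  rewrite Z in K1. 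
  assert (K2 : g <= Cmod (0 - a * E 0 1 (RtoC x))).
  { replace (0 - a * E 0 1 (RtoC x)) with (- (a * E 0 1 (RtoC x))) by ring. rewrite Cmod_opp, Cmod_mult, Ha, Rmult_1_l. apply Re_le_Cmod. }
  replace (Re (RtoC (y * (d / 2)) * E 0 1 (RtoC x) + (RtoC (y * (/ d / 2 * / x)) * E 0 1 (RtoC (x + 1)) +
      (RtoC (y * (/ d / 2 * x)) * E 0 1 (RtoC (x - 1)) + RtoC (y * - / d) * E 0 1 (RtoC x)))))
    with (y * (d / 2) * g + (y * (/ d / 2 * / x) * Re (E 0 1 (RtoC (x + 1))) + (y * (/ d / 2 * x) * Re (E 0 1 (RtoC (x - 1))) + y * - / d * g)))%R in K1
    by (unfold g, Re; simpl; ring).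
  rewrite gp, gm in K1.
  assert (K3 : (y * (d / 2) * g + (y * (/ d / 2 * / x) * (x * g) + (y * (/ d / 2 * x) * (g / (x - 1)) + y * - / d * g)) = g * (y * d / 2 + y * / d / (2 * (x - 1))))%R).
  { field. repeat split; lra. }
  rewrite K3 in K1. rewrite Hd' in K1.
  assert (g0 : 0 < g) by (generalize (exp_pos (- exp 1)); lra).
  assert (L1 : y * d / 2 < / 2). { assert (y * d < 1); [|lra]. apply Rmult_lt_reg_r with (y + 1)%R; [lra|]. unfold d. rewrite Rmult_assoc, Rinv_l; lra. }
  assert (L2 : y * (y + 1) / (2 * (x - 1)) < / 2).
  { apply Rmult_lt_reg_r with (2 * (x - 1))%R; [lra|]. replace (y * (y + 1) / (2 * (x - 1)) * (2 * (x - 1)))%R with (y * (y + 1))%R by (field; lra). lra. }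
  nra.
Qed.

(** ** Rotation of the path and behaviour at infinity *)

Lemma cos_ge_between q p : Rmin 0 p <= q <= Rmax 0 p -> Rabs p <= PI -> cos p <= cos q.
Proof.
  intros Hq Hp.
  assert (A : Rabs q <= Rabs p).
  { unfold Rmin, Rmax in Hq. destruct (Rle_dec 0 p).
    - rewrite !Rabs_pos_eq by lra. lra.
    - rewrite (Rabs_left1 q), (Rabs_left p) by lra. lra. }
  assert (C : forall t, cos (Rabs t) = cos t). { intros t. unfold Rabs. destruct (Rcase_abs t); [apply cos_neg|reflexivity]. }
  rewrite <- (C p), <- (C q). apply cos_decr_1; auto; try apply Rabs_pos; lra.
Qed.

Lemma Cexp_line v q : Cexp (RtoC v + Ci * RtoC q) = RtoC (exp v) * (RtoC (cos q) + Ci * RtoC (sin q)).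
Proof.
  unfold Cexp. replace (Re (RtoC v + Ci * RtoC q)) with v by reim.
  replace (Im (RtoC v + Ci * RtoC q)) with q by reim. ceq; ring.
Qed.

(** The ray of Euler's integral may be turned by p, since e^(- e^v cos p) still decreases. *)
Lemma Gamma_rotate m p : 0 < Re m -> Rabs p < PI / 2 ->
  (exists M, dom (fun v => ker 0 1 m (RtoC v + Ci * RtoC p)) M) /\
  II (fun v => ker 0 1 m (RtoC v + Ci * RtoC p)) = E 0 1 m.
Proof.
  intros Hm Hp. assert (HPI := PI_RGT_0).
  assert (Hc : 0 < cos p). { apply Rabs_def2 in Hp. apply cos_gt_0; lra. }
  destruct (wt_dom (cos p) (Re m) Hc Hm) as [M [HM H]].
  assert (B : forall q v, Rmin 0 p <= q <= Rmax 0 p ->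
    (Cmod (ker 0 1 m (RtoC v + Ci * RtoC q)) <= (exp (Rabs (Im m) * PI) * M) / (1 + v * v))).
  { intros q v Hq. rewrite ker_mod.
    assert (cq := cos_ge_between q p Hq ltac:(lra)).
    assert (Q : Rabs q <= PI).
    { apply Rabs_def2 in Hp. unfold Rmin, Rmax in Hq. destruct (Rle_dec 0 p); apply Rabs_le; lra. }
    apply Rle_trans with (exp (Rabs (Im m) * PI) * wt (cos p) (Re m) v)%R.
    - unfold wt. rewrite <- exp_plus. apply exp_le.
      rewrite Cexp_line.
      replace (Re (- (1) * (RtoC (exp v) * (RtoC (cos q) + Ci * RtoC (sin q))) - 0 * Cexp (2 * (RtoC v + Ci * RtoC q)) + m * (RtoC v + Ci * RtoC q)))
        with (- (exp v * cos q) + (Re m * v - Im m * q))%R by reim.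
      assert (- (Im m * q) <= Rabs (Im m) * PI).
      { eapply Rle_trans; [apply Rle_abs|]. rewrite Rabs_Ropp, Rabs_mult. apply Rmult_le_compat_l; [apply Rabs_pos|exact Q]. }
      generalize (exp_pos v). nra.
    - unfold Rdiv. rewrite Rmult_assoc. apply Rmult_le_compat_l; [left; apply exp_pos|apply H]. }
  split.
  - eexists. split; [|intros v; apply B; unfold Rmin, Rmax; destruct (Rle_dec 0 p); lra].
    intros v. unfold ker. cc.
  - apply (II_contour_shift (ker 0 1 m) _ p (exp (Rabs (Im m) * PI) * M)%R (ker_dC 0 1 m)); [|exact B].
    intros z. unfold ker. cc.
Qed.

(** Turning the ray by p keeps the Gaussian factor decreasing when |2 p| < pi/2. *)
Lemma E_rotate z m p : 0 < Re m -> Rabs p < PI / 4 ->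
  (exists M, dom (fun v => ker (RtoC (1/2)) z m (RtoC v + Ci * RtoC p)) M) /\
  II (fun v => ker (RtoC (1/2)) z m (RtoC v + Ci * RtoC p)) = E (1/2) z m.
Proof.
  intros Hm Hp. assert (HPI := PI_RGT_0).
  assert (Hc : 0 < cos (2 * p)). { apply Rabs_def2 in Hp. apply cos_gt_0; lra. }
  assert (Ad := adm_gauss (cos (2 * p) / 2) (RtoC (Cmod z)) (Cmod z) ltac:(lra)).
  rewrite Cmod_R, (Rabs_pos_eq (Cmod z)) in Ad by apply Cmod_ge_0. specialize (Ad (Rle_refl _)).
  set (K := ((1 + Cmod z) * (1 + Cmod z) / (4 * (cos (2 * p) / 2)))%R) in *.
  assert (Ad2 : forall y, 0 < y -> 1 * y - K <= - Cmod z * y + cos (2 * p) / 2 * (y * y)).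
  { intros y Hy. assert (A2 := adm_gauss (cos (2 * p) / 2) (RtoC (- Cmod z)) (Cmod z) ltac:(lra)).
    rewrite Cmod_R, Rabs_Ropp, (Rabs_pos_eq (Cmod z)) in A2 by apply Cmod_ge_0.
    exact (proj2 (A2 (Rle_refl _)) y Hy). }
  destruct (wt_dom 1 (Re m) Rlt_0_1 Hm) as [M [HM H]].
  assert (B : forall q v, Rmin 0 p <= q <= Rmax 0 p ->
    (Cmod (ker (RtoC (1/2)) z m (RtoC v + Ci * RtoC q)) <= (exp (K + Rabs (Im m) * PI) * M) / (1 + v * v))).
  { intros q v Hq. rewrite ker_mod.
    assert (cq : cos (2 * p) <= cos (2 * q)).
    { apply cos_ge_between. - unfold Rmin, Rmax in *. destruct (Rle_dec 0 p), (Rle_dec 0 (2 * p)); lra.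
      - rewrite Rabs_mult, Rabs_pos_eq; lra. }
    assert (Q : Rabs q <= PI).
    { apply Rabs_def2 in Hp. unfold Rmin, Rmax in Hq. destruct (Rle_dec 0 p); apply Rabs_le; lra. }
    apply Rle_trans with (exp (K + Rabs (Im m) * PI) * wt 1 (Re m) v)%R.
    - unfold wt. rewrite <- exp_plus. apply exp_le.
      rewrite !Re_plus.
      assert (R1 : Re (- z * Cexp (RtoC v + Ci * RtoC q)) <= Cmod z * exp v).
      { eapply Rle_trans; [apply Re_le_Cmod|]. rewrite Cmod_mult, Cmod_opp, Cmod_Cexp. right. do 2 f_equal. unfold Re; simpl; ring. }
      assert (R2 : (Re (- (RtoC (1/2) * Cexp (2 * (RtoC v + Ci * RtoC q)))) = - (cos (2 * q) / 2) * (exp v * exp v))%R).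
      { replace (2 * (RtoC v + Ci * RtoC q)) with (RtoC (2 * v) + Ci * RtoC (2 * q)) by (rewrite !RtoC_mult; ring).
        rewrite Cexp_line, exp_double. unfold Re; simpl; field. }
      replace (Re (- z * Cexp (RtoC v + Ci * RtoC q) - RtoC (1 / 2) * Cexp (2 * (RtoC v + Ci * RtoC q)))) with
       (Re (- z * Cexp (RtoC v + Ci * RtoC q)) + Re (- (RtoC (1 / 2) * Cexp (2 * (RtoC v + Ci * RtoC q)))))%R by reflexivity.
      rewrite R2.
      replace (Re (m * (RtoC v + Ci * RtoC q))) with (Re m * v - Im m * q)%R by reim.
      assert (- (Im m * q) <= Rabs (Im m) * PI).
      { eapply Rle_trans; [apply Rle_abs|]. rewrite Rabs_Ropp, Rabs_mult. apply Rmult_le_compat_l; [apply Rabs_pos|exact Q]. }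
      specialize (Ad2 (exp v) (exp_pos v)). generalize (exp_pos v). intros.
      assert (cos (2 * p) / 2 * (exp v * exp v) <= cos (2 * q) / 2 * (exp v * exp v)).
      { apply Rmult_le_compat_r; [nra|lra]. } lra.
    - unfold Rdiv. rewrite Rmult_assoc. apply Rmult_le_compat_l; [left; apply exp_pos|apply H]. }
  split.
  - eexists. split; [|intros v; apply B; unfold Rmin, Rmax; destruct (Rle_dec 0 p); lra].
    intros v. unfold ker. cc.
  - apply (II_contour_shift (ker (RtoC (1/2)) z m) _ p (exp (K + Rabs (Im m) * PI) * M)%R (ker_dC (RtoC (1/2)) z m)); [|exact B].
    intros w. unfold ker. cc.
Qed.

(** With z = e^w, the path v -> v - Re w - i Im w / 3 turns z e^v into e^(v + 2 i Im w / 3), in the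
    right half-plane, and keeps the Gaussian factor decreasing, as long as |Im w| < 3 pi / 4. *)
Lemma E_asymptotic m delta : 0 < Re m -> 0 < delta < PI / 4 -> exists K, 0 <= K /\ forall w,
  Rabs (Im w) <= 3 * PI / 4 - delta ->
  Cmod (Cexp (m * w) * E (1/2) (Cexp w) m - E 0 1 m) <= K * exp (- 2 * Re w).
Proof.
  intros Hm Hd. assert (HPI := PI_RGT_0).
  set (c := cos (PI / 2 - 2 / 3 * delta)). assert (Hc : 0 < c) by (apply cos_gt_0; lra).
  destruct (wt_dom c (Re m + 2) Hc ltac:(lra)) as [M [HM H]].
  exists (/ 2 * exp (Rabs (Im m) * PI) * M * PI)%R. 
  assert (P := exp_pos (Rabs (Im m) * PI)).
  split. { apply Rmult_le_pos; [apply Rmult_le_pos; [apply Rmult_le_pos|]|]; lra. }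
  intros w Hw. set (p := (- Im w / 3)%R). set (q := (2 / 3 * Im w)%R).
  assert (Hp : Rabs p < PI / 4).
  { unfold p, Rdiv. rewrite Rabs_mult, Rabs_Ropp, (Rabs_pos_eq (/ 3)) by lra. lra. }
  assert (Hq : Rabs q <= PI / 2 - 2 / 3 * delta).
  { unfold q. rewrite Rabs_mult, (Rabs_pos_eq (2 / 3)) by lra. lra. }
  destruct (E_rotate (Cexp w) m p Hm Hp) as [[M1 D1] E1].
  destruct (Gamma_rotate m q Hm ltac:(lra)) as [[M2 D2] E2].
  assert (D1' : dom (fun v => ker (RtoC (1/2)) (Cexp w) m (RtoC (v + - Re w) + Ci * RtoC p)) (Cmod 1 * 0 + M1 * (2 + 2 * Re w * Re w))).
  { split. { intros v. unfold ker. cc. } intros v. destruct D1 as [_ D1]. eapply Rle_trans; [apply D1|].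
    assert (HM1 : 0 <= M1).
    { specialize (D1 0%R). generalize (Cmod_ge_0 (ker (RtoC (1 / 2)) (Cexp w) m (RtoC 0 + Ci * RtoC p))).
      replace (M1 / (1 + 0 * 0))%R with M1 in D1 by field. lra. }
    set (u := (v + - Re w)%R). assert (v = u + Re w)%R by (unfold u; ring).
    apply Rmult_le_reg_r with ((1 + u * u) * (1 + v * v))%R. { apply Rmult_lt_0_compat; apply sqr1_pos. }
    replace (M1 / (1 + u * u) * ((1 + u * u) * (1 + v * v)))%R with (M1 * (1 + v * v))%R by (field; generalize (sqr1_pos u); lra).
    replace ((Cmod 1 * 0 + M1 * (2 + 2 * Re w * Re w)) / (1 + v * v) * ((1 + u * u) * (1 + v * v)))%R with
     (M1 * ((2 + 2 * Re w * Re w) * (1 + u * u)))%R by (field; generalize (sqr1_pos v); lra).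
    apply Rmult_le_compat_l; auto. rewrite H0. nra. }
  rewrite <- E1. rewrite <- (II_shift _ _ (- Re w) D1).
  rewrite <- (II_scal _ (Cexp (m * w)) _ D1'). rewrite <- E2.
  replace (/ 2 * exp (Rabs (Im m) * PI) * M * PI * exp (- 2 * Re w))%R with ((/ 2 * exp (Rabs (Im m) * PI) * M * exp (- 2 * Re w)) * PI)%R by ring.
  apply (II_diff_bound _ _ _ _ _ (dom_scal _ (Cexp (m * w)) _ D1') D2).
  intros v.
  set (r := RtoC (1/2 * exp (- 2 * Re w)) * Cexp (RtoC (2 * v) + Ci * RtoC (2 * p))).
  replace (Cexp (m * w) * ker (RtoC (1 / 2)) (Cexp w) m (RtoC (v + - Re w) + Ci * RtoC p) - ker 0 1 m (RtoC v + Ci * RtoC q))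
    with ((Cexp (- r) - 1) * ker 0 1 m (RtoC v + Ci * RtoC q)).
  - rewrite Cmod_mult.
    assert (R0 : 0 <= Re r).
    { unfold r. rewrite Cexp_line. 
      replace (Re (RtoC (1 / 2 * exp (- 2 * Re w)) * (RtoC (exp (2 * v)) * (RtoC (cos (2 * p)) + Ci * RtoC (sin (2 * p))))))
        with (1 / 2 * exp (- 2 * Re w) * exp (2 * v) * cos (2 * p))%R by reim.
      assert (0 < cos (2 * p)). { apply Rabs_def2 in Hp. apply cos_gt_0; lra. }
      generalize (exp_pos (-2 * Re w)) (exp_pos (2 * v)). intros. repeat apply Rmult_le_pos; lra. }
    assert (R1 : Cmod (Cexp (- r) - 1) <= / 2 * exp (-2 * Re w) * exp (2 * v)).
    { eapply Rle_trans; [apply Cexp_taylor1|]. 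
      rewrite Rmax_left by (change (- Re r <= 0); lra). rewrite exp_0, Rmult_1_r, Cmod_opp. unfold r.
      rewrite Cmod_mult, Cmod_R, Rabs_pos_eq, Cmod_Cexp. 2:{ generalize (exp_pos (-2 * Re w)); lra. }
      replace (Re (RtoC (2 * v) + Ci * RtoC (2 * p))) with (2 * v)%R by reim. lra. }
    assert (R2 : Cmod (ker 0 1 m (RtoC v + Ci * RtoC q)) <= exp (Rabs (Im m) * PI) * wt c (Re m) v).
    { rewrite ker_mod. unfold wt. rewrite <- exp_plus. apply exp_le. rewrite Cexp_line.
      replace (Re (- (1) * (RtoC (exp v) * (RtoC (cos q) + Ci * RtoC (sin q))) - 0 * Cexp (2 * (RtoC v + Ci * RtoC q)) + m * (RtoC v + Ci * RtoC q)))
        with (- (exp v * cos q) + (Re m * v - Im m * q))%R by reim.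
      assert (- (Im m * q) <= Rabs (Im m) * PI).
      { eapply Rle_trans; [apply Rle_abs|]. rewrite Rabs_Ropp, Rabs_mult. apply Rmult_le_compat_l; [apply Rabs_pos|lra]. }
      assert (cq : c <= cos q).
      { unfold c. assert (CA : forall t, cos (Rabs t) = cos t). { intros t. unfold Rabs. destruct (Rcase_abs t); [apply cos_neg|reflexivity]. }
        rewrite <- (CA q). apply cos_decr_1; try lra; try apply Rabs_pos. }
      generalize (exp_pos v). nra. }
    eapply Rle_trans; [apply Rmult_le_compat; [apply Cmod_ge_0|apply Cmod_ge_0|exact R1|exact R2]|].
    replace (/ 2 * exp (-2 * Re w) * exp (2 * v) * (exp (Rabs (Im m) * PI) * wt c (Re m) v))%R with
      (/ 2 * exp (Rabs (Im m) * PI) * exp (-2 * Re w) * wt c (Re m + 2) v)%R.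
    2:{ unfold wt. replace (- c * exp v + (Re m + 2) * v)%R with ((- c * exp v + Re m * v) + 2 * v)%R by ring. rewrite (exp_plus _ (2 * v)). ring. }
    replace (/ 2 * exp (Rabs (Im m) * PI) * M * exp (-2 * Re w) / (1 + v * v))%R with (/ 2 * exp (Rabs (Im m) * PI) * exp (-2 * Re w) * (M / (1 + v * v)))%R
      by (field; generalize (sqr1_pos v); lra).
    apply Rmult_le_compat_l; [|apply H]. generalize (exp_pos (-2 * Re w)); intros; repeat apply Rmult_le_pos; lra.
  - transitivity (Cexp (- r) * ker 0 1 m (RtoC v + Ci * RtoC q) - ker 0 1 m (RtoC v + Ci * RtoC q)); [ring|]. f_equal. unfold ker. rewrite <- !Cexp_plus. f_equal.
    assert (HX : Cexp w * Cexp (RtoC (v + - Re w) + Ci * RtoC p) = Cexp (RtoC v + Ci * RtoC q)).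
    { rewrite <- Cexp_plus. f_equal. unfold p, q. apply C_ext; unfold Re, Im; simpl; field. }
    replace (- Cexp w * Cexp (RtoC (v + - Re w) + Ci * RtoC p)) with (- Cexp (RtoC v + Ci * RtoC q))
      by (rewrite <- HX; ring).
    replace (RtoC (1 / 2) * Cexp (2 * (RtoC (v + - Re w) + Ci * RtoC p))) with r.
    2:{ unfold r. rewrite RtoC_mult, <- Cexp_R, <- Cmult_assoc, <- Cexp_plus. do 2 f_equal. ceq; ring. }
    clearbody r. generalize (Cexp (RtoC v + Ci * RtoC q)) (Cexp (2 * (RtoC v + Ci * RtoC q))). intros e1 e2. unfold p, q. apply C_ext; unfold Re, Im; simpl; field.
Qed.

(** * The confluent hypergeometric function *)

(** ** Linear differential systems *)

Lemma Cmult_eq_reg_l (r z w : C) : r * z = r * w -> r <> 0 -> z = w.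
Proof.
  intros H Hr. transitivity (/ r * (r * z)); [field; auto|]. rewrite H. field; auto.
Qed.

Lemma Cinv_dC (z : C) : z <> 0 -> dC (fun x => / x) z (- / (z * z)).
Proof.
  intros Hz. assert (P := proj1 (Cmod_gt_0 z) Hz).
  apply (dC_quad _ _ _ (2 / (Cmod z * Cmod z * Cmod z)) (Cmod z / 2)); [lra|].
  intros h Hh.
  assert (Q : Cmod z / 2 <= Cmod (z + h)).
  { assert (T := Cmod_triangle (z + h) (- h)). replace (z + h + - h) with z in T by ring. rewrite Cmod_opp in T. lra. }
  assert (N : z + h <> 0). { apply Cmod_gt_0. lra. }
  replace (/ (z + h) - / z - h * - / (z * z)) with (h * h * / (z * z * (z + h))) by (field; auto).
  rewrite Cmod_mult, Cmod_inv by (repeat apply Cmult_neq_0; auto). rewrite !Cmod_mult.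
  rewrite (Rmult_comm (2 / _)). apply Rmult_le_compat_l. { generalize (Cmod_ge_0 h); nra. }
  replace (2 / (Cmod z * Cmod z * Cmod z))%R with (/ (Cmod z * Cmod z * (Cmod z / 2)))%R by (field; lra).
  apply Rinv_le_contravar. { repeat apply Rmult_lt_0_compat; lra. }
  apply Rmult_le_compat_l; [nra|exact Q].
Qed.

Lemma dR_div (f g : R -> C) (t : R) (a b : C) : dR f t a -> dR g t b -> g t <> 0 ->
  dR (fun x => f x / g x) t ((a * g t - f t * b) / (g t * g t)).
Proof.
  intros Hf Hg N. eapply dR_eq.
  - apply (dR_mult f (fun x => / g x)); [exact Hf|]. apply (dR_comp (fun x => / x) g); [apply Cinv_dC; exact N|exact Hg].
  - cbv beta. field. exact N.
Qed.

(** Gronwall's argument for the energy |u|^2 + |w|^2. *)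
Lemma system_zero (u w al be ga : R -> C) (K T : R) : 0 <= T ->
  (forall t, 0 <= t <= T -> dR u t (al t * w t)) ->
  (forall t, 0 <= t <= T -> dR w t (be t * w t + ga t * u t)) ->
  (forall t, 0 <= t <= T -> (Cmod (al t) <= K /\ Cmod (be t) <= K /\ Cmod (ga t) <= K)%R) ->
  u 0%R = 0 -> w 0%R = 0 -> u T = 0 /\ w T = 0.
Proof.
  intros HT Hu Hw HK U0 W0.
  set (sq := fun z : C => (Re z * Re z + Im z * Im z)%R).
  assert (Dsq : forall f t l, dR f t l -> is_derive (fun t => sq (f t)) t (2 * Re (Cconj (f t) * l))%R).
  { intros f t l H. assert (H1 := dR_Re _ _ _ H). assert (H2 := dR_Im _ _ _ H).
    replace (2 * Re (Cconj (f t) * l))%R with ((Re l * Re (f t) + Re (f t) * Re l) + (Im l * Im (f t) + Im (f t) * Im l))%R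
      by reim.
    exact (is_derive_plus _ _ _ _ _ (Rd_mult _ _ _ _ _ H1 H1) (Rd_mult _ _ _ _ _ H2 H2)). }
  set (h := fun t => (sq (u t) + sq (w t))%R).
  assert (K0 : 0 <= K). { destruct (HK 0%R ltac:(lra)) as [H _]. generalize (Cmod_ge_0 (al 0%R)); lra. }
  assert (Dexp : forall t : R, is_derive (fun t => exp (- (4 * K) * t))%R t (- (4 * K) * exp (- (4 * K) * t))%R).
  { intros t. auto_derive; [trivial|ring]. }
  assert (G : h T * exp (- (4 * K) * T) <= h 0%R * exp (- (4 * K) * 0)).
  { apply (Rderiv_nonpos (fun t => h t * exp (- (4 * K) * t))%R
      (fun t => (2 * Re (Cconj (u t) * (al t * w t)) + 2 * Re (Cconj (w t) * (be t * w t + ga t * u t))) * exp (- (4 * K) * t)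
        + h t * (- (4 * K) * exp (- (4 * K) * t)))%R 0 T HT).
    - intros t Ht. apply (Rd_mult h (fun t => exp (- (4 * K) * t))%R).
      + exact (is_derive_plus _ _ _ _ _ (Dsq _ _ _ (Hu t Ht)) (Dsq _ _ _ (Hw t Ht))).
      + exact (Dexp t).
    - intros t Ht. destruct (HK t Ht) as [A [B C]].
      assert (Ht' : h t = (Cmod (u t) * Cmod (u t) + Cmod (w t) * Cmod (w t))%R) by (unfold h, sq; rewrite !Cmod_sqr; ring).
      assert (L1 : Re (Cconj (u t) * (al t * w t)) <= Cmod (u t) * (K * Cmod (w t))).
      { eapply Rle_trans; [apply Re_le_Cmod|]. rewrite !Cmod_mult, Cmod_conj. apply Rmult_le_compat_l; [apply Cmod_ge_0|].
        apply Rmult_le_compat_r; [apply Cmod_ge_0|auto]. }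
      assert (L2 : Re (Cconj (w t) * (be t * w t + ga t * u t)) <= Cmod (w t) * (K * Cmod (w t) + K * Cmod (u t))).
      { eapply Rle_trans; [apply Re_le_Cmod|]. rewrite Cmod_mult, Cmod_conj. apply Rmult_le_compat_l; [apply Cmod_ge_0|].
        triangle. rewrite !Cmod_mult. apply Rplus_le_compat; apply Rmult_le_compat_r; try apply Cmod_ge_0; auto. }
      assert (0 <= (Cmod (u t) - Cmod (w t)) * (Cmod (u t) - Cmod (w t))) by apply Rle_0_sqr.
      generalize (exp_pos (- (4 * K) * t)) (Cmod_ge_0 (u t)) (Cmod_ge_0 (w t)). intros E1 E2 E3.
      set (p := Cmod (u t)) in *. set (q := Cmod (w t)) in *.
      assert (2 * Re (Cconj (u t) * (al t * w t)) + 2 * Re (Cconj (w t) * (be t * w t + ga t * u t)) <= 4 * K * h t); [|nra].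
      rewrite Ht'. nra. }
  assert (H0 : h 0%R = 0%R) by (unfold h, sq; rewrite U0, W0; simpl; ring).
  rewrite H0, Rmult_0_l in G. 
  assert (HT0 : h T <= 0). { generalize (exp_pos (- (4 * K) * T)). intros. nra. }
  unfold h in HT0. 
  assert (S : forall z, sq z = (Cmod z * Cmod z)%R) by (intros; unfold sq; rewrite Cmod_sqr; ring).
  rewrite !S in HT0. generalize (Cmod_ge_0 (u T)) (Cmod_ge_0 (w T)). intros.
  split; apply Cmod_eq_0; nra.
Qed.

Lemma dR_zero_const f (a b : R) : a <= b -> (forall t, a <= t <= b -> dR f t 0) -> f b = f a.
Proof.
  intros Hab H. assert (Q := mean_value_const f (fun _ => 0) 0 a b Hab H).
  assert (Z : f b - f a = 0). { apply Cmod_eq_0. apply Rle_antisym; [|apply Cmod_ge_0].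
    rewrite <- (Rmult_0_l (b - a)). apply Q. intros; rewrite Cmod_0; lra. }
  rewrite <- (Cplus_0_r (f a)), <- Z. ring.
Qed.

(** ** Uniqueness of the solution with algebraic behaviour *)

(** Kummer's equation z u'' + (1/2 - z) u' = a u as a first-order system in t = log z, with
    w = du/dz. *)
Definition ksys (a : C) (u w : R -> C) : Prop := forall t : R,
  dR u t (RtoC (exp t) * w t) /\ dR w t (RtoC (exp t - 1/2) * w t + a * u t).

Definition tends (f : R -> C) (l : C) : Prop :=
  forall eps, 0 < eps -> exists M, forall t, M < t -> Cmod (f t - l) < eps.

Lemma ksys_minus (a : C) (u w y y1 : R -> C) (g : C) : ksys a u w -> ksys a y y1 -> ksys a (fun t => y t - g * u t) (fun t => y1 t - g * w t).
Proof.
  intros H1 H2 t. destruct (H1 t) as [A B], (H2 t) as [A' B']. split.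
  - eapply dR_eq; [apply dR_minus; [exact A'|apply dR_mult; [apply dR_const|exact A]]|dring].
  - eapply dR_eq; [apply dR_minus; [exact B'|apply dR_mult; [apply dR_const|exact B]]|dring].
Qed.

(** Abel's identity. The Wronskian of two solutions is a multiple of e^z, beyond any product of
    solutions of algebraic size. *)
Lemma ksys_wronskian (a : C) (u w y y1 : R -> C) : ksys a u w -> ksys a y y1 -> exists C0, forall t,
  u t * y1 t - w t * y t = C0 * RtoC (exp (exp t - t / 2)).
Proof.
  intros H1 H2.
  set (F := fun t => (u t * y1 t - w t * y t) * RtoC (exp (t / 2 - exp t))).
  assert (D : forall t, dR F t 0).
  { intros t. destruct (H1 t) as [A B], (H2 t) as [A' B'].
    assert (De : dR (fun t => RtoC (exp (t / 2 - exp t))) t (RtoC ((/2 - exp t) * exp (t / 2 - exp t)))).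
    { apply dR_RtoC. auto_derive; [trivial|unfold Rdiv, Rminus; ring]. }
    eapply dR_eq; [apply dR_mult; [apply dR_minus; apply dR_mult; eassumption|exact De]|].
    cbv beta. rewrite RtoC_mult, !RtoC_minus. replace (RtoC (/ 2)) with (RtoC (1 / 2)) by (f_equal; lra). ring. }
  exists (F 0%R). intros t.
  assert (E0 : F t = F 0%R).
  { destruct (Rle_dec 0 t).
    - apply dR_zero_const; auto.
    - symmetry. apply dR_zero_const; auto. lra. }
  rewrite <- E0. unfold F. rewrite <- Cmult_assoc, <- RtoC_mult, <- exp_plus.
  replace (t / 2 - exp t + (exp t - t / 2))%R with 0%R by ring. rewrite exp_0. ring.
Qed.

(** The derivative of y / u is the Wronskian over u^2. If the Wronskian were not 0, it would be
    huge on an interval of fixed length, while y / u is bounded; so y / u is constant, and its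
    limit is 0. The equation carries y = 0 back to all real t. *)
Lemma ksys_recessive (a : C) (u w y y1 : R -> C) : - (1/2) < Re a -> ksys a u w -> ksys a y y1 ->
  tends (fun t => u t / Cexp (- a * RtoC t)) 1 -> tends (fun t => y t / Cexp (- a * RtoC t)) 0 ->
  forall t, y t = 0 /\ y1 t = 0.
Proof.
  intros Ha H1 H2 Tu Ty.
  destruct (ksys_wronskian a u w y y1 H1 H2) as [C0 HW].
  set (ex := fun t => Cexp (- a * RtoC t)).
  assert (exn : forall t, ex t <> 0) by (intros; apply Cexp_neq_0).
  destruct (Tu (1/16)%R ltac:(lra)) as [M1 HM1]. destruct (Ty (1/2)%R ltac:(lra)) as [M2 HM2].
  change (forall t, M1 < t -> Cmod (u t / ex t - 1) < 1/16) in HM1.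
  change (forall t, M2 < t -> Cmod (y t / ex t - 0) < 1/2) in HM2.
  set (v := fun t => u t / ex t).
  assert (Hv : forall t, M1 < t -> 15/16 <= Cmod (v t) <= 17/16).
  { intros t Ht. specialize (HM1 t Ht). fold (ex t) in HM1. fold (v t) in HM1.
    assert (A := Cmod_triangle_inv (v t) 1). assert (B := Cmod_triangle_inv 1 (v t)).
    rewrite (Cmod_minus_sym 1) in B. rewrite Cmod_1 in A, B. lra. }
  assert (un : forall t, M1 < t -> u t <> 0).
  { intros t Ht E. specialize (Hv t Ht). unfold v in Hv. rewrite E in Hv. replace (0 / ex t) with (RtoC 0) in Hv by (field; auto).
    rewrite Cmod_0 in Hv. lra. }
  set (q := fun t => y t / u t).
  assert (Dq : forall t, M1 < t -> dR q t (C0 * RtoC (exp (exp t + t / 2)) / (u t * u t))).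
  { intros t Ht. destruct (H1 t) as [A _], (H2 t) as [A' _].
    eapply dR_eq; [apply (dR_div y u t _ _ A' A (un t Ht))|].
    f_equal. transitivity (RtoC (exp t) * (u t * y1 t - w t * y t)); [ring|]. rewrite HW.
    replace (exp t + t / 2)%R with (t + (exp t - t / 2))%R by field. rewrite (exp_plus t), RtoC_mult. ring. }
  assert (qv : forall t, M1 < t -> q t = (y t / ex t) / v t).
  { intros t Ht. unfold q, v. field. repeat split; first [apply exn | apply un; auto]. }
  assert (CZ : C0 = 0).
  { destruct (Ceq_dec C0 0) as [E|E]; auto. exfalso.
    assert (Cp := proj1 (Cmod_gt_0 C0) E).
    (* on an interval of length h the argument of z^(2a) turns by at most 1/4, so that one fixed rotation ka makes the real part of the derivative of y / u large and positive *)
    set (h := (/ (8 * (Rabs (Im a) + 1)))%R).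
    assert (Hh : 0 < h). { apply Rinv_0_lt_compat. generalize (Rabs_pos (Im a)); lra. }
    set (N := (Rmax 0 (Rmax M1 M2) + 1 + 4 * (8 / (h * Cmod C0)))%R).
    assert (hC : 0 < 8 / (h * Cmod C0)). { apply Rdiv_lt_0_compat; [lra|]. apply Rmult_lt_0_compat; auto. }
    assert (N0 : (0 < N /\ M1 < N /\ M2 < N)%R).
    { unfold N. generalize (Rmax_l 0 (Rmax M1 M2)) (Rmax_r 0 (Rmax M1 M2)) (Rmax_l M1 M2) (Rmax_r M1 M2). lra. }
    set (ka := / C0 * Cexp (- (2 * Ci * RtoC (Im a) * RtoC N))).
    assert (Hka : Cmod ka = (/ Cmod C0)%R).
    { unfold ka. rewrite Cmod_mult, Cmod_inv, Cmod_Cexp by auto. 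
      replace (Re (- (2 * Ci * RtoC (Im a) * RtoC N))) with 0%R by reim. rewrite exp_0; ring. }
    assert (Qb : forall t, N <= t -> Rabs (Re (ka * q t)) <= / Cmod C0).
    { intros t Ht. eapply Rle_trans; [apply re_le_Cmod|]. rewrite Cmod_mult, Hka.
      rewrite <- (Rmult_1_r (/ Cmod C0)) at 2. apply Rmult_le_compat_l; [left; apply Rinv_0_lt_compat; auto|].
      rewrite qv by lra. specialize (HM2 t ltac:(lra)). cbv beta in HM2. fold (ex t) in HM2.
      replace (y t / ex t - 0) with (y t / ex t) in HM2 by ring.
      assert (vt := Hv t ltac:(lra)).
      rewrite Cmod_div by (apply Cmod_gt_0; lra). apply Rmult_le_reg_r with (Cmod (v t)); [lra|].
      unfold Rdiv. rewrite Rmult_assoc, Rinv_l by lra. lra. }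
    assert (Low : Re (ka * q N) - (- (/ 8 * exp (N / 2) * N)) <= Re (ka * q (N + h)%R) - (- (/8 * exp (N / 2) * (N + h))) - 2 * (/ 8 * exp (N / 2) * h)).
    { assert (M := Rderiv_nonpos (fun t => / 8 * exp (N / 2) * t - Re (ka * q t))%R
        (fun t => / 8 * exp (N / 2) - Re (ka * (C0 * RtoC (exp (exp t + t / 2)) / (u t * u t))))%R N (N + h) ltac:(lra)).
      assert (M' : / 8 * exp (N / 2) * (N + h) - Re (ka * q (N + h)%R) <= / 8 * exp (N / 2) * N - Re (ka * q N)).
      { apply M.
        - intros t Ht. apply (is_derive_minus (V:=R_NormedModule)).
          + auto_derive; [trivial|ring].
          + apply (dR_Re (fun t => ka * q t)). eapply dR_eq; [apply dR_mult; [apply dR_const|apply Dq; lra]|dring].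
        - intros t Ht.
          set (th := (2 * Im a * (t - N))%R). set (k := / (v t * v t)).
          assert (vt := Hv t ltac:(lra)). assert (vn : v t <> 0) by (apply Cmod_gt_0; lra).
          assert (X : ka * (C0 * RtoC (exp (exp t + t / 2)) / (u t * u t)) =
             RtoC (exp (exp t + t / 2 + 2 * Re a * t)) * (Cexp (Ci * RtoC th) * k)).
          { unfold ka, k. replace (u t) with (v t * ex t) by (unfold v; field; auto). unfold ex.
            rewrite (exp_plus (exp t + t / 2)%R (2 * Re a * t)%R), RtoC_mult, <- (Cexp_R (2 * Re a * t)).
            replace (Ci * RtoC th) with ((2 * a * RtoC t) + (- (2 * Ci * RtoC (Im a) * RtoC N)) + - RtoC (2 * Re a * t)).
            2:{ unfold th. apply C_ext; unfold Re, Im; simpl; ring. }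
            rewrite !Cexp_plus. 
            replace (2 * a * RtoC t) with (a * RtoC t + a * RtoC t) by ring. rewrite Cexp_plus.
            assert (I1 := Cexp_opp (RtoC (2 * Re a * t))). assert (I2 := Cexp_opp (a * RtoC t)).
            replace (- a * RtoC t) with (- (a * RtoC t)) by ring.
            set (e1 := Cexp (RtoC (2 * Re a * t))) in *. set (e2 := Cexp (- RtoC (2 * Re a * t))) in *.
            set (e3 := Cexp (a * RtoC t)) in *. set (e4 := Cexp (- (a * RtoC t))) in *.
            assert (n4 : e4 <> 0) by apply Cexp_neq_0.
            replace e3 with (/ e4) by (apply (Cmult_eq_reg_l e4); [rewrite I2; field; auto|auto]).
            transitivity (Cexp (- (2 * Ci * RtoC (Im a) * RtoC N)) * RtoC (exp (exp t + t / 2)) / (v t * v t * (e4 * e4)) * (e2 * e1)).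
            - rewrite I1. field. auto.
            - field. auto. }
          rewrite X. 
          replace (Re (RtoC (exp (exp t + t / 2 + 2 * Re a * t)) * (Cexp (Ci * RtoC th) * k)))
            with (exp (exp t + t / 2 + 2 * Re a * t) * Re (Cexp (Ci * RtoC th) * k))%R by reim.
          assert (P1 : exp (N / 2) <= exp (exp t + t / 2 + 2 * Re a * t)).
          { apply exp_le. assert (Q := exp_ineq1_le t). nra. }
          assert (kb : Cmod k <= 256/225).
          { unfold k. rewrite Cmod_inv, Cmod_mult by (apply Cmult_neq_0; auto).
            replace (256/225)%R with (/ (15/16 * (15/16)))%R by field. apply Rinv_le_contravar; nra. }
          assert (k1 : Cmod (k - 1) <= 3/16).
          { replace (k - 1) with (k * ((1 - v t) * (1 + v t))) by (unfold k; field; auto).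
            rewrite !Cmod_mult. rewrite (Cmod_minus_sym 1). specialize (HM1 t ltac:(lra)). cbv beta in HM1. fold (ex t) in HM1. fold (v t) in HM1.
            assert (T := Cmod_triangle 1 (v t)). rewrite Cmod_1 in T.
            assert (Cmod (v t - 1) * Cmod (1 + v t) <= 1/16 * (33/16)).
            { apply Rmult_le_compat; try apply Cmod_ge_0; lra. }
            assert (Cmod k * (Cmod (v t - 1) * Cmod (1 + v t)) <= 256/225 * (1/16 * (33/16))).
            { apply Rmult_le_compat; try apply Cmod_ge_0; auto. apply Rmult_le_pos; apply Cmod_ge_0. }
            lra. }
          assert (thb : Cmod (Cexp (Ci * RtoC th) - 1) <= 1/4).
          { eapply Rle_trans; [apply Cexp_taylor1|]. rewrite Cmod_mult, Cmod_Ci, Cmod_R.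
            replace (Re (Ci * RtoC th)) with 0%R by reim. rewrite Rmax_left, exp_0 by lra.
            unfold th. rewrite !Rabs_mult, (Rabs_pos_eq 2), (Rabs_pos_eq (t - N)) by lra.
            assert (Rabs (Im a) * (t - N) <= Rabs (Im a) * h) by (apply Rmult_le_compat_l; [apply Rabs_pos|lra]).
            assert (Rabs (Im a) * h <= 1/8).
            { unfold h. apply Rmult_le_reg_r with (8 * (Rabs (Im a) + 1))%R. { generalize (Rabs_pos (Im a)); lra. }
              rewrite Rmult_assoc, Rinv_l by (generalize (Rabs_pos (Im a)); lra). generalize (Rabs_pos (Im a)); lra. }
            lra. }
          assert (Rk : 1/4 <= Re (Cexp (Ci * RtoC th) * k)).
          { assert (Cmod (Cexp (Ci * RtoC th) * k - 1) <= 3/4).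
            { replace (Cexp (Ci * RtoC th) * k - 1) with ((Cexp (Ci * RtoC th) - 1) * k + (k - 1)) by ring.
              triangle. rewrite Cmod_mult.
              assert (Cmod (Cexp (Ci * RtoC th) - 1) * Cmod k <= 1/4 * (256/225)) by (apply Rmult_le_compat; try apply Cmod_ge_0; auto).
              lra. }
            assert (RR := re_le_Cmod (Cexp (Ci * RtoC th) * k - 1)). apply Rabs_le_between in RR.
            replace (Re (Cexp (Ci * RtoC th) * k - 1)) with (Re (Cexp (Ci * RtoC th) * k) - 1)%R in RR by reflexivity. lra. }
          generalize (exp_pos (N / 2)). nra. }
      lra. }
    assert (B1 := Qb N ltac:(lra)). assert (B2 := Qb (N + h)%R ltac:(lra)).
    apply Rabs_le_between in B1. apply Rabs_le_between in B2.
    assert (Big : / 8 * exp (N / 2) * h > 2 * / Cmod C0).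
    { assert (8 / (h * Cmod C0) * 2 < exp (N / 2) * 1).
      { generalize (exp_ineq1_le (N / 2)). 
        intros. set (X := (8 / (h * Cmod C0))%R) in *.
        assert (2 * X <= N / 2); [|lra]. unfold N. generalize (Rmax_l 0 (Rmax M1 M2)). fold X. lra. }
      replace (2 * / Cmod C0)%R with (/ 8 * (8 / (h * Cmod C0) * 2) * h)%R by (field; lra).
      apply Rmult_lt_compat_r; lra. }
    lra. }
  assert (Wz : forall t, u t * y1 t - w t * y t = 0) by (intros t; rewrite HW, CZ; ring).
  set (B := (M1 + 1)%R).
  assert (qc : forall t, B <= t -> q t = q B).
  { intros t Ht. apply dR_zero_const; auto. intros s Hs. eapply dR_eq; [apply Dq; unfold B in *; lra|]. rewrite CZ. field. apply un; unfold B in *; lra. }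
  assert (qz : q B = 0).
  { apply Cmod_eq_0. apply Rle_antisym; [|apply Cmod_ge_0]. apply Cmod_le_limit. intros eps He. rewrite Rplus_0_l.
    destruct (Ty (eps / 2)%R ltac:(lra)) as [M3 HM3].
    set (t := (Rmax B M3 + 1)%R). assert (B < t /\ M3 < t)%R by (unfold t; generalize (Rmax_l B M3) (Rmax_r B M3); lra).
    rewrite <- (qc t) by lra. rewrite qv by (unfold B in *; lra). specialize (HM3 t ltac:(lra)). cbv beta in HM3. fold (ex t) in HM3.
    replace (y t / ex t - 0) with (y t / ex t) in HM3 by ring.
    assert (vt := Hv t ltac:(unfold B in *; lra)).
    rewrite Cmod_div by (apply Cmod_gt_0; lra). apply Rmult_le_reg_r with (Cmod (v t)); [lra|].
    unfold Rdiv. rewrite Rmult_assoc, Rinv_l by lra. nra. }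
  assert (Zr : forall t, B <= t -> y t = 0 /\ y1 t = 0).
  { intros t Ht. assert (ut := un t ltac:(unfold B in *; lra)).
    assert (yt : y t = 0). { replace (y t) with (q t * u t) by (unfold q; field; auto). rewrite qc, qz by auto. ring. }
    split; auto. specialize (Wz t). rewrite yt in Wz. apply (Cmult_eq_reg_l (u t)); auto.
    transitivity (u t * y1 t - w t * 0); [ring|]. rewrite Wz. ring. }
  intros t. destruct (Rle_dec B t) as [L|L]; [apply Zr; auto|].
  assert (L' : 0 <= B - t) by lra.
  assert (RZ := system_zero (fun s => y (B - s)%R) (fun s => y1 (B - s)%R)
    (fun s => - RtoC (exp (B - s))) (fun s => - RtoC (exp (B - s) - 1/2)) (fun _ => - a)
    (exp B + 1 + Cmod a) (B - t) L').
  cbv beta in RZ. replace (B - (B - t))%R with t in RZ by ring. apply RZ.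
  - intros s Hs. destruct (H2 (B - s)%R) as [A _].
    eapply dR_eq; [apply (dR_comp_R y (fun s => (B - s)%R) s _ (-1)%R A); auto_derive; [trivial|ring]|ceq; ring].
  - intros s Hs. destruct (H2 (B - s)%R) as [_ A].
    eapply dR_eq; [apply (dR_comp_R y1 (fun s => (B - s)%R) s _ (-1)%R A); auto_derive; [trivial|ring]|].
    replace (RtoC (-1)) with (- RtoC 1) by (ceq; ring). ring.
  - intros s Hs. assert (P := exp_pos (B - s)). assert (exp (B - s) <= exp B) by (apply exp_le; lra).
    assert (Ca := Cmod_ge_0 a). rewrite !Cmod_opp, !Cmod_R, (Rabs_pos_eq (exp _)) by lra.
    repeat split; try lra. apply Rabs_le. lra.
  - rewrite Rminus_0_r. apply Zr; lra.
  - rewrite Rminus_0_r. apply Zr; lra.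
Qed.

Lemma ksys_unique (a : C) (u w y y1 : R -> C) (g : C) : - (1/2) < Re a -> ksys a u w -> ksys a y y1 ->
  tends (fun t => u t / Cexp (- a * RtoC t)) 1 -> tends (fun t => y t / Cexp (- a * RtoC t)) g ->
  forall t, y t = g * u t /\ y1 t = g * w t.
Proof.
  intros Ha H1 H2 Tu Ty t.
  destruct (ksys_recessive a u w _ _ Ha H1 (ksys_minus a u w y y1 g H1 H2) Tu) with t as [A B].
  - intros eps He. assert (P : 0 < Cmod g + 1) by (generalize (Cmod_ge_0 g); lra).
    destruct (Tu (eps / 2 / (Cmod g + 1))%R) as [M1 HM1]. { repeat apply Rdiv_lt_0_compat; lra. }
    destruct (Ty (eps / 2)%R ltac:(lra)) as [M2 HM2]. exists (Rmax M1 M2). intros s Hs.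
    specialize (HM1 s ltac:(generalize (Rmax_l M1 M2); lra)). specialize (HM2 s ltac:(generalize (Rmax_r M1 M2); lra)).
    assert (n := Cexp_neq_0 (- a * RtoC s)).
    replace ((y s - g * u s) / Cexp (- a * RtoC s) - 0) with
      ((y s / Cexp (- a * RtoC s) - g) + - (g * (u s / Cexp (- a * RtoC s) - 1))) by (field; auto).
    eapply Rle_lt_trans; [apply Cmod_triangle|]. rewrite Cmod_opp, (Cmod_mult g).
    apply Rmult_lt_compat_l with (r := (Cmod g + 1)%R) in HM1; [|lra].
    replace ((Cmod g + 1) * (eps / 2 / (Cmod g + 1)))%R with (eps/2)%R in HM1 by (field; lra).
    generalize (Cmod_ge_0 (u s / Cexp (- a * RtoC s) - 1)). lra.
  - split.
    + rewrite <- (Cplus_0_r (g * u t)), <- A. ring.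
    + rewrite <- (Cplus_0_r (g * w t)), <- B. ring.
Qed.

Lemma RtoC_neq (a b : R) : a <> b -> RtoC a <> RtoC b.
Proof. intros H E. apply H. exact (f_equal Re E). Qed.

Ltac cfield := field; repeat split; try assumption; try (apply RtoC_neq; lra).
(** ** Existence *)

Definition EH (m z : C) : C := E (1/2) z m.
Lemma admH z : adm (1/2) z 1 ((1 + Cmod z) * (1 + Cmod z) / (4 * (1/2))).
Proof. apply adm_gauss; lra. Qed.

Lemma EH_dC m z : 0 < Re m -> dC (EH m) z (- EH (m + 1) z).
Proof. intros Hm. apply (E_dC _ _ _ _ _ (admH z) Hm). Qed.

Lemma EH_rec m z : 0 < Re m -> m * EH m z = z * EH (m + 1) z + EH (m + 2) z.
Proof.
  intros Hm. unfold EH. rewrite (E_rec _ _ _ _ _ (admH z) Hm). rewrite RtoC_div by lra. cfield.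
Qed.

(** z E(mu+1) + E(mu+2) is mu E(mu) when Re mu > 0, and continues it to Re mu > -1; it solves
    Y'' = z Y' + mu Y. *)
Definition weber (mu z : C) : C := z * EH (mu + 1) z + EH (mu + 2) z.

Lemma weber_dC mu z : -1 < Re mu -> dC (weber mu) z (- mu * EH (mu + 1) z).
Proof.
  intros Hm. assert (H1 : 0 < Re (mu + 1)) by (rewrite Re_plus; simpl; lra).
  assert (H2 : 0 < Re (mu + 2)) by (rewrite Re_plus; simpl; lra).
  eapply dC_eq.
  - apply dC_plus; [apply dC_mult; [apply dC_id|apply EH_dC; auto]|apply EH_dC; auto].
  - cbv beta. assert (Q := EH_rec (mu + 1) z H1).
    replace (mu + 1 + 2) with (mu + 2 + 1) in Q by ring. replace (mu + 1 + 1) with (mu + 2) in * by ring.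
    transitivity (EH (mu + 1) z - (z * EH (mu + 2) z + EH (mu + 2 + 1) z)); [ring|]. rewrite <- Q. ring.
Qed.

(** The variable z = sqrt (2 e^x) of the parabolic cylinder function, and its inverse. *)
Definition ZX (x : C) : C := Cexp (x / 2 + RtoC (ln 2 / 2)).
Definition IZX (x : C) : C := Cexp (- (x / 2 + RtoC (ln 2 / 2))).
Lemma ZX_IZX x : IZX x * ZX x = 1.
Proof. apply Cexp_opp. Qed.

Lemma ZX_sqr x : ZX x * ZX x = 2 * Cexp x.
Proof.
  unfold ZX. rewrite <- Cexp_plus.
  replace (x / 2 + RtoC (ln 2 / 2) + (x / 2 + RtoC (ln 2 / 2))) with (RtoC (ln 2) + x).
  - rewrite Cexp_plus, Cexp_R, exp_ln by lra. reflexivity.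
  - rewrite RtoC_div by lra. cfield.
Qed.

Lemma half_dC x : dC (fun x => x / 2 + RtoC (ln 2 / 2)) x (/ 2).
Proof.
  eapply dC_eq; [apply dC_plus; [apply dC_mult; [apply dC_id|apply dC_const]|apply dC_const]|]. cbv beta. cfield.
Qed.

Lemma ZX_dC x : dC ZX x (ZX x / 2).
Proof. eapply dC_eq; [apply dC_Cexp, half_dC|]. unfold ZX. cfield. Qed.

Lemma IZX_dC x : dC IZX x (- (IZX x / 2)).
Proof. eapply dC_eq; [apply dC_Cexp, dC_opp, half_dC|]. unfold IZX. cfield. Qed.

(** U(a, 1/2, e^x), normalised by its behaviour at infinity. *)
Definition UE (a x : C) : C := Cexp (a * RtoC (ln 2)) / E 0 1 (2 * a + 1) * weber (2 * a) (ZX x).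
Lemma Cexp_sub z w : Cexp (z - w) = Cexp z / Cexp w.
Proof.
  assert (n := Cexp_neq_0 w). apply (Cmult_eq_reg_l (Cexp w)); auto.
  rewrite <- Cexp_plus. replace (w + (z - w)) with z by ring. cfield; auto.
Qed.

Lemma is_confluentU_UE a : - (1/2) < Re a -> is_confluentU a (1/2) (UE a).
Proof.
  intros Ha. 
  assert (Hmu : -1 < Re (2 * a)) by (unfold Re in *; simpl; lra).
  assert (H1 : 0 < Re (2 * a + 1)) by (rewrite Re_plus; simpl Re at 2; lra).
  assert (H2 : 0 < Re (2 * a + 2)) by (rewrite Re_plus; simpl Re at 2; lra).
  assert (GN := Gamma_neq_0 (2 * a + 1) H1).
  set (G := E 0 1 (2 * a + 1)) in *. set (cst := Cexp (a * RtoC (ln 2)) / G).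
  split.
  - exists (fun x => cst * (- (2 * a)) * (EH (2 * a + 1) (ZX x) * IZX x)).
    exists (fun x => Cexp (- x) * (cst * a * (EH (2 * a + 2) (ZX x) + EH (2 * a + 1) (ZX x) * IZX x))).
    intros x. assert (I1 := ZX_IZX x). assert (I2 := ZX_sqr x). assert (I3 := Cexp_opp x).
    split; [|split].
    + apply (dC_eq (UE a) x (0 * weber (2 * a) (ZX x) + cst * (ZX x / 2 * (- (2 * a) * EH (2 * a + 1) (ZX x))))).
      * apply (dC_mult (fun _ => cst) (fun x => weber (2 * a) (ZX x))); [apply dC_const|].
        apply (dC_comp (weber (2 * a)) ZX); [apply weber_dC; auto|apply ZX_dC].
      * transitivity (cst * - (2 * a) * EH (2 * a + 1) (ZX x) * ((ZX x * ZX x) / 2) * IZX x).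
        -- transitivity (cst * (ZX x / 2 * (- (2 * a) * EH (2 * a + 1) (ZX x))) * (IZX x * ZX x)).
           ++ rewrite I1. ring. ++ cfield.
        -- rewrite I2. cfield.
    + eapply (dC_eq (fun x => cst * (- (2 * a)) * (EH (2 * a + 1) (ZX x) * IZX x)) x).
      * apply dC_mult; [apply dC_const|apply dC_mult].
        -- apply (dC_comp (EH (2 * a + 1)) ZX); [apply EH_dC; auto|apply ZX_dC].
        -- apply IZX_dC.
      * cbv beta. replace (2 * a + 1 + 1) with (2 * a + 2) by ring.
        transitivity (cst * a * (EH (2 * a + 2) (ZX x) * (IZX x * ZX x) + EH (2 * a + 1) (ZX x) * IZX x)); [cfield|].
        rewrite I1. transitivity (Cexp (- x) * Cexp x * (cst * a * (EH (2 * a + 2) (ZX x) + EH (2 * a + 1) (ZX x) * IZX x))); [rewrite I3; ring|ring].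
    + unfold UE. fold G. fold cst. unfold weber.
      set (e1 := EH (2 * a + 1) (ZX x)). set (e2 := EH (2 * a + 2) (ZX x)).
      transitivity (cst * a * (Cexp (- x) * Cexp x) * (e2 + e1 * IZX x) + (1/2 - Cexp x) * (cst * - (2 * a) * (e1 * IZX x)) - a * (cst * (ZX x * e1 + e2))); [ring|].
      rewrite I3. transitivity (cst * a * e1 * (2 * Cexp x * IZX x - ZX x)); [cfield|]. rewrite <- I2.
      transitivity (cst * a * e1 * (ZX x * (IZX x * ZX x) - ZX x)); [ring|]. rewrite I1. ring.
  - intros delta Hd eps He. assert (HPI := PI_RGT_0).
    set (d := Rmin (delta / 2) (PI / 8)).
    assert (d1 : 0 < d) by (apply Rmin_pos; lra).
    assert (d2 : d <= delta / 2) by apply Rmin_l. assert (d3 : d <= PI / 8) by apply Rmin_r.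
    destruct (E_asymptotic (2 * a + 1) d H1 ltac:(lra)) as [K1 [K1p HK1]].
    destruct (E_asymptotic (2 * a + 2) d H2 ltac:(lra)) as [K2 [K2p HK2]].
    fold G in HK1. set (G2 := E 0 1 (2 * a + 2)) in *.
    assert (Gp := proj1 (Cmod_gt_0 G) GN). 
    set (L := ((K1 + K2 + Cmod G2) / Cmod G)%R).
    assert (HL : 0 <= L). { unfold L. apply Rmult_le_pos; [generalize (Cmod_ge_0 G2); lra|left; apply Rinv_0_lt_compat; lra]. }
    exists (Rmax 0 (ln ((L + 1) / eps))). intros x Hx Hi.
    assert (X0 : 0 < Re x) by (generalize (Rmax_l 0 (ln ((L + 1) / eps))); lra).
    assert (X1 : ln ((L + 1) / eps) < Re x) by (generalize (Rmax_r 0 (ln ((L + 1) / eps))); lra).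
    set (w := x / 2 + RtoC (ln 2 / 2)).
    assert (Wr : (- 2 * Re w = - Re x + - ln 2)%R) by (unfold w, Re; simpl; cfield).
    assert (Wi : Im w = (Im x / 2)%R) by (unfold w, Im; simpl; cfield).
    assert (Hw : Rabs (Im w) <= 3 * PI / 4 - d).
    { rewrite Wi. unfold Rdiv. rewrite Rabs_mult, (Rabs_pos_eq (/ 2)) by lra. lra. }
    specialize (HK1 w Hw). specialize (HK2 w Hw).
    set (ew := exp (- 2 * Re w)) in *.
    assert (ew0 : 0 < ew) by apply exp_pos.
    assert (ew1 : ew <= exp (- Re x)).
    { unfold ew. rewrite Wr. apply exp_le. assert (0 < ln 2) by (rewrite <- ln_1; apply ln_increasing; lra). lra. }
    assert (ew2 : ew <= 1). { eapply Rle_trans; [exact ew1|]. rewrite <- exp_0. apply exp_le. lra. }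
    change (Cexp w) with (ZX x) in HK1, HK2. change (E (1/2) (ZX x)) with (fun m => EH m (ZX x)) in HK1, HK2.
    set (A1 := Cexp ((2 * a + 1) * w) * EH (2 * a + 1) (ZX x)).
    set (A2 := Cexp ((2 * a + 2) * w) * EH (2 * a + 2) (ZX x)).
    assert (EQ : UE a x / Cexp (- a * x) - 1 = / G * ((A1 - G) + Cexp (- 2 * w) * A2)).
    { unfold UE. fold G.
      assert (nx := Cexp_neq_0 (- a * x)).
      replace (Cexp (a * RtoC (ln 2)) / G * weber (2 * a) (ZX x) / Cexp (- a * x) - 1) with
        (/ G * (Cexp (a * RtoC (ln 2)) / Cexp (- a * x) * weber (2 * a) (ZX x) - G)) by (cfield; auto).
      f_equal. rewrite <- Cexp_sub. 
      replace (a * RtoC (ln 2) - - a * x) with (2 * a * w) by (unfold w; rewrite RtoC_div by lra; cfield).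
      unfold A1, A2, weber.
      replace ((2 * a + 1) * w) with (2 * a * w + w) by ring. replace ((2 * a + 2) * w) with (2 * a * w + 2 * w) by ring.
      rewrite !(Cexp_plus (2 * a * w)). change (Cexp w) with (ZX x).
      assert (I := Cexp_opp (2 * w)). replace (- 2 * w) with (- (2 * w)) by ring.
      transitivity (Cexp (2 * a * w) * ZX x * EH (2 * a + 1) (ZX x) - G + Cexp (2 * a * w) * EH (2 * a + 2) (ZX x) * (Cexp (- (2 * w)) * Cexp (2 * w))); [rewrite I; ring|ring]. }
    rewrite EQ, Cmod_mult, Cmod_inv by auto.
    assert (B1 : Cmod (A1 - G) <= K1 * ew) by exact HK1.
    assert (B2 : Cmod A2 <= K2 * 1 + Cmod G2).
    { replace A2 with ((A2 - G2) + G2) by ring. triangle. apply Rplus_le_compat_r.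
      eapply Rle_trans; [exact HK2|]. apply Rmult_le_compat_l; auto. }
    assert (B3 : Cmod (Cexp (- 2 * w)) = ew). { rewrite Cmod_Cexp. unfold ew. f_equal. unfold Re; simpl; ring. }
    assert (B4 : Cmod (A1 - G + Cexp (- 2 * w) * A2) <= (K1 + K2 + Cmod G2) * ew).
    { triangle. rewrite (Cmod_mult (Cexp _)), B3. nra. }
    apply Rle_lt_trans with (L * exp (- Re x))%R.
    + apply Rle_trans with (L * ew)%R; [|apply Rmult_le_compat_l; auto].
      unfold L. apply Rle_trans with (/ Cmod G * ((K1 + K2 + Cmod G2) * ew))%R.
      * apply Rmult_le_compat_l; [left; apply Rinv_0_lt_compat; auto|exact B4].
      * right. cfield. lra.
    + assert (Q : (L + 1) / eps < exp (Re x)).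
      { rewrite <- (exp_ln ((L + 1) / eps)) by (apply Rdiv_lt_0_compat; lra). apply exp_increasing; auto. }
      rewrite exp_Ropp. apply Rmult_lt_reg_r with (exp (Re x)); [apply exp_pos|].
      rewrite Rmult_assoc, Rinv_l, Rmult_1_r by (generalize (exp_pos (Re x)); lra).
      apply Rmult_lt_compat_l with (r := eps) in Q; [|lra]. replace (eps * ((L + 1) / eps))%R with (L + 1)%R in Q by (cfield; lra). lra.
Qed.

(** ** The defining properties determine the function *)

(** The confluent equation in x = log z; the predicate delimits the part of the logarithmic
    plane. *)
Definition ksysC (a : C) (u w : C -> C) (P : C -> Prop) : Prop := forall x, P x ->
  dC u x (Cexp x * w x) /\ dC w x ((Cexp x - 1/2) * w x + a * u x).

Lemma is_confluentU_ksysC a u : is_confluentU a (1/2) u -> exists w, ksysC a u w (fun _ => True).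
Proof.
  intros [[w1 [w2 H]] _]. exists w1. intros x _. destruct (H x) as [A [B C]]. split; [exact A|].
  eapply dC_eq; [exact B|]. 
  transitivity ((Cexp x * w2 x + (1 / 2 - Cexp x) * w1 x - a * u x) + ((Cexp x - 1/2) * w1 x + a * u x)); [ring|].
  rewrite C. ring.
Qed.

Lemma is_confluentU_tends a u : is_confluentU a (1/2) u -> tends (fun t => u (RtoC t) / Cexp (- a * RtoC t)) 1.
Proof.
  intros [_ H] eps He. assert (HPI := PI_RGT_0). destruct (H PI HPI eps He) as [M HM]. exists M. intros t Ht.
  apply HM; auto. simpl. rewrite Rabs_R0. lra.
Qed.

Lemma ksysC_real a u w (P : C -> Prop) : (forall t, P (RtoC t)) -> ksysC a u w P ->
  ksys a (fun t => u (RtoC t)) (fun t => w (RtoC t)).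
Proof.
  intros HP H t. destruct (H (RtoC t) (HP t)) as [A B]. split.
  - eapply dR_eq; [exact (dR_comp u (fun t => RtoC t) t _ _ A (dR_id t))|]. rewrite Cexp_R. ring.
  - eapply dR_eq; [exact (dR_comp w (fun t => RtoC t) t _ _ B (dR_id t))|]. rewrite Cexp_R, RtoC_minus, RtoC_div by lra. ring.
Qed.

(** The equation propagates equality from the real line along vertical segments. *)
Lemma ksysC_vertical a u w y y1 (g : C) (b : R) : 
  ksysC a u w (fun x => (Rabs (Im x) < b)) -> ksysC a y y1 (fun x => (Rabs (Im x) < b)) ->
  (forall t, y (RtoC t) = g * u (RtoC t) /\ y1 (RtoC t) = g * w (RtoC t)) ->
  forall x, Rabs (Im x) < b -> y x = g * u x.
Proof.
  intros H1 H2 HR x Hx.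
  set (s := if Rle_dec 0 (Im x) then 1%R else (-1)%R). set (T := Rabs (Im x)).
  assert (sT : (s * T = Im x)%R).
  { unfold s, T. destruct (Rle_dec 0 (Im x)); [rewrite Rabs_pos_eq by lra|rewrite Rabs_left by lra]; ring. }
  assert (s1 : Rabs s = 1%R). { unfold s. destruct (Rle_dec 0 (Im x)); [rewrite Rabs_pos_eq; lra|rewrite Rabs_left; lra]. }
  set (p := fun t : R => RtoC (Re x) + Ci * RtoC s * RtoC t).
  assert (pI : forall t, Im (p t) = (s * t)%R) by (intros; unfold p, Im; simpl; ring).
  assert (pR : forall t, Re (p t) = Re x) by (intros; unfold p, Re; simpl; ring).
  assert (pT : p T = x). { apply C_ext; [apply pR|rewrite pI; exact sT]. }
  assert (p0 : p 0%R = RtoC (Re x)) by (unfold p; ring).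
  assert (Dp : forall t, dR p t (Ci * RtoC s)).
  { intros t. eapply dR_eq; [apply dR_plus; [apply dR_const|apply dR_mult; [apply dR_const|apply dR_id]]|dring]. }
  assert (pb : forall t, 0 <= t <= T -> Rabs (Im (p t)) < b).
  { intros t Ht. rewrite pI, Rabs_mult, s1, (Rabs_pos_eq t) by lra. unfold T in *. lra. }
  assert (RZ := system_zero (fun t => y (p t) - g * u (p t)) (fun t => y1 (p t) - g * w (p t))
    (fun t => Ci * RtoC s * Cexp (p t)) (fun t => Ci * RtoC s * (Cexp (p t) - 1/2)) (fun _ => Ci * RtoC s * a)
    (exp (Re x) + 1 + Cmod a) T (Rabs_pos _)).
  cbv beta in RZ. rewrite pT, p0 in RZ. destruct (HR (Re x)) as [HR1 HR2]. rewrite HR1, HR2 in RZ.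
  destruct RZ as [Z _].
  - intros t Ht. destruct (H1 (p t) (pb t Ht)) as [A _], (H2 (p t) (pb t Ht)) as [A' _].
    eapply dR_eq; [apply dR_minus; [apply (dR_comp y p _ _ _ A' (Dp t))|apply dR_mult; [apply dR_const|apply (dR_comp u p _ _ _ A (Dp t))]]|dring].
  - intros t Ht. destruct (H1 (p t) (pb t Ht)) as [_ A], (H2 (p t) (pb t Ht)) as [_ A'].
    eapply dR_eq; [apply dR_minus; [apply (dR_comp y1 p _ _ _ A' (Dp t))|apply dR_mult; [apply dR_const|apply (dR_comp w p _ _ _ A (Dp t))]]|dring].
  - intros t Ht. assert (M1 : Cmod (Ci * RtoC s) = 1%R) by (rewrite Cmod_mult, Cmod_Ci, Cmod_R, s1; ring).
    assert (M2 : Cmod (Cexp (p t)) = exp (Re x)) by (rewrite Cmod_Cexp, pR; reflexivity).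
    assert (P := exp_pos (Re x)). assert (Ca := Cmod_ge_0 a).
    rewrite !(Cmod_mult (Ci * RtoC s)), M1, M2. repeat split; try lra.
    assert (T2 := Cmod_triangle (Cexp (p t)) (- (1/2))). rewrite Cmod_opp, M2 in T2.
    replace (Cmod (1/2)) with (1/2)%R in T2. 2:{ rewrite <- RtoC_div, Cmod_R, Rabs_pos_eq by lra. lra. }
    change (Cexp (p t) - 1/2) with (Cexp (p t) + - (1/2)). lra.
  - ring.
  - ring.
  - transitivity ((y x - g * u x) + g * u x); [ring|]. rewrite Z. ring.
Qed.

Lemma ksysC_sub a u w (P Q : C -> Prop) : (forall x, Q x -> P x) -> ksysC a u w P -> ksysC a u w Q.
Proof. intros H K x Hx. apply K, H, Hx. Qed.

(** The two functions have the same behaviour at + infinity, so they agree on the real line and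
    hence everywhere. *)
Theorem confluentU_UE a : - (1/2) < Re a -> confluentU a (1/2) = UE a.
Proof.
  intros Ha.
  assert (H1 := is_confluentU_UE a Ha).
  assert (H2 : is_confluentU a (1/2) (confluentU a (1/2))).
  { unfold confluentU. apply epsilon_spec. exists (UE a). exact H1. }
  destruct (is_confluentU_ksysC _ _ H1) as [w1 K1]. destruct (is_confluentU_ksysC _ _ H2) as [w2 K2].
  apply functional_extensionality. intros x.
  rewrite <- (Cmult_1_l (UE a x)).
  apply (ksysC_vertical a (UE a) w1 _ w2 1 (Rabs (Im x) + 1)).
  - apply (ksysC_sub _ _ _ (fun _ => True)); auto.
  - apply (ksysC_sub _ _ _ (fun _ => True)); auto.
  - apply (ksys_unique a (fun t => UE a (RtoC t)) (fun t => w1 (RtoC t)) _ (fun t => w2 (RtoC t)) 1 Ha).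
    + apply (ksysC_real a _ _ (fun _ => True)); auto.
    + apply (ksysC_real a _ _ (fun _ => True)); auto.
    + apply is_confluentU_tends; auto.
    + apply is_confluentU_tends; auto.
  - lra.
Qed.

(** ** Laplace transforms *)

(** The exponents b, b' measure the size of f at t = e^v near 0 and near infinity. *)
Definition lapw (f : R -> C) (b b' K : R) : Prop :=
  0 < b /\ b <= b' /\ 0 <= K /\ cont f /\ forall v, Cmod (f v) <= K * (exp (b * v) + exp (b' * v)).

Definition Lap (f : R -> C) (c : C) : C := II (fun v => Cexp (- c * RtoC (exp v)) * f v).
Lemma lapw_exp f b b' K : lapw f b b' K -> lapw (fun v => RtoC (exp v) * f v) (b + 1) (b' + 1) K.
Proof.
  intros [H1 [H2 [H3 [H4 H5]]]]. repeat split; try lra.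
  - intros v. specialize (H4 v). cc.
  - intros v. rewrite Cmod_mult, Cmod_R, Rabs_pos_eq by (left; apply exp_pos).
    replace (exp ((b + 1) * v)) with (exp v * exp (b * v))%R by (rewrite <- exp_plus; f_equal; ring).
    replace (exp ((b' + 1) * v)) with (exp v * exp (b' * v))%R by (rewrite <- exp_plus; f_equal; ring).
    specialize (H5 v). generalize (exp_pos v). nra.
Qed.

Lemma Lap_bound f b b' K c v : lapw f b b' K -> 
  Cmod (Cexp (- c * RtoC (exp v)) * f v) <= K * (wt (Re c) b v + wt (Re c) b' v).
Proof.
  intros [H1 [H2 [H3 [H4 H5]]]]. rewrite Cmod_mult, Cmod_Cexp. unfold wt.
  replace (Re (- c * RtoC (exp v))) with (- Re c * exp v)%R by reim.
  rewrite !exp_plus. specialize (H5 v). generalize (exp_pos (- Re c * exp v)). nra.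
Qed.

Lemma Lap_dom_unif b b' K c0 : 0 < b -> b <= b' -> 0 <= K -> 0 < c0 -> exists M, 0 <= M /\
  forall f c, lapw f b b' K -> c0 <= Re c -> dom (fun v => Cexp (- c * RtoC (exp v)) * f v) M.
Proof.
  intros H1 H2 H3 Hc.
  destruct (wt_dom2 c0 b b' Hc H1 H2) as [M [HM H]].
  exists (K * (2 * M))%R. split; [nra|]. intros f c Hf Hcc. split.
  - intros v. destruct Hf as [_ [_ [_ [H4 _]]]]. specialize (H4 v). cc.
  - intros v. eapply Rle_trans; [apply (Lap_bound f b b' K); auto|].
    assert (A := H (Re c) b v Hcc ltac:(lra)). assert (B := H (Re c) b' v Hcc ltac:(lra)).
    replace (K * (2 * M) / (1 + v * v))%R with (K * (M / (1 + v * v) + M / (1 + v * v)))%R by (field; generalize (sqr1_pos v); lra).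
    apply Rmult_le_compat_l; lra.
Qed.

Lemma Lap_dom f b b' K c : lapw f b b' K -> 0 < Re c -> exists M, dom (fun v => Cexp (- c * RtoC (exp v)) * f v) M.
Proof.
  intros Hf Hc. destruct (Lap_dom_unif b b' K (Re c)) as [M [_ H]]; try apply Hf; auto. exists M. apply H; auto; lra.
Qed.

Lemma Lap_dC f b b' K c : lapw f b b' K -> 0 < Re c -> dC (Lap f) c (- Lap (fun v => RtoC (exp v) * f v) c).
Proof.
  intros Hf Hc. 
  destruct (Lap_dom_unif b b' K (Re c / 2)) as [M [HM H]]; try apply Hf; try lra.
  destruct (Lap_dom _ _ _ _ c (lapw_exp _ _ _ _ Hf) Hc) as [M1 H1].
  assert (W2 := lapw_exp _ _ _ _ (lapw_exp _ _ _ _ Hf)).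
  destruct (Lap_dom_unif (b + 1 + 1) (b' + 1 + 1) K (Re c / 2)) as [M2 [HM2 H2]]; try apply W2; try lra.
  eapply dC_eq.
  - apply (II_dC (fun c v => Cexp (- c * RtoC (exp v)) * f v) (fun v => (- (1)) * (Cexp (- c * RtoC (exp v)) * (RtoC (exp v) * f v))) c
      (Re c / 2) M2 M (Cmod (- (1)) * M1)); [lra| | |].
    + intros h Hh. apply H; auto. rewrite Re_plus. generalize (re_le_Cmod h). intros Q. apply Rabs_le_between in Q. lra.
    + apply dom_scal. exact H1.
    + intros h v Hh.
      replace (- (c + h) * RtoC (exp v)) with (- h * RtoC (exp v) + - c * RtoC (exp v)) by ring. rewrite Cexp_plus.
      match goal with |- (Cmod ?x <= _) => replace x with
        ((Cexp (- h * RtoC (exp v)) - 1 - (- h * RtoC (exp v))) * (Cexp (- c * RtoC (exp v)) * f v)) by ring end.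
      rewrite Cmod_mult.
      replace (M2 * (Cmod h * Cmod h) / (1 + v * v))%R with ((Cmod h * Cmod h) * (M2 / (1 + v * v)))%R by (cfield; generalize (sqr1_pos v); lra).
      destruct (H2 _ (c / 2) W2) as [_ B]. { unfold Re; simpl; unfold Re; lra. }
      eapply Rle_trans; [|apply Rmult_le_compat_l; [generalize (Cmod_ge_0 h); nra|apply (B v)]].
      rewrite !Cmod_mult, !Cmod_Cexp, !Cmod_R, (Rabs_pos_eq (exp v)) by (left; apply exp_pos).
      apply Rle_trans with (((Cmod h * exp v) * (Cmod h * exp v) * exp (Re c / 2 * exp v)) * (exp (Re (- c * RtoC (exp v))) * Cmod (f v)))%R.
      * apply Rmult_le_compat_r. { apply Rmult_le_pos; [left; apply exp_pos|apply Cmod_ge_0]. }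
        eapply Rle_trans; [apply Cexp_taylor2|].
        rewrite Cmod_mult, Cmod_opp, Cmod_R, (Rabs_pos_eq (exp v)) by (left; apply exp_pos).
        apply Rmult_le_compat_l. { generalize (Cmod_ge_0 h) (exp_pos v). intros. assert (0 <= Cmod h * exp v) by (apply Rmult_le_pos; lra). nra. }
        apply exp_le. apply Rmax_lub. { generalize (exp_pos v); nra. }
        replace (Re (- h * RtoC (exp v))) with (- Re h * exp v)%R by reim.
        apply Rmult_le_compat_r; [left; apply exp_pos|]. generalize (re_le_Cmod h). intros Q. apply Rabs_le_between in Q. lra.
      * right. replace (Re (- c * RtoC (exp v))) with (- Re c * exp v)%R by reim.
        replace (Re (- (c / 2) * RtoC (exp v))) with (- Re c * exp v + Re c / 2 * exp v)%R by (unfold Re; simpl; cfield).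
        rewrite exp_plus. ring.
  - rewrite (II_scal _ _ M1) by exact H1. unfold Lap. ring.
Qed.

(** ** The Laplace representation in the right half-plane *)

Lemma Chalf : 1 / 2 = RtoC (1/2).
Proof. rewrite RtoC_div by lra. reflexivity. Qed.

Definition ell (v : R) : R := ln (1 + exp v).
Lemma exp1_pos v : 0 < 1 + exp v. Proof. generalize (exp_pos v); lra. Qed.
Lemma exp_ell v : exp (ell v) = (1 + exp v)%R.
Proof. apply exp_ln, exp1_pos. Qed.

Lemma ell_pos v : 0 <= ell v.
Proof. unfold ell. rewrite <- ln_1. apply ln_le; [lra|]. generalize (exp_pos v); lra. Qed.

Lemma ell_le v : ell v <= exp v.
Proof. generalize (exp_ineq1_le (ell v)). rewrite exp_ell. lra. Qed.

Lemma ell_derive v : is_derive ell v (exp v / (1 + exp v))%R.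
Proof. unfold ell. auto_derive; [apply exp1_pos|]. field. generalize (exp1_pos v); lra. Qed.

Lemma ell_cont v : continuous ell v.
Proof. apply (ex_derive_continuous (V := R_NormedModule)). eexists; apply ell_derive. Qed.

Ltac cce := repeat (cc; try apply (cR_comp ell); try apply ell_cont).
(** The density t^(a+1/2) (1+t)^(-a), with respect to dt / t, at t = e^v. *)
Definition fa (a : C) (v : R) : C := Cexp ((a + 1/2) * RtoC v - a * RtoC (ell v)).

Lemma fa_cont a : cont (fa a).
Proof. intros v. unfold fa. cc. apply ell_cont. Qed.

Lemma fa_lapw a : - (1/2) < Re a -> lapw (fa a) (Re a + 1/2) (Re a + 1/2 + 1) 1.
Proof.
  intros Ha. repeat split; try lra; [apply fa_cont|]. intros v. unfold fa. rewrite Chalf, Cmod_Cexp.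
  replace (Re ((a + RtoC (1/2)) * RtoC v - a * RtoC (ell v))) with ((Re a + 1/2) * v + - Re a * ell v)%R by reim.
  rewrite exp_plus.
  assert (A : exp (- Re a * ell v) <= 1 + exp v).
  { rewrite <- exp_ell. apply exp_le. generalize (ell_pos v). nra. }
  replace ((Re a + 1/2 + 1) * v)%R with ((Re a + 1/2) * v + v)%R by ring. rewrite exp_plus.
  generalize (exp_pos ((Re a + 1/2) * v)). nra.
Qed.

Definition L0 a := Lap (fa a).
Definition L1 a := Lap (fun v => RtoC (exp v) * fa a v).
Definition L2 a := Lap (fun v => RtoC (exp v) * (RtoC (exp v) * fa a v)).
(** The integral of the derivative of e^(-ct) t^(a+1/2) (1+t)^(1-a) is 0. *)
Lemma L_identity a c : - (1/2) < Re a -> 0 < Re c ->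
  c * L2 a c = (3/2 - c) * L1 a c + (a + 1/2) * L0 a c.
Proof.
  intros Ha Hc.
  assert (W0 := fa_lapw a Ha). assert (W1 := lapw_exp _ _ _ _ W0). assert (W2 := lapw_exp _ _ _ _ W1).
  destruct (Lap_dom _ _ _ _ c W0 Hc) as [M0 H0]. destruct (Lap_dom _ _ _ _ c W1 Hc) as [M1 H1].
  destruct (Lap_dom _ _ _ _ c W2 Hc) as [M2 H2].
  assert (D0 := dom_scal _ (a + 1/2) _ H0). assert (D1 := dom_scal _ (3/2 - c) _ H1).
  assert (D2 := dom_scal _ (- c) _ H2). cbv beta in D0, D1, D2.
  assert (D01 := dom_plus _ _ _ _ D0 D1). cbv beta in D01. assert (D := dom_plus _ _ _ _ D01 D2). cbv beta in D.
  assert (DF := dom_plus _ _ _ _ H0 H1).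
  assert (Z := fun M => II_total_derivative (fun v => Cexp (- c * RtoC (exp v)) * fa a v * RtoC (1 + exp v))
    (fun v => (a + 1/2) * (Cexp (- c * RtoC (exp v)) * fa a v) + (3/2 - c) * (Cexp (- c * RtoC (exp v)) * (RtoC (exp v) * fa a v))
      + - c * (Cexp (- c * RtoC (exp v)) * (RtoC (exp v) * (RtoC (exp v) * fa a v)))) M (M0 + M1)).
  assert (ZZ : II (fun v => (a + 1/2) * (Cexp (- c * RtoC (exp v)) * fa a v) + (3/2 - c) * (Cexp (- c * RtoC (exp v)) * (RtoC (exp v) * fa a v))
      + - c * (Cexp (- c * RtoC (exp v)) * (RtoC (exp v) * (RtoC (exp v) * fa a v)))) = 0).
  { eapply Z; [|exact D|].
    - intros v. set (t := exp v). assert (Ht : 0 < t) by apply exp_pos.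
      assert (De : dR (fun v => RtoC (exp v)) v (RtoC t)).
      { apply dR_RtoC. unfold t. auto_derive; [trivial|ring]. }
      assert (Dl : dR (fun v => RtoC (ell v)) v (RtoC (t / (1 + t)))). { apply dR_RtoC. apply ell_derive. }
      assert (Df : dR (fa a) v ((a + 1/2 - a * RtoC (t / (1 + t))) * fa a v)).
      { unfold fa. eapply dR_eq; [apply dR_Cexp; apply dR_minus; apply dR_mult; [apply dR_const|apply dR_id|apply dR_const|exact Dl]|dring]. }
      assert (D1t : dR (fun v => RtoC (1 + exp v)) v (RtoC t)).
      { apply dR_RtoC. unfold t. auto_derive; [trivial|ring]. }
      eapply dR_eq; [apply dR_mult; [apply dR_mult; [apply dR_Cexp; apply dR_mult; [apply dR_const|exact De]|exact Df]|exact D1t]|].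
      cbv beta. fold t. set (e := Cexp (- c * RtoC t)). set (g := fa a v).
      rewrite RtoC_div by lra. rewrite !RtoC_plus. field. change (RtoC 1 + RtoC t <> RtoC 0). rewrite <- RtoC_plus. apply RtoC_neq. lra.
    - intros v. destruct DF as [_ DF]. specialize (DF v). cbv beta in DF. eapply Rle_trans; [|exact DF]. right. f_equal.
      rewrite RtoC_plus. ring. }
  rewrite (II_plus _ _ _ _ D01 D2), (II_plus _ _ _ _ D0 D1), (II_scal _ _ _ H0), (II_scal _ _ _ H1), (II_scal _ _ _ H2) in ZZ.
  unfold L0, L1, L2, Lap.
  match goal with |- c * ?x2 = _ * ?x1 + _ * ?x0 => transitivity (c * x2 + ((a + 1/2) * x0 + (3/2 - c) * x1 + - c * x2)); [|ring] end.
  rewrite ZZ. ring.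
Qed.

(** Gamma(a+1/2) U(a, 1/2, e^x) as a Laplace integral, and its derivative with respect to e^x. *)
Definition Trep (a x : C) : C := Cexp (x / 2) * L0 a (Cexp x).
Definition Trep1 (a x : C) : C := Cexp (- (x / 2)) * (L0 a (Cexp x) / 2 - Cexp x * L1 a (Cexp x)).
Lemma Re_Cexp_pos x : Rabs (Im x) < PI / 2 -> 0 < Re (Cexp x).
Proof.
  intros H. unfold Cexp. replace (Re (RtoC (exp (Re x)) * (cos (Im x), sin (Im x)))) with (exp (Re x) * cos (Im x))%R by reim.
  apply Rmult_lt_0_compat; [apply exp_pos|]. apply Rabs_def2 in H. apply cos_gt_0; lra.
Qed.

Lemma xhalf_dC x : dC (fun x => x / 2) x (/ 2).
Proof. eapply dC_eq; [apply dC_mult; [apply dC_id|apply dC_const]|]. cbv beta. field. Qed.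

Lemma Trep_ksysC a : - (1/2) < Re a -> ksysC a (Trep a) (Trep1 a) (fun x => (Rabs (Im x) < PI / 2)).
Proof.
  intros Ha x Hx. assert (Hc := Re_Cexp_pos x Hx).
  assert (W0 := fa_lapw a Ha). assert (W1 := lapw_exp _ _ _ _ W0).
  assert (DL0 : dC (fun x => L0 a (Cexp x)) x (Cexp x * - L1 a (Cexp x))).
  { apply (dC_comp (L0 a) Cexp); [apply (Lap_dC _ _ _ _ _ W0 Hc)|apply dC_exp]. }
  assert (DL1 : dC (fun x => L1 a (Cexp x)) x (Cexp x * - L2 a (Cexp x))).
  { apply (dC_comp (L1 a) Cexp); [apply (Lap_dC _ _ _ _ _ W1 Hc)|apply dC_exp]. }
  assert (I := L_identity a (Cexp x) Ha Hc).
  assert (I1 : Cexp x = Cexp (x / 2) * Cexp (x / 2)) by (rewrite <- Cexp_plus; f_equal; field).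
  assert (I2 := Cexp_opp (x / 2)).
  split.
  - eapply dC_eq; [apply dC_mult; [apply dC_Cexp, xhalf_dC|exact DL0]|].
    unfold Trep1. cbv beta. set (l0 := L0 a (Cexp x)) in *. set (l1 := L1 a (Cexp x)) in *.
    rewrite I1. set (p := Cexp (x / 2)) in *. set (r := Cexp (- (x / 2))) in *.
    transitivity ((r * p) * p * (l0 / 2 - p * p * l1)); [rewrite I2; field|field].
  - eapply dC_eq; [apply dC_mult; [apply dC_Cexp, dC_opp, xhalf_dC|apply dC_minus;
      [apply dC_mult; [exact DL0|apply dC_const]|apply dC_mult; [apply dC_exp|exact DL1]]]|].
    cbv beta. unfold Trep, Trep1. set (l0 := L0 a (Cexp x)) in *. set (l1 := L1 a (Cexp x)) in *. set (l2 := L2 a (Cexp x)) in *.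
    set (r := Cexp (- (x / 2))) in *. set (p := Cexp (x / 2)) in *. set (e := Cexp x) in *.
    transitivity (r * (- / 2 * (l0 / 2 - e * l1) - e * l1 / 2 - e * l1 + e * (e * l2))); [field|].
    rewrite I. transitivity ((e - 1 / 2) * (r * (l0 / 2 - e * l1)) + a * (r * e * l0)); [field|].
    f_equal. f_equal. rewrite I1. transitivity ((r * p) * p * l0); [ring|]. rewrite I2. ring.
Qed.

(** After t is replaced by t / c, the factor (1 + t/c)^(-a) tends to 1. *)
Lemma Trep_tends a : - (1/2) < Re a ->
  tends (fun t => Trep a (RtoC t) / Cexp (- a * RtoC t)) (E 0 1 (a + 1/2)).
Proof.
  intros Ha. set (be := (Re a + 1/2)%R). assert (Hb : 0 < be) by (unfold be; lra).
  assert (Hm : Re (a + 1/2) = be) by (rewrite Chalf; reflexivity).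
  destruct (wt_dom 1 (be + 1) Rlt_0_1 ltac:(lra)) as [N1 [P1 H1]].
  destruct (wt_dom 1 (be + 2) Rlt_0_1 ltac:(lra)) as [N2 [P2 H2]].
  set (K := (Cmod a * (N1 + N2) * PI)%R).
  assert (HK : 0 <= K). { unfold K. generalize (Cmod_ge_0 a) PI_RGT_0. intros. apply Rmult_le_pos; [apply Rmult_le_pos|]; lra. }
  assert (B : forall t, 0 <= t -> Cmod (Trep a (RtoC t) / Cexp (- a * RtoC t) - E 0 1 (a + 1/2)) <= K * exp (- t)).
  { intros t Ht.
    destruct (Lap_dom _ _ _ _ (Cexp (RtoC t)) (fa_lapw a Ha)) as [M D]. { rewrite Cexp_R. apply exp_pos. }
    destruct (ker_dom 0 1 (a + 1/2) 1 0 adm01) as [M' D']; [rewrite Hm; auto|].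
    assert (EQ : Trep a (RtoC t) / Cexp (- a * RtoC t) = II (fun v => Cexp ((a + 1/2) * RtoC t) * (Cexp (- Cexp (RtoC t) * RtoC (exp (v + - t))) * fa a (v + - t)%R))).
    { transitivity (Cexp ((a + 1/2) * RtoC t) * L0 a (Cexp (RtoC t))).
      - unfold Trep. rewrite <- (Cmult_1_l (L0 a _)) at 1. 
        replace ((a + 1/2) * RtoC t) with (RtoC t / 2 - - a * RtoC t) by field. rewrite Cexp_sub. field. apply Cexp_neq_0.
      - unfold L0, Lap. rewrite <- (II_scal _ (Cexp ((a + 1/2) * RtoC t)) _ D).
        symmetry. exact (II_shift _ _ (- t) (dom_scal _ (Cexp ((a + 1/2) * RtoC t)) _ D)). }
    rewrite EQ. unfold E.
    assert (PW : forall v, Cexp ((a + 1/2) * RtoC t) * (Cexp (- Cexp (RtoC t) * RtoC (exp (v + - t))) * fa a (v + - t)%R) =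
      Cexp (- a * RtoC (ell (v + - t))) * ker 0 1 (a + 1/2) (RtoC v)).
    { intros v. unfold fa, ker. rewrite <- !Cexp_plus. f_equal. rewrite !Cexp_R.
      replace (- RtoC (exp t) * RtoC (exp (v + - t))) with (- RtoC (exp v)).
      2:{ transitivity (- RtoC (exp t * exp (v + - t))); [rewrite <- exp_plus; do 3 f_equal; ring|rewrite RtoC_mult; ring]. }
      rewrite RtoC_plus, RtoC_opp. ring. }
    replace (K * exp (- t))%R with ((Cmod a * exp (- t) * (N1 + N2)) * PI)%R by (unfold K; ring).
    assert (BB : forall v, Cmod ((Cexp (- a * RtoC (ell (v + - t))) - 1) * ker 0 1 (a + 1/2) (RtoC v)) <= Cmod a * exp (- t) * (N1 + N2) / (1 + v * v)).
    { intros v. set (u := (v + - t)%R). rewrite Cmod_mult.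
      assert (l0 := ell_pos u). assert (l1 := ell_le u). assert (l2 := exp_ell u).
      assert (eu : exp u = (exp (- t) * exp v)%R) by (unfold u; rewrite exp_plus; ring).
      assert (et : exp (- t) <= 1) by (rewrite <- exp_0; apply exp_le; lra).
      assert (A1 : Cmod (Cexp (- a * RtoC (ell u)) - 1) <= Cmod a * exp u * (1 + exp u)).
      { eapply Rle_trans; [apply Cexp_taylor1|]. rewrite Cmod_mult, Cmod_opp, Cmod_R, (Rabs_pos_eq (ell u)) by auto.
        apply Rmult_le_compat; [apply Rmult_le_pos; [apply Cmod_ge_0|auto]|left; apply exp_pos|apply Rmult_le_compat_l; [apply Cmod_ge_0|auto]|].
        rewrite <- l2. apply exp_le. apply Rmax_lub; auto.
        replace (Re (- a * RtoC (ell u))) with (- Re a * ell u)%R by reim. nra. }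
      assert (A2 := ker_bound 0 1 (a + 1/2) 1 0 v adm01). rewrite Hm, exp_0, Rmult_1_l in A2.
      apply Rle_trans with (Cmod a * exp u * (1 + exp u) * wt 1 be v)%R.
      { apply Rmult_le_compat; try apply Cmod_ge_0; auto. }
      apply Rle_trans with (Cmod a * exp (- t) * (wt 1 (be + 1) v + wt 1 (be + 2) v))%R.
      - replace (wt 1 (be + 1) v) with (exp v * wt 1 be v)%R by (unfold wt; rewrite <- exp_plus; f_equal; ring).
        replace (wt 1 (be + 2) v) with (exp v * exp v * wt 1 be v)%R by (unfold wt; rewrite <- !exp_plus; f_equal; ring).
        rewrite eu. assert (W := wt_pos 1 be v). assert (V := exp_pos v). assert (T := exp_pos (- t)). assert (CA := Cmod_ge_0 a).
        apply Rle_trans with (Cmod a * exp (- t) * (exp v * wt 1 be v) * (1 + exp (- t) * exp v))%R; [right; ring|].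
        replace (Cmod a * exp (- t) * (exp v * wt 1 be v + exp v * exp v * wt 1 be v))%R with (Cmod a * exp (- t) * (exp v * wt 1 be v) * (1 + exp v))%R by ring.
        apply Rmult_le_compat_l; [|nra]. repeat apply Rmult_le_pos; lra.
      - replace (Cmod a * exp (- t) * (N1 + N2) / (1 + v * v))%R with (Cmod a * exp (- t) * (N1 / (1 + v * v) + N2 / (1 + v * v)))%R by (field; generalize (sqr1_pos v); lra).
        apply Rmult_le_compat_l; [apply Rmult_le_pos; [apply Cmod_ge_0|left; apply exp_pos]|]. generalize (H1 v) (H2 v); lra. }
    rewrite (II_ext _ _ PW).
    apply (II_diff_bound _ _ (Cmod a * exp (- t) * (N1 + N2) + M') M').
    - eapply dom_ext with (f := fun v => (Cexp (- a * RtoC (ell (v + - t))) - 1) * ker 0 1 (a + 1/2) (RtoC v) + ker 0 1 (a + 1/2) (RtoC v)).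
      { intros v. ring. }
      apply dom_plus; [|exact D']. split. { intros v. cce. unfold ker. cc. }
      intros v. apply BB.
    - exact D'.
    - intros v. 
      match goal with |- (Cmod ?x <= _) => replace x with ((Cexp (- a * RtoC (ell (v + - t))) - 1) * ker 0 1 (a + 1/2) (RtoC v)) by ring end.
      apply BB. }
  intros eps He. exists (Rmax 0 (ln ((K + 1) / eps))). intros t Ht.
  assert (T0 : 0 < t) by (generalize (Rmax_l 0 (ln ((K + 1) / eps))); lra).
  assert (T1 : ln ((K + 1) / eps) < t) by (generalize (Rmax_r 0 (ln ((K + 1) / eps))); lra).
  eapply Rle_lt_trans; [apply B; lra|].
  assert (Q : (K + 1) / eps < exp t).
  { rewrite <- (exp_ln ((K + 1) / eps)) by (apply Rdiv_lt_0_compat; lra). apply exp_increasing; auto. }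
  rewrite exp_Ropp. apply Rmult_lt_reg_r with (exp t); [apply exp_pos|].
  rewrite Rmult_assoc, Rinv_l, Rmult_1_r by (generalize (exp_pos t); lra).
  apply Rmult_lt_compat_l with (r := eps) in Q; [|lra]. replace (eps * ((K + 1) / eps))%R with (K + 1)%R in Q by (field; lra). lra.
Qed.

(** Both sides solve the confluent equation and have proportional behaviour at + infinity. *)
Theorem UE_laplace a x : - (1/2) < Re a -> Rabs (Im x) < PI / 2 ->
  Trep a x = E 0 1 (a + 1/2) * UE a x.
Proof.
  intros Ha Hx. destruct (is_confluentU_ksysC _ _ (is_confluentU_UE a Ha)) as [w1 K1].
  apply (ksysC_vertical a (UE a) w1 _ (Trep1 a) _ (PI / 2)); auto.
  - apply (ksysC_sub _ _ _ (fun _ => True)); auto.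
  - apply Trep_ksysC; auto.
  - apply (ksys_unique a (fun t => UE a (RtoC t)) (fun t => w1 (RtoC t)) _ (fun t => Trep1 a (RtoC t)) _ Ha).
    + apply (ksysC_real a _ _ (fun _ => True)); auto.
    + apply (ksysC_real a _ _ (fun x => (Rabs (Im x) < PI / 2))); [|apply Trep_ksysC; auto].
      intros t. simpl. rewrite Rabs_R0. generalize PI_RGT_0; lra.
    + apply is_confluentU_tends, is_confluentU_UE; auto.
    + apply Trep_tends; auto.
Qed.

Implicit Types (z s xi eta nu mu : C).

(** * The parabolic cylinder function *)

Lemma Gamma_E z : 0 < Re z -> Gamma z = E 0 1 z.
Proof.
  intros Hz. unfold Gamma.
  replace (Z.to_nat (up (- Re z))) with 0%nat.
  - simpl. rewrite <- GammaInt_E by auto. rewrite Cplus_0_r. field.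
  - destruct (archimed (- Re z)) as [H1 H2].
    assert (up (- Re z) <= 0)%Z; [|lia]. assert (up (- Re z) < 1)%Z; [|lia]. apply lt_IZR. lra.
Qed.

Lemma cos_sin_acos x : -1 <= x <= 1 -> cos (acos x) = x /\ sin (acos x) = sqrt (1 - x * x).
Proof. intros H. split; [apply cos_acos; auto|]. rewrite sin_acos by auto. reflexivity. Qed.

Lemma Re_div_Cmod z : z <> 0 -> -1 <= Re z / Cmod z <= 1.
Proof.
  intros Hz. assert (P := proj1 (Cmod_gt_0 z) Hz). assert (Q := re_le_Cmod z). apply Rabs_le_between in Q.
  split; apply Rmult_le_reg_r with (Cmod z); auto; unfold Rdiv; rewrite Rmult_assoc, Rinv_l; lra.
Qed.

Lemma Cexp_Clog z : z <> 0 -> Cexp (Clog z) = z.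
Proof.
  intros Hz. assert (P := proj1 (Cmod_gt_0 z) Hz). assert (B := Re_div_Cmod z Hz).
  destruct (cos_sin_acos _ B) as [HC HS].
  assert (S : (Cmod z * sqrt (1 - Re z / Cmod z * (Re z / Cmod z)) = Rabs (Im z))%R).
  { replace (1 - Re z / Cmod z * (Re z / Cmod z))%R with ((Im z / Cmod z) * (Im z / Cmod z))%R.
    - change (Cmod z * sqrt (Rsqr (Im z / Cmod z)) = Rabs (Im z))%R. rewrite sqrt_Rsqr_abs. unfold Rdiv.
      rewrite Rabs_mult, (Rabs_pos_eq (/ Cmod z)) by (left; apply Rinv_0_lt_compat; auto). field. lra.
    - assert (Q := Cmod_sqr z). field_simplify_eq; [|lra]. simpl. nra. }
  change (Cexp (Clog z)) with (RtoC (exp (ln (Cmod z))) * (cos (Carg z), sin (Carg z))).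
  rewrite exp_ln by auto. unfold Carg.
  destruct (Rlt_dec (Im z) 0) as [L|L].
  - rewrite cos_neg, sin_neg, HC, HS. apply C_ext; simpl.
    + unfold Re. field. lra.
    + rewrite Rabs_left in S by auto. unfold Re, Im in *. lra.
  - rewrite HC, HS. apply C_ext; simpl.
    + unfold Re. field. lra.
    + rewrite Rabs_pos_eq in S by lra. unfold Re, Im in *. lra.
Qed.

(** D_nu without branches: an entire function of z, valid for Re nu < 1. *)
Definition pcf (nu z : C) : C := Cexp (- (z ^ 2) / 4) * weber (- nu) z / E 0 1 (1 - nu).

Lemma pcfD_pcf nu z : Re nu < 1 -> z <> 0 -> pcfD nu z = pcf nu z.
Proof.
  intros Hn Hz. unfold pcfD. destruct (excluded_middle_informative (z = 0)); [contradiction|].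
  unfold pcfD_nonzero. rewrite confluentU_UE.
  2:{ replace (- nu / 2) with (RtoC (- (1/2)) * nu) by (rewrite RtoC_opp, <- Chalf; field). unfold Re in *; simpl; lra. }
  unfold UE, pcf.
  replace (2 * (- nu / 2)) with (- nu) by field. replace (- nu + 1) with (1 - nu) by ring.
  replace (ZX (2 * Clog z - RtoC (ln 2))) with z.
  2:{ unfold ZX. rewrite RtoC_div by lra. rewrite <- (Cexp_Clog z Hz) at 1. f_equal. field. }
  assert (I := Cexp_opp (nu / 2 * RtoC (ln 2))). 
  replace (- nu / 2 * RtoC (ln 2)) with (- (nu / 2 * RtoC (ln 2))) by field.
  assert (GN : E 0 1 (1 - nu) <> 0). { apply Gamma_neq_0. unfold Re in *; simpl; lra. }
  set (p := Cexp (nu / 2 * RtoC (ln 2))) in *. set (r := Cexp (- (nu / 2 * RtoC (ln 2)))) in *.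
  transitivity ((r * p) * (Cexp (- z ^ 2 / 4) * weber (- nu) z / E 0 1 (1 - nu))); [field; auto|]. rewrite I. ring.
Qed.

Lemma weber_conj mu z : -1 < Re mu -> weber (Cconj mu) (Cconj z) = Cconj (weber mu z).
Proof.
  intros Hm. unfold weber, EH. 
  replace (Cconj mu + 1) with (Cconj (mu + 1)) by (ceq; ring). replace (Cconj mu + 2) with (Cconj (mu + 2)) by (ceq; ring).
  rewrite !(E_conj _ _ _ _ _ (admH z)) by (rewrite Re_plus; simpl; lra).
  rewrite Cplus_conj, Cmult_conj. reflexivity.
Qed.

Lemma Gamma_conj m : 0 < Re m -> E 0 1 (Cconj m) = Cconj (E 0 1 m).
Proof. intros Hm. rewrite <- (E_conj _ _ _ _ _ adm01 Hm). f_equal. ceq; ring. Qed.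

Lemma Cconj_R r : Cconj (RtoC r) = RtoC r.
Proof. ceq; ring. Qed.

Lemma Cconj_half : Cconj (1 / 2) = 1 / 2. Proof. rewrite Chalf. apply Cconj_R. Qed.
Lemma pcf_conj nu z : Re nu < 1 -> pcf (Cconj nu) (Cconj z) = Cconj (pcf nu z).
Proof.
  intros Hn. unfold pcf. rewrite Cdiv_conj, Cmult_conj.
  - rewrite <- Gamma_conj by (unfold Re in *; simpl; lra). rewrite <- weber_conj by (unfold Re in *; simpl; lra).
    rewrite Cexp_conj.
    replace (Cconj (1 - nu)) with (1 - Cconj nu) by (ceq; ring).
    replace (Cconj (- nu)) with (- Cconj nu) by (ceq; ring).
    rewrite Cdiv_conj by (apply RtoC_neq; lra). rewrite Copp_conj, Cpow_conj, Cconj_R. reflexivity.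
  - apply Gamma_neq_0. unfold Re in *; simpl; lra.
Qed.

(** ** The factor depending on xi, and its differential equation *)

(** The factor of the integrand that depends on xi. *)
Definition AA (s xi : C) : C := E 0 1 (3 / 4 - s) * pcf (2 * s - 1 / 2) ((1 - Ci) * xi).
Definition strip (s : C) : Prop := (Rabs (Re s) < 3 / 4).
Lemma C34 : 3 / 4 = RtoC (3/4). Proof. rewrite RtoC_div by lra. reflexivity. Qed.
Lemma C32 : 3 / 2 = RtoC (3/2). Proof. rewrite RtoC_div by lra. reflexivity. Qed.
Lemma strip_1 s : strip s -> 0 < Re (3 / 4 - s).
Proof. unfold strip. intros H. apply Rabs_def2 in H. rewrite C34. unfold Re in *; simpl; lra. Qed.

Lemma strip_2 s : strip s -> Re (2 * s - 1 / 2) < 1.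
Proof. unfold strip. intros H. apply Rabs_def2 in H. rewrite Chalf. unfold Re in *; simpl; lra. Qed.

Lemma strip_3 s : strip s -> -1 < Re (- (2 * s - 1 / 2)).
Proof. unfold strip. intros H. apply Rabs_def2 in H. rewrite Chalf. unfold Re in *; simpl; lra. Qed.

Lemma strip_4 s : strip s -> 0 < Re (1 - (2 * s - 1 / 2)).
Proof. unfold strip. intros H. apply Rabs_def2 in H. rewrite Chalf. unfold Re in *; simpl; lra. Qed.

Lemma strip_opp s : strip s -> strip (- s).
Proof. unfold strip. replace (Re (- s)) with (- Re s)%R by reflexivity. rewrite Rabs_Ropp. auto. Qed.

Lemma strip_conj s : strip s -> strip (Cconj s).
Proof. unfold strip. rewrite re_conj. auto. Qed.

Lemma AA_pcfD s xi : strip s -> xi <> 0 -> Gamma (3 / 4 - s) * pcfD (2 * s - 1 / 2) ((1 - Ci) * xi) = AA s xi.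
Proof.
  intros Hs Hx. unfold AA. rewrite Gamma_E by (apply strip_1; auto). rewrite pcfD_pcf; auto.
  - apply strip_2; auto.
  - apply Cmult_neq_0; auto. intro H. apply (f_equal Re) in H. simpl in H. lra.
Qed.

(** The rays (1+i) xi and (1-i) xi are exchanged by conjugation. *)
Lemma AA_conj_pcfD s xi : strip s -> xi <> 0 ->
  Gamma (3 / 4 - s) * pcfD (2 * s - 1 / 2) ((1 + Ci) * xi) = Cconj (AA (Cconj s) (Cconj xi)).
Proof.
  intros Hs Hx. unfold AA. rewrite Gamma_E by (apply strip_1; auto). rewrite pcfD_pcf; auto.
  2:{ apply strip_2; auto. } 2:{ apply Cmult_neq_0; auto. intro H. apply (f_equal Re) in H. simpl in H. lra. }
  rewrite Cmult_conj, <- Gamma_conj, <- pcf_conj.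
  - replace (Cconj (3 / 4 - Cconj s)) with (3 / 4 - s) by (rewrite Cminus_conj, Cconj_conj, C34, Cconj_R; reflexivity).
    replace (Cconj (2 * Cconj s - 1 / 2)) with (2 * s - 1 / 2) by (rewrite Cminus_conj, Cmult_conj, Cconj_conj, Cconj_half, Cconj_R; reflexivity).
    replace (Cconj ((1 - Ci) * Cconj xi)) with ((1 + Ci) * xi) by (ceq; ring). reflexivity.
  - apply strip_2, strip_conj; auto.
  - apply strip_1, strip_conj; auto.
Qed.

Lemma gauss_dC z : dC (fun z => Cexp (- (z ^ 2) / 4)) z (- (z / 2) * Cexp (- (z ^ 2) / 4)).
Proof.
  eapply dC_eq; [apply dC_Cexp|].
  - unfold Cdiv. apply dC_mult; [apply dC_opp|apply dC_const]. simpl. apply dC_mult; [apply dC_id|apply dC_mult; [apply dC_id|apply dC_const]].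
  - cbv beta. f_equal. cbn. field.
Qed.

Lemma lin_dC c x : dC (fun x => c * x) x c.
Proof. eapply dC_eq; [apply dC_mult; [apply dC_const|apply dC_id]|dring]. Qed.

(** Numerator of [pcf], and its derivative. *)
Definition pcn (mu z : C) : C := Cexp (- (z ^ 2) / 4) * weber mu z.

Definition pcn1 (mu z : C) : C := Cexp (- (z ^ 2) / 4) * (- mu * EH (mu + 1) z - z / 2 * weber mu z).
Lemma pcn_dC mu z : -1 < Re mu -> dC (pcn mu) z (pcn1 mu z).
Proof.
  intros Hm. eapply dC_eq; [apply (dC_mult _ _ _ _ _ (gauss_dC z) (weber_dC mu z Hm))|].
  unfold pcn1. ring.
Qed.

Lemma pcn1_dC mu z : -1 < Re mu -> dC (pcn1 mu) z ((z * z / 4 + mu - 1 / 2) * pcn mu z).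
Proof.
  intros Hm. assert (H1 : 0 < Re (mu + 1)) by (rewrite Re_plus; simpl; lra).
  assert (Hz : dC (fun z => z / 2) z (/ 2)) by apply xhalf_dC.
  eapply dC_eq; [apply (dC_mult _ _ _ _ _ (gauss_dC z) (dC_minus _ _ _ _ _ (dC_mult _ _ _ _ _ (dC_const (- mu) z) (EH_dC _ z H1))
    (dC_mult _ _ _ _ _ Hz (weber_dC mu z Hm))))|].
  unfold pcn, weber. cbv beta. replace (mu + 1 + 1) with (mu + 2) by ring. field.
Qed.

Definition gfac (s : C) : C := E 0 1 (3 / 4 - s) / E 0 1 (1 - (2 * s - 1 / 2)).
Definition AA1 (s xi : C) : C := gfac s * ((1 - Ci) * pcn1 (- (2 * s - 1 / 2)) ((1 - Ci) * xi)).
Lemma AA_pcn s xi : strip s -> AA s xi = gfac s * pcn (- (2 * s - 1 / 2)) ((1 - Ci) * xi).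
Proof.
  intros Hs. assert (GN := Gamma_neq_0 _ (strip_4 s Hs)). unfold AA, pcf, gfac, pcn. field. exact GN.
Qed.

Lemma AA_dC s xi : strip s -> dC (AA s) xi (AA1 s xi).
Proof.
  intros Hs. assert (H3 := strip_3 s Hs). 
  apply (dC_ext (fun xi => gfac s * pcn (- (2 * s - 1 / 2)) ((1 - Ci) * xi))).
  { intros x. symmetry. apply AA_pcn; auto. }
  eapply dC_eq.
  - apply (dC_mult _ _ _ _ _ (dC_const (gfac s) xi)
      (dC_comp (pcn (- (2 * s - 1 / 2))) (fun x => (1 - Ci) * x) _ _ _ (pcn_dC _ _ H3) (lin_dC _ _))).
  - unfold AA1. ring.
Qed.

(** Weber's equation along the ray. On a vertical line of s the term 4 i s is real up to a
    bounded one. *)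
Lemma AA1_dC s xi : strip s -> dC (AA1 s) xi ((4 * Ci * s - xi * xi) * AA s xi).
Proof.
  intros Hs. assert (H3 := strip_3 s Hs). rewrite AA_pcn by auto.
  eapply dC_eq.
  - apply (dC_mult _ _ _ _ _ (dC_const (gfac s) xi) (dC_mult _ _ _ _ _ (dC_const (1 - Ci) xi)
      (dC_comp (pcn1 (- (2 * s - 1 / 2))) (fun x => (1 - Ci) * x) _ _ _ (pcn1_dC _ _ H3) (lin_dC _ _)))).
  - cbv beta. set (p := pcn (- (2 * s - 1 / 2)) ((1 - Ci) * xi)). set (g := gfac s).
    assert (I2 : (1 - Ci) * (1 - Ci) = - (2 * Ci)) by (ceq; ring). assert (I1 : Ci * Ci = - (1)) by (ceq; ring).
    transitivity (g * ((1 - Ci) * (1 - Ci)) * ((((1 - Ci) * (1 - Ci)) * (xi * xi) / 4 + - (2 * s - 1 / 2) - 1 / 2) * p)); [field|].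
    rewrite I2. transitivity (((Ci * Ci) * (xi * xi) + 4 * Ci * s) * (g * p)); [field|]. rewrite I1. ring.
Qed.

Lemma E_along (mf : R -> C) k z c K t : adm k z c K -> continuous mf t -> 0 < Re (mf t) -> continuous (fun t => E k z (mf t)) t.
Proof. intros Ha Hm Hp. apply (cC_comp (fun m => E k z m) mf); auto. apply (E_cont_m k z c K); auto. Qed.

Lemma AA_AA1_cont sg xi : Rabs sg < 3 / 4 -> cont (fun t => AA (RtoC sg + Ci * RtoC t) xi) /\ cont (fun t => AA1 (RtoC sg + Ci * RtoC t) xi).
Proof.
  intros Hs. pose (sf := fun t : R => RtoC sg + Ci * RtoC t).
  assert (S : forall t, strip (sf t)). { intros u. unfold strip, sf. replace (Re (RtoC sg + Ci * RtoC u)) with sg by reim. auto. }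
  assert (Cs : forall t, continuous sf t) by (intros t; unfold sf; cc).
  assert (Cg : forall t, continuous (fun t => gfac (sf t)) t).
  { intros t. specialize (Cs t). unfold gfac. apply cC_div.
    - apply (E_along _ 0%R 1 _ _ _ adm01); [cc|apply (strip_1 (sf t)), S].
    - apply (E_along _ 0%R 1 _ _ _ adm01); [cc|apply (strip_4 (sf t)), S].
    - apply Gamma_neq_0, (strip_4 (sf t)), S. }
  assert (CE : forall (n : C) t, 0 < Re n -> 1 <= Re n -> continuous (fun t => EH (- (2 * sf t - 1 / 2) + n) ((1 - Ci) * xi)) t).
  { intros n t Hn Hn1. specialize (Cs t). apply (E_along _ _ _ _ _ _ (admH _)); [cc|]. rewrite Re_plus. generalize (strip_3 _ (S t)). lra. }
  assert (CW : forall t, continuous (fun t => weber (- (2 * sf t - 1 / 2)) ((1 - Ci) * xi)) t).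
  { intros t. unfold weber. apply cC_plus; [apply cC_mult; [apply cC_const|]|]; apply CE; simpl; lra. }
  split; intros t.
  - apply (continuous_ext (fun t => gfac (sf t) * pcn (- (2 * sf t - 1 / 2)) ((1 - Ci) * xi))).
    { intros u. symmetry. apply AA_pcn, S. }
    apply cC_mult; [apply Cg|]. unfold pcn. apply cC_mult; [apply cC_const|apply CW].
  - unfold AA1. fold (sf t). apply cC_mult; [apply Cg|]. unfold pcn1. apply cC_mult; [apply cC_const|]. apply cC_mult; [apply cC_const|].
    specialize (Cs t). apply cC_minus; apply cC_mult; [cc|apply CE; simpl; lra|apply cC_const|apply CW].
Qed.

Lemma AA_cont sg xi : Rabs sg < 3 / 4 -> cont (fun t => AA (RtoC sg + Ci * RtoC t) xi).
Proof. intros Hs. exact (proj1 (AA_AA1_cont sg xi Hs)). Qed.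

(** ** The Laplace representation when Im (xi^2) > 0 *)

(** In this quadrant - i xi^2 has positive real part, and s enters the density only through (1 +
    1/t)^s. *)
Lemma AA_laplace s xi : strip s -> 0 < Re xi -> 0 < Im xi ->
  AA s xi = Cexp ((s - 3 / 4) * RtoC (ln 2)) * ((1 - Ci) * xi) * Cexp (Ci * (xi * xi) / 2) * Lap (fa (1 / 4 - s)) (- Ci * (xi * xi)).
Proof.
  intros Hs Hr Hi. set (z := (1 - Ci) * xi).
  assert (zR : Re z = (Re xi + Im xi)%R) by (unfold z, Re, Im; simpl; ring).
  assert (zI : Im z = (Im xi - Re xi)%R) by (unfold z, Re, Im; simpl; ring).
  assert (zn : z <> 0). { intro H. rewrite H in zR. simpl in zR. lra. }
  assert (P := proj1 (Cmod_gt_0 z) zn). assert (B := Re_div_Cmod z zn).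
  set (x := 2 * Clog z - RtoC (ln 2)).
  assert (HPI := PI_RGT_0).
  assert (Ac : acos (Re z / Cmod z) < PI / 4).
  { destruct (acos_bound (Re z / Cmod z)) as [A1 A2].
    apply Rnot_le_lt. intros L.
    assert (Q := cos_decr_1 (PI / 4) (acos (Re z / Cmod z)) ltac:(lra) ltac:(lra) A1 A2 L).
    rewrite cos_acos in Q by auto. rewrite cos_PI4 in Q.
    assert (S := Cmod_sqr z). assert (s2 := sqrt_sqrt 2 ltac:(lra)). assert (s0 := Rlt_sqrt2_0).
    assert (Q2 : Re z * sqrt 2 <= Cmod z).
    { apply Rmult_le_reg_r with (/ Cmod z)%R; [apply Rinv_0_lt_compat; auto|]. rewrite Rinv_r by lra.
      replace (1)%R with (1 / sqrt 2 * sqrt 2)%R by (field; lra). unfold Rdiv in *.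
      replace (Re z * sqrt 2 * / Cmod z)%R with (Re z * / Cmod z * sqrt 2)%R by ring.
      apply Rmult_le_compat_r; lra. }
    assert (R0 : 0 < Re z * sqrt 2) by (apply Rmult_lt_0_compat; lra).
    assert (Q3 : (Re z * sqrt 2) * (Re z * sqrt 2) <= Cmod z * Cmod z) by (apply Rmult_le_compat; lra).
    replace ((Re z * sqrt 2) * (Re z * sqrt 2))%R with (2 * (Re z * Re z))%R in Q3 by (transitivity (Re z * Re z * (sqrt 2 * sqrt 2))%R; [rewrite s2; ring|ring]).
    rewrite S, zR, zI in Q3. nra. }
  assert (xI : Rabs (Im x) < PI / 2).
  { unfold x. replace (Im (2 * Clog z - RtoC (ln 2))) with (2 * Carg z)%R by (unfold Clog, Im; simpl; ring).
    unfold Carg. destruct (acos_bound (Re z / Cmod z)) as [A1 A2]. apply Rabs_def1; destruct (Rlt_dec (Im z) 0); lra. }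
  assert (Zx : ZX x = z). { unfold ZX, x. rewrite RtoC_div by lra. rewrite <- (Cexp_Clog z zn). f_equal. rewrite Cexp_Clog by auto. field. }
  assert (Ex : Cexp x = - Ci * (xi * xi)).
  { assert (Q := ZX_sqr x). rewrite Zx in Q. transitivity (z * z / 2); [rewrite Q; field|]. 
    assert (I2 : (1 - Ci) * (1 - Ci) = - (2 * Ci)) by (ceq; ring).
    unfold z. transitivity (((1 - Ci) * (1 - Ci)) * (xi * xi) / 2); [field|]. rewrite I2. field. }
  assert (Ha : - (1/2) < Re (1 / 4 - s)).
  { unfold strip in Hs. apply Rabs_def2 in Hs. replace (1 / 4) with (RtoC (1/4)) by (rewrite RtoC_div by lra; reflexivity). unfold Re in *; simpl; lra. }
  assert (U := UE_laplace (1 / 4 - s) x Ha xI).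
  unfold Trep, L0, UE in U. rewrite Zx, Ex in U.
  replace (1 / 4 - s + 1 / 2) with (3 / 4 - s) in U by field.
  replace (2 * (1 / 4 - s) + 1) with (1 - (2 * s - 1 / 2)) in U by field.
  replace (2 * (1 / 4 - s)) with (- (2 * s - 1 / 2)) in U by field.
  assert (GN := Gamma_neq_0 _ (strip_4 s Hs)).
  unfold AA, pcf. fold z.
  assert (Hx2 : Cexp (x / 2) = z * Cexp (- (RtoC (ln 2) / 2))).
  { rewrite <- Zx. unfold ZX. rewrite <- Cexp_plus. f_equal. rewrite RtoC_div by lra. field. }
  rewrite Hx2 in U.
  replace (Cexp (- z ^ 2 / 4)) with (Cexp (Ci * (xi * xi) / 2)).
  2:{ f_equal. assert (Q := ZX_sqr x). rewrite Zx, Ex in Q. simpl. transitivity (- (z * z) / 4); [rewrite Q; field|field]. }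
  set (G1 := E 0 1 (3 / 4 - s)) in *. set (G2 := E 0 1 (1 - (2 * s - 1 / 2))) in *. set (w := weber (- (2 * s - 1 / 2)) z) in *.
  set (q := Cexp (Ci * (xi * xi) / 2)). set (LL := Lap (fa (1 / 4 - s)) (- Ci * (xi * xi))) in *.
  assert (I := Cexp_opp ((1 / 4 - s) * RtoC (ln 2))).
  replace (Cexp ((s - 3 / 4) * RtoC (ln 2))) with (Cexp (- ((1 / 4 - s) * RtoC (ln 2))) * Cexp (- (RtoC (ln 2) / 2))).
  2:{ rewrite <- Cexp_plus. f_equal. field. }
  set (p := Cexp ((1 / 4 - s) * RtoC (ln 2))) in *. set (r := Cexp (- ((1 / 4 - s) * RtoC (ln 2)))) in *.
  transitivity (q * r * (G1 * (p / G2 * w))).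
  - transitivity ((r * p) * (q * (G1 * w / G2))); [rewrite I; field; auto|field; auto].
  - rewrite <- U. ring.
Qed.

(** * Growth in the spectral parameter *)

(** ** Two estimates for u'' = q u *)

Lemma Dsq (f : R -> C) (t : R) (l : C) : dR f t l ->
  is_derive (fun t => Cmod (f t) * Cmod (f t))%R t (2 * Re (Cconj (f t) * l))%R.
Proof.
  intros H. assert (H1 := dR_Re _ _ _ H). assert (H2 := dR_Im _ _ _ H).
  apply (is_derive_ext (fun t => Re (f t) * Re (f t) + Im (f t) * Im (f t))%R).
  { intros x. symmetry. apply Cmod_sqr. }
  replace (2 * Re (Cconj (f t) * l))%R with ((Re l * Re (f t) + Re (f t) * Re l) + (Im l * Im (f t) + Im (f t) * Im l))%R
    by reim.
  exact (is_derive_plus _ _ _ _ _ (Rd_mult _ _ _ _ _ H1 H1) (Rd_mult _ _ _ _ _ H2 H2)).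
Qed.

(** Along the imaginary direction the equation reads u'' = - q u, and the energy |u'|^2 + k |u|^2
    changes only through q - k. *)
Lemma energy (u w q : R -> C) (s k kap d : R) : (s * s = 1)%R -> 0 <= d -> 0 < k ->
  (forall t, 0 <= t <= d -> dR u t (Ci * RtoC s * w t)) ->
  (forall t, 0 <= t <= d -> dR w t (Ci * RtoC s * (q t * u t))) ->
  (forall t, 0 <= t <= d -> Cmod (q t - RtoC k) <= kap * sqrt k) ->
  (Cmod (w d) * Cmod (w d) + k * (Cmod (u d) * Cmod (u d)) <=
   (Cmod (w 0%R) * Cmod (w 0%R) + k * (Cmod (u 0%R) * Cmod (u 0%R))) * exp (kap * d)).
Proof.
  intros Hs Hd Hk Hu Hw Hq.
  set (h := fun t => (Cmod (w t) * Cmod (w t) + k * (Cmod (u t) * Cmod (u t)))%R).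
  assert (Dexp : forall t : R, is_derive (fun t => exp (- kap * t))%R t (- kap * exp (- kap * t))%R).
  { intros t. auto_derive; [trivial|ring]. }
  assert (G : h d * exp (- kap * d) <= h 0%R * exp (- kap * 0)).
  { apply (Rderiv_nonpos (fun t => h t * exp (- kap * t))%R
      (fun t => (2 * Re (Cconj (w t) * (Ci * RtoC s * (q t * u t))) + k * (2 * Re (Cconj (u t) * (Ci * RtoC s * w t)))) * exp (- kap * t)
        + h t * (- kap * exp (- kap * t)))%R 0 d Hd).
    - intros t Ht. apply (Rd_mult h (fun t => exp (- kap * t))%R); [|apply Dexp].
      exact (is_derive_plus _ _ _ _ _ (Dsq _ _ _ (Hw t Ht)) (is_derive_scal _ _ _ _ (Dsq _ _ _ (Hu t Ht)))).
    - intros t Ht.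
      assert (X : (2 * Re (Cconj (w t) * (Ci * RtoC s * (q t * u t))) + k * (2 * Re (Cconj (u t) * (Ci * RtoC s * w t))) =
        2 * Re (Ci * RtoC s * (Cconj (w t) * (u t * (q t - RtoC k)))))%R) by reim.
      assert (s1 : Rabs s = 1%R). { assert (Rabs s * Rabs s = 1)%R by (rewrite <- Rabs_mult, Hs; apply Rabs_R1). generalize (Rabs_pos s). nra. }
      assert (L : Re (Ci * RtoC s * (Cconj (w t) * (u t * (q t - RtoC k)))) <= Cmod (w t) * (Cmod (u t) * (kap * sqrt k))).
      { eapply Rle_trans; [apply Re_le_Cmod|]. rewrite !Cmod_mult, Cmod_Ci, Cmod_R, s1, Cmod_conj, !Rmult_1_l.
        repeat (apply Rmult_le_compat_l; [apply Cmod_ge_0|]). apply Hq; auto. }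
      assert (k0 : 0 <= kap).
      { specialize (Hq t Ht). generalize (Cmod_ge_0 (q t - RtoC k)). intros Q. assert (0 < sqrt k) by (apply sqrt_lt_R0; auto).
        apply Rmult_le_reg_r with (sqrt k); lra. }
      assert (Y : 2 * (Cmod (w t) * (Cmod (u t) * (kap * sqrt k))) <= kap * h t).
      { unfold h. assert (sk := sqrt_sqrt k ltac:(lra)). set (r := sqrt k) in *. set (a := Cmod (w t)). set (b := Cmod (u t)).
        assert (0 <= (a - r * b) * (a - r * b)) by apply Rle_0_sqr.
        replace (a * a + k * (b * b))%R with (a * a + r * r * (b * b))%R by (rewrite sk; ring).
        assert (0 <= kap * ((a - r * b) * (a - r * b))) by (apply Rmult_le_pos; auto). lra. }
      rewrite X. generalize (exp_pos (- kap * t)). intros. nra. }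
  rewrite Rmult_0_r, exp_0, Rmult_1_r in G. fold (h d). fold (h 0%R).
  apply Rmult_le_reg_r with (exp (- kap * d)); [apply exp_pos|].
  rewrite Rmult_assoc, <- exp_plus. replace (kap * d + - kap * d)%R with 0%R by ring. rewrite exp_0, Rmult_1_r. exact G.
Qed.

(** Maximum principle for h'' >= kap^2 h, from the factorisation of the operator. *)
Lemma max_principle (h h1 h2 : R -> R) (kap c L M x : R) : 0 < kap -> c <= x <= L -> 0 <= M ->
  (forall t, c <= t <= L -> is_derive h t (h1 t)) ->
  (forall t, c <= t <= L -> is_derive h1 t (h2 t)) ->
  (forall t, c <= t <= L -> kap * kap * h t <= h2 t) ->
  h c <= M -> h L <= M ->
  (h x <= M * (exp (- kap * (x - c)) + exp (- kap * (L - x)))).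
Proof.
  intros Hk Hx HM H1 H2 Hh Hc HL.
  set (e1 := fun t => exp (- kap * (t - c))%R). set (e2 := fun t => exp (- kap * (L - t))%R).
  assert (D1 : forall t, is_derive e1 t (- kap * e1 t)%R) by (intros; unfold e1; auto_derive; [trivial|unfold Rminus; ring]).
  assert (D2 : forall t, is_derive e2 t (kap * e2 t)%R) by (intros; unfold e2; auto_derive; [trivial|unfold Rminus; ring]).
  set (d := fun t => (h t - M * (e1 t + e2 t))%R). set (d1 := fun t => (h1 t - M * (- kap * e1 t + kap * e2 t))%R).
  set (d2 := fun t => (h2 t - M * (- kap * (- kap * e1 t) + kap * (kap * e2 t)))%R).
  assert (Dd : forall t, c <= t <= L -> is_derive d t (d1 t)).
  { intros t Ht. exact (is_derive_minus _ _ _ _ _ (H1 t Ht) (is_derive_scal _ _ _ _ (is_derive_plus _ _ _ _ _ (D1 t) (D2 t)))). }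
  assert (Dd1 : forall t, c <= t <= L -> is_derive d1 t (d2 t)).
  { intros t Ht. exact (is_derive_minus _ _ _ _ _ (H2 t Ht) (is_derive_scal _ _ _ _ (is_derive_plus _ _ _ _ _ (is_derive_scal _ _ _ _ (D1 t)) (is_derive_scal _ _ _ _ (D2 t))))). }
  assert (dd : forall t, c <= t <= L -> kap * kap * d t <= d2 t).
  { intros t Ht. specialize (Hh t Ht). unfold d, d2. nra. }
  assert (dc : d c <= 0).
  { unfold d, e1. replace (c - c)%R with 0%R by ring. rewrite Rmult_0_r, exp_0. generalize (exp_pos (- kap * (L - c))). unfold e2. nra. }
  assert (dL : d L <= 0).
  { unfold d, e2. replace (L - L)%R with 0%R by ring. rewrite Rmult_0_r, exp_0. generalize (exp_pos (- kap * (L - c))). unfold e1. nra. }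
  assert (Ep : forall t : R, is_derive (fun t => exp (kap * t)) t (kap * exp (kap * t))%R) by (intros; auto_derive; [trivial|ring]).
  assert (Em : forall t : R, is_derive (fun t => exp (- kap * t)) t (- kap * exp (- kap * t))%R) by (intros; auto_derive; [trivial|ring]).
  set (g := fun t => (exp (kap * t) * (d1 t - kap * d t))%R).
  assert (gm : forall a b, c <= a -> a <= b -> b <= L -> g a <= g b).
  { intros a b Ha Hab Hb.
    assert (Q := Rderiv_nonpos (fun t => - g t)%R (fun t => - (kap * exp (kap * t) * (d1 t - kap * d t) + exp (kap * t) * (d2 t - kap * d1 t)))%R a b Hab).
    assert (- g b <= - g a); [|lra]. apply Q.
    - intros t Ht. apply (is_derive_opp (V:=R_NormedModule)). unfold g.
      exact (Rd_mult _ _ _ _ _ (Ep t) (is_derive_minus _ _ _ _ _ (Dd1 t ltac:(lra)) (is_derive_scal _ _ _ _ (Dd t ltac:(lra))))).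
    - intros t Ht. specialize (dd t ltac:(lra)). generalize (exp_pos (kap * t)). intros. nra. }
  set (k := fun t => (exp (- kap * t) * d t)%R).
  assert (Dk : forall t, c <= t <= L -> is_derive k t (- kap * exp (- kap * t) * d t + exp (- kap * t) * d1 t)%R).
  { intros t Ht. exact (Rd_mult _ _ _ _ _ (Em t) (Dd t Ht)). }
  assert (kg : forall t, (- kap * exp (- kap * t) * d t + exp (- kap * t) * d1 t = exp (- kap * t) * exp (- kap * t) * g t)%R).
  { intros t. unfold g. assert (U : (exp (- kap * t) * exp (kap * t) = 1)%R) by (rewrite <- exp_plus, <- exp_0; f_equal; ring).
    transitivity (exp (- kap * t) * (exp (- kap * t) * exp (kap * t)) * (d1 t - kap * d t))%R; [rewrite U; ring|ring]. }
  assert (kx : k x <= 0).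
  { destruct (Rle_dec (g x) 0) as [S|S].
    - apply Rle_trans with (k c).
      + apply (Rderiv_nonpos k (fun t => - kap * exp (- kap * t) * d t + exp (- kap * t) * d1 t)%R c x); [lra| |].
        * intros t Ht. apply Dk; lra.
        * intros t Ht. rewrite kg. specialize (gm t x ltac:(lra) ltac:(lra) ltac:(lra)). generalize (exp_pos (- kap * t)). intros. 
          assert (0 < exp (- kap * t) * exp (- kap * t)) by (apply Rmult_lt_0_compat; auto). nra.
      + unfold k. generalize (exp_pos (- kap * c)). nra.
    - apply Rle_trans with (k L).
      + assert (- k L <= - k x); [|lra].
        apply (Rderiv_nonpos (fun t => - k t)%R (fun t => - (- kap * exp (- kap * t) * d t + exp (- kap * t) * d1 t))%R x L); [lra| |].
        * intros t Ht. apply (is_derive_opp (V:=R_NormedModule)). apply Dk; lra.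
        * intros t Ht. rewrite kg. specialize (gm x t ltac:(lra) ltac:(lra) ltac:(lra)). generalize (exp_pos (- kap * t)). intros. 
          assert (0 < exp (- kap * t) * exp (- kap * t)) by (apply Rmult_lt_0_compat; auto). nra.
      + unfold k. generalize (exp_pos (- kap * L)). nra. }
  assert (dx : d x <= 0). { unfold k in kx. generalize (exp_pos (- kap * x)). intros. nra. }
  unfold d, e1, e2 in dx. lra.
Qed.

(** A solution of u'' = q u with Re q >= kap^2 that is bounded at both ends of a segment is
    exponentially small inside: |u| regularised as sqrt(|u|^2 + del^2) - del satisfies the
    differential inequality of the maximum principle. *)
Lemma decay_between (u w q : R -> C) (kap c L M x : R) : 0 < kap -> c <= x <= L ->
  (forall t, c <= t <= L -> dR u t (w t)) ->
  (forall t, c <= t <= L -> dR w t (q t * u t)) ->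
  (forall t, c <= t <= L -> kap * kap <= Re (q t)) ->
  Cmod (u c) <= M -> Cmod (u L) <= M ->
  Cmod (u x) <= M * (exp (- kap * (x - c)) + exp (- kap * (L - x))).
Proof.
  intros Hk Hx Hu Hw Hq Hc HL.
  assert (HM : 0 <= M) by (generalize (Cmod_ge_0 (u c)); lra).
  apply le_epsilon. intros del Hdel.
  set (S := fun t => (Cmod (u t) * Cmod (u t) + del * del)%R).
  assert (S0 : forall t, 0 < S t) by (intros t; unfold S; generalize (Rle_0_sqr (Cmod (u t))); unfold Rsqr; nra).
  set (g := fun t => sqrt (S t)). set (p := fun t => Re (Cconj (u t) * w t)).
  assert (g0 : forall t, 0 < g t) by (intros; apply sqrt_lt_R0; auto).
  assert (gg : forall t, (g t * g t = S t)%R) by (intros; apply sqrt_sqrt; left; auto).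
  assert (gd : forall t, del <= g t).
  { intros t. apply Rsqr_incr_0_var; [|left; auto]. unfold Rsqr. rewrite gg. unfold S. generalize (Rle_0_sqr (Cmod (u t))); unfold Rsqr; lra. }
  assert (gu : forall t, Cmod (u t) <= g t).
  { intros t. apply Rsqr_incr_0_var; [|left; auto]. unfold Rsqr. rewrite gg. unfold S. nra. }
  assert (gu2 : forall t, g t - del <= Cmod (u t)).
  { intros t. assert (g t <= Cmod (u t) + del); [|lra]. apply Rsqr_incr_0_var; [|generalize (Cmod_ge_0 (u t)); lra].
    unfold Rsqr. rewrite gg. unfold S. generalize (Cmod_ge_0 (u t)). nra. }
  assert (Dg : forall t, c <= t <= L -> is_derive g t (p t / g t)%R).
  { intros t Ht. unfold g.
    assert (DS : is_derive S t (2 * p t)%R).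
    { unfold S. replace (2 * p t)%R with (2 * p t + 0)%R by ring. 
      exact (is_derive_plus _ _ _ _ _ (Dsq u t _ (Hu t Ht)) (is_derive_const _ _)). }
    replace (p t / sqrt (S t))%R with (2 * p t * / (2 * sqrt (S t)))%R by (field; apply Rgt_not_eq, g0).
    apply (is_derive_comp sqrt S t (/ (2 * sqrt (S t)))%R (2 * p t)%R); [|exact DS].
    apply is_derive_Reals. apply derivable_pt_lim_sqrt. auto. }
  assert (Dp : forall t, c <= t <= L -> is_derive p t (Cmod (w t) * Cmod (w t) + Re (q t) * (Cmod (u t) * Cmod (u t)))%R).
  { intros t Ht. unfold p.
    assert (A := dR_Re _ _ _ (Hu t Ht)). assert (B := dR_Im _ _ _ (Hu t Ht)).
    assert (A' := dR_Re _ _ _ (Hw t Ht)). assert (B' := dR_Im _ _ _ (Hw t Ht)).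
    apply (is_derive_ext (fun t => Re (u t) * Re (w t) + Im (u t) * Im (w t))%R).
    { intros y. unfold Re, Im; simpl; ring. }
    replace (Cmod (w t) * Cmod (w t) + Re (q t) * (Cmod (u t) * Cmod (u t)))%R with
      ((Re (w t) * Re (w t) + Re (u t) * Re (q t * u t)) + (Im (w t) * Im (w t) + Im (u t) * Im (q t * u t)))%R.
    2:{ rewrite !Cmod_sqr. unfold Re, Im; simpl; ring. }
    exact (is_derive_plus _ _ _ _ _ (Rd_mult _ _ _ _ _ A A') (Rd_mult _ _ _ _ _ B B')). }
  assert (Q := max_principle (fun t => g t - del)%R (fun t => p t / g t)%R
    (fun t => ((Cmod (w t) * Cmod (w t) + Re (q t) * (Cmod (u t) * Cmod (u t))) * g t - p t * (p t / g t)) / (g t * g t))%R kap c L M x Hk Hx HM).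
  cbv beta in Q.
  assert (F : g x - del <= M * (exp (- kap * (x - c)) + exp (- kap * (L - x)))).
  { apply Q.
    - intros t Ht. replace (p t / g t)%R with (p t / g t - 0)%R by ring.
      exact (is_derive_minus _ _ _ _ _ (Dg t Ht) (is_derive_const _ _)).
    - intros t Ht. assert (n := g0 t). 
      replace (((Cmod (w t) * Cmod (w t) + Re (q t) * (Cmod (u t) * Cmod (u t))) * g t - p t * (p t / g t)) / (g t * g t))%R with
       ((Cmod (w t) * Cmod (w t) + Re (q t) * (Cmod (u t) * Cmod (u t))) * / g t + p t * (- (p t / g t) / (g t ^ 2)))%R by (field; lra).
      apply (Rd_mult p (fun t => / g t)%R); [apply Dp; auto|].
      apply (is_derive_inv g t _ (Dg t Ht)). lra.
    - intros t Ht. assert (n := g0 t).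
      assert (P2 : p t * p t <= (g t * g t) * (Cmod (w t) * Cmod (w t))).
      { assert (PA : Rabs (p t) <= g t * Cmod (w t)).
        { unfold p. eapply Rle_trans; [apply re_le_Cmod|]. rewrite Cmod_mult, Cmod_conj. apply Rmult_le_compat_r; [apply Cmod_ge_0|auto]. }
        assert (p t * p t = Rabs (p t) * Rabs (p t))%R by (rewrite <- Rabs_mult, Rabs_pos_eq; nra).
        rewrite H. replace (g t * g t * (Cmod (w t) * Cmod (w t)))%R with ((g t * Cmod (w t)) * (g t * Cmod (w t)))%R by ring.
        apply Rmult_le_compat; auto using Rabs_pos. }
      apply Rmult_le_reg_r with (g t * (g t * g t))%R. { repeat apply Rmult_lt_0_compat; auto. }
      replace (((Cmod (w t) * Cmod (w t) + Re (q t) * (Cmod (u t) * Cmod (u t))) * g t - p t * (p t / g t)) / (g t * g t) * (g t * (g t * g t)))%R with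
        ((g t * g t) * (Cmod (w t) * Cmod (w t)) - p t * p t + (g t * g t) * (Re (q t) * (Cmod (u t) * Cmod (u t))))%R by (field; lra).
      specialize (Hq t Ht).
      assert (B1 : kap * kap * (Cmod (u t) * Cmod (u t)) <= Re (q t) * (Cmod (u t) * Cmod (u t))).
      { apply Rmult_le_compat_r; [apply Rle_0_sqr|auto]. }
      assert (B2 : (g t - del) * g t <= Cmod (u t) * Cmod (u t)).
      { assert (Cmod (u t) * Cmod (u t) = g t * g t - del * del)%R by (rewrite gg; unfold S; ring). specialize (gd t). nra. }
      assert (B3 : kap * kap * ((g t - del) * g t) <= Re (q t) * (Cmod (u t) * Cmod (u t))).
      { eapply Rle_trans; [|exact B1]. apply Rmult_le_compat_l; [nra|auto]. }
      replace (kap * kap * (g t - del) * (g t * (g t * g t)))%R with ((g t * g t) * (kap * kap * ((g t - del) * g t)))%R by ring.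
      assert (B4 : (g t * g t) * (kap * kap * ((g t - del) * g t)) <= (g t * g t) * (Re (q t) * (Cmod (u t) * Cmod (u t)))).
      { apply Rmult_le_compat_l; [apply Rle_0_sqr|auto]. }
      lra.
    - generalize (gu2 c). lra.
    - generalize (gu2 L). lra. }
  generalize (gu x). lra.
Qed.

(** ** Bounds for the xi-factor *)

Ltac pos := first [lra | apply Cmod_ge_0 | left; apply exp_pos | apply Rmult_le_pos; pos].
Definition vline (sg t : R) : C := RtoC sg + Ci * RtoC t.
(** On a vertical line of s, the spectral parameter 4 i s has the size of 4 om^2. *)
Definition om (t : R) : R := sqrt (1 + Rabs t).
Lemma vline_strip sg t : Rabs sg < 3/4 -> strip (vline sg t).
Proof. intros H. unfold strip, vline. replace (Re (RtoC sg + Ci * RtoC t)) with sg by reim. exact H. Qed.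

Lemma om_sqr t : (om t * om t = 1 + Rabs t)%R.
Proof. unfold om. apply sqrt_sqrt. generalize (Rabs_pos t); lra. Qed.

Lemma om_ge1 t : 1 <= om t.
Proof.
  unfold om. assert (H : sqrt 1 <= sqrt (1 + Rabs t)) by (apply sqrt_le_1_alt; generalize (Rabs_pos t); lra).
  rewrite sqrt_1 in H. exact H.
Qed.

Lemma om_opp t : om (- t) = om t. Proof. unfold om. rewrite Rabs_Ropp. reflexivity. Qed.
(** The potential in AA'' = qq AA. *)
Definition qq (s xi : C) : C := 4 * Ci * s - xi * xi.
Lemma AA_dR_along s p dp t : strip s -> dR p t dp ->
  dR (fun t => AA s (p t)) t (dp * AA1 s (p t)) /\ dR (fun t => AA1 s (p t)) t (dp * (qq s (p t) * AA s (p t))).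
Proof.
  intros Hs Hp. split.
  - apply (dR_comp (AA s) p); [apply AA_dC; auto|auto].
  - apply (dR_comp (AA1 s) p); [apply AA1_dC; auto|auto].
Qed.

Lemma qq_bound sg t xi R0 Y0 : Rabs sg < 3/4 -> Rabs (Re xi) <= R0 -> Rabs (Im xi) <= Y0 ->
  Cmod (4 * Ci * RtoC sg - xi * xi) <= 3 + (R0 + Y0) * (R0 + Y0) /\
  Cmod (qq (vline sg t) xi) <= 4 * Rabs t + (3 + (R0 + Y0) * (R0 + Y0)).
Proof.
  intros Hs HR HY.
  assert (A : Cmod (4 * Ci * RtoC sg - xi * xi) <= 3 + (R0 + Y0) * (R0 + Y0)).
  { unfold Cminus. triangle. rewrite Cmod_opp, !Cmod_mult, Cmod_Ci, !Cmod_R, (Rabs_pos_eq 4) by lra.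
    assert (Cmod xi <= R0 + Y0) by (eapply Rle_trans; [apply Cmod_le_sum|lra]).
    assert (Cmod xi * Cmod xi <= (R0 + Y0) * (R0 + Y0)) by (apply Rmult_le_compat; auto using Cmod_ge_0). lra. }
  split; auto.
  replace (qq (vline sg t) xi) with (RtoC (- 4 * t) + (4 * Ci * RtoC sg - xi * xi)).
  2:{ unfold qq, vline. ceq; ring. }
  triangle. rewrite Cmod_R, Rabs_mult, Rabs_left1 by lra. lra.
Qed.

(** On the vertical line only the modulus of the density counts in the Laplace representation,
    and t does not enter it. *)
Lemma AA_easy_bound sg c L y : Rabs sg < 3/4 -> 0 < c <= L -> 0 < y -> exists M, 0 <= M /\
  forall t r, c <= r <= L -> Cmod (AA (vline sg t) (RtoC r + Ci * RtoC y)) <= M.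
Proof.
  intros Hs Hc Hy. assert (Hs' := Hs). apply Rabs_def2 in Hs'.
  destruct (Lap_dom_unif (1/4 - sg + 1/2) (1/4 - sg + 1/2 + 1) 1 (2 * c * y)) as [M [HM H]]; try lra. { apply Rmult_lt_0_compat; lra. }
  exists (exp ((sg - 3/4) * ln 2) * (2 * (L + y)) * 1 * (M * PI))%R. assert (HPI := PI_RGT_0).
  assert (P0 := exp_pos ((sg - 3/4) * ln 2)).
  split. { pos. }
  intros t r Hr. set (xi := RtoC r + Ci * RtoC y).
  assert (xr : Re xi = r) by (unfold xi, Re; simpl; ring). assert (xy : Im xi = y) by (unfold xi, Im; simpl; ring).
  rewrite AA_laplace; [|apply vline_strip; auto|rewrite xr; lra|rewrite xy; lra].
  rewrite !Cmod_mult, !Cmod_Cexp.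
  assert (E1 : Re ((vline sg t - 3 / 4) * RtoC (ln 2)) = ((sg - 3/4) * ln 2)%R) by (rewrite C34; unfold vline, Re; simpl; ring).
  assert (E2 : (Re (Ci * (xi * xi) / 2) = - (r * y))%R).
  { replace (Ci * (xi * xi) / 2) with (RtoC (1/2) * (Ci * (xi * xi))) by (rewrite <- Chalf; field). unfold xi, Re; simpl; field. }
  assert (E3 : Re (- Ci * (xi * xi)) = (2 * r * y)%R) by (unfold xi, Re; simpl; ring).
  rewrite E1, E2.
  assert (W : lapw (fa (1 / 4 - vline sg t)) (1/4 - sg + 1/2) (1/4 - sg + 1/2 + 1) 1).
  { assert (C14 : Re (1 / 4 - vline sg t) = (1/4 - sg)%R). { replace (1 / 4) with (RtoC (1/4)) by (rewrite RtoC_div by lra; reflexivity). unfold vline, Re; simpl; ring. }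
    assert (F := fa_lapw (1 / 4 - vline sg t)). rewrite C14 in F. apply F. lra. }
  apply Rmult_le_compat; try apply Cmod_ge_0.
  - pos.
  - apply Rmult_le_compat.
    + pos.
    + left; apply exp_pos.
    + apply Rmult_le_compat_l; [left; apply exp_pos|]. apply Rmult_le_compat; try apply Cmod_ge_0.
      * unfold Cminus. triangle. rewrite Cmod_opp, Cmod_1, Cmod_Ci. lra.
      * eapply Rle_trans; [apply Cmod_le_sum|]. rewrite xr, xy, !Rabs_pos_eq by lra. lra.
    + rewrite <- exp_0. apply exp_le. assert (0 <= r * y) by (apply Rmult_le_pos; lra). lra.
  - unfold Lap. apply II_bound. apply H; auto. rewrite E3. apply Rmult_le_compat_r; lra.
Qed.

(** Taylor's formula of order two on the segment [xi, xi + 1], where A'' = q A. *)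
Lemma AA1_from_AA sg t xi M Q : Rabs sg < 3/4 -> 
  (forall h, 0 <= h <= 1 -> Cmod (AA (vline sg t) (xi + RtoC h)) <= M) ->
  (forall h, 0 <= h <= 1 -> Cmod (qq (vline sg t) (xi + RtoC h)) <= Q) ->
  Cmod (AA1 (vline sg t) xi) <= (2 + Q) * M.
Proof.
  intros Hs HM HQ. assert (S := vline_strip sg t Hs).
  assert (Dp : forall h, dR (fun h => xi + RtoC h) h 1).
  { intros h. eapply dR_eq; [apply dR_plus; [apply dR_const|apply dR_id]|ring]. }
  assert (T := taylor2 (fun h => AA (vline sg t) (xi + RtoC h)) (fun h => 1 * AA1 (vline sg t) (xi + RtoC h))
    (fun h => 1 * (qq (vline sg t) (xi + RtoC h) * AA (vline sg t) (xi + RtoC h))) (Q * M)).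
  cbv beta in T. rewrite Cplus_0_r in T. 
  assert (B : Cmod (AA (vline sg t) (xi + 1) - AA (vline sg t) xi - 1 * AA1 (vline sg t) xi) <= Q * M).
  { apply T.
    - intros h _. exact (proj1 (AA_dR_along _ _ _ _ S (Dp h))).
    - intros h _. eapply dR_eq; [apply dR_mult; [apply dR_const|exact (proj2 (AA_dR_along _ _ _ _ S (Dp h)))]|dring].
    - intros h Hh. rewrite Cmult_1_l, Cmod_mult. apply Rmult_le_compat; auto using Cmod_ge_0. }
  assert (M0 := HM 0%R ltac:(lra)). rewrite Cplus_0_r in M0. assert (M1 := HM 1%R ltac:(lra)).
  replace (AA1 (vline sg t) xi) with (- (AA (vline sg t) (xi + 1) - AA (vline sg t) xi - 1 * AA1 (vline sg t) xi) + (AA (vline sg t) (xi + 1) + - AA (vline sg t) xi)) by ring.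
  triangle. rewrite Cmod_opp.
  assert (T2 := Cmod_triangle (AA (vline sg t) (xi + 1)) (- AA (vline sg t) xi)). rewrite Cmod_opp in T2. lra.
Qed.

Lemma energy_extract u w k X : 0 <= u -> 0 <= w -> 1 <= k -> 0 <= X ->
  w * w + k * (u * u) <= X * X -> (u <= X /\ w <= X)%R.
Proof.
  intros Hu Hw Hk HX H. assert (0 <= u * u) by nra. assert (0 <= w * w) by nra.
  split; apply Rsqr_incr_0_var; auto; unfold Rsqr; nra.
Qed.

(** Transport of bounds from the line Im = y to a parallel one, by the energy estimate. *)
Lemma AA_transport sg t r y x M N kap : Rabs sg < 3/4 -> 0 <= M -> 0 <= N -> 
  Cmod (AA (vline sg t) (RtoC r + Ci * RtoC y)) <= M ->
  Cmod (AA1 (vline sg t) (RtoC r + Ci * RtoC y)) <= N ->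
  (forall h, Rabs h <= Rmax (Rabs x) (Rabs y) -> Cmod (qq (vline sg t) (RtoC r + Ci * RtoC h) - RtoC (4 * (om t * om t))) <= kap * (2 * om t)) ->
  Cmod (AA (vline sg t) (RtoC r + Ci * RtoC x)) <= (N + 2 * om t * M) * exp (kap / 2 * Rabs (x - y)) /\
  Cmod (AA1 (vline sg t) (RtoC r + Ci * RtoC x)) <= (N + 2 * om t * M) * exp (kap / 2 * Rabs (x - y)).
Proof.
  intros Hs HM HN BA BA1 Hq. assert (S := vline_strip sg t Hs). assert (o1 := om_ge1 t).
  set (s0 := if Rle_dec y x then 1%R else (-1)%R). set (d := Rabs (x - y)).
  assert (s02 : (s0 * s0 = 1)%R) by (unfold s0; destruct (Rle_dec y x); ring).
  assert (sd : (s0 * d = x - y)%R). { unfold s0, d. destruct (Rle_dec y x); [rewrite Rabs_pos_eq by lra|rewrite Rabs_left by lra]; ring. }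
  set (p := fun h : R => RtoC r + Ci * RtoC (y + s0 * h)).
  assert (Dp : forall h, dR p h (Ci * RtoC s0)).
  { intros h. unfold p. eapply dR_eq; [apply dR_plus; [apply dR_const|apply dR_mult; [apply dR_const|apply dR_RtoC]]|].
    - auto_derive; [trivial|reflexivity]. - ceq; ring. }
  assert (En := energy (fun h => AA (vline sg t) (p h)) (fun h => AA1 (vline sg t) (p h)) (fun h => qq (vline sg t) (p h)) s0 (4 * (om t * om t)) kap d s02 (Rabs_pos _)).
  assert (k0 : 0 < 4 * (om t * om t)) by nra.
  assert (sk : sqrt (4 * (om t * om t)) = (2 * om t)%R).
  { replace (4 * (om t * om t))%R with (Rsqr (2 * om t)) by (unfold Rsqr; ring). apply sqrt_Rsqr. lra. }
  specialize (En k0). rewrite sk in En.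
  assert (pd : p d = RtoC r + Ci * RtoC x). { unfold p. rewrite sd. do 2 f_equal. f_equal. ring. }
  assert (p0 : p 0%R = RtoC r + Ci * RtoC y). { unfold p. do 2 f_equal. f_equal. ring. }
  rewrite pd, p0 in En.
  set (X := ((N + 2 * om t * M) * exp (kap / 2 * d))%R).
  assert (X0 : 0 <= X). { unfold X. apply Rmult_le_pos; [nra|left; apply exp_pos]. }
  apply (energy_extract _ _ (4 * (om t * om t)) X); try apply Cmod_ge_0; auto; [nra|].
  eapply Rle_trans.
  - apply En.
    + intros h _. exact (proj1 (AA_dR_along _ _ _ _ S (Dp h))).
    + intros h _. exact (proj2 (AA_dR_along _ _ _ _ S (Dp h))).
    + intros h Hh. apply Hq.
      assert (B1 := Rmax_l (Rabs x) (Rabs y)). assert (B2 := Rmax_r (Rabs x) (Rabs y)).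
      assert (Q1 := Rle_abs x). assert (Q2 := Rle_abs y). assert (Q3 := Rle_abs (- x)). assert (Q4 := Rle_abs (- y)). rewrite Rabs_Ropp in Q3, Q4.
      apply Rabs_le. unfold s0, d in *. destruct (Rle_dec y x); [rewrite Rabs_pos_eq in Hh by lra|rewrite Rabs_left in Hh by lra]; lra.
  - unfold X. replace ((N + 2 * om t * M) * exp (kap / 2 * d) * ((N + 2 * om t * M) * exp (kap / 2 * d)))%R with
      (((N + 2 * om t * M) * (N + 2 * om t * M)) * exp (kap * d))%R.
    2:{ replace (kap * d)%R with (kap / 2 * d + kap / 2 * d)%R by field. rewrite exp_plus. ring. }
    apply Rmult_le_compat_r; [left; apply exp_pos|].
    set (a := Cmod (AA1 (vline sg t) (RtoC r + Ci * RtoC y))) in *. set (b := Cmod (AA (vline sg t) (RtoC r + Ci * RtoC y))) in *.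
    assert (a0 : 0 <= a) by apply Cmod_ge_0. assert (b0 : 0 <= b) by apply Cmod_ge_0.
    assert (a * a <= N * N) by nra. assert (b * b <= M * M) by nra.
    assert (0 <= om t * (N * M)) by (apply Rmult_le_pos; [lra|nra]).
    assert (om t * om t * (b * b) <= om t * om t * (M * M)) by (apply Rmult_le_compat_l; nra). nra.
Qed.

Lemma vline_qq_minus sg t r h c : Rabs sg < 3/4 -> qq (vline sg t) (RtoC r + Ci * RtoC h) - RtoC c =
  RtoC (- 4 * t - c) + (4 * Ci * RtoC sg - (RtoC r + Ci * RtoC h) * (RtoC r + Ci * RtoC h)).
Proof. intros _. unfold qq, vline. ceq; ring. Qed.

(** From the line Im xi = e, where the function is bounded, the energy grows at the rate 2 om,
    up to a constant. *)
Lemma AA_growth sg c R0 Y0 e : Rabs sg < 3/4 -> 0 < c <= R0 -> 0 < e -> 0 <= Y0 ->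
  exists K, 0 <= K /\ forall t r x, c <= r <= R0 -> Rabs x <= Y0 ->
  Cmod (AA (vline sg t) (RtoC r + Ci * RtoC x)) <= K * (om t * om t) * exp (2 * om t * (Rabs x + e)) /\
  Cmod (AA1 (vline sg t) (RtoC r + Ci * RtoC x)) <= K * (om t * om t) * exp (2 * om t * (Rabs x + e)).
Proof.
  intros Hs Hc He HY. 
  destruct (AA_easy_bound sg c (R0 + 1) e Hs ltac:(lra) He) as [M [HM H]].
  set (B := (3 + (R0 + 1 + (Y0 + e)) * (R0 + 1 + (Y0 + e)))%R).
  assert (B0 : 3 <= B) by (unfold B; nra).
  exists ((8 + B) * M * exp (B * (Y0 + e)))%R. split. { apply Rmult_le_pos; [apply Rmult_le_pos; lra|left; apply exp_pos]. }
  intros t r x Hr Hx. assert (o1 := om_ge1 t). assert (o2 := om_sqr t).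
  assert (Qb : forall xi, 0 <= Re xi <= R0 + 1 -> Rabs (Im xi) <= Y0 + e -> Cmod (qq (vline sg t) xi) <= 4 * Rabs t + B).
  { intros xi H1 H2. apply (qq_bound sg t xi (R0 + 1) (Y0 + e)); auto. rewrite Rabs_pos_eq; lra. }
  assert (N1 : Cmod (AA1 (vline sg t) (RtoC r + Ci * RtoC e)) <= (2 + (4 * Rabs t + B)) * M).
  { apply AA1_from_AA; auto.
    - intros h Hh. replace (RtoC r + Ci * RtoC e + RtoC h) with (RtoC (r + h) + Ci * RtoC e) by (ceq; ring). apply H; lra.
    - intros h Hh. apply Qb. 
      + replace (Re (RtoC r + Ci * RtoC e + RtoC h)) with (r + h)%R by reim. lra.
      + replace (Im (RtoC r + Ci * RtoC e + RtoC h)) with e by reim. rewrite Rabs_pos_eq; lra. }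
  destruct (AA_transport sg t r e x M ((2 + (4 * Rabs t + B)) * M) (4 * om t + B) Hs HM) as [A1 A2]; auto.
  - apply Rmult_le_pos; auto. generalize (Rabs_pos t); lra.
  - apply H; lra.
  - intros h Hh. unfold Cminus. triangle. rewrite Cmod_opp, Cmod_R, Rabs_pos_eq by nra.
    assert (Q : Cmod (qq (vline sg t) (RtoC r + Ci * RtoC h)) <= 4 * Rabs t + B).
    { apply Qb. 
      + replace (Re (RtoC r + Ci * RtoC h)) with r by reim. lra.
      + replace (Im (RtoC r + Ci * RtoC h)) with h by reim. eapply Rle_trans; [exact Hh|].
        apply Rmax_lub; [lra|rewrite Rabs_pos_eq; lra]. }
    nra.
  - assert (d1 : Rabs (x - e) <= Rabs x + e). { unfold Rminus. eapply Rle_trans; [apply Rabs_triang|]. rewrite Rabs_Ropp, (Rabs_pos_eq e); lra. }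
    assert (F : ((2 + (4 * Rabs t + B)) * M + 2 * om t * M) * exp ((4 * om t + B) / 2 * Rabs (x - e)) <= (8 + B) * M * exp (B * (Y0 + e)) * (om t * om t) * exp (2 * om t * (Rabs x + e))).
    { apply Rle_trans with ((8 + B) * M * (om t * om t) * (exp (B * (Y0 + e)) * exp (2 * om t * (Rabs x + e))))%R; [|right; ring].
      apply Rmult_le_compat.
      - generalize (Rabs_pos t). intros. apply Rplus_le_le_0_compat; apply Rmult_le_pos; lra.
      - left; apply exp_pos.
      - assert (Rabs t = om t * om t - 1)%R by lra. rewrite H0.
        replace ((2 + (4 * (om t * om t - 1) + B)) * M + 2 * om t * M)%R with ((2 + (4 * (om t * om t - 1) + B) + 2 * om t) * M)%R by ring.
        replace ((8 + B) * M * (om t * om t))%R with ((8 + B) * (om t * om t) * M)%R by ring. apply Rmult_le_compat_r; auto. assert (G1 : 1 <= om t * om t) by nra. assert (G2 : om t <= om t * om t) by nra. assert (G3 : B * 1 <= B * (om t * om t)) by (apply Rmult_le_compat_l; lra). lra.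
      - rewrite <- exp_plus. apply exp_le.
        assert (0 <= Rabs (x - e)) by apply Rabs_pos.
        assert (B / 2 * Rabs (x - e) <= B * (Y0 + e)) by nra.
        assert (2 * om t * Rabs (x - e) <= 2 * om t * (Rabs x + e)) by (apply Rmult_le_compat_l; lra). lra. }
    split; eapply Rle_trans; eauto.
Qed.

(** For t <= 0 the potential is large and positive along the line Im xi = e, so that a solution
    bounded at both ends of a long segment is exponentially small inside. As qq stays within a
    constant of 4 om^2, changing Im xi costs only a constant. *)
Lemma AA_decay sg c R0 Y0 e : Rabs sg < 3/4 -> 0 < c <= R0 -> 0 < e -> 0 <= Y0 ->
  exists K, 0 <= K /\ forall t r x, t <= 0 -> c <= r <= R0 -> Rabs x <= Y0 ->
  Cmod (AA (vline sg t) (RtoC r + Ci * RtoC x)) <= K * (om t * om t) * exp (- 2 * om t * (r - e)) /\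
  Cmod (AA1 (vline sg t) (RtoC r + Ci * RtoC x)) <= K * (om t * om t) * exp (- 2 * om t * (r - e)).
Proof.
  intros Hs Hc He HY.
  set (c1 := Rmin c e). assert (c1p : 0 < c1) by (apply Rmin_pos; lra).
  assert (c1c : c1 <= c) by apply Rmin_l. assert (c1e : c1 <= e) by apply Rmin_r.
  (* the right end L is further from every r <= R0 + 1 than the left end c1 is *)
  set (L := (2 * (R0 + 1))%R). 
  destruct (AA_easy_bound sg c1 L e Hs ltac:(unfold L; lra) He) as [M [HM H]].
  set (Bk := (L * L + 4)%R). assert (Bk4 : 4 <= Bk) by (unfold Bk; nra).
  set (M2 := (2 * M * exp (Bk * (R0 + 1)) + M * exp (2 * (Bk + 1) * (R0 + 1)))%R).
  assert (P1 := exp_pos (Bk * (R0 + 1))). assert (P2 := exp_pos (2 * (Bk + 1) * (R0 + 1))).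
  assert (M20 : 0 <= M2) by (unfold M2; apply Rplus_le_le_0_compat; pos).
  set (B := (3 + (R0 + 1 + (Y0 + e)) * (R0 + 1 + (Y0 + e)))%R).
  assert (B0 : 3 <= B) by (unfold B; nra).
  assert (Line : forall t r, t <= 0 -> c <= r <= R0 + 1 ->
     (Cmod (AA (vline sg t) (RtoC r + Ci * RtoC e)) <= M2 * exp (- 2 * om t * (r - e)))).
  { intros t r Ht Hr. assert (o1 := om_ge1 t). assert (o2 := om_sqr t). rewrite Rabs_left1 in o2 by lra.
    destruct (Rle_dec (Bk + 1) (om t)) as [Lo|Lo].
    - set (kap := (2 * om t - Bk)%R).
      assert (S := vline_strip sg t Hs).
      assert (Dp : forall h, dR (fun h => RtoC h + Ci * RtoC e) h 1).
      { intros h. eapply dR_eq; [apply dR_plus; [apply dR_id|apply dR_const]|dring]. }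
      assert (D := decay_between (fun h => AA (vline sg t) (RtoC h + Ci * RtoC e)) (fun h => AA1 (vline sg t) (RtoC h + Ci * RtoC e))
        (fun h => qq (vline sg t) (RtoC h + Ci * RtoC e)) kap c1 L M r ltac:(unfold kap; lra) ltac:(unfold L; lra)).
      eapply Rle_trans; [apply D|].
      + intros h _. eapply dR_eq; [exact (proj1 (AA_dR_along _ _ _ _ S (Dp h)))|dring].
      + intros h _. eapply dR_eq; [exact (proj2 (AA_dR_along _ _ _ _ S (Dp h)))|dring].
      + intros h Hh. replace (Re (qq (vline sg t) (RtoC h + Ci * RtoC e))) with (- 4 * t - h * h + e * e)%R by (unfold qq, vline, Re; simpl; ring).
        assert (h * h <= L * L) by (apply Rmult_le_compat; lra).
        unfold kap. assert (Bk * Bk + Bk <= 4 * om t * Bk) by nra. unfold Bk in *. nra.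
      + apply H; unfold L; lra.
      + apply H; unfold L; lra.
      + apply Rle_trans with (M * (2 * (exp (Bk * (R0 + 1)) * exp (- 2 * om t * (r - e)))))%R.
        * apply Rmult_le_compat_l; auto. rewrite <- exp_plus.
          assert (A1 : exp (- kap * (r - c1)) <= exp (Bk * (R0 + 1) + - 2 * om t * (r - e))).
          { apply exp_le. unfold kap. nra. }
          assert (A2 : exp (- kap * (L - r)) <= exp (- kap * (r - c1))).
          { apply exp_le. unfold L. assert (0 < kap) by (unfold kap; lra). nra. }
          lra.
        * unfold M2. assert (E1 := exp_pos (- 2 * om t * (r - e))). 
          assert (0 <= M * exp (2 * (Bk + 1) * (R0 + 1)) * exp (- 2 * om t * (r - e))) by (pos). lra.
    - apply Rle_trans with M; [apply H; unfold L; lra|].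
      assert (E1 : 1 <= exp (2 * (Bk + 1) * (R0 + 1)) * exp (- 2 * om t * (r - e))).
      { rewrite <- exp_plus. apply Rle_trans with (exp 0); [rewrite exp_0; lra|]. apply exp_le.
        assert (om t * (r - e) <= om t * (R0 + 1)) by (apply Rmult_le_compat_l; lra).
        assert (om t * (R0 + 1) <= (Bk + 1) * (R0 + 1)) by (apply Rmult_le_compat_r; lra). lra. }
      unfold M2. assert (E2 := exp_pos (- 2 * om t * (r - e))).
      assert (0 <= 2 * M * exp (Bk * (R0 + 1)) * exp (- 2 * om t * (r - e))) by (pos).
      assert (M * 1 <= M * (exp (2 * (Bk + 1) * (R0 + 1)) * exp (- 2 * om t * (r - e)))) by (apply Rmult_le_compat_l; auto). lra. }
  exists ((8 + B) * M2 * exp ((4 + B) * (Y0 + e)))%R. split. { apply Rmult_le_pos; [apply Rmult_le_pos; lra|left; apply exp_pos]. }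
  intros t r x Ht Hr Hx. assert (o1 := om_ge1 t). assert (o2 := om_sqr t).
  set (X := exp (- 2 * om t * (r - e))). assert (X0 : 0 < X) by apply exp_pos.
  assert (N1 : Cmod (AA1 (vline sg t) (RtoC r + Ci * RtoC e)) <= (2 + (4 * Rabs t + B)) * (M2 * X)).
  { apply AA1_from_AA; auto.
    - intros h Hh. replace (RtoC r + Ci * RtoC e + RtoC h) with (RtoC (r + h) + Ci * RtoC e) by (ceq; ring).
      eapply Rle_trans; [apply Line; lra|]. apply Rmult_le_compat_l; auto. apply exp_le. nra.
    - intros h Hh. apply (qq_bound sg t _ (R0 + 1) (Y0 + e)); auto.
      + replace (Re (RtoC r + Ci * RtoC e + RtoC h)) with (r + h)%R by reim. rewrite Rabs_pos_eq; lra.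
      + replace (Im (RtoC r + Ci * RtoC e + RtoC h)) with e by reim. rewrite Rabs_pos_eq; lra. }
  assert (MX : 0 <= M2 * X) by (apply Rmult_le_pos; lra).
  destruct (AA_transport sg t r e x (M2 * X) ((2 + (4 * Rabs t + B)) * (M2 * X)) (4 + B) Hs MX) as [A1 A2]; auto.
  - apply Rmult_le_pos; auto. generalize (Rabs_pos t); lra.
  - apply Line; lra.
  - intros h Hh. rewrite vline_qq_minus by auto. triangle.
    rewrite o2, (Rabs_left1 t) by lra. replace (-4 * t - 4 * (1 + - t))%R with (-4)%R by ring. rewrite Cmod_R, Rabs_left by lra.
    assert (Q : Cmod (4 * Ci * RtoC sg - (RtoC r + Ci * RtoC h) * (RtoC r + Ci * RtoC h)) <= B).
    { apply (proj1 (qq_bound sg t (RtoC r + Ci * RtoC h) (R0 + 1) (Y0 + e) Hs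
        ltac:(replace (Re (RtoC r + Ci * RtoC h)) with r by reim; rewrite Rabs_pos_eq; lra)
        ltac:(replace (Im (RtoC r + Ci * RtoC h)) with h by reim; eapply Rle_trans; [exact Hh|]; apply Rmax_lub; [lra|rewrite Rabs_pos_eq; lra]))). }
    nra.
  - assert (d1 : Rabs (x - e) <= Y0 + e). { unfold Rminus. eapply Rle_trans; [apply Rabs_triang|]. rewrite Rabs_Ropp, (Rabs_pos_eq e); lra. }
    assert (F : ((2 + (4 * Rabs t + B)) * (M2 * X) + 2 * om t * (M2 * X)) * exp ((4 + B) / 2 * Rabs (x - e)) <= (8 + B) * M2 * exp ((4 + B) * (Y0 + e)) * (om t * om t) * X).
    { apply Rle_trans with (((8 + B) * (om t * om t) * (M2 * X)) * exp ((4 + B) * (Y0 + e)))%R; [|right; ring].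
      apply Rmult_le_compat.
      - generalize (Rabs_pos t). intros. apply Rplus_le_le_0_compat; apply Rmult_le_pos; lra.
      - left; apply exp_pos.
      - assert (Rabs t = om t * om t - 1)%R by lra. rewrite H0.
        replace ((2 + (4 * (om t * om t - 1) + B)) * (M2 * X) + 2 * om t * (M2 * X))%R with ((2 + (4 * (om t * om t - 1) + B) + 2 * om t) * (M2 * X))%R by ring.
        apply Rmult_le_compat_r; auto. assert (G1 : 1 <= om t * om t) by nra. assert (G2 : om t <= om t * om t) by nra. assert (G3 : B * 1 <= B * (om t * om t)) by (apply Rmult_le_compat_l; lra). lra.
      - apply exp_le. assert (0 <= Rabs (x - e)) by apply Rabs_pos. nra. }
    split; eapply Rle_trans; eauto.
Qed.

(** * A Parseval formula *)

(** - log (t / (1+t)) at t = e^v, the variable in which the integrals are Fourier transforms. *)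
Definition phase (v : R) : R := ell (- v).

Definition rate (v : R) : R := / (1 + exp v).
Lemma phase_ell v : phase v = (ell v - v)%R.
Proof.
  unfold phase, ell. replace (1 + exp (- v))%R with ((1 + exp v) * exp (- v))%R.
  - rewrite ln_mult, ln_exp; [ring|apply exp1_pos|apply exp_pos].
  - rewrite Rmult_plus_distr_r, <- exp_plus. replace (v + - v)%R with 0%R by ring. rewrite exp_0. ring.
Qed.

Lemma rate_pos v : 0 < rate v. Proof. apply Rinv_0_lt_compat, exp1_pos. Qed.
Lemma phase_derive v : is_derive phase v (- rate v)%R.
Proof.
  apply (is_derive_ext (fun v => ell v - v)%R). { intros; symmetry; apply phase_ell. }
  replace (- rate v)%R with (exp v / (1 + exp v) - 1)%R by (unfold rate; field; generalize (exp1_pos v); lra).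
  exact (is_derive_minus _ _ _ _ _ (ell_derive v) (is_derive_id v)).
Qed.

Lemma phase_cont v : continuous phase v.
Proof. apply (ex_derive_continuous (V := R_NormedModule)). eexists; apply phase_derive. Qed.

Lemma rate_cont v : continuous rate v.
Proof. unfold rate. cc. generalize (exp1_pos v); lra. Qed.

Lemma phase_ge_rate v : rate v <= phase v.
Proof.
  assert (H := exp_ineq1_le (- phase v)). unfold phase at 2 in H. rewrite exp_Ropp, exp_ell in H.
  assert (E : (/ (1 + exp (- v)) = 1 - rate v)%R).
  { unfold rate. rewrite exp_Ropp. field. generalize (exp_pos v); lra. } lra.
Qed.

Lemma phase_pos v : 0 < phase v. Proof. generalize (phase_ge_rate v) (rate_pos v); lra. Qed.
Lemma phase_ge_opp v : - v <= phase v. Proof. rewrite phase_ell. generalize (ell_pos v); lra. Qed.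
Lemma phase_le v : phase v <= exp (- v). Proof. apply ell_le. Qed.
Ltac ccp := cc; try (first [apply ell_cont | apply phase_cont | apply rate_cont | apply (cR_comp ell) | apply (cR_comp phase) | apply (cR_comp rate)]; ccp).
(** ** The regularising kernel *)

(** The linear factor makes the Fourier transform [bump] decrease like x^(-4), so that |x| is
    integrable against it, as is not the case for e^(-e|t|) alone. *)
Definition damp (e t : R) : R := ((1 + e * Rabs t) * exp (- e * Rabs t))%R.
Definition bump (e x : R) : R := (4 * (e * e * e) / ((e * e + x * x) * (e * e + x * x)))%R.
Lemma damp_cont e v : continuous (damp e) v.
Proof. unfold damp. cc. Qed.

Lemma damp_bounds e t : 0 < e -> 0 <= damp e t /\ Rabs (damp e t - 1) <= e * Rabs t.
Proof.
  intros He. unfold damp. set (x := (e * Rabs t)%R). assert (Hx : 0 <= x) by (apply Rmult_le_pos; [lra|apply Rabs_pos]).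
  replace (- e * Rabs t)%R with (- x)%R by (unfold x; ring).
  assert (A := exp_ineq1_le x). assert (B := exp_ineq1_le (- x)). assert (P := exp_pos (- x)).
  assert (U : (exp x * exp (- x) = 1)%R) by (rewrite <- exp_plus, <- exp_0; f_equal; ring).
  split; [apply Rmult_le_pos; lra|]. apply Rabs_le. split; [|nra].
  destruct (Rle_dec x 1); [nra|]. assert (0 <= (1 + x) * exp (- x)) by (apply Rmult_le_pos; lra). lra.
Qed.

Lemma damp_dom e : 0 < e -> exists M, 0 <= M /\ forall t, damp e t <= M / (1 + t * t).
Proof.
  intros He. set (d := (e / 2)%R).
  exists (1 + 8 / (d * d))%R. assert (dp : 0 < d) by (unfold d; lra).
  assert (P : 0 < / (d * d)) by (apply Rinv_0_lt_compat; nra).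
  split; [unfold Rdiv; lra|]. intros t.
  apply Rmult_le_reg_r with (1 + t * t)%R; [apply sqr1_pos|].
  replace ((1 + 8 / (d * d)) / (1 + t * t) * (1 + t * t))%R with (1 + 8 / (d * d))%R by (field; split; [lra|generalize (sqr1_pos t); lra]).
  unfold damp. set (y := (d * Rabs t)%R). assert (Hy : 0 <= y) by (apply Rmult_le_pos; [lra|apply Rabs_pos]).
  replace (- e * Rabs t)%R with (- y + - y)%R by (unfold y, d; field). replace (e * Rabs t)%R with (2 * y)%R by (unfold y, d; field).
  rewrite exp_plus, exp_Ropp.
  assert (tt : (t * t = y * y * / (d * d))%R).
  { unfold y. replace (t * t)%R with (Rabs t * Rabs t)%R. field; lra. rewrite <- Rabs_mult, Rabs_pos_eq; nra. }
  rewrite tt. assert (A := exp_ineq1_le y). assert (B := exp_ge_sqr y Hy).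
  set (E := exp y) in *. assert (E0 : 0 < / E) by (apply Rinv_0_lt_compat; lra).
  assert (I1 : (1 + 2 * y) * / E <= 2). { apply Rmult_le_reg_r with E; [lra|]. rewrite Rmult_assoc, Rinv_l; lra. }
  assert (I0 : (1 + 2 * y) * / E * / E <= 1).
  { apply Rmult_le_reg_r with (E * E)%R; [nra|]. replace ((1 + 2 * y) * / E * / E * (E * E))%R with (1 + 2 * y)%R by (field; lra). nra. }
  assert (I2 : y * y * / E <= 2). { apply Rmult_le_reg_r with E; [lra|]. rewrite Rmult_assoc, Rinv_l; lra. }
  assert (I3 : (1 + 2 * y) * / E * (y * y * / E) <= 2 * 2).
  { apply Rmult_le_compat; auto; [apply Rmult_le_pos; lra|apply Rmult_le_pos; nra]. }
  replace ((1 + 2 * y) * (/ E * / E) * (1 + y * y * / (d * d)))%R with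
    ((1 + 2 * y) * / E * / E + ((1 + 2 * y) * / E * (y * y * / E)) * / (d * d))%R by ring.
  unfold Rdiv. assert ((1 + 2 * y) * / E * (y * y * / E) * / (d * d) <= 4 * / (d * d)) by (apply Rmult_le_compat_r; lra). lra.
Qed.

Lemma half_transform e x b : 0 < e -> 0 <= b -> 
  let g := RtoC e - Ci * RtoC x in
  CI (fun t => RtoC (damp e t) * Cexp (Ci * RtoC (t * x))) 0 b =
   (/ g + RtoC e / (g * g)) - ((1 + RtoC (e * b)) / g + RtoC e / (g * g)) * Cexp (- g * RtoC b).
Proof.
  intros He Hb g.
  assert (gn : g <> 0). { intro H. apply (f_equal Re) in H. simpl in H. lra. }
  set (F := fun t : R => - (((1 + RtoC (e * t)) / g + RtoC e / (g * g)) * Cexp (- g * RtoC t))).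
  transitivity (F b - F 0%R).
  - apply CI_unique. 
    assert (Q : is_RInt (V := C_R_CompleteNormedModule) (fun t => (1 + RtoC (e * t)) * Cexp (- g * RtoC t)) 0 b (F b - F 0%R)).
    { apply CI_FTC_loc; auto.
      - intros t _. unfold F. eapply dR_eq.
        + apply dR_opp. apply dR_mult.
          * apply dR_plus; [|apply dR_const]. unfold Cdiv. apply dR_mult; [|apply dR_const].
            apply dR_plus; [apply dR_const|]. apply dR_RtoC. apply (is_derive_scal (fun t => t) t e 1). apply (is_derive_id (K:=R_AbsRing)).
          * apply dR_Cexp. apply dR_mult; [apply dR_const|apply dR_id].
        + cbv beta. replace (RtoC (e * 1)) with (RtoC e) by (f_equal; ring). field. auto.
      - intros t _. cc. }
    refine (is_RInt_ext (V := C_R_CompleteNormedModule) _ _ _ _ _ _ Q).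
    intros t. rewrite Rmin_left by lra. intros Ht. unfold damp. rewrite Rabs_pos_eq by lra.
    replace (- g * RtoC t) with (RtoC (- e * t) + Ci * RtoC (t * x)) by (unfold g; ceq; ring).
    rewrite Cexp_plus, Cexp_R, (RtoC_mult (1 + e * t)), RtoC_plus. change (@eq C ((1 + RtoC (e * t)) * (RtoC (exp (- e * t)) * Cexp (Ci * RtoC (t * x)))) ((1 + RtoC (e * t)) * RtoC (exp (- e * t)) * Cexp (Ci * RtoC (t * x)))). ring.
  - unfold F. rewrite Rmult_0_r. replace (- g * RtoC 0) with (RtoC 0) by ring. rewrite Cexp_0. field. auto.
Qed.

Lemma damp_transform_dom e x : 0 < e -> exists M, dom (fun t => RtoC (damp e t) * Cexp (Ci * RtoC (t * x))) M.
Proof.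
  intros He. destruct (damp_dom e He) as [M [_ H]]. exists M. split.
  - intros t. cc. apply damp_cont.
  - intros t. rewrite Cmod_mult, Cmod_R, Cmod_Cexp. replace (Re (Ci * RtoC (t * x))) with 0%R by reim.
    rewrite exp_0, Rmult_1_r, Rabs_pos_eq by (apply damp_bounds; auto). apply H.
Qed.

Lemma damp_transform e x : 0 < e -> II (fun t => RtoC (damp e t) * Cexp (Ci * RtoC (t * x))) = RtoC (bump e x).
Proof.
  intros He. destruct (damp_transform_dom e x He) as [M D].
  apply is_II_unique. apply is_II_intro; [apply D|]. intros eps Heps.
  set (g := fun x => RtoC e - Ci * RtoC x).
  assert (gn : forall x, g x <> 0). { intros y H. apply (f_equal Re) in H. simpl in H. lra. }
  assert (Neg : forall b, 0 <= b -> CI (fun t => RtoC (damp e t) * Cexp (Ci * RtoC (t * x))) (- b) 0 = CI (fun t => RtoC (damp e t) * Cexp (Ci * RtoC (t * - x))) 0 b).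
  { intros b Hb. destruct (damp_transform_dom e (- x) He) as [M' D'].
    assert (Q := CI_comp_affine (fun t => RtoC (damp e t) * Cexp (Ci * RtoC (t * - x))) (-1) 0 (- b) 0 (proj1 D')).
    replace (-1 * - b + 0)%R with b in Q by ring. replace (-1 * 0 + 0)%R with 0%R in Q by ring.
    rewrite (CI_swap _ 0 b (proj1 D')) in Q. 
    transitivity (- - CI (fun t => RtoC (damp e t) * Cexp (Ci * RtoC (t * - x))) 0 b); [|ring]. rewrite <- Q.
    transitivity (RtoC (-1) * RtoC (-1) * CI (fun t => RtoC (damp e t) * Cexp (Ci * RtoC (t * x))) (- b) 0); [ceq; ring|].
    transitivity (- (RtoC (-1) * CI (fun y => RtoC (damp e (-1 * y + 0)) * Cexp (Ci * RtoC ((-1 * y + 0) * - x))) (- b) 0)); [|reflexivity].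
    rewrite (CI_ext (fun y => RtoC (damp e (-1 * y + 0)) * Cexp (Ci * RtoC ((-1 * y + 0) * - x))) (fun t => RtoC (damp e t) * Cexp (Ci * RtoC (t * x)))).
    - ceq; ring.
    - intros t _. replace (-1 * t + 0)%R with (- t)%R by ring. replace (- t * - x)%R with (t * x)%R by ring. f_equal. unfold damp. rewrite Rabs_Ropp. reflexivity. }
  set (K0 := (Cmod (/ g x) + Cmod (RtoC e / (g x * g x)) + (Cmod (/ g (-x)%R) + Cmod (RtoC e / (g (-x)%R * g (-x)%R))) + 1)%R).
  assert (K0p : 1 <= K0). { unfold K0. generalize (Cmod_ge_0 (/ g x)) (Cmod_ge_0 (RtoC e / (g x * g x))) (Cmod_ge_0 (/ g (-x)%R)) (Cmod_ge_0 (RtoC e / (g (-x)%R * g (-x)%R))). lra. }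
  destruct (damp_dom e He) as [Mm [Mm0 HMm]].
  destruct (inv_sqr_small Mm (eps / (4 * K0)) Mm0) as [N [N0 HN]]. { apply Rdiv_lt_0_compat; lra. }
  exists N. intros a b Ha Hb.
  assert (R0 : forall y b, Cmod (/ g y) + Cmod (RtoC e / (g y * g y)) <= K0 -> N < b ->
    (Cmod (((1 + RtoC (e * b)) / g y + RtoC e / (g y * g y)) * Cexp (- g y * RtoC b)) < eps / 2)).
  { intros y b' HK Hb'. rewrite Cmod_mult, Cmod_Cexp.
    replace (Re (- g y * RtoC b')) with (- e * b')%R by (unfold g, Re; simpl; ring).
    assert (T : Cmod ((1 + RtoC (e * b')) / g y + RtoC e / (g y * g y)) <= (1 + e * b') * K0).
    { triangle. unfold Cdiv at 1. rewrite <- RtoC_plus, Cmod_mult, Cmod_R, Rabs_pos_eq by nra.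
      assert (0 <= e * b') by nra. generalize (Cmod_ge_0 (/ g y)) (Cmod_ge_0 (RtoC e / (g y * g y))). nra. }
    assert (L := HMm b'). unfold damp in L. rewrite Rabs_pos_eq in L by lra.
    specialize (HN b' ltac:(rewrite Rabs_pos_eq; lra)).
    apply Rle_lt_trans with (K0 * ((1 + e * b') * exp (- e * b')))%R.
    - eapply Rle_trans; [apply Rmult_le_compat_r; [left; apply exp_pos|exact T]|]. right; ring.
    - apply Rle_lt_trans with (K0 * (Mm / (1 + b' * b')))%R; [apply Rmult_le_compat_l; lra|].
      apply Rlt_le_trans with (K0 * (eps / (4 * K0)))%R; [apply Rmult_lt_compat_l; lra|].
      replace (K0 * (eps / (4 * K0)))%R with (eps / 4)%R by (field; lra). lra. }
  rewrite <- (CI_Chasles _ a 0 b (proj1 D)). replace a with (- - a)%R by ring. rewrite Neg by lra.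
  rewrite !half_transform by lra. fold (g x). fold (g (- x)%R).
  assert (KE : RtoC (bump e x) = (/ g x + RtoC e / (g x * g x)) + (/ g (- x)%R + RtoC e / (g (- x)%R * g (- x)%R))).
  { assert (n1 := gn x). assert (n2 := gn (- x)%R). 
    assert (PD : g x * g (- x)%R = RtoC (e * e + x * x)) by (unfold g; ceq; ring).
    assert (pd0 : (e * e + x * x <> 0)%R) by nra.
    unfold bump. rewrite RtoC_div by nra. rewrite (RtoC_mult (e * e + x * x)), <- PD.
    replace (RtoC (4 * (e * e * e))) with (2 * RtoC e * (g x * g (- x)%R) + RtoC e * (g x * g x + g (-x)%R * g (-x)%R)) by (unfold g; ceq; ring).
    replace (2 * RtoC e) with (g x + g (- x)%R) by (unfold g; ceq; ring). field. auto. }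
  rewrite KE.
  match goal with |- (Cmod (?p - ?r1 + (?q - ?r2) - (?q + ?p)) < _) => replace (p - r1 + (q - r2) - (q + p)) with (- r1 + - r2) by ring end.
  eapply Rle_lt_trans; [apply Cmod_triangle|]. rewrite !Cmod_opp.
  assert (A1 := R0 (- x)%R (- a)%R). assert (A2 := R0 x b). 
  assert (Cmod (/ g x) + Cmod (RtoC e / (g x * g x)) <= K0).
  { unfold K0. generalize (Cmod_ge_0 (/ g (-x)%R)) (Cmod_ge_0 (RtoC e / (g (-x)%R * g (-x)%R))). lra. }
  assert (Cmod (/ g (- x)%R) + Cmod (RtoC e / (g (- x)%R * g (- x)%R)) <= K0).
  { unfold K0. generalize (Cmod_ge_0 (/ g x)) (Cmod_ge_0 (RtoC e / (g x * g x))). lra. }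
  specialize (A1 ltac:(assumption) ltac:(lra)). specialize (A2 ltac:(assumption) ltac:(lra)). lra.
Qed.

(** ** The approximate identity *)

(** A primitive of [bump], with limits - pi and pi. *)
Definition bump_prim (e x : R) : R := (2 * e * x / (e * e + x * x) + 2 * atan (x / e))%R.
Lemma atan_derive_comp (g : R -> R) t g' : is_derive g t g' -> is_derive (fun t => atan (g t)) t (g' / (1 + g t * g t))%R.
Proof. intros H. exact (is_derive_comp atan g t _ _ (is_derive_atan (g t)) H). Qed.

Lemma bump_prim_derive e x : 0 < e -> is_derive (bump_prim e) x (bump e x).
Proof.
  intros He. assert (0 < e * e + x * x) by nra. unfold bump_prim.
  replace (bump e x) with (2 * e * (e * e - x * x) / ((e * e + x * x) * (e * e + x * x)) + 2 * (/ e / (1 + x / e * (x / e))))%R.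
  - apply (is_derive_plus (fun x => 2 * e * x / (e * e + x * x))%R (fun x => 2 * atan (x / e))%R).
    + auto_derive; [lra|]. field. lra.
    + apply (is_derive_scal (fun x => atan (x / e))). apply (atan_derive_comp (fun x => (x / e)%R)). auto_derive; auto. field. lra.
  - unfold bump. field. repeat split; nra.
Qed.

Lemma atan_le x : 0 <= x -> 0 <= atan x <= x.
Proof.
  intros Hx. split.
  - rewrite <- atan_0. destruct Hx as [Hx| <-]; [left; apply atan_increasing; auto|lra].
  - assert (H := Rderiv_nonpos (fun t => atan t - t)%R (fun t => / (1 + t * t) - 1)%R 0 x Hx).
    cut (atan x - x <= atan 0 - 0); [rewrite atan_0; lra|]. apply H.
    + intros t _. apply (is_derive_minus atan (fun t => t)); [apply is_derive_atan|apply (is_derive_id (K := R_AbsRing))].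
    + intros t _. cut (/ (1 + t * t) <= 1); [lra|]. rewrite <- Rinv_1. apply Rinv_le_contravar; nra.
Qed.

Lemma bump_prim_limit e x : 0 < e -> 0 < x -> Rabs (PI - bump_prim e x) <= 2 * e / x.
Proof.
  intros He Hx. assert (Q : 0 < e / x) by (apply Rdiv_lt_0_compat; auto).
  assert (A : (PI / 2 - atan (x / e) = atan (e / x))%R).
  { rewrite <- atan_inv by (apply Rdiv_lt_0_compat; auto). f_equal. field. lra. }
  assert (B := atan_le _ (Rlt_le _ _ Q)).
  assert (D : 0 <= 2 * e * x / (e * e + x * x) <= 2 * (e / x)).
  { split. - apply Rmult_le_pos; [nra|]. left. apply Rinv_0_lt_compat. nra.
    - apply Rmult_le_reg_r with (e * e + x * x)%R; [nra|]. unfold Rdiv at 1. rewrite Rmult_assoc, Rinv_l by nra.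
      replace (2 * (e / x) * (e * e + x * x))%R with (2 * e * x + 2 * (e / x) * (e * e))%R by (field; lra). nra. }
  unfold bump_prim. replace (2 * e / x)%R with (2 * (e / x))%R by (field; lra). apply Rabs_le. lra.
Qed.

Lemma bump_prim_odd e x : bump_prim e (- x) = (- bump_prim e x)%R.
Proof.
  unfold bump_prim. replace (- x / e)%R with (- (x / e))%R by (unfold Rdiv; ring). rewrite atan_opp.
  replace (- x * - x)%R with (x * x)%R by ring. unfold Rdiv. ring.
Qed.

Lemma bump_bound e x : 0 < e -> 0 <= bump e x <= 4 / e /\ Rabs x * bump e x <= 2 * (e * e) / (e * e + x * x).
Proof.
  intros He. assert (P : 0 < e * e + x * x) by nra. assert (PP : 0 < (e * e + x * x) * (e * e + x * x)) by nra.
  assert (e3 : 0 < e * e * e) by (apply Rmult_lt_0_compat; nra).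
  split; [split|].
  - apply Rmult_le_pos; [lra|]. left. apply Rinv_0_lt_compat; auto.
  - unfold bump. apply Rmult_le_reg_r with (e * ((e * e + x * x) * (e * e + x * x)))%R; [nra|].
    replace (4 * (e * e * e) / ((e * e + x * x) * (e * e + x * x)) * (e * ((e * e + x * x) * (e * e + x * x))))%R with (4 * ((e * e) * (e * e)))%R by (field; lra).
    replace (4 / e * (e * ((e * e + x * x) * (e * e + x * x))))%R with (4 * ((e * e + x * x) * (e * e + x * x)))%R by (field; lra).
    apply Rmult_le_compat_l; [lra|]. apply Rmult_le_compat; nra.
  - unfold bump. apply Rmult_le_reg_r with ((e * e + x * x) * (e * e + x * x))%R; [nra|].
    replace (Rabs x * (4 * (e * e * e) / ((e * e + x * x) * (e * e + x * x))) * ((e * e + x * x) * (e * e + x * x)))%R with (2 * (e * e) * (2 * e * Rabs x))%R by (field; lra).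
    replace (2 * (e * e) / (e * e + x * x) * ((e * e + x * x) * (e * e + x * x)))%R with (2 * (e * e) * (e * e + x * x))%R by (field; lra).
    apply Rmult_le_compat_l; [nra|]. replace (x * x)%R with (Rabs x * Rabs x)%R by (rewrite <- Rabs_mult, Rabs_pos_eq; nra).
    generalize (Rle_0_sqr (e - Rabs x)). unfold Rsqr. nra.
Qed.

Lemma bump_cont e x : 0 < e -> continuous (bump e) x.
Proof. intros He. unfold bump. cc. assert (P : 0 < e * e + x * x) by nra. apply Rgt_not_eq, Rmult_lt_0_compat; exact P. Qed.

Lemma phase_ge_inv v : / phase v <= 1 + exp v.
Proof.
  rewrite <- (Rinv_inv (1 + exp v)). apply Rinv_le_contravar; [apply rate_pos|apply phase_ge_rate].
Qed.

Lemma rate_ball (be be' : R -> C) K1 : (forall w, dR be w (be' w)) -> (forall w, Cmod (be' w) <= K1 * rate w) ->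
  forall v w, Cmod (be w - be v) <= K1 * Rabs (phase w - phase v).
Proof.
  intros D B. assert (K1p : 0 <= K1). { generalize (B 0%R) (rate_pos 0) (Cmod_ge_0 (be' 0%R)). nra. }
  assert (L : forall v w, v <= w -> Cmod (be w - be v) <= K1 * Rabs (phase w - phase v)).
  { intros v w Hvw.
    assert (H := mean_value_ineq be be' (fun w => - K1 * phase w)%R (fun w => - K1 * - rate w)%R v w Hvw).
    eapply Rle_trans; [apply H|].
    - intros; auto. - intros; apply (is_derive_scal phase), phase_derive. - intros t _. generalize (B t); lra.
    - rewrite <- (Rabs_Ropp (phase w - phase v)). replace (- K1 * phase w - - K1 * phase v)%R with (K1 * - (phase w - phase v))%R by ring.
      apply Rmult_le_compat_l; [auto|apply Rle_abs]. }
  intros v w. destruct (Rle_dec v w); [auto|]. rewrite Cmod_minus_sym, <- Rabs_Ropp, Ropp_minus_distr. apply L; lra.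
Qed.

(** In the variable phase w, whose density is rate dw, [bump e] is an approximate identity of
    total mass 2 pi, up to the mass lost beyond the end phase = 0 of the half-line; that loss is
    of order e / phase v. *)
Lemma approx_identity (b be be' : R -> C) K0 K1 Mb e v : 0 < e ->
  (forall w, b w = be w * RtoC (rate w)) -> dom b Mb ->
  (forall w, dR be w (be' w)) -> (forall w, Cmod (be w) <= K0) -> (forall w, Cmod (be' w) <= K1 * rate w) ->
  Cmod (II (fun w => (b w * RtoC (bump e (phase v - phase w)))%C) - 2 * RtoC PI * be v) <= e * (2 * PI * K1 + 8 * K0) * (1 + exp v).
Proof.
  intros He Hb Db D B0 B1. set (y := phase v). assert (yp : 0 < y) by apply phase_pos.
  assert (bc : cont be) by (intros w; eapply dR_continuous, D).
  assert (K0p : 0 <= K0). { generalize (B0 0%R) (Cmod_ge_0 (be 0%R)). lra. }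
  assert (K1p : 0 <= K1). { generalize (B1 0%R) (rate_pos 0) (Cmod_ge_0 (be' 0%R)). nra. }
  assert (kc : forall w, continuous (fun w => bump e (phase w - y)) w).
  { intros w. apply (cR_comp (bump e) (fun w => phase w - y)%R); [ccp|apply bump_cont; auto]. }
  assert (jc := rate_cont).
  rewrite (II_ext _ (fun w => be w * RtoC (rate w) * RtoC (bump e (phase w - y)))).
  2:{ intros w. rewrite Hb. unfold bump. replace ((y - phase w) * (y - phase w))%R with ((phase w - y) * (phase w - y))%R by ring. reflexivity. }
  set (F := fun w => be w * RtoC (rate w) * RtoC (bump e (phase w - y))).
  assert (DF : dom F (4 / e * Mb)).
  { split. { intros w. unfold F. cc; first [apply jc|apply bc|apply kc]. }
    intros w. unfold F. rewrite <- Hb, Cmod_mult, Cmod_R, Rabs_pos_eq by (apply bump_bound; auto).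
    rewrite Rmult_comm. unfold Rdiv. rewrite (Rmult_assoc _ Mb). apply Rmult_le_compat; [apply bump_bound; auto|pos|apply bump_bound; auto|apply Db]. }
  apply Cmod_le_limit. intros eps Heps.
  destruct (is_II_eps F _ (proj1 DF) (dom_is_II _ _ DF) (eps / 2) ltac:(lra)) as [N HN].
  (* n below makes phase (-n) - y at least X, so that the mass beyond it is negligible, and phase n at most y / 2 *)
  set (X := (4 * e * K0 / eps + 1)%R).
  assert (Xp : 0 < X). { unfold X. assert (0 <= 4 * e * K0 / eps); [|lra]. apply Rmult_le_pos; [pos|left; apply Rinv_0_lt_compat; lra]. }
  set (n := (Rmax N (Rmax (y + X) (- ln (y / 2))) + 1)%R).
  assert (n1 : N < n) by (unfold n; generalize (Rmax_l N (Rmax (y + X) (- ln (y / 2)))); lra).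
  assert (n2 : y + X < n) by (unfold n; generalize (Rmax_r N (Rmax (y + X) (- ln (y / 2)))) (Rmax_l (y + X) (- ln (y / 2))); lra).
  assert (n3 : - ln (y / 2) < n) by (unfold n; generalize (Rmax_r N (Rmax (y + X) (- ln (y / 2)))) (Rmax_r (y + X) (- ln (y / 2))); lra).
  specialize (HN (- n)%R n ltac:(lra) ltac:(lra)).
  assert (pn : phase n <= y / 2).
  { eapply Rle_trans; [apply phase_le|]. rewrite <- (exp_ln (y / 2)) by lra. apply exp_le. lra. }
  assert (pm : X <= phase (- n) - y) by (generalize (phase_ge_opp (- n)); lra).
  assert (S : CI F (- n) n = CI (fun w => (be w - be v) * RtoC (rate w) * RtoC (bump e (phase w - y))) (- n) n + be v * CI (fun w => RtoC (rate w * bump e (phase w - y))) (- n) n).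
  { rewrite <- CI_scal, <- CI_plus.
    - apply CI_ext. intros w _. unfold F. rewrite RtoC_mult. ring.
    - intros w. cc; first [apply jc|apply bc|apply kc]. - intros w. cc; first [apply jc|apply bc|apply kc]. - intros w. cc; first [apply jc|apply bc|apply kc]. }
  assert (S1 : Cmod (CI (fun w => ((be w - be v) * RtoC (rate w) * RtoC (bump e (phase w - y)))%C) (- n) n) <= 2 * PI * K1 * e).
  { eapply Rle_trans; [apply (CI_norm_primitive _ (fun w => K1 * (2 * e) * - atan ((phase w - y) / e))%R (fun w => K1 * (2 * e) * - (- rate w / e / (1 + (phase w - y) / e * ((phase w - y) / e))))%R)|].
    - lra.
    - intros w. cc; first [apply jc|apply bc|apply kc].
    - intros w. apply is_derive_scal. apply (is_derive_opp (fun w => atan ((phase w - y) / e))). apply (atan_derive_comp (fun w => (phase w - y) / e)%R).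
      unfold Rdiv. apply (is_derive_ext (fun w => / e * (phase w - y))%R); [intros; apply Rmult_comm|].
      rewrite (Rmult_comm (- rate w)). apply (is_derive_scal (fun w => phase w - y)%R). 
      replace (- rate w)%R with (- rate w - 0)%R by ring. apply (is_derive_minus phase (fun _ => y)); [apply phase_derive|apply (is_derive_const (V := R_NormedModule))].
    - intros w. ccp; try apply jc; try lra. generalize (sqr1_pos ((phase w - y) / e)); lra.
    - intros w _. rewrite !Cmod_mult, !Cmod_R, (Rabs_pos_eq (rate w)) by (left; apply rate_pos).
      rewrite (Rabs_pos_eq (bump _ _)) by (apply bump_bound; auto).
      assert (Q := rate_ball be be' K1 D B1 v w). fold y in Q. destruct (bump_bound e (phase w - y) He) as [Q1 Q2].
      set (x := (phase w - y)%R) in *. assert (J := rate_pos w).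
      apply Rle_trans with (K1 * (Rabs x * bump e x) * rate w)%R.
      + replace (K1 * (Rabs x * bump e x) * rate w)%R with ((K1 * Rabs x) * rate w * bump e x)%R by ring.
        apply Rmult_le_compat_r; [lra|]. apply Rmult_le_compat_r; [lra|exact Q].
      + apply Rle_trans with (K1 * (2 * (e * e) / (e * e + x * x)) * rate w)%R.
        * apply Rmult_le_compat_r; [lra|]. apply Rmult_le_compat_l; auto.
        * right. field. split; [lra|nra].
    - generalize (atan_bound ((phase n - y) / e)) (atan_bound ((phase (- n) - y) / e)). intros.
      replace (2 * PI * K1 * e)%R with (K1 * (2 * e) * PI)%R by ring. 
      replace (K1 * (2 * e) * - atan ((phase n - y) / e) - K1 * (2 * e) * - atan ((phase (- n) - y) / e))%R with
        (K1 * (2 * e) * (atan ((phase (- n) - y) / e) - atan ((phase n - y) / e)))%R by ring.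
      apply Rmult_le_compat_l; [pos|lra]. }
  assert (S2 : CI (fun w => RtoC (rate w * bump e (phase w - y))) (- n) n = RtoC (bump_prim e (phase (- n) - y) + bump_prim e (y - phase n))).
  { rewrite (CI_FTC (fun w => RtoC (- bump_prim e (phase w - y)))).
    - rewrite <- RtoC_minus. f_equal. replace (phase n - y)%R with (- (y - phase n))%R by ring. rewrite bump_prim_odd. ring.
    - intros w. apply dR_RtoC. replace (rate w * bump e (phase w - y))%R with (- (- rate w * bump e (phase w - y)))%R by ring.
      apply (is_derive_opp (fun w => bump_prim e (phase w - y))). 
      apply (is_derive_comp (bump_prim e) (fun w => phase w - y)%R); [apply bump_prim_derive; auto|].
      replace (- rate w)%R with (- rate w - 0)%R by ring. apply (is_derive_minus phase (fun _ => y)); [apply phase_derive|apply (is_derive_const (V := R_NormedModule))].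
    - intros w. cc; first [apply jc|apply bc|apply kc]. }
  assert (S3 : Rabs (2 * PI - (bump_prim e (phase (- n) - y) + bump_prim e (y - phase n))) <= 2 * e / X + 4 * e / y).
  { replace (2 * PI - (bump_prim e (phase (- n) - y) + bump_prim e (y - phase n)))%R with ((PI - bump_prim e (phase (- n) - y)) + (PI - bump_prim e (y - phase n)))%R by ring.
    eapply Rle_trans; [apply Rabs_triang|]. apply Rplus_le_compat.
    - eapply Rle_trans; [apply bump_prim_limit; lra|]. apply Rmult_le_compat_l; [lra|]. apply Rinv_le_contravar; lra.
    - eapply Rle_trans; [apply bump_prim_limit; lra|]. replace (4 * e / y)%R with (2 * e * / (y / 2))%R by (field; lra).
      apply Rmult_le_compat_l; [lra|]. apply Rinv_le_contravar; lra. }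
  assert (S4 : K0 * (2 * e / X) <= eps / 2).
  { apply Rmult_le_reg_r with X; [auto|]. replace (K0 * (2 * e / X) * X)%R with (2 * e * K0)%R by (field; lra).
    replace (eps / 2 * X)%R with (2 * e * K0 + eps / 2)%R by (unfold X; field; lra). lra. }
  assert (S5 := phase_ge_inv v). fold y in S5.
  set (P := (bump_prim e (phase (- n) - y) + bump_prim e (y - phase n))%R) in *.
  set (T := CI (fun w => (be w - be v) * RtoC (rate w) * RtoC (bump e (phase w - y))) (- n) n) in *.
  rewrite S, S2 in HN.
  replace (II F - 2 * RtoC PI * be v) with (- (T + be v * RtoC P - II F) + (T + - (be v * RtoC (2 * PI - P)))).
  2:{ rewrite RtoC_minus, RtoC_mult. ring. }
  triangle. rewrite Cmod_opp.
  assert (U : Cmod (T + - (be v * RtoC (2 * PI - P))) <= 2 * PI * K1 * e + K0 * (2 * e / X + 4 * e / y)).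
  { triangle. rewrite Cmod_opp, Cmod_mult, Cmod_R. apply Rplus_le_compat; auto.
    apply Rmult_le_compat; auto; [apply Cmod_ge_0|apply Rabs_pos]. }
  assert (V : 4 * e / y <= 8 * e * (1 + exp v)).
  { unfold Rdiv. generalize (Rinv_0_lt_compat y yp). intros. apply Rmult_le_compat; lra. }
  assert (W : 2 * PI * K1 * e <= 2 * PI * K1 * e * (1 + exp v)).
  { rewrite <- (Rmult_1_r (2 * PI * K1 * e)) at 1. apply Rmult_le_compat_l; [generalize PI_RGT_0; intros; pos|generalize (exp_pos v); lra]. }
  assert (V' := Rmult_le_compat_l K0 _ _ K0p V). lra.
Qed.

(** Insert [damp e], which changes the left side by O(e); two interchanges of integrals then
    give the double integral of a(v) b(w) bump e (phase v - phase w), where the approximate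
    identity applies. *)
Lemma parseval (a b be be' A B : R -> C) Ma Mb Mt K0 K1 :
  dom (fun v => a v * RtoC (1 + exp v)) Ma -> dom b Mb -> (forall w, b w = be w * RtoC (rate w)) ->
  (forall w, dR be w (be' w)) -> (forall w, Cmod (be w) <= K0) -> (forall w, Cmod (be' w) <= K1 * rate w) ->
  (forall t, A t = II (fun v => a v * Cexp (Ci * RtoC (t * phase v)))) ->
  (forall t, B t = II (fun w => b w * Cexp (- (Ci * RtoC (t * phase w))))) ->
  cont B -> dom (fun t => A t * B t) Mt -> (forall t, Rabs t * Cmod (A t * B t) <= Mt / (1 + t * t)) ->
  II (fun t => A t * B t) = 2 * RtoC PI * II (fun v => a v * be v).
Proof.
  intros Da Db Hb D B0 B1 HA HB cB DAB HT.
  assert (bc : cont be) by (intros w; eapply dR_continuous, D).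
  assert (Map := dom_pos _ _ Da). assert (Mbp := dom_pos _ _ Db). assert (Mtp := dom_pos _ _ DAB).
  assert (K0p : 0 <= K0). { generalize (B0 0%R) (Cmod_ge_0 (be 0%R)). lra. }
  assert (K1p : 0 <= K1). { generalize (B1 0%R) (rate_pos 0) (Cmod_ge_0 (be' 0%R)). nra. }
  assert (ca : cont a).
  { intros v. apply (continuous_ext (fun v => a v * RtoC (1 + exp v) * RtoC (rate v))).
    - intros w. rewrite <- Cmult_assoc, <- RtoC_mult. unfold rate. rewrite Rinv_r by (generalize (exp1_pos w); lra). apply Cmult_1_r.
    - apply cC_mult; [apply Da|apply cC_RtoC, rate_cont]. }
  assert (Da1 : forall v, Cmod (a v) * (1 + exp v) <= Ma / (1 + v * v)).
  { intros v. generalize (proj2 Da v). rewrite Cmod_mult, Cmod_R, Rabs_pos_eq; auto. generalize (exp1_pos v); lra. }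
  assert (Da0 : forall v, Cmod (a v) <= Ma / (1 + v * v)).
  { intros v. eapply Rle_trans; [|apply Da1]. generalize (Cmod_ge_0 (a v)) (exp_pos v). nra. }
  assert (Dab : dom (fun v => a v * be v) (K0 * Ma)).
  { split. - intros v. apply cC_mult; auto.
    - intros v. rewrite Cmod_mult, Rmult_comm. unfold Rdiv. rewrite Rmult_assoc. apply Rmult_le_compat; auto using Cmod_ge_0. }
  assert (unit : forall x, Cmod (Cexp (Ci * RtoC x)) = 1%R /\ Cmod (Cexp (- (Ci * RtoC x))) = 1%R).
  { intros x. rewrite !Cmod_Cexp. replace (Re (Ci * RtoC x)) with 0%R by reim.
    replace (Re (- (Ci * RtoC x))) with 0%R by reim. rewrite exp_0; auto. }
  assert (Bb : forall t, Cmod (B t) <= Mb * PI).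
  { intros t. rewrite HB. apply II_bound. split; [intros w; ccp; apply Db|].
    intros w. rewrite Cmod_mult, (proj2 (unit _)), Rmult_1_r. apply Db. }
  set (J := fun e => II (fun t => RtoC (damp e t) * (A t * B t))).
  assert (E1 : forall e, 0 < e -> Cmod (J e - II (fun t => (A t * B t)%C)) <= e * Mt * PI).
  { intros e He. destruct (damp_dom e He) as [Mm [Mm0 HMm]]. unfold J.
    assert (m1 : forall t, damp e t <= 1 + e * Rabs t). { intros t. generalize (proj2 (damp_bounds e t He)). intros Q. generalize (Rle_abs (damp e t - 1)). lra. }
    apply (II_diff_bound _ _ ((1 + e) * Mt) Mt); auto.
    - split. { intros t. apply cC_mult; [apply cC_RtoC, damp_cont|apply DAB]. }
      intros t. rewrite Cmod_mult, Cmod_R, Rabs_pos_eq by (apply damp_bounds; auto).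
      replace ((1 + e) * Mt / (1 + t * t))%R with (Mt / (1 + t * t) + e * (Mt / (1 + t * t)))%R by (field; generalize (sqr1_pos t); lra).
      apply Rle_trans with ((1 + e * Rabs t) * Cmod (A t * B t))%R; [apply Rmult_le_compat_r; [apply Cmod_ge_0|apply m1]|].
      generalize (proj2 DAB t) (Rmult_le_compat_l e _ _ (Rlt_le _ _ He) (HT t)). lra.
    - intros t. replace (RtoC (damp e t) * (A t * B t) - A t * B t) with (RtoC (damp e t - 1) * (A t * B t)) by (rewrite RtoC_minus; ring).
      rewrite Cmod_mult, Cmod_R. eapply Rle_trans; [apply Rmult_le_compat_r; [apply Cmod_ge_0|apply (damp_bounds e t He)]|].
      rewrite Rmult_assoc. unfold Rdiv. rewrite (Rmult_assoc e). apply Rmult_le_compat_l; [lra|apply HT]. }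
  assert (E2 : forall e, 0 < e -> Cmod (J e - 2 * RtoC PI * II (fun v => (a v * be v)%C)) <= e * ((2 * PI * K1 + 8 * K0) * Ma) * PI).
  { intros e He. destruct (damp_dom e He) as [Mm [Mm0 HMm]].
    assert (mp := fun t => proj1 (damp_bounds e t He)).
    set (F := fun t v => a v * (RtoC (damp e t) * Cexp (Ci * RtoC (t * phase v)) * B t)).
    assert (DF : dom2 F (Ma * (Mm * (Mb * PI)))).
    { split.
      - intros t v. unfold F. cc.
        + apply (cC_compR a (fun p : R * R => snd p)); [apply cR_snd|apply ca].
        + apply (cR_comp (damp e) (fun p : R * R => fst p)); [apply cR_fst|apply damp_cont].
        + apply (cR_comp phase (fun p : R * R => snd p)); [apply cR_snd|apply phase_cont].
        + apply (cC_compR B (fun p : R * R => fst p)); [apply cR_fst|apply cB].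
      - intros t v. unfold F. rewrite !Cmod_mult, Cmod_R, (proj1 (unit _)), Rmult_1_r, Rabs_pos_eq by auto.
        replace (Ma * (Mm * (Mb * PI)) / ((1 + t * t) * (1 + v * v)))%R with ((Ma / (1 + v * v)) * ((Mm / (1 + t * t)) * (Mb * PI)))%R
         by (field; split; generalize (sqr1_pos t) (sqr1_pos v); lra).
        apply Rmult_le_compat; auto using Cmod_ge_0.
        + apply Rmult_le_pos; auto using Cmod_ge_0.
        + apply Rmult_le_compat; auto using Cmod_ge_0. }
    assert (JF : J e = II (fun v => II (fun t => F t v))).
    { rewrite <- (II_fubini F _ DF). unfold J. apply II_ext. intros t. rewrite HA.
      transitivity (II (fun v => RtoC (damp e t) * B t * (a v * Cexp (Ci * RtoC (t * phase v))))).
      2:{ apply II_ext. intros v. unfold F. ring. }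
      rewrite (II_scal _ _ Ma).
      - ring. - split; [intros v; ccp; apply ca|]. intros v. rewrite Cmod_mult, (proj1 (unit _)), Rmult_1_r; auto. }
    assert (IN : forall v, II (fun t => F t v) = a v * II (fun w => b w * RtoC (bump e (phase v - phase w)))).
    { intros v. unfold F. rewrite (II_scal _ _ (Mm * (Mb * PI))).
      2:{ split. { intros t. cc; [apply damp_cont|apply cB]. }
          intros t. rewrite !Cmod_mult, Cmod_R, (proj1 (unit _)), Rmult_1_r, Rabs_pos_eq by auto.
          replace (Mm * (Mb * PI) / (1 + t * t))%R with (Mm / (1 + t * t) * (Mb * PI))%R by (field; generalize (sqr1_pos t); lra).
          apply Rmult_le_compat; auto using Cmod_ge_0. }
      f_equal.
      set (G := fun t w => b w * (RtoC (damp e t) * Cexp (Ci * RtoC (t * (phase v - phase w))))).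
      assert (DG : dom2 G (Mb * Mm)).
      { split.
        - intros t w. unfold G. cc.
          + apply (cC_compR b (fun p : R * R => snd p)); [apply cR_snd|apply Db].
          + apply (cR_comp (damp e) (fun p : R * R => fst p)); [apply cR_fst|apply damp_cont].
          + apply (cR_comp phase (fun p : R * R => snd p)); [apply cR_snd|apply phase_cont].
        - intros t w. unfold G. rewrite !Cmod_mult, Cmod_R, (proj1 (unit _)), Rmult_1_r, Rabs_pos_eq by auto.
          replace (Mb * Mm / ((1 + t * t) * (1 + w * w)))%R with (Mb / (1 + w * w) * (Mm / (1 + t * t)))%R
           by (field; split; generalize (sqr1_pos t) (sqr1_pos w); lra).
          apply Rmult_le_compat; auto using Cmod_ge_0. apply Db. }
      transitivity (II (fun t => II (G t))).
      - apply II_ext. intros t. rewrite HB. rewrite <- (II_scal _ _ Mb).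
        + apply II_ext. intros w. unfold G. replace (Ci * RtoC (t * (phase v - phase w))) with (Ci * RtoC (t * phase v) + - (Ci * RtoC (t * phase w))) by (ceq; ring).
          rewrite Cexp_plus. ring.
        + split; [intros w; ccp; apply Db|]. intros w. rewrite Cmod_mult, (proj2 (unit _)), Rmult_1_r. apply Db.
      - rewrite (II_fubini G _ DG : II (fun t => II (G t)) = _). apply II_ext. intros w. unfold G.
        destruct (damp_transform_dom e (phase v - phase w) He) as [M' D']. rewrite (II_scal _ _ _ D'), damp_transform by auto. reflexivity. }
    assert (DS : dom (fun v => a v * II (fun w => b w * RtoC (bump e (phase v - phase w)))) (Ma * (Mm * (Mb * PI)) * PI)).
    { eapply dom_ext; [|apply (dom2_II _ _ (dom2_swap _ _ DF))]. intros v. cbv beta. apply IN. }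
    rewrite JF, (II_ext _ _ IN), <- (II_scal _ _ _ Dab).
    eapply (II_diff_bound _ _ _ _ _ DS (dom_scal _ _ _ Dab)).
    intros v. replace (a v * II (fun w => b w * RtoC (bump e (phase v - phase w))) - 2 * RtoC PI * (a v * be v)) with
      (a v * (II (fun w => b w * RtoC (bump e (phase v - phase w))) - 2 * RtoC PI * be v)) by ring.
    rewrite Cmod_mult. eapply Rle_trans; [apply Rmult_le_compat_l; [apply Cmod_ge_0|apply (approx_identity b be be' K0 K1 Mb e v); auto]|].
    replace (Cmod (a v) * (e * (2 * PI * K1 + 8 * K0) * (1 + exp v)))%R with (e * (2 * PI * K1 + 8 * K0) * (Cmod (a v) * (1 + exp v)))%R by ring.
    replace (e * ((2 * PI * K1 + 8 * K0) * Ma) / (1 + v * v))%R with (e * (2 * PI * K1 + 8 * K0) * (Ma / (1 + v * v)))%R by (unfold Rdiv; ring).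
    apply Rmult_le_compat_l; auto. assert (HP := PI_RGT_0). assert (0 <= PI * K1) by (apply Rmult_le_pos; lra). apply Rmult_le_pos; lra. }
  set (X := II (fun t => A t * B t)) in *. set (Y := 2 * RtoC PI * II (fun v => a v * be v)) in *.
  cut (X - Y = 0). { intros H. rewrite <- (Cplus_0_r Y), <- H. ring. }
  apply Cmod_eq_0. apply Rle_antisym; [|apply Cmod_ge_0]. apply Cmod_le_limit. intros eps Heps.
  set (L := (Mt * PI + ((2 * PI * K1 + 8 * K0) * Ma) * PI + 1)%R). assert (HP := PI_RGT_0).
  assert (Lp : 0 < L).
  { unfold L. assert (0 <= PI * K1) by pos. assert (0 <= Mt * PI) by pos.
    assert (0 <= ((2 * PI * K1 + 8 * K0) * Ma) * PI); [|lra]. apply Rmult_le_pos; [|lra]. apply Rmult_le_pos; lra. }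
  set (e := (eps / L)%R). assert (He : 0 < e) by (apply Rdiv_lt_0_compat; auto).
  replace (X - Y) with (- (J e - X) + (J e - Y)) by ring.
  triangle. rewrite Cmod_opp.
  assert (eL : (eps = e * L)%R) by (unfold e; field; lra). rewrite eL. unfold L. generalize (E1 e He) (E2 e He). lra.
Qed.

(** * The integral over one ray *)

(** ** Decay of the product of the two factors *)

(** 72 = 2 * 6^2: this is x^2 / 2 <= e^x at x = d om / 6, to be raised to the sixth power. *)
Lemma om_exp d t : 0 < d -> om t * om t <= 72 / (d * d) * exp (d * om t / 6).
Proof.
  intros Hd. assert (H := om_ge1 t). 
  assert (A := exp_ge_sqr (d * om t / 6) ltac:(apply Rmult_le_pos; nra)).
  apply Rmult_le_reg_l with (d * d / 72)%R; [nra|].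
  replace (d * d / 72 * (72 / (d * d) * exp (d * om t / 6)))%R with (exp (d * om t / 6)) by (field; lra). nra.
Qed.

Lemma om_poly_exp d t : 0 < d -> 
  ((om t * om t) * (om t * om t) * exp (- d * om t) <= (72 / (d * d))^6 / ((1 + t * t) * (1 + t * t))).
Proof.
  intros Hd. assert (A := om_exp d t Hd). assert (P := om_sqr t). set (w := (om t * om t)%R) in *.
  set (q := (72 / (d * d))%R) in *. assert (qp : 0 < q) by (apply Rdiv_lt_0_compat; nra).
  assert (w1 : 1 <= w) by (rewrite P; generalize (Rabs_pos t); lra).
  assert (T : 1 + t * t <= w * w).
  { rewrite P. replace (t * t)%R with (Rabs t * Rabs t)%R by (rewrite <- Rabs_mult, Rabs_pos_eq; nra). generalize (Rabs_pos t). nra. }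
  set (y := exp (d * om t / 6)) in *. assert (yp : 0 < y) by apply exp_pos.
  assert (E : (exp (- d * om t) * (y * y * y * (y * y * y)) = 1)%R).
  { unfold y. rewrite <- !exp_plus. transitivity (exp 0); [f_equal; field|apply exp_0]. }
  assert (S := sqr1_pos t).
  assert (B : w * w * ((1 + t * t) * (1 + t * t)) <= (q * y) ^ 6).
  { apply Rle_trans with (w * w * ((w * w) * (w * w)))%R.
    - apply Rmult_le_compat_l; [nra|]. apply Rmult_le_compat; lra.
    - replace (w * w * (w * w * (w * w)))%R with (w ^ 6)%R by ring. apply pow_incr. lra. }
  apply Rmult_le_reg_r with ((1 + t * t) * (1 + t * t))%R; [nra|].
  replace (q ^ 6 / ((1 + t * t) * (1 + t * t)) * ((1 + t * t) * (1 + t * t)))%R with (q ^ 6)%R by (field; lra).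
  set (g := exp (- d * om t)) in *. assert (gp : 0 < g) by apply exp_pos.
  apply Rle_trans with (g * (q * y) ^ 6)%R; [nra|].
  right. replace (g * (q * y) ^ 6)%R with (q ^ 6 * (g * (y * y * y * (y * y * y))))%R by ring. rewrite E. ring.
Qed.

Lemma vline_opp sg t : - vline sg t = vline (- sg) (- t).
Proof. unfold vline. ceq; ring. Qed.

(** A compact part of the wedge, with a margin d in its two inequalities, on which bounds are
    uniform. *)
Definition box (c R0 Y0 d : R) (xi eta : C) : Prop :=
  (c <= Re xi <= R0) /\ c <= Re eta <= R0 /\ Rabs (Im xi) <= Y0 /\ Rabs (Im eta) <= Y0 /\
  (Rabs (Im eta) + d <= Re xi) /\ Rabs (Im xi) + d <= Re eta.

Lemma C_decomp z : z = RtoC (Re z) + Ci * RtoC (Im z).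
Proof. ceq; ring. Qed.

(** The factor at s grows like e^(2 om |Im xi|) and the one at - s decreases like e^(-2 om Re
    eta); the margin d leaves e^(- om d). *)
Lemma AA_opposite_bound sg c R0 Y0 d : Rabs sg < 3/4 -> 0 < c <= R0 -> 0 < d -> 0 <= Y0 ->
  exists K, 0 <= K /\ forall t xi eta, 0 <= t -> box c R0 Y0 d xi eta ->
  forall u v, (u = AA (vline sg t) xi \/ u = AA1 (vline sg t) xi) -> (v = AA (- vline sg t) eta \/ v = AA1 (- vline sg t) eta) ->
  Cmod u * Cmod v <= K / ((1 + t * t) * (1 + t * t)).
Proof.
  intros Hs Hc Hd HY.
  destruct (AA_growth sg c R0 Y0 (d / 4) Hs Hc ltac:(lra) HY) as [K1 [K1p H1]].
  destruct (AA_decay (- sg) c R0 Y0 (d / 4) ltac:(rewrite Rabs_Ropp; lra) Hc ltac:(lra) HY) as [K2 [K2p H2]].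
  exists (K1 * K2 * (72 / (d * d)) ^ 6)%R. 
  assert (q6 : 0 <= (72 / (d * d)) ^ 6) by (apply pow_le; left; apply Rdiv_lt_0_compat; nra).
  split; [pos|]. intros t xi eta Ht [B1 [B2 [B3 [B4 [B5 B6]]]]] u v Hu Hv.
  assert (w1 := om_ge1 t). set (w := om t) in *.
  assert (U : Cmod u <= K1 * (w * w) * exp (2 * w * (Rabs (Im xi) + d / 4))).
  { destruct (H1 t (Re xi) (Im xi) B1 B3) as [U1 U2]. rewrite <- C_decomp in U1, U2. destruct Hu; subst u; auto. }
  assert (V : Cmod v <= K2 * (w * w) * exp (- 2 * w * (Re eta - d / 4))).
  { destruct (H2 (- t)%R (Re eta) (Im eta) ltac:(lra) B2 B4) as [U1 U2]. rewrite <- C_decomp, <- vline_opp, om_opp in U1, U2. destruct Hv; subst v; auto. }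
  eapply Rle_trans; [apply Rmult_le_compat; [apply Cmod_ge_0|apply Cmod_ge_0|exact U|exact V]|].
  replace (K1 * (w * w) * exp (2 * w * (Rabs (Im xi) + d / 4)) * (K2 * (w * w) * exp (- 2 * w * (Re eta - d / 4))))%R with
   (K1 * K2 * ((w * w) * (w * w) * exp (2 * w * (Rabs (Im xi) + d / 4) + - 2 * w * (Re eta - d / 4))))%R by (rewrite exp_plus; ring).
  replace (K1 * K2 * (72 / (d * d)) ^ 6 / ((1 + t * t) * (1 + t * t)))%R with (K1 * K2 * ((72 / (d * d)) ^ 6 / ((1 + t * t) * (1 + t * t))))%R by (unfold Rdiv; ring).
  apply Rmult_le_compat_l; [pos|]. eapply Rle_trans; [|apply om_poly_exp; auto]. fold w.
  apply Rmult_le_compat_l; [nra|]. apply exp_le. nra.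
Qed.

Lemma AA_product_bound sg c R0 Y0 d : Rabs sg < 3/4 -> 0 < c <= R0 -> 0 < d -> 0 <= Y0 ->
  exists K, 0 <= K /\ forall t xi eta, box c R0 Y0 d xi eta ->
  forall u v, (u = AA (vline sg t) xi \/ u = AA1 (vline sg t) xi) -> (v = AA (- vline sg t) eta \/ v = AA1 (- vline sg t) eta) ->
  Cmod u * Cmod v <= K / ((1 + t * t) * (1 + t * t)).
Proof.
  intros Hs Hc Hd HY.
  destruct (AA_opposite_bound sg c R0 Y0 d Hs Hc Hd HY) as [K1 [K1p H1]].
  destruct (AA_opposite_bound (- sg) c R0 Y0 d ltac:(rewrite Rabs_Ropp; lra) Hc Hd HY) as [K2 [K2p H2]].
  exists (K1 + K2)%R. split; [lra|]. intros t xi eta B u v Hu Hv.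
  assert (P : 0 < / ((1 + t * t) * (1 + t * t))) by (apply Rinv_0_lt_compat; generalize (sqr1_pos t); nra).
  destruct (Rle_dec 0 t) as [Ht|Ht].
  - eapply Rle_trans; [apply (H1 t xi eta Ht B u v Hu Hv)|]. unfold Rdiv. nra.
  - rewrite Rmult_comm. eapply Rle_trans; [apply (H2 (- t)%R eta xi ltac:(lra))|].
    + unfold box in *. tauto.
    + rewrite <- vline_opp. exact Hv.
    + rewrite <- vline_opp. replace (- - vline sg t) with (vline sg t) by ring. exact Hu.
    + replace (- t * - t)%R with (t * t)%R by ring. unfold Rdiv. nra.
Qed.

(** The product of the two factors on the ray (1-i), on the line Re s = sg. *)
Definition FF (sg : R) (xi eta : C) (t : R) : C := AA (vline sg t) xi * AA (- vline sg t) eta.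
Lemma AA_cont_opp sg eta : Rabs sg < 3/4 -> cont (fun t => AA (- vline sg t) eta).
Proof.
  intros Hs t. apply (continuous_ext (fun t => AA (RtoC (- sg) + Ci * RtoC (- t)) eta)).
  - intros u. f_equal. unfold vline. ceq; ring.
  - apply (cC_compR (fun t => AA (RtoC (- sg) + Ci * RtoC t) eta) (fun t => - t)%R); [cc|]. apply AA_cont. rewrite Rabs_Ropp; auto.
Qed.

Lemma FF_cont sg xi eta : Rabs sg < 3/4 -> cont (FF sg xi eta).
Proof. intros Hs t. apply cC_mult; [apply AA_cont; auto|apply AA_cont_opp; auto]. Qed.

Lemma inv_sqr_sqr K t : 0 <= K -> K / ((1 + t * t) * (1 + t * t)) <= K / (1 + t * t) /\
  ((1 + Rabs t) * (K / ((1 + t * t) * (1 + t * t))) <= 2 * K / (1 + t * t)).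
Proof.
  intros HK. assert (S : 1 <= 1 + t * t) by nra. set (q := (1 + t * t)%R) in *.
  assert (T : 1 + Rabs t <= 2 * q).
  { unfold q. replace (t * t)%R with (Rabs t * Rabs t)%R by (rewrite <- Rabs_mult, Rabs_pos_eq; nra). nra. }
  assert (I : 0 < / q <= 1). { split; [apply Rinv_0_lt_compat; lra|]. rewrite <- Rinv_1. apply Rinv_le_contravar; lra. }
  unfold Rdiv. rewrite Rinv_mult. assert (0 <= K * / q) by (apply Rmult_le_pos; lra). split.
  - rewrite <- Rmult_assoc. nra.
  - replace ((1 + Rabs t) * (K * (/ q * / q)))%R with ((K * / q) * ((1 + Rabs t) * / q))%R by ring.
    replace (2 * K * / q)%R with ((K * / q) * 2)%R by ring. apply Rmult_le_compat_l; auto.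
    apply Rmult_le_reg_r with q; [lra|]. rewrite Rmult_assoc, Rinv_l; lra.
Qed.

Lemma FF_dom_unif sg c R0 Y0 d : Rabs sg < 3/4 -> 0 < c <= R0 -> 0 < d -> 0 <= Y0 ->
  exists K, 0 <= K /\ forall xi eta, box c R0 Y0 d xi eta -> dom (FF sg xi eta) K /\
  forall t, Rabs t * Cmod (FF sg xi eta t) <= K / (1 + t * t).
Proof.
  intros Hs Hc Hd HY. destruct (AA_product_bound sg c R0 Y0 d Hs Hc Hd HY) as [K [Kp H]].
  exists (2 * K)%R. split; [lra|]. intros xi eta B.
  assert (F : forall t, Cmod (FF sg xi eta t) <= K / ((1 + t * t) * (1 + t * t))).
  { intros t. unfold FF. rewrite Cmod_mult. apply (H t xi eta B); auto. }
  assert (G : forall t, (1 + Rabs t) * Cmod (FF sg xi eta t) <= 2 * K / (1 + t * t)).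
  { intros t. eapply Rle_trans; [apply Rmult_le_compat_l; [generalize (Rabs_pos t); lra|apply F]|]. apply inv_sqr_sqr; auto. }
  split; [split|].
  - apply FF_cont; auto.
  - intros t. eapply Rle_trans; [|apply G]. generalize (Cmod_ge_0 (FF sg xi eta t)) (Rabs_pos t). nra.
  - intros t. eapply Rle_trans; [|apply G]. generalize (Cmod_ge_0 (FF sg xi eta t)) (Rabs_pos t). nra.
Qed.

Definition wedge (xi eta : C) : Prop := (Rabs (Im eta) < Re xi) /\ Rabs (Im xi) < Re eta.
Lemma wedge_box xi eta : wedge xi eta -> exists c R0 Y0 d, 0 < c <= R0 /\ 0 < d /\ 0 <= Y0 /\ box c R0 Y0 d xi eta.
Proof.
  intros [H1 H2]. generalize (Rabs_pos (Im xi)) (Rabs_pos (Im eta)). intros P1 P2.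
  exists (Rmin (Re xi) (Re eta)), (Rmax (Re xi) (Re eta)), (Rmax (Rabs (Im xi)) (Rabs (Im eta))), (Rmin (Re xi - Rabs (Im eta)) (Re eta - Rabs (Im xi))).
  unfold box.
  generalize (Rmin_l (Re xi) (Re eta)) (Rmin_r (Re xi) (Re eta)) (Rmax_l (Re xi) (Re eta)) (Rmax_r (Re xi) (Re eta))
   (Rmax_l (Rabs (Im xi)) (Rabs (Im eta))) (Rmax_r (Rabs (Im xi)) (Rabs (Im eta)))
   (Rmin_l (Re xi - Rabs (Im eta)) (Re eta - Rabs (Im xi))) (Rmin_r (Re xi - Rabs (Im eta)) (Re eta - Rabs (Im xi)))
   (Rmin_glb_lt (Re xi) (Re eta) 0 ltac:(lra) ltac:(lra)) (Rmin_glb_lt (Re xi - Rabs (Im eta)) (Re eta - Rabs (Im xi)) 0 ltac:(lra) ltac:(lra)).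
  intros. repeat split; lra.
Qed.

(** ** The quadrant where both factors are Laplace transforms *)

Lemma lapw_1exp f b b' K : lapw f b b' K -> lapw (fun v => RtoC (1 + exp v) * f v) b (b' + 1) (4 * K).
Proof.
  intros [H1 [H2 [H3 [H4 H5]]]]. repeat split; try lra.
  - intros v. specialize (H4 v). cc.
  - intros v. rewrite Cmod_mult, Cmod_R, Rabs_pos_eq by (generalize (exp1_pos v); lra).
    assert (X : forall x, b <= x <= b' + 1 -> exp (x * v) <= exp (b * v) + exp ((b' + 1) * v)).
    { intros x Hx. destruct (Rle_dec 0 v).
      - apply Rle_trans with (exp ((b' + 1) * v)); [apply exp_le; nra|generalize (exp_pos (b * v)); lra].
      - apply Rle_trans with (exp (b * v)); [apply exp_le; nra|generalize (exp_pos ((b' + 1) * v)); lra]. }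
    assert (Y : ((1 + exp v) * (exp (b * v) + exp (b' * v)) = exp (b * v) + exp (b' * v) + exp ((b + 1) * v) + exp ((b' + 1) * v))%R).
    { replace ((b + 1) * v)%R with (v + b * v)%R by ring. replace ((b' + 1) * v)%R with (v + b' * v)%R by ring. rewrite !exp_plus. ring. }
    assert (Z := X b ltac:(lra)). assert (Z1 := X b' ltac:(lra)). assert (Z2 := X (b + 1)%R ltac:(lra)). assert (Z3 := X (b' + 1)%R ltac:(lra)).
    apply Rle_trans with ((1 + exp v) * (K * (exp (b * v) + exp (b' * v))))%R; [apply Rmult_le_compat_l; [generalize (exp1_pos v); lra|apply H5]|].
    replace ((1 + exp v) * (K * (exp (b * v) + exp (b' * v))))%R with (K * ((1 + exp v) * (exp (b * v) + exp (b' * v))))%R by ring.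
    rewrite Y. replace (4 * K * (exp (b * v) + exp ((b' + 1) * v)))%R with (K * (4 * (exp (b * v) + exp ((b' + 1) * v))))%R by ring. apply Rmult_le_compat_l; lra.
Qed.

(** The integrand of the Laplace representation without the factor that depends on t. *)
Definition lapf (c : C) (sg : R) (v : R) : C := Cexp (- c * RtoC (exp v)) * fa (1 / 4 - RtoC sg) v.
Lemma fa_quarter_lapw sg : Rabs sg < 3/4 -> exists b b', lapw (fa (1 / 4 - RtoC sg)) b b' 1.
Proof. intros H. apply Rabs_def2 in H. do 2 eexists. apply fa_lapw. replace (Re (1 / 4 - RtoC sg)) with (1 / 4 - sg)%R by (unfold Re; simpl; field). lra. Qed.

Lemma lapf_dom c sg : 0 < Re c -> Rabs sg < 3/4 -> exists M, dom (lapf c sg) M /\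
  dom (fun v => lapf c sg v * RtoC (1 + exp v)) M /\
  (forall v, Cmod (lapf c sg v) * (1 + exp v) <= M) /\ (forall v, Cmod (lapf c sg v) * (1 + exp v) * (1 + exp v) * (1 + exp v) <= M).
Proof.
  intros Hc Hs. destruct (fa_quarter_lapw sg Hs) as [b [b' L0]].
  assert (L1 := lapw_1exp _ _ _ _ L0). assert (L2 := lapw_1exp _ _ _ _ L1). assert (L3 := lapw_1exp _ _ _ _ L2).
  destruct (Lap_dom _ _ _ _ c L0 Hc) as [M0 D0]. destruct (Lap_dom _ _ _ _ c L1 Hc) as [M1 D1]. destruct (Lap_dom _ _ _ _ c L3 Hc) as [M3 D3].
  assert (P0 := dom_pos _ _ D0). assert (P1 := dom_pos _ _ D1). assert (P3 := dom_pos _ _ D3).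
  exists (M0 + M1 + M3)%R.
  assert (B : forall f M v, dom f M -> Cmod (f v) <= M).
  { intros f M v Df. eapply Rle_trans; [apply Df|]. assert (Q := dom_pos _ _ Df). apply Rmult_le_reg_r with (1 + v * v)%R; [apply sqr1_pos|].
    unfold Rdiv. rewrite Rmult_assoc, Rinv_l by (generalize (sqr1_pos v); lra). nra. }
  split; [apply (dom_le _ M0); [exact D0|lra]|]. split; [|split].
  - apply (dom_le _ M1); [|lra]. eapply dom_ext; [|exact D1]. intros v. cbv beta. unfold lapf. ring.
  - intros v. assert (Q := B _ _ v D1). cbv beta in Q. unfold lapf. rewrite !Cmod_mult, Cmod_R, Rabs_pos_eq in Q by (generalize (exp1_pos v); lra).
    rewrite Cmod_mult. lra.
  - intros v. assert (Q := B _ _ v D3). cbv beta in Q. unfold lapf. rewrite !Cmod_mult, !Cmod_R, Rabs_pos_eq in Q by (generalize (exp1_pos v); lra).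
    rewrite Cmod_mult. lra.
Qed.

Lemma lapf_dR c sg v : dR (lapf c sg) v ((- c * RtoC (exp v) + (3/4 - RtoC sg) - (1/4 - RtoC sg) * RtoC (exp v / (1 + exp v))) * lapf c sg v).
Proof.
  unfold lapf, fa. eapply dR_eq.
  - apply dR_mult.
    + apply dR_Cexp. apply dR_mult; [apply dR_const|]. apply dR_RtoC. apply is_derive_exp.
    + apply dR_Cexp. apply dR_minus.
      * apply dR_mult; [apply dR_const|apply dR_id].
      * apply dR_mult; [apply dR_const|]. apply dR_RtoC, ell_derive.
  - cbv beta. field.
Qed.

Lemma fa_pp s t v sg : s = vline sg t -> fa (1 / 4 - s) v = fa (1 / 4 - RtoC sg) v * Cexp (Ci * RtoC (t * phase v)).
Proof.
  intros ->. unfold fa, vline. rewrite <- Cexp_plus. f_equal. rewrite phase_ell. rewrite RtoC_mult, RtoC_minus. ring.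
Qed.

(** The two factors are transforms in the same phase with opposite signs, so that Parseval's
    formula leaves a single integral. *)
Lemma FF_quadrant sg xi eta : Rabs sg < 3/4 -> wedge xi eta -> 0 < Re xi -> 0 < Im xi -> 0 < Re eta -> 0 < Im eta ->
  II (FF sg xi eta) = Cexp (- (3 / 2) * RtoC (ln 2)) * (- 2 * Ci) * (xi * eta) * (2 * RtoC PI) *
    (Cexp (Ci * (xi * xi + eta * eta) / 2) * II (fun v => Cexp (Ci * (xi * xi + eta * eta) * RtoC (exp v) + 3 / 2 * RtoC v + 1 / 2 * RtoC (ell v)))).
Proof.
  intros Hs Hw X1 X2 Y1 Y2.
  destruct (wedge_box _ _ Hw) as [c [R0 [Y0 [d [Hc [Hd [HY0 B]]]]]]].
  destruct (FF_dom_unif sg c R0 Y0 d Hs Hc Hd HY0) as [K [Kp HK]]. destruct (HK xi eta B) as [DF TF]. clear HK.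
  assert (Rx : 0 < Re (- Ci * (xi * xi))) by (unfold Re, Im in *; simpl; nra).
  assert (Ry : 0 < Re (- Ci * (eta * eta))) by (unfold Re, Im in *; simpl; nra).
  set (cx := - Ci * (xi * xi)) in *. set (cy := - Ci * (eta * eta)) in *.
  assert (Hs' : Rabs (- sg) < 3/4) by (rewrite Rabs_Ropp; auto).
  destruct (lapf_dom cx sg Rx Hs) as [Ma [A0 [A1 _]]]. destruct (lapf_dom cy (- sg) Ry Hs') as [Mb [B0 [B1 [B2 B3]]]].
  set (a := lapf cx sg) in *. set (b := lapf cy (- sg)) in *.
  set (px := fun s => Cexp ((s - 3 / 4) * RtoC (ln 2)) * ((1 - Ci) * xi) * Cexp (Ci * (xi * xi) / 2)).
  set (py := fun s => Cexp ((s - 3 / 4) * RtoC (ln 2)) * ((1 - Ci) * eta) * Cexp (Ci * (eta * eta) / 2)).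
  set (pf := Cexp (- (3 / 2) * RtoC (ln 2)) * (- 2 * Ci) * (xi * eta) * Cexp (Ci * (xi * xi + eta * eta) / 2)).
  assert (pfE : forall s, px s * py (- s) = pf).
  { intros s. unfold px, py, pf. replace (- (3 / 2) * RtoC (ln 2)) with ((s - 3 / 4) * RtoC (ln 2) + (- s - 3 / 4) * RtoC (ln 2)) by field.
    replace (Ci * (xi * xi + eta * eta) / 2) with (Ci * (xi * xi) / 2 + Ci * (eta * eta) / 2) by field.
    replace (- 2 * Ci) with ((1 - Ci) * (1 - Ci)) by (ceq; ring). rewrite !Cexp_plus. ring. }
  assert (ex : xi <> 0) by (intros ->; simpl in X1; lra). assert (ey : eta <> 0) by (intros ->; simpl in Y1; lra).
  assert (pfn : pf <> 0).
  { unfold pf. assert (i2 : - 2 * Ci <> 0) by (intros H; apply (f_equal Im) in H; simpl in H; lra).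
    apply Cmult_neq_0; [|apply Cexp_neq_0]. apply Cmult_neq_0; [|apply Cmult_neq_0; auto]. apply Cmult_neq_0; [apply Cexp_neq_0|exact i2]. }
  assert (pxn : forall s, px s <> 0 /\ py (- s) <> 0).
  { intros s. assert (H := pfn). rewrite <- (pfE s) in H. split; intros E; apply H; rewrite E; ring. }
  assert (EA : forall t, AA (vline sg t) xi = px (vline sg t) * II (fun v => a v * Cexp (Ci * RtoC (t * phase v)))).
  { intros t. rewrite AA_laplace by (auto; apply vline_strip; auto). fold cx. unfold px. f_equal. unfold Lap. apply II_ext. intros v. 
    rewrite (fa_pp _ t v sg) by reflexivity. unfold a, lapf. ring. }
  assert (EB : forall t, AA (- vline sg t) eta = py (- vline sg t) * II (fun v => b v * Cexp (- (Ci * RtoC (t * phase v))))).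
  { intros t. rewrite AA_laplace by (auto; apply strip_opp, vline_strip; auto). fold cy. unfold py. f_equal. unfold Lap. apply II_ext. intros v. 
    rewrite (fa_pp _ (- t) v (- sg)) by apply vline_opp. unfold b, lapf. rewrite <- Cmult_assoc. do 3 f_equal. ceq; ring. }
  set (A := fun t => II (fun v => a v * Cexp (Ci * RtoC (t * phase v)))).
  set (BB := fun t => II (fun v => b v * Cexp (- (Ci * RtoC (t * phase v))))).
  assert (FE : forall t, FF sg xi eta t = pf * (A t * BB t)).
  { intros t. unfold FF. rewrite EA, EB, <- (pfE (vline sg t)). unfold A, BB. ring. }
  assert (FE' : forall t, A t * BB t = / pf * FF sg xi eta t) by (intros t; rewrite FE; field; auto).
  assert (DAB := dom_ext _ _ _ (fun t => eq_sym (FE' t)) (dom_scal _ (/ pf) _ DF)).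
  set (be := fun v => b v * RtoC (1 + exp v)).
  set (g := fun v => - cy * RtoC (exp v) + (3/4 - RtoC (- sg)) - (1/4 - RtoC (- sg)) * RtoC (exp v / (1 + exp v))).
  assert (gb : forall v, Cmod (g v) <= (Cmod cy + 3) * (1 + exp v)).
  { intros v. unfold g. assert (ev := exp_pos v).
    assert (r1 : Rabs (3 / 4 - - sg) <= 3/2) by (apply Rabs_def2 in Hs; apply Rabs_le; lra).
    assert (r2 : Rabs (1 / 4 - - sg) <= 1) by (apply Rabs_def2 in Hs; apply Rabs_le; lra).
    assert (r3 : 0 <= exp v / (1 + exp v) <= 1).
    { split; [left; apply Rdiv_lt_0_compat; lra|]. apply Rmult_le_reg_r with (1 + exp v)%R; [lra|]. unfold Rdiv. rewrite Rmult_assoc, Rinv_l; lra. }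
    rewrite C34. replace (1 / 4) with (RtoC (1 / 4)) by (rewrite RtoC_div; [reflexivity|lra]). rewrite <- !RtoC_minus, <- RtoC_mult.
    triangle. rewrite Cmod_opp. 
    assert (Q := Cmod_triangle (- cy * RtoC (exp v)) (RtoC (3 / 4 - - sg))). rewrite Cmod_mult, Cmod_opp, !Cmod_R, (Rabs_pos_eq (exp v)) in Q by lra.
    rewrite Cmod_R, Rabs_mult, (Rabs_pos_eq (exp v / _)) by lra. generalize (Cmod_ge_0 cy) (Rabs_pos (1 / 4 - - sg)). intros. nra. }
  rewrite (II_ext _ _ FE), (II_scal _ _ _ DAB).
  assert (K1' := Cmod_ge_0 (/ pf)). assert (K2' := Cmod_ge_0 cy).
  rewrite (parseval a b be (fun v => g v * b v * RtoC (1 + exp v) + b v * RtoC (exp v)) A BB Ma Mb (Cmod (/ pf) * K) Mb ((Cmod cy + 4) * Mb)); auto.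
  - unfold pf. transitivity (pf * (2 * RtoC PI * II (fun v => Cexp (Ci * (xi * xi + eta * eta) * RtoC (exp v) + 3 / 2 * RtoC v + 1 / 2 * RtoC (ell v))))); [|unfold pf; ring].
    unfold pf. do 2 f_equal. apply II_ext. intros v. unfold be, a, b, lapf, fa. rewrite <- exp_ell, <- (Cexp_R (ell v)).
    rewrite !Cmult_assoc, <- !Cexp_plus. 
    transitivity (Cexp (- cx * RtoC (exp v) + ((1 / 4 - RtoC sg + 1 / 2) * RtoC v - (1 / 4 - RtoC sg) * RtoC (ell v)) + (- cy * RtoC (exp v) + ((1 / 4 - RtoC (- sg) + 1 / 2) * RtoC v - (1 / 4 - RtoC (- sg)) * RtoC (ell v)) + RtoC (ell v)))).
    + rewrite !Cexp_plus. ring.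
    + f_equal. unfold cx, cy. rewrite RtoC_opp. field.
  - intros w. unfold be. rewrite <- Cmult_assoc, <- RtoC_mult. unfold rate. rewrite Rinv_r by (generalize (exp1_pos w); lra). ring.
  - intros w. unfold be. eapply dR_eq; [apply dR_mult; [apply lapf_dR|apply dR_RtoC]|].
    + apply (is_derive_plus (fun _ => 1%R) exp w 0%R (exp w)); [apply (is_derive_const (V := R_NormedModule))|apply is_derive_exp].
    + fold b. rewrite Rplus_0_l. unfold g. ring.
  - intros w. unfold be. rewrite Cmod_mult, Cmod_R, Rabs_pos_eq by (generalize (exp1_pos w); lra). apply B2.
  - intros w. assert (ew := exp_pos w). unfold rate. apply Rmult_le_reg_r with (1 + exp w)%R; [lra|]. rewrite Rmult_assoc, Rinv_l, Rmult_1_r by lra.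
    apply Rle_trans with ((Cmod cy + 4) * (Cmod (b w) * (1 + exp w) * (1 + exp w) * (1 + exp w)))%R; [|apply Rmult_le_compat_l; [lra|apply B3]].
    replace ((Cmod cy + 4) * (Cmod (b w) * (1 + exp w) * (1 + exp w) * (1 + exp w)))%R with (((Cmod cy + 4) * (Cmod (b w) * (1 + exp w) * (1 + exp w))) * (1 + exp w))%R by ring.
    apply Rmult_le_compat_r; [lra|]. triangle. rewrite !Cmod_mult, !Cmod_R, !Rabs_pos_eq by lra.
    assert (P := Cmod_ge_0 (b w)). specialize (gb w).
    assert (Cmod (g w) * (Cmod (b w) * (1 + exp w)) <= (Cmod cy + 3) * (1 + exp w) * (Cmod (b w) * (1 + exp w))) by (apply Rmult_le_compat_r; [nra|auto]).
    assert (Cmod (b w) * exp w <= Cmod (b w) * ((1 + exp w) * (1 + exp w))) by (apply Rmult_le_compat_l; nra). nra.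
  - intros t. apply (continuous_ext (fun t => / py (- vline sg t) * AA (- vline sg t) eta)).
    + intros u. rewrite EB, Cmult_assoc, Cinv_l, Cmult_1_l; [reflexivity|apply pxn].
    + apply cC_mult; [|apply AA_cont_opp; auto]. apply cC_inv; [|apply pxn]. unfold py, vline. cc.
  - intros t. rewrite FE', Cmod_mult. replace (Rabs t * (Cmod (/ pf) * Cmod (FF sg xi eta t)))%R with (Cmod (/ pf) * (Rabs t * Cmod (FF sg xi eta t)))%R by ring.
    unfold Rdiv. rewrite (Rmult_assoc (Cmod (/ pf))). apply Rmult_le_compat_l; auto.
Qed.

(** ** Hyperbolic substitutions *)

Lemma cosh_ge1 t : 1 <= cosh t.
Proof. unfold cosh. generalize (exp_ineq1_le t) (exp_ineq1_le (- t)). lra. Qed.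

Lemma cosh2_sinh2 t : (cosh t * cosh t = 1 + sinh t * sinh t)%R.
Proof.
  unfold cosh, sinh. assert (E : (exp t * exp (- t) = 1)%R) by (rewrite <- exp_plus, Rplus_opp_r; apply exp_0). nra.
Qed.

Lemma sinh_ge t : 0 <= t -> t <= sinh t.
Proof.
  intros Ht. cut (t - sinh t <= 0 - sinh 0); [rewrite sinh_0; lra|].
  apply (Rderiv_nonpos (fun t => t - sinh t)%R (fun t => 1 - cosh t)%R 0 t Ht).
  - intros u _. apply (is_derive_minus (fun u => u) sinh); [apply (is_derive_id (K := R_AbsRing))|apply is_derive_Reals, derivable_pt_lim_sinh].
  - intros u _. generalize (cosh_ge1 u); lra.
Qed.

Lemma cosh_pos t : 0 < cosh t. Proof. generalize (cosh_ge1 t); lra. Qed.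
Lemma arcsinh_bounds x : 0 <= x -> 0 <= arcsinh x <= x.
Proof.
  intros Hx. split.
  - rewrite <- arcsinh_0. apply arcsinh_le; auto.
  - rewrite <- (arcsinh_sinh x) at 2. apply arcsinh_le, sinh_ge; auto.
Qed.

Lemma arcsinh_derive (g : R -> R) t g' : is_derive g t g' -> is_derive (fun t => arcsinh (g t)) t (g' / sqrt (g t * g t + 1))%R.
Proof.
  intros H. apply (is_derive_comp arcsinh g t (/ sqrt (g t * g t + 1))%R g'); auto.
  apply is_derive_Reals. replace (g t * g t)%R with (g t ^ 2)%R by ring. apply derivable_pt_lim_arcsinh.
Qed.

(** The substitution is made in a primitive of f, so that no improper integral in y occurs. *)
Lemma substitution_limit f (q : R -> C) (y y' : R -> R) M : cont f -> (forall v, is_derive y v (y' v)) ->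
  (forall v, q v = RtoC (y' v) * f (y v)) -> dom q M -> (forall v, v <= 0 -> 0 <= y v <= 2 * exp (v / 2)) ->
  forall eps, 0 < eps -> exists N, forall v, N < v -> Cmod (CI f 0 (y v) - II q) < eps.
Proof.
  intros Hf Hy Hq Dq Hb eps He.
  assert (G : forall x, dR (fun x => CI f 0 x) x (f x)).
  { intros x. apply (is_derive_RInt (V := C_R_CompleteNormedModule) f (fun x => CI f 0 x) 0 x); [|apply Hf].
    apply filter_forall. intros z. apply CI_correct; auto. }
  assert (G0 : CI f 0 0 = 0) by (apply CI_unique, (is_RInt_point (V := C_R_CompleteNormedModule))).
  assert (C0 := proj1 (continuous_C_eps _ _) (dR_continuous _ _ _ (G 0%R)) (eps / 2)%R ltac:(lra)).
  destruct C0 as [[d dp] Hd]. simpl in Hd.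
  destruct (is_II_eps q _ (proj1 Dq) (dom_is_II _ _ Dq) (eps / 2) ltac:(lra)) as [N HN].
  set (a := (Rmin (Rmin (- N) 0) (2 * ln (d / 4)) - 1)%R).
  assert (a1 : a < - N) by (unfold a; generalize (Rmin_l (Rmin (- N) 0) (2 * ln (d / 4))) (Rmin_l (- N) 0); lra).
  assert (a2 : a < 0) by (unfold a; generalize (Rmin_l (Rmin (- N) 0) (2 * ln (d / 4))) (Rmin_r (- N) 0); lra).
  assert (a3 : a < 2 * ln (d / 4)) by (unfold a; generalize (Rmin_r (Rmin (- N) 0) (2 * ln (d / 4))); lra).
  assert (ya : 0 <= y a <= d / 2).
  { destruct (Hb a ltac:(lra)) as [B1 B2]. split; auto. eapply Rle_trans; [exact B2|].
    replace (d / 2)%R with (2 * (d / 4))%R by field. apply Rmult_le_compat_l; [lra|].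
    rewrite <- (exp_ln (d / 4)) by lra. apply exp_le. lra. }
  assert (Sa : Cmod (CI f 0 (y a)) < eps / 2).
  { replace (CI f 0 (y a)) with (CI f 0 (y a) - CI f 0 0) by (rewrite G0; ring). apply Hd.
    change (Rabs (y a - 0) < d). rewrite Rminus_0_r, Rabs_pos_eq; lra. }
  exists N. intros v Hv. specialize (HN a v a1 Hv).
  rewrite (CI_FTC (fun v => CI f 0 (y v)) q) in HN.
  - replace (CI f 0 (y v) - II q) with ((CI f 0 (y v) - CI f 0 (y a) - II q) + CI f 0 (y a)) by ring.
    eapply Rle_lt_trans; [apply Cmod_triangle|]. lra.
  - intros w. rewrite Hq. apply (dR_comp_R (fun x => CI f 0 x) y); auto.
  - apply Dq.
Qed.

(** ** Rotation of the contour from the half-line [1, oo) to [1, 0] and [0, i oo) *)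

Definition Ccosh (w : C) : C := (Cexp w + Cexp (- w)) / 2.
Definition Csinh (w : C) : C := (Cexp w - Cexp (- w)) / 2.
Lemma exp_opp_dC w : dC (fun w => Cexp (- w)) w (- Cexp (- w)).
Proof. eapply dC_eq; [apply dC_Cexp, dC_opp, dC_id|]. ring. Qed.

Lemma Ccosh_dC w : dC Ccosh w (Csinh w).
Proof.
  unfold Ccosh, Csinh, Cdiv. eapply dC_eq; [apply dC_mult; [apply dC_plus; [apply dC_exp|apply exp_opp_dC]|apply dC_const]|]. cbv beta. ring.
Qed.

Lemma Csinh_dC w : dC Csinh w (Ccosh w).
Proof.
  unfold Ccosh, Csinh, Cdiv. eapply dC_eq; [apply dC_mult; [apply dC_minus; [apply dC_exp|apply exp_opp_dC]|apply dC_const]|]. cbv beta. ring.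
Qed.

Lemma Cexp_opp_line y p : Cexp (- (RtoC y + Ci * RtoC p)) = RtoC (exp (- y)) * (RtoC (cos p) - Ci * RtoC (sin p)).
Proof.
  replace (- (RtoC y + Ci * RtoC p)) with (RtoC (- y) + Ci * RtoC (- p)) by (ceq; ring).
  rewrite Cexp_line, cos_neg, sin_neg, RtoC_opp. ring.
Qed.

Lemma Ccosh_line y p : Ccosh (RtoC y + Ci * RtoC p) = RtoC (cosh y * cos p) + Ci * RtoC (sinh y * sin p).
Proof. unfold Ccosh. rewrite Cexp_line, Cexp_opp_line. unfold cosh, sinh. ceq; field. Qed.

Lemma Csinh_line y p : Csinh (RtoC y + Ci * RtoC p) = RtoC (sinh y * cos p) + Ci * RtoC (cosh y * sin p).
Proof. unfold Csinh. rewrite Cexp_line, Cexp_opp_line. unfold cosh, sinh. ceq; field. Qed.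

(** The integrand e^(izx) sqrt (x^2 - 1) dx at x = cosh w, where it is entire. *)
Definition hf (z w : C) : C := Cexp (Ci * z * Ccosh w) * (Csinh w * Csinh w).
Definition hf' (z w : C) : C := Cexp (Ci * z * Ccosh w) * (Ci * z * Csinh w * (Csinh w * Csinh w) + 2 * (Csinh w * Ccosh w)).
Lemma hf_dC z w : dC (hf z) w (hf' z w).
Proof.
  unfold hf, hf'. eapply dC_eq.
  - apply dC_mult; [apply dC_Cexp; apply dC_mult; [apply dC_const|apply Ccosh_dC]|apply dC_mult; apply Csinh_dC].
  - cbv beta. ring.
Qed.

Lemma Ccosh_cont w : continuous Ccosh w. Proof. eapply dC_continuous, Ccosh_dC. Qed.
Lemma Csinh_cont w : continuous Csinh w. Proof. eapply dC_continuous, Csinh_dC. Qed.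
Lemma hf'_cont z w : continuous (hf' z) w.
Proof. generalize (Ccosh_cont w) (Csinh_cont w). intros. unfold hf'. cc. Qed.

Lemma hf_bottom z y : hf z (RtoC y) = Cexp (Ci * z * RtoC (cosh y)) * RtoC (sinh y * sinh y).
Proof.
  unfold hf. replace (RtoC y) with (RtoC y + Ci * RtoC 0) by ring. rewrite Ccosh_line, Csinh_line, cos_0, sin_0.
  rewrite !Rmult_1_r, !Rmult_0_r, RtoC_mult, !Cmult_0_r, !Cplus_0_r. reflexivity.
Qed.

Lemma hf_top z y : hf z (RtoC y + Ci * RtoC (PI / 2)) = - (Cexp (- z * RtoC (sinh y)) * RtoC (cosh y * cosh y)).
Proof.
  unfold hf. rewrite Ccosh_line, Csinh_line, cos_PI2, sin_PI2.
  rewrite !Rmult_1_r, !Rmult_0_r, RtoC_mult.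
  replace (Ci * z * (RtoC 0 + Ci * RtoC (sinh y))) with (- z * RtoC (sinh y)) by (ceq; ring).
  replace ((RtoC 0 + Ci * RtoC (cosh y)) * (RtoC 0 + Ci * RtoC (cosh y))) with (- (RtoC (cosh y) * RtoC (cosh y))) by (ceq; ring). ring.
Qed.

Lemma hf_left z p : hf z (RtoC 0 + Ci * RtoC p) = - (Cexp (Ci * z * RtoC (cos p)) * RtoC (sin p * sin p)).
Proof.
  unfold hf. rewrite Ccosh_line, Csinh_line, cosh_0, sinh_0, !Rmult_0_l, !Rmult_1_l, RtoC_mult.
  replace (RtoC (cos p) + Ci * RtoC 0) with (RtoC (cos p)) by ring.
  replace ((RtoC 0 + Ci * RtoC (sin p)) * (RtoC 0 + Ci * RtoC (sin p))) with (- (RtoC (sin p) * RtoC (sin p))) by (ceq; ring). ring.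
Qed.

(** A quarter period of the circle; the even part in z is Poisson's integral. *)
Definition SS z : C := CI (fun p => Cexp (Ci * z * RtoC (cos p)) * RtoC (sin p * sin p)) 0 (PI / 2).
(** Lap kw z is the integral of e^(-zu) sqrt (1 + u^2) over the half-line, u = e^v. *)
Definition kw (v : R) : C := Cexp (RtoC (v + ell (2 * v) / 2)).
(** The integral of e^(izx) sqrt (x^2 - 1) over [1, oo), along the path [1, 0] and [0, i oo):
    the condition Im z > 0 is replaced by Re z > 0. *)
Definition NN z : C := - Ci * SS z - Lap kw z.
Lemma kw_lapw : lapw kw 1 2 1.
Proof.
  split; [lra|split; [lra|split; [lra|split]]].
  - intros v. unfold kw. cc; [apply (cR_comp ell (fun v => 2 * v)%R); [cc|apply ell_cont]|lra].
  - intros v. unfold kw. rewrite Cexp_R, Cmod_R, Rabs_pos_eq by (left; apply exp_pos). rewrite exp_plus, Rmult_1_l.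
    assert (B : exp (ell (2 * v) / 2) <= 1 + exp v).
    { assert (Q : (exp (ell (2 * v) / 2) * exp (ell (2 * v) / 2) = 1 + exp v * exp v)%R).
      { rewrite <- exp_plus. replace (ell (2 * v) / 2 + ell (2 * v) / 2)%R with (ell (2 * v)) by field.
        rewrite exp_ell. f_equal. rewrite <- exp_plus. f_equal. ring. }
      generalize (exp_pos v) (exp_pos (ell (2 * v) / 2)). nra. }
    replace (2 * v)%R with (v + v)%R at 2 by ring. rewrite exp_plus, Rmult_1_l. generalize (exp_pos v). nra.
Qed.

(** Green's formula on [0, Y] x [0, pi/2]; the right edge is the error term. *)
Lemma contour_identity z Y : 0 <= Y ->
  CI (fun y => hf z (RtoC y)) 0 Y + CI (fun y => Cexp (- z * RtoC (sinh y)) * RtoC (cosh y * cosh y)) 0 Y + Ci * SS z =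
  - (Ci * CI (fun p => hf z (RtoC Y + Ci * RtoC p)) 0 (PI / 2)).
Proof.
  intros HY. assert (P := PI_RGT_0).
  assert (hc : forall w, continuous (hf z) w) by (intros w; eapply dC_continuous, hf_dC).
  assert (lc : forall y, cont (fun p => hf z (RtoC y + Ci * RtoC p))) by (intros y p; apply (cC_comp (hf z)); [cc|auto]).
  assert (bc : forall p, cont (fun y => hf z (RtoC y + Ci * RtoC p))) by (intros y p; apply (cC_comp (hf z)); [cc|auto]).
  assert (G := green (fun y p => Ci * hf z (RtoC y + Ci * RtoC p)) (fun y p => hf z (RtoC y + Ci * RtoC p))
    (fun y p => Ci * hf' z (RtoC y + Ci * RtoC p)) 0 Y 0 (PI / 2) HY ltac:(lra)).
  rewrite (CI_minus (fun p => Ci * hf z (RtoC Y + Ci * RtoC p)) (fun p => Ci * hf z (RtoC 0 + Ci * RtoC p))) in G.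
  2,3: intros p; apply cC_mult; [apply cC_const|apply lc].
  rewrite (CI_minus (fun y => hf z (RtoC y + Ci * RtoC (PI / 2))) (fun y => hf z (RtoC y + Ci * RtoC 0))) in G by apply bc.
  rewrite !CI_scal in G by apply lc.
  rewrite (CI_ext (fun y => hf z (RtoC y + Ci * RtoC 0)) (fun y => hf z (RtoC y))) in G by (intros; f_equal; ring).
  rewrite (CI_ext (fun y => hf z (RtoC y + Ci * RtoC (PI / 2))) (fun y => - (Cexp (- z * RtoC (sinh y)) * RtoC (cosh y * cosh y)))) in G by (intros; apply hf_top).
  rewrite (CI_ext (fun p => hf z (RtoC 0 + Ci * RtoC p)) (fun p => - (Cexp (Ci * z * RtoC (cos p)) * RtoC (sin p * sin p)))) in G by (intros; apply hf_left).
  rewrite !CI_opp in G.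
  - unfold SS. rewrite <- (Cplus_0_r (- (Ci * _))). 
    set (X := CI (fun p => Cexp (Ci * z * RtoC (cos p)) * RtoC (sin p * sin p)) 0 (PI / 2)) in *.
    set (V := CI (fun p => hf z (RtoC Y + Ci * RtoC p)) 0 (PI / 2)) in *.
    set (U := CI (fun y => Cexp (- z * RtoC (sinh y)) * RtoC (cosh y * cosh y)) 0 Y) in *.
    set (H := CI (fun y => hf z (RtoC y)) 0 Y) in *.
    assert (E : H = - U - (Ci * V - Ci * - X)). { rewrite G; [ring| | |].
      - intros y p _ _. eapply dR_eq; [apply (dR_mult (fun _ => Ci)); [apply dR_const|apply (dR_comp (hf z) (fun y => RtoC y + Ci * RtoC p)); [apply hf_dC|apply dR_plus; [apply dR_id|apply dR_const]]]|]. dring.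
      - intros y p _ _. eapply dR_eq; [apply (dR_comp (hf z) (fun p => RtoC y + Ci * RtoC p)); [apply hf_dC|apply dR_plus; [apply dR_const|apply dR_mult; [apply dR_const|apply dR_id]]]|]. dring.
      - intros y p _. apply cC_mult; [apply cC_const|]. apply (cC_comp (hf' z)); [cc|apply hf'_cont]. }
    rewrite E. ring.
  - intros y. unfold sinh, cosh. cc; lra.
  - intros p. cc.
Qed.

(** On the right edge the exponential is at most e^(- m sinh Y), m = min (Re z, Im z). *)
Lemma right_edge_small z eps : 0 < Re z -> 0 < Im z -> 0 < eps -> exists Y0, forall Y, Y0 < Y -> 
  Cmod (CI (fun p => hf z (RtoC Y + Ci * RtoC p)) 0 (PI / 2)) < eps.
Proof.
  intros Hr Hi He. set (m := Rmin (Re z) (Im z)). assert (mp : 0 < m) by (apply Rmin_glb_lt; auto).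
  assert (P := PI_RGT_0).
  set (T := (128 / (m * m * (m * m)))%R). assert (Tp : 0 < T) by (apply Rdiv_lt_0_compat; [lra|repeat apply Rmult_lt_0_compat; auto]).
  exists (Rmax 1 (T * PI / eps)). intros Y HY.
  assert (Y1 : 1 < Y) by (generalize (Rmax_l 1 (T * PI / eps)); lra).
  assert (Y2 : T * PI / eps < Y) by (generalize (Rmax_r 1 (T * PI / eps)); lra).
  assert (SY := sinh_ge Y ltac:(lra)). set (S := sinh Y) in *.
  assert (B : forall p, 0 <= p <= PI / 2 -> Cmod (hf z (RtoC Y + Ci * RtoC p)) <= T / S).
  { intros p Hp. unfold hf. rewrite Ccosh_line, Csinh_line. fold S.
    assert (cp : 0 <= cos p) by (apply cos_ge_0; lra). assert (sp : 0 <= sin p) by (apply sin_ge_0; lra).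
    assert (sc : (sin p * sin p + cos p * cos p = 1)%R) by (generalize (sin2_cos2 p); unfold Rsqr; auto).
    assert (cs : (cosh Y * cosh Y = 1 + S * S)%R) by apply cosh2_sinh2.
    assert (cS : S <= cosh Y) by (generalize (cosh_pos Y); nra).
    set (w := RtoC (S * cos p) + Ci * RtoC (cosh Y * sin p)).
    assert (Mw : Cmod (w * w) <= 1 + S * S).
    { rewrite Cmod_mult, Cmod_sqr. unfold w, Re, Im; simpl. 
      replace ((S * cos p + (0 * (cosh Y * sin p) - 1 * 0)) * (S * cos p + (0 * (cosh Y * sin p) - 1 * 0)) + (0 + (0 * 0 + 1 * (cosh Y * sin p))) * (0 + (0 * 0 + 1 * (cosh Y * sin p))))%R
        with (S * S * (cos p * cos p) + cosh Y * cosh Y * (sin p * sin p))%R by ring. rewrite cs. nra. }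
    rewrite Cmod_mult, Cmod_Cexp.
    assert (Ex : Re (Ci * z * (RtoC (cosh Y * cos p) + Ci * RtoC (S * sin p))) <= - (m * S)).
    { replace (Re (Ci * z * (RtoC (cosh Y * cos p) + Ci * RtoC (S * sin p)))) with (- (Re z * (S * sin p) + Im z * (cosh Y * cos p)))%R by reim.
      assert (m1 : m <= Re z) by apply Rmin_l. assert (m2 : m <= Im z) by apply Rmin_r.
      assert (q1 : m * (S * sin p) <= Re z * (S * sin p)) by (apply Rmult_le_compat_r; auto; apply Rmult_le_pos; lra).
      assert (q2 : m * (S * cos p) <= Im z * (cosh Y * cos p)) by (apply Rmult_le_compat; try lra; [apply Rmult_le_pos; lra|apply Rmult_le_compat_r; lra]).
      assert (q3 : 1 <= sin p + cos p) by nra.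
      assert (q4 : m * S * 1 <= m * S * (sin p + cos p)) by (apply Rmult_le_compat_l; [apply Rmult_le_pos; lra|auto]). lra. }
    assert (E2 : m * m * (m * m) * (S * S * (S * S)) / 64 <= exp (m * S)).
    { assert (A := exp_ge_sqr (m * S / 2) ltac:(apply Rmult_le_pos; [apply Rmult_le_pos; lra|lra])).
      replace (exp (m * S)) with (exp (m * S / 2) * exp (m * S / 2))%R by (rewrite <- exp_plus; f_equal; field).
      replace (m * m * (m * m) * (S * S * (S * S)) / 64)%R with ((m * S / 2 * (m * S / 2) / 2) * (m * S / 2 * (m * S / 2) / 2))%R by field.
      assert (0 <= m * S / 2 * (m * S / 2) / 2) by nra. apply Rmult_le_compat; auto. }
    apply Rle_trans with (exp (- (m * S)) * (1 + S * S))%R.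
    { apply Rmult_le_compat; auto using Cmod_ge_0. left; apply exp_pos. apply exp_le, Ex. }
    rewrite exp_Ropp. set (E := exp (m * S)) in *. assert (Ep : 0 < E) by apply exp_pos.
    apply Rmult_le_reg_r with (E * S)%R; [apply Rmult_lt_0_compat; lra|].
    replace (/ E * (1 + S * S) * (E * S))%R with ((1 + S * S) * S)%R by (field; lra).
    replace (T / S * (E * S))%R with (T * E)%R by (field; lra).
    apply Rle_trans with (T * (m * m * (m * m) * (S * S * (S * S)) / 64))%R; [|apply Rmult_le_compat_l; lra].
    unfold T. replace (128 / (m * m * (m * m)) * (m * m * (m * m) * (S * S * (S * S)) / 64))%R with (2 * (S * S * (S * S)))%R by (field; lra).
    assert (1 <= S * S) by nra. assert (S * S <= S * S * S) by nra. assert (S * S * S <= S * S * (S * S)) by nra. nra. }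
  eapply Rle_lt_trans; [apply (CI_norm_const _ (T / S)); [lra| |exact B]|].
  - intros p. apply (cC_comp (hf z)); [cc|]. eapply dC_continuous, hf_dC.
  - assert (Q : T * PI / S < eps).
    { apply Rmult_lt_reg_r with S; [lra|]. replace (T * PI / S * S)%R with (T * PI)%R by (field; lra).
      apply Rlt_le_trans with (eps * Y)%R; [|apply Rmult_le_compat_l; lra].
      apply Rmult_lt_reg_r with (/ eps)%R; [apply Rinv_0_lt_compat; lra|]. replace (eps * Y * / eps)%R with Y by (field; lra). exact Y2. }
    assert (0 < T / S) by (apply Rdiv_lt_0_compat; lra).
    replace (T * PI / S)%R with (T / S * PI)%R in Q by (unfold Rdiv; ring). nra.
Qed.

(** A quarter of the integral of e^(iz(x-1)) sqrt (x^2 - 1) over [1, oo), x = 1 + 2 e^v. *)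
Definition quad z : C := II (fun v => Cexp (Ci * (2 * z) * RtoC (exp v) + 3 / 2 * RtoC v + 1 / 2 * RtoC (ell v))).
Lemma exp_half_sqr x : (exp (x / 2) * exp (x / 2) = exp x)%R.
Proof. rewrite <- exp_plus. f_equal. field. Qed.

(** The substitutions y = 2 arsinh (e^(v/2)) and y = arsinh (e^v) bring both line integrals to
    the edges of the rectangle. *)
Lemma NN_quadrant z : 0 < Re z -> 0 < Im z -> 4 * (Cexp (Ci * z) * quad z) = NN z.
Proof.
  intros Hr Hi.
  set (q1 := fun v => Cexp (Ci * (2 * z) * RtoC (exp v) + 3 / 2 * RtoC v + 1 / 2 * RtoC (ell v))).
  assert (D1 : exists M, dom q1 M).
  { destruct (Lap_dom (fun v => Cexp (3 / 2 * RtoC v + 1 / 2 * RtoC (ell v))) (3/2) (5/2) 1 (- Ci * (2 * z))) as [M H].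
    - split; [lra|split; [lra|split; [lra|split]]].
      + intros v. cc. apply ell_cont.
      + intros v. rewrite C32, Chalf, <- !RtoC_mult, <- RtoC_plus, Cexp_R, Cmod_R, Rabs_pos_eq, exp_plus by (left; apply exp_pos).
        replace (1 / 2 * ell v)%R with (ell v / 2)%R by field.
        assert (Q := exp_half_sqr (ell v)). rewrite exp_ell in Q. 
        assert (B : exp (ell v / 2) <= 1 + exp v) by (generalize (exp_pos (ell v / 2)) (exp_pos v); nra).
        replace (5 / 2 * v)%R with (3 / 2 * v + v)%R by field. rewrite exp_plus. generalize (exp_pos (3/2 * v)). nra.
    - unfold Re, Im in *; simpl. lra.
    - exists M. eapply dom_ext; [|exact H]. intros v. cbv beta. unfold q1. rewrite <- Cexp_plus. f_equal. ring. }
  destruct D1 as [M1 D1].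
  destruct (Lap_dom kw 1 2 1 z kw_lapw Hr) as [M2 D2].
  set (g1 := fun y => hf z (RtoC y)).
  set (g2 := fun y => Cexp (- z * RtoC (sinh y)) * RtoC (cosh y * cosh y)).
  set (y1 := fun v => (2 * arcsinh (exp (v / 2)))%R). set (y2 := fun v => arcsinh (exp v)).
  assert (c1 : cont g1). { intros y. apply (cC_comp (hf z)); [cc|]. eapply dC_continuous, hf_dC. }
  assert (c2 : cont g2). { intros y. unfold g2, cosh, sinh. cc; lra. }
  assert (S1 := substitution_limit g1 (fun v => 4 * Cexp (Ci * z) * q1 v) y1 (fun v => 2 * ((/ 2 * exp (v / 2)) / sqrt (exp (v / 2) * exp (v / 2) + 1)))%R (Cmod (4 * Cexp (Ci * z)) * M1)%R c1).
  assert (S2 := substitution_limit g2 (fun v => Cexp (- z * RtoC (exp v)) * kw v) y2 (fun v => exp v / sqrt (exp v * exp v + 1))%R M2 c2).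
  assert (X1 := fun H1 H2 H3 => S1 H1 H2 (dom_scal _ (4 * Cexp (Ci * z)) _ D1) H3). clear S1.
  assert (X2 := fun H1 H2 H3 => S2 H1 H2 D2 H3). clear S2.
  rewrite (II_scal _ _ _ D1) in X1. fold (quad z) in X1. fold (Lap kw z) in X2.
  assert (Z1 : forall eps, 0 < eps -> exists N, forall v, N < v -> Cmod (CI g1 0 (y1 v) - 4 * Cexp (Ci * z) * II q1) < eps).
  { apply X1; clear X1 X2.
    - intros v. unfold y1. apply (is_derive_scal (fun v => arcsinh (exp (v / 2)))). apply (arcsinh_derive (fun v => exp (v / 2))).
      apply (Rd_exp (fun v => v / 2)%R v (/ 2)%R). auto_derive; auto; field.
    - intros v. unfold g1. rewrite hf_bottom. unfold y1. set (a := arcsinh (exp (v / 2))).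
      assert (sa : sinh a = exp (v / 2)) by apply sinh_arcsinh. assert (ca := cosh2_sinh2 a). rewrite sa, exp_half_sqr in ca.
      assert (c2a : (cosh (2 * a) = 1 + 2 * exp v)%R).
      { transitivity (cosh a * cosh a + sinh a * sinh a)%R; [|rewrite ca, sa, exp_half_sqr; ring].
        unfold cosh, sinh. replace (- (2 * a))%R with (- a + - a)%R by ring. replace (2 * a)%R with (a + a)%R by ring. rewrite !exp_plus. field. }
      assert (s2a : (sinh (2 * a) * sinh (2 * a) = 4 * exp v * (1 + exp v))%R).
      { generalize (cosh2_sinh2 (2 * a)). rewrite c2a. intros. nra. }
      rewrite c2a, s2a, exp_half_sqr. unfold q1.
      assert (sq : sqrt (exp v + 1) = exp (ell v / 2)).
      { rewrite Rplus_comm, <- exp_ell, <- exp_half_sqr. apply sqrt_square. left; apply exp_pos. }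
      rewrite sq. assert (h2 := exp_half_sqr (ell v)). rewrite exp_ell in h2. rewrite <- h2.
      replace (Ci * z * RtoC (1 + 2 * exp v)) with (Ci * z + Ci * (2 * z) * RtoC (exp v)) by (rewrite RtoC_plus, RtoC_mult; ring).
      replace (Ci * (2 * z) * RtoC (exp v) + 3 / 2 * RtoC v + 1 / 2 * RtoC (ell v)) with (Ci * (2 * z) * RtoC (exp v) + RtoC (v + v / 2 + ell v / 2)).
      2:{ rewrite C32, Chalf, <- Cplus_assoc, <- !RtoC_mult, <- RtoC_plus. do 2 f_equal. field. }
      rewrite !Cexp_plus, Cexp_R, !exp_plus.
      set (E1 := Cexp (Ci * z)). set (E2 := Cexp (Ci * (2 * z) * RtoC (exp v))).
      set (u := exp (v / 2)). assert (n : exp (ell v / 2) <> 0%R) by (apply Rgt_not_eq, exp_pos). set (h := exp (ell v / 2)) in *.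
      transitivity (RtoC (4 * (exp v * u * h)) * (E1 * E2)); [rewrite (RtoC_mult 4); ring|].
      transitivity (RtoC (2 * (/ 2 * u / h) * (4 * exp v * (h * h))) * (E1 * E2)); [do 2 f_equal; field; exact n|].
      rewrite (RtoC_mult (2 * _)). ring.
    - intros v Hv. unfold y1. generalize (arcsinh_bounds (exp (v / 2)) ltac:(left; apply exp_pos)). lra. }
  assert (Z2 : forall eps, 0 < eps -> exists N, forall v, N < v -> Cmod (CI g2 0 (y2 v) - Lap kw z) < eps).
  { apply X2; clear X1 X2.
    - intros v. apply (arcsinh_derive exp). apply is_derive_exp.
    - intros v. unfold g2, y2. rewrite cosh2_sinh2, sinh_arcsinh. unfold kw. rewrite Cexp_R, exp_plus.
      assert (e2 : (exp v * exp v = exp (2 * v))%R) by (rewrite <- exp_plus; f_equal; ring). rewrite e2.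
      assert (sq : sqrt (exp (2 * v) + 1) = exp (ell (2 * v) / 2)).
      { rewrite Rplus_comm, <- exp_ell, <- exp_half_sqr. apply sqrt_square. left; apply exp_pos. }
      rewrite sq. assert (h2 := exp_half_sqr (ell (2 * v))). rewrite exp_ell in h2. rewrite <- h2.
      assert (n : exp (ell (2 * v) / 2) <> 0%R) by (apply Rgt_not_eq, exp_pos). set (h := exp (ell (2 * v) / 2)) in *.
      transitivity (RtoC (exp v / h * (h * h)) * Cexp (- z * RtoC (exp v))); [|rewrite RtoC_mult; ring].
      rewrite Cmult_comm. do 2 f_equal. field. exact n.
    - intros v Hv. unfold y2. destruct (arcsinh_bounds (exp v) ltac:(left; apply exp_pos)) as [A1 A2]. split; auto.
      eapply Rle_trans; [exact A2|]. assert (exp v <= exp (v / 2)) by (apply exp_le; lra). generalize (exp_pos (v / 2)). lra. }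
  clear X1 X2. unfold NN. fold q1 in Z1. unfold quad. fold q1.
  set (L1 := 4 * Cexp (Ci * z) * II q1) in *.
  cut (L1 + Lap kw z + Ci * SS z = 0).
  { intros H. transitivity L1; [unfold L1; ring|]. transitivity (L1 + Lap kw z + Ci * SS z - Ci * SS z - Lap kw z); [ring|]. rewrite H. ring. }
  apply Cmod_eq_0. apply Rle_antisym; [|apply Cmod_ge_0]. apply Cmod_le_limit. intros eps He.
  destruct (Z1 (eps / 3)%R ltac:(lra)) as [N1 H1]. destruct (Z2 (eps / 3)%R ltac:(lra)) as [N2 H2].
  destruct (right_edge_small z (eps / 3) Hr Hi ltac:(lra)) as [Y0 H3].
  set (Y := (2 * exp (Rabs N1 + 1) + exp (Rabs N2 + 1) + Rabs Y0)%R).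
  assert (Y1 : Y0 < Y) by (unfold Y; generalize (exp_pos (Rabs N1 + 1)) (exp_pos (Rabs N2 + 1)) (Rle_abs Y0); lra).
  assert (Yp : 0 < Y) by (unfold Y; generalize (exp_pos (Rabs N1 + 1)) (exp_pos (Rabs N2 + 1)) (Rabs_pos Y0); lra).
  set (v1 := (2 * ln (sinh (Y / 2)))%R). set (v2 := ln (sinh Y)).
  assert (s1 := sinh_ge (Y / 2) ltac:(lra)). assert (s2 := sinh_ge Y ltac:(lra)).
  assert (e1 : y1 v1 = Y).
  { unfold y1, v1. replace (2 * ln (sinh (Y / 2)) / 2)%R with (ln (sinh (Y / 2))) by field. rewrite exp_ln by lra. rewrite arcsinh_sinh. field. }
  assert (e2 : y2 v2 = Y). { unfold y2, v2. rewrite exp_ln by lra. apply arcsinh_sinh. }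
  assert (b1 : N1 < v1).
  { assert (Q : Rabs N1 + 1 <= ln (sinh (Y / 2))).
    { rewrite <- (ln_exp (Rabs N1 + 1)). apply ln_le; [apply exp_pos|]. eapply Rle_trans; [|exact s1].
      unfold Y. generalize (exp_pos (Rabs N2 + 1)) (Rabs_pos Y0); lra. }
    unfold v1. generalize (Rle_abs N1) (Rabs_pos N1). lra. }
  assert (b2 : N2 < v2).
  { assert (Q : Rabs N2 + 1 <= ln (sinh Y)).
    { rewrite <- (ln_exp (Rabs N2 + 1)). apply ln_le; [apply exp_pos|]. eapply Rle_trans; [|exact s2].
      unfold Y. generalize (exp_pos (Rabs N1 + 1)) (Rabs_pos Y0); lra. }
    unfold v2. generalize (Rle_abs N2). lra. }
  specialize (H1 v1 b1). specialize (H2 v2 b2). specialize (H3 Y Y1). rewrite e1 in H1. rewrite e2 in H2.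
  assert (G := contour_identity z Y ltac:(lra)). fold g1 g2 in G.
  replace (L1 + Lap kw z + Ci * SS z) with (- (CI g1 0 Y - L1) + (- (CI g2 0 Y - Lap kw z) + (CI g1 0 Y + CI g2 0 Y + Ci * SS z))) by ring.
  rewrite G. triangle. 
  assert (T := Cmod_triangle (- (CI g2 0 Y - Lap kw z)) (- (Ci * CI (fun p => hf z (RtoC Y + Ci * RtoC p)) 0 (PI / 2)))).
  rewrite !Cmod_opp, Cmod_mult, Cmod_Ci in T. rewrite Cmod_opp. lra.
Qed.

(** * Poisson's integral for J_1 *)

(** ** Partial sums of the exponential series *)

Fixpoint epart (N : nat) (w : C) : C :=
  match N with O => 0 | S n => epart n w + RtoC (/ INR (fact n)) * w ^ n end.

Lemma epart_S0 N : epart (S N) 0 = 1.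
Proof.
  induction N as [|N IH].
  - simpl. rewrite Rinv_1. ring.
  - change (epart (S N) 0 + RtoC (/ INR (fact (S N))) * (0 * 0 ^ N) = 1). rewrite IH. ring.
Qed.

Lemma ray_dR (w : C) t : dR (fun t => RtoC t * w) t w.
Proof. eapply dR_eq; [apply dR_mult; [apply dR_id|apply dR_const]|]. dring. Qed.

Lemma Cpow_dR (w : C) n t : dR (fun t => (RtoC t * w) ^ (S n)) t (RtoC (INR (S n)) * w * (RtoC t * w) ^ n).
Proof.
  induction n as [|n IH].
  - eapply dR_eq; [|instantiate (1 := w); simpl; ring].
    apply (dR_ext (fun t => RtoC t * w)); [intros; simpl; ring|apply ray_dR].
  - eapply dR_eq; [apply (dR_mult (fun t => RtoC t * w) (fun t => (RtoC t * w) ^ S n)); [apply ray_dR|exact IH]|].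
    cbv beta. rewrite (S_INR (S n)), RtoC_plus. simpl Cpow. ring.
Qed.

Lemma fact_INR n : INR (fact (S n)) = (INR (S n) * INR (fact n))%R.
Proof. rewrite <- mult_INR. reflexivity. Qed.

Lemma fact_pos n : 0 < INR (fact n). Proof. apply INR_fact_lt_0. Qed.
Lemma epart_dR w N t : dR (fun t => epart (S N) (RtoC t * w)) t (w * epart N (RtoC t * w)).
Proof.
  induction N as [|N IH].
  - apply (dR_ext (fun _ => 1)). { intros; simpl. rewrite Rinv_1. ring. } eapply dR_eq; [apply dR_const|simpl; ring].
  - eapply dR_eq; [apply (dR_plus (fun t => epart (S N) (RtoC t * w)) (fun t => RtoC (/ INR (fact (S N))) * (RtoC t * w) ^ (S N))); [exact IH|]|].
    + apply dR_mult; [apply dR_const|apply Cpow_dR].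
    + cbv beta. simpl epart. assert (P := fact_pos N). assert (Q : 0 < INR (S N)) by (apply lt_0_INR; lia).
      replace (RtoC (/ INR (fact N))) with (RtoC (/ INR (fact (S N))) * RtoC (INR (S N))); [ring|].
      rewrite <- RtoC_mult. f_equal. rewrite fact_INR. field. lra.
Qed.

(** Each remainder is a primitive of the preceding one. *)
Lemma epart_remainder w N t : 0 <= t <= 1 ->
  Cmod (Cexp (RtoC t * w) - epart N (RtoC t * w)) <= exp (Cmod w) * (Cmod w ^ N / INR (fact N)) * t ^ N.
Proof.
  revert t. assert (W := Cmod_ge_0 w). assert (Ew := exp_pos (Cmod w)).
  induction N as [|N IH]; intros t Ht.
  - simpl. replace (Cexp (RtoC t * w) - 0) with (Cexp (RtoC t * w)) by ring. rewrite Cmod_Cexp.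
    replace (exp (Cmod w) * (1 / 1) * 1)%R with (exp (Cmod w)) by field. apply exp_le.
    eapply Rle_trans; [apply Re_le_Cmod|]. rewrite Cmod_mult, Cmod_R, Rabs_pos_eq by lra. nra.
  - assert (P := fact_pos N). assert (Q : 0 < INR (S N)) by (apply lt_0_INR; lia).
    set (B := (exp (Cmod w) * (Cmod w ^ S N / INR (fact (S N))))%R).
    assert (H := mean_value_ineq (fun t => Cexp (RtoC t * w) - epart (S N) (RtoC t * w)) (fun t => w * Cexp (RtoC t * w) - w * epart N (RtoC t * w))
      (fun t => B * t ^ S N)%R (fun t => B * (INR (S N) * t ^ N))%R 0 t ltac:(lra)).
    cbv beta in H. replace (RtoC 0 * w) with (RtoC 0) in H by ring. rewrite Cexp_0, epart_S0 in H.
    replace (Cexp (RtoC t * w) - epart (S N) (RtoC t * w) - (1 - 1)) with (Cexp (RtoC t * w) - epart (S N) (RtoC t * w)) in H by ring.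
    eapply Rle_trans; [apply H|].
    + intros u _. apply dR_minus; [|apply epart_dR]. apply dR_Cexp, ray_dR.
    + intros u _. apply (is_derive_scal (fun t => t ^ S N)%R). replace (INR (S N) * u ^ N)%R with (INR (S N) * 1 * u ^ pred (S N))%R by (rewrite Rmult_1_r; reflexivity).
      apply (is_derive_pow (fun t => t) (S N) u 1%R). apply (is_derive_id (K := R_AbsRing)).
    + intros u Hu. replace (w * Cexp (RtoC u * w) - w * epart N (RtoC u * w)) with (w * (Cexp (RtoC u * w) - epart N (RtoC u * w))) by ring.
      rewrite Cmod_mult. eapply Rle_trans; [apply Rmult_le_compat_l; [auto|apply IH; lra]|].
      right. unfold B. rewrite fact_INR. simpl pow. field. lra.
    + rewrite pow_i by lia. lra.
Qed.

(** ** Moments of sin^2 against powers of cos *)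

Definition mom (n : nat) : C := CI (fun p => RtoC (cos p ^ n * (sin p * sin p))) 0 (PI / 2).
Lemma cos_pow_cont n (p : R) : continuous (fun p => (cos p ^ n)%R) p.
Proof. induction n; simpl; [apply cR_const|apply cR_mult; [cc|exact IHn]]. Qed.

Lemma mom_cont n : cont (fun p => RtoC (cos p ^ n * (sin p * sin p))).
Proof. intros p. cc. apply cos_pow_cont. Qed.

Lemma mom_0 : mom 0 = RtoC (PI / 4).
Proof.
  unfold mom. rewrite (CI_FTC (fun p => RtoC ((p - sin p * cos p) / 2))).
  - rewrite cos_PI2, sin_0, <- RtoC_minus. f_equal. field.
  - intros p. apply dR_RtoC. auto_derive; auto. generalize (sin2_cos2 p). unfold Rsqr. simpl. intros. nra.
  - apply mom_cont.
Qed.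

(** The derivative of cos^(n+1) sin^3 has integral 0. *)
Lemma mom_rec n : RtoC (INR n + 4) * mom (S (S n)) = RtoC (INR n + 1) * mom n.
Proof.
  unfold mom. rewrite <- !CI_scal by apply mom_cont.
  cut (CI (fun p => RtoC (INR n + 4) * RtoC (cos p ^ S (S n) * (sin p * sin p)) - RtoC (INR n + 1) * RtoC (cos p ^ n * (sin p * sin p))) 0 (PI / 2) = 0).
  - rewrite CI_minus by (intros p; apply cC_mult; [apply cC_const|apply mom_cont]). intros H.
    match goal with |- ?a = ?b => replace a with (a - b + b) by ring end. rewrite H. ring.
  - rewrite (CI_FTC (fun p => RtoC (cos p ^ S n * (sin p * sin p * sin p)))).
    + rewrite cos_PI2, sin_0, pow_i by lia. rewrite <- RtoC_minus. f_equal. ring.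
    + intros p. rewrite <- !RtoC_mult, <- RtoC_minus. apply dR_RtoC. 
      replace ((INR n + 4) * (cos p ^ S (S n) * (sin p * sin p)) - (INR n + 1) * (cos p ^ n * (sin p * sin p)))%R with
        ((INR (S n) * (- sin p) * cos p ^ pred (S n)) * (sin p * sin p * sin p) + cos p ^ S n * (3 * (sin p * sin p) * cos p))%R.
      * apply (Rd_mult (fun p => cos p ^ S n)%R (fun p => sin p * sin p * sin p)%R).
        -- apply (is_derive_pow cos (S n) p (- sin p)%R), is_derive_cos.
        -- auto_derive; auto. ring.
      * change (Nat.pred (S n)) with n. rewrite S_INR. simpl pow. assert (E : (sin p * sin p = 1 - cos p * cos p)%R) by (generalize (sin2_cos2 p); unfold Rsqr; lra).
        replace ((INR n + 1) * - sin p * cos p ^ n * (sin p * sin p * sin p))%R with (- (INR n + 1) * cos p ^ n * (sin p * sin p) * (sin p * sin p))%R by ring.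
        rewrite E. ring.
    + intros p. apply cC_minus; apply cC_mult; try apply cC_const; apply mom_cont.
Qed.

Lemma mom_even k : mom (2 * k) = RtoC (PI / 4 * INR (fact (2 * k)) / (4 ^ k * INR (fact k) * INR (fact (1 + k)))).
Proof.
  induction k as [|k IH].
  - simpl. rewrite mom_0. f_equal. field.
  - replace (2 * S k)%nat with (S (S (2 * k))) by lia.
    assert (N : RtoC (INR (2 * k) + 4) <> 0). { intros H. apply (f_equal Re) in H. simpl in H. generalize (pos_INR (2 * k)). simpl. lra. }
    apply (Cmult_eq_reg_l (RtoC (INR (2 * k) + 4))); [|exact N]. rewrite mom_rec, IH, <- !RtoC_mult. f_equal.
    change (1 + S k)%nat with (S (S k)). change (1 + k)%nat with (S k). rewrite !fact_INR.
    assert (P1 := fact_pos k). assert (P2 := fact_pos (2 * k)). assert (P3 : 0 < 4 ^ k) by (apply pow_lt; lra).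
    rewrite !S_INR, !mult_INR. assert (P4 := pos_INR k). simpl (INR 2). simpl (4 ^ S k)%R. field. repeat split; lra.
Qed.

Fixpoint mpart (N : nat) z : C :=
  match N with O => 0 | S n => mpart n z + RtoC (/ INR (fact n)) * (Ci * z) ^ n * mom n end.

Lemma epart_moments z N : CI (fun p => epart N (RtoC (cos p) * (Ci * z)) * RtoC (sin p * sin p)) 0 (PI / 2) = mpart N z /\
  cont (fun p => epart N (RtoC (cos p) * (Ci * z)) * RtoC (sin p * sin p)).
Proof.
  induction N as [|N [IH IC]].
  - split; [|intros p; simpl; cc].
    rewrite (CI_ext _ (fun _ => 0)) by (intros; simpl; ring). apply CI_zero.
  - assert (Q : forall p, epart (S N) (RtoC (cos p) * (Ci * z)) * RtoC (sin p * sin p) = 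
      epart N (RtoC (cos p) * (Ci * z)) * RtoC (sin p * sin p) + RtoC (/ INR (fact N)) * (Ci * z) ^ N * RtoC (cos p ^ N * (sin p * sin p))).
    { intros p. simpl epart. rewrite Cpow_mult_l, (RtoC_mult (cos p ^ N)), RtoC_pow. ring. }
    assert (QC : cont (fun p => RtoC (/ INR (fact N)) * (Ci * z) ^ N * RtoC (cos p ^ N * (sin p * sin p)))).
    { intros p. apply cC_mult; [apply cC_const|apply mom_cont]. }
    split.
    + rewrite (CI_ext _ _ _ _ (fun p _ => Q p)), CI_plus, IH, CI_scal; auto. apply mom_cont.
    + intros p. apply (continuous_ext _ _ _ (fun p => eq_sym (Q p))). apply cC_plus; [apply IC|apply QC].
Qed.

Lemma Cpow_double (x : C) k : x ^ (2 * k) = (x * x) ^ k.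
Proof. induction k; [reflexivity|]. replace (2 * S k)%nat with (S (S (2 * k))) by lia. rewrite !Cpow_S, IHk. ring. Qed.

Definition bterm z k : C := RtoC (((-1) ^ k) / (INR (fact k) * INR (fact (1 + k))))%R * (z / 2) ^ (2 * k + 1).
Fixpoint bpart (K : nat) z : C := match K with O => 0 | S k => bpart k z + bterm z k end.
(** The odd powers cancel between z and - z, and the even moments turn the exponential series
    into that of J_1. *)
Lemma mpart_even z K : z / RtoC PI * (mpart (2 * K) z + mpart (2 * K) (- z)) = bpart K z.
Proof.
  assert (HP := PI_RGT_0). assert (pn : RtoC PI <> 0) by (apply RtoC_neq; lra).
  induction K as [|k IH].
  - simpl. ring.
  - replace (2 * S k)%nat with (S (S (2 * k))) by lia. simpl bpart. rewrite <- IH. simpl mpart.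
    assert (E1 : (Ci * z) ^ (k + (k + 0)) = RtoC ((-1) ^ k) * (z * z) ^ k).
    { replace (k + (k + 0))%nat with (2 * k)%nat by lia. rewrite Cpow_double, RtoC_pow, <- Cpow_mult_l. f_equal. ceq; ring. }
    assert (E2 : (Ci * - z) ^ (k + (k + 0)) = RtoC ((-1) ^ k) * (z * z) ^ k).
    { replace (k + (k + 0))%nat with (2 * k)%nat by lia. rewrite Cpow_double, RtoC_pow, <- Cpow_mult_l. f_equal. ceq; ring. }
    rewrite E1, E2. replace (k + (k + 0))%nat with (2 * k)%nat by lia. rewrite mom_even.
    assert (T : bterm z k = RtoC ((-1) ^ k / (INR (fact k) * INR (fact (1 + k))) * (/ 4 ^ k)) * ((z * z) ^ k * (z / 2))).
    { unfold bterm. replace (2 * k + 1)%nat with (S (2 * k)) by lia. rewrite Cpow_S, Cpow_double.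
      replace (z / 2 * (z / 2)) with (RtoC (/ 4) * (z * z)) by (simpl; rewrite RtoC_inv by lra; field).
      rewrite Cpow_mult_l, <- RtoC_pow, pow_inv, (RtoC_mult (_ / _)). ring. }
    rewrite T. assert (P1 := fact_pos k). assert (P2 := fact_pos (2 * k)). assert (P3 : 0 < 4 ^ k) by (apply pow_lt; lra). assert (P4 := fact_pos (1 + k)).
    set (Z := (z * z) ^ k).
    replace (RtoC ((-1) ^ k / (INR (fact k) * INR (fact (1 + k))) * / 4 ^ k)) with
      (RtoC 4 / RtoC PI * (RtoC (/ INR (fact (2 * k))) * RtoC ((-1) ^ k) * RtoC (PI / 4 * INR (fact (2 * k)) / (4 ^ k * INR (fact k) * INR (fact (1 + k)))))).
    + field. auto.
    + rewrite <- RtoC_div by lra. rewrite <- !RtoC_mult. f_equal. field. repeat split; lra.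
Qed.

Lemma SS_approx z N : Cmod (SS z - mpart N z) <= exp (Cmod z) * (Cmod z ^ N / INR (fact N)) * (PI / 2).
Proof.
  assert (HP := PI_RGT_0). destruct (epart_moments z N) as [E EC]. rewrite <- E. unfold SS. rewrite <- CI_minus; [|intros p; cc|apply EC].
  replace (exp (Cmod z) * (Cmod z ^ N / INR (fact N)) * (PI / 2))%R with (exp (Cmod z) * (Cmod z ^ N / INR (fact N)) * (PI / 2 - 0))%R by ring.
  apply CI_norm_const; [lra| |].
  - intros p. apply cC_minus; [cc|apply EC].
  - intros p Hp. replace (Ci * z * RtoC (cos p)) with (RtoC (cos p) * (Ci * z)) by ring.
    assert (cp : 0 <= cos p) by (apply cos_ge_0; lra). assert (c1 := COS_bound p). assert (S2 := sin2_cos2 p). unfold Rsqr in S2.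
    assert (R0 := epart_remainder (Ci * z) N (cos p) ltac:(lra)). rewrite Cmod_mult, Cmod_Ci, Rmult_1_l in R0.
    set (X := RtoC (cos p) * (Ci * z)) in *.
    replace (Cexp X * RtoC (sin p * sin p) - epart N X * RtoC (sin p * sin p)) with ((Cexp X - epart N X) * RtoC (sin p * sin p)) by ring.
    rewrite Cmod_mult, Cmod_R, Rabs_pos_eq by nra.
    assert (U : cos p ^ N <= 1) by (rewrite <- (pow1 N); apply pow_incr; lra).
    assert (V : 0 <= exp (Cmod z) * (Cmod z ^ N / INR (fact N))).
    { apply Rmult_le_pos; [left; apply exp_pos|]. apply Rmult_le_pos; [apply pow_le, Cmod_ge_0|left; apply Rinv_0_lt_compat, fact_pos]. }
    set (B := (exp (Cmod z) * (Cmod z ^ N / INR (fact N)))%R) in *.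
    assert (W : Cmod (Cexp X - epart N X) <= B).
    { eapply Rle_trans; [exact R0|]. rewrite <- (Rmult_1_r B) at 2. apply Rmult_le_compat_l; auto. }
    apply Rle_trans with (B * 1)%R; [apply Rmult_le_compat; try nra; apply Cmod_ge_0|lra].
Qed.

Lemma bpart_sum z n : sum_n (fun k => Re (bterm z k)) n = Re (bpart (S n) z) /\ sum_n (fun k => Im (bterm z k)) n = Im (bpart (S n) z).
Proof.
  induction n as [|n [IH1 IH2]].
  - rewrite !sum_O. simpl bpart. rewrite Re_plus, Im_plus. simpl. split; ring.
  - rewrite !sum_Sn, IH1, IH2. simpl bpart. rewrite !Re_plus, !Im_plus. split; reflexivity.
Qed.

(** Poisson's integral J_1(z) = (2z/pi) int_0^(pi/2) cos (z cos p) sin^2 p dp. *)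
Lemma BesselJ1_SS z : BesselJ 1 z = z / RtoC PI * (SS z + SS (- z)).
Proof.
  assert (HP := PI_RGT_0). set (L := z / RtoC PI * (SS z + SS (- z))).
  assert (Lim : forall eps, 0 < eps -> exists N, forall n, (N <= n)%nat -> Cmod (bpart (S n) z - L) < eps).
  { intros eps He. set (X := (exp (Cmod z) * PI)%R). set (c := (Cmod (z / RtoC PI) * X + 1)%R).
    assert (Xp : 0 < X) by (apply Rmult_lt_0_compat; [apply exp_pos|lra]).
    assert (cp : 0 < c) by (unfold c; generalize (Cmod_ge_0 (z / RtoC PI)); nra).
    destruct (cv_speed_pow_fact (Cmod z) (eps / c)%R ltac:(apply Rdiv_lt_0_compat; lra)) as [N HN].
    exists N. intros n Hn. specialize (HN (2 * S n)%nat ltac:(lia)). unfold R_dist in HN. rewrite Rminus_0_r in HN.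
    rewrite <- mpart_even. unfold L. 
    replace (z / RtoC PI * (mpart (2 * S n) z + mpart (2 * S n) (- z)) - z / RtoC PI * (SS z + SS (- z))) with
      (- (z / RtoC PI * ((SS z - mpart (2 * S n) z) + (SS (- z) - mpart (2 * S n) (- z))))) by ring.
    rewrite Cmod_opp, Cmod_mult. assert (A := SS_approx z (2 * S n)). assert (B := SS_approx (- z) (2 * S n)). rewrite Cmod_opp in B.
    set (y := (Cmod z ^ (2 * S n) / INR (fact (2 * S n)))%R) in *. assert (HN' := Rle_abs y).
    assert (D : Cmod ((SS z - mpart (2 * S n) z) + (SS (- z) - mpart (2 * S n) (- z))) <= X * y).
    { triangle. unfold X. lra. }
    assert (y0 : 0 <= y).
    { apply Rmult_le_pos; [apply pow_le, Cmod_ge_0|left; apply Rinv_0_lt_compat, fact_pos]. }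
    apply Rle_lt_trans with (Cmod (z / RtoC PI) * (X * y))%R; [apply Rmult_le_compat_l; [apply Cmod_ge_0|exact D]|].
    apply Rle_lt_trans with (c * y)%R; [unfold c; nra|].
    replace eps with (c * (eps / c))%R by (field; lra). apply Rmult_lt_compat_l; lra. }
  unfold BesselJ, CSeries. apply C_ext; simpl.
  - apply is_series_unique. change (is_lim_seq (sum_n (fun k => Re (bterm z k))) (Re L)). apply is_lim_seq_spec. intros eps.
    destruct (Lim eps (cond_pos eps)) as [N HN]. exists N. intros n Hn. rewrite (proj1 (bpart_sum z n)).
    eapply Rle_lt_trans; [|apply (HN n Hn)]. replace (Re (bpart (S n) z) - Re L)%R with (Re (bpart (S n) z - L)) by reim. apply re_le_Cmod.
  - apply is_series_unique. change (is_lim_seq (sum_n (fun k => Im (bterm z k))) (Im L)). apply is_lim_seq_spec. intros eps.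
    destruct (Lim eps (cond_pos eps)) as [N HN]. exists N. intros n Hn. rewrite (proj2 (bpart_sum z n)).
    eapply Rle_lt_trans; [|apply (HN n Hn)]. replace (Im (bpart (S n) z) - Im L)%R with (Im (bpart (S n) z - L)) by reim. apply Im_le_Cmod.
Qed.

(** * Cauchy's formula and unique continuation *)

(** Continuity of the derivative is carried along for the sake of Green's formula. *)
Definition holo (D : C -> Prop) (f f' : C -> C) : Prop := forall z, D z -> dC f z (f' z) /\ continuous f' z.
Definition circ (r : R) (p : R) : C := RtoC r * Cexp (Ci * RtoC p).
Lemma circ_dR r p : dR (circ r) p (Ci * circ r p).
Proof. eapply dR_eq; [apply (dR_mult (fun _ => RtoC r)); [apply dR_const|apply dR_Cexp, dR_mult; [apply dR_const|apply dR_id]]|]. unfold circ. dring. Qed.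

Lemma circ_mod r p : 0 <= r -> Cmod (circ r p) = r.
Proof.
  intros Hr. unfold circ. rewrite Cmod_mult, Cmod_R, Cmod_Cexp, Rabs_pos_eq by auto.
  replace (Re (Ci * RtoC p)) with 0%R by reim. rewrite exp_0; ring.
Qed.

Lemma circ_period r : circ r (2 * PI) = circ r 0.
Proof.
  unfold circ. f_equal. replace (Ci * RtoC (2 * PI)) with (RtoC 0 + Ci * RtoC (2 * PI)) by (ceq; ring).
  replace (Ci * RtoC 0) with (RtoC 0) by ring. rewrite Cexp_line, cos_2PI, sin_2PI, exp_0, Cexp_0. ring.
Qed.

Lemma circ_cont r p : continuous (circ r) p. Proof. eapply dR_continuous, circ_dR. Qed.
Lemma circ_away (b : C) (r u p : R) : Cmod b < r -> 0 <= u <= 1 -> r - Cmod b <= Cmod (RtoC u * b + circ r p).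
Proof.
  intros Hb Hu. assert (B := Cmod_ge_0 b).
  assert (H := Cmod_triangle_inv (circ r p) (- (RtoC u * b))). rewrite Cmod_opp, Cmod_mult, Cmod_R, Rabs_pos_eq, circ_mod in H by lra.
  replace (circ r p - - (RtoC u * b)) with (RtoC u * b + circ r p) in H by ring. nra.
Qed.

Lemma circ_off (b : C) (r u p : R) : Cmod b < r -> 0 <= u <= 1 -> RtoC u * b + circ r p <> 0.
Proof. intros Hb Hu H. generalize (circ_away b r u p Hb Hu). rewrite H, Cmod_0. lra. Qed.

Lemma dR_inv (g : R -> C) t g' : dR g t g' -> g t <> 0 -> dR (fun t => / g t) t (- g' / (g t * g t)).
Proof. intros H Hn. eapply dR_eq; [apply (dR_comp Cinv g t); [apply Cinv_dC; auto|exact H]|]. field. auto. Qed.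

(** Moving the centre b to the origin changes the integrand by a derivative in the angle. *)
Lemma winding (b : C) (r : R) : Cmod b < r -> CI (fun p => Ci * circ r p / (b + circ r p)) 0 (2 * PI) = 2 * RtoC PI * Ci.
Proof.
  intros Hb. assert (HP := PI_RGT_0). assert (B := Cmod_ge_0 b).
  assert (off := fun u p => circ_off b r u p Hb).
  assert (cc0 := circ_cont r).
  set (P := fun u p : R => - (Ci * circ r p) * b / ((RtoC u * b + circ r p) * (RtoC u * b + circ r p))).
  assert (G := green (fun u p => Ci * circ r p / (RtoC u * b + circ r p)) (fun u p => b / (RtoC u * b + circ r p)) P 0 1 0 (2 * PI) ltac:(lra) ltac:(lra)).
  assert (cP : forall u, 0 <= u <= 1 -> cont (fun p => Ci * circ r p / (RtoC u * b + circ r p))).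
  { intros u Hu p. specialize (cc0 p). apply cC_div; [apply cC_mult; [apply cC_const|exact cc0]|apply cC_plus; [apply cC_const|exact cc0]|apply off; auto]. }
  rewrite CI_minus in G by (apply cP; lra).
  rewrite (CI_ext (fun u => b / (RtoC u * b + circ r (2 * PI)) - b / (RtoC u * b + circ r 0)) (fun _ => 0)) in G by (intros; rewrite circ_period; ring).
  rewrite CI_zero in G.
  rewrite (CI_ext (fun p => Ci * circ r p / (RtoC 0 * b + circ r p)) (fun _ => Ci)) in G.
  2:{ intros p _. assert (N := off 0%R p ltac:(lra)). replace (RtoC 0 * b + circ r p) with (circ r p) in * by ring. field. exact N. }
  assert (CC : CI (fun _ => Ci) 0 (2 * PI) = 2 * RtoC PI * Ci).
  { rewrite (CI_FTC (fun p => Ci * RtoC p)).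
    - rewrite RtoC_mult. ring.
    - intros p. eapply dR_eq; [apply dR_mult; [apply dR_const|apply dR_id]|]. dring.
    - intros p. apply cC_const. }
  rewrite <- CC. 
  rewrite (CI_ext (fun p => Ci * circ r p / (b + circ r p)) (fun p => Ci * circ r p / (RtoC 1 * b + circ r p))) by (intros; f_equal; ring).
  match goal with |- ?x = ?y => transitivity (x - y + y); [ring|] end. rewrite G; [ring| | |].
  - intros u p Hu _. unfold P, Cdiv. eapply dR_eq; [apply (dR_mult (fun _ => Ci * circ r p)); [apply dR_const|apply dR_inv]|].
    + apply (dR_plus (fun u => RtoC u * b)); [apply ray_dR|apply dR_const].
    + apply off; auto.
    + cbv beta. field. apply off; auto.
  - intros u p Hu _. unfold P, Cdiv. eapply dR_eq; [apply (dR_mult (fun _ => b)); [apply dR_const|apply dR_inv]|].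
    + apply dR_plus; [apply dR_const|apply circ_dR].
    + apply off; auto.
    + cbv beta. field. apply off; auto.
  - intros u p Hu. unfold P. 
    assert (cp : continuous (fun q : R * R => circ r (snd q)) (u, p)) by (apply (cC_compR (circ r) (fun q : R * R => snd q)); [apply cR_snd|apply cc0]).
    assert (N := off u p Hu). cc. apply Cmult_neq_0; exact N.
Qed.

(** The circle is contracted to z0 along z = z0 + u (a - z0 + r e^(ip)), where dz / (z - z0)
    does not depend on u; the integrals for all u agree by Green's formula, and u -> 0 gives f
    z0 times the winding integral. *)
Lemma cauchy_formula (f f' : C -> C) (a z0 : C) (r : R) : holo (fun z => (Cmod (z - a) <= r)) f f' -> Cmod (z0 - a) < r ->
  CI (fun p => f (a + circ r p) * (Ci * circ r p / (a - z0 + circ r p))) 0 (2 * PI) = 2 * RtoC PI * Ci * f z0 /\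
  cont (fun p => f (a + circ r p) * (Ci * circ r p / (a - z0 + circ r p))).
Proof.
  intros Hf Hz. assert (HP := PI_RGT_0). set (b := a - z0).
  assert (Hb : Cmod b < r) by (unfold b; rewrite Cmod_minus_sym; auto). assert (B := Cmod_ge_0 b).
  assert (off : forall p, b + circ r p <> 0). { intros p. generalize (circ_off b r 1 p Hb ltac:(lra)). rewrite Cmult_1_l. auto. }
  assert (cc0 := circ_cont r).
  set (zz := fun u p : R => z0 + RtoC u * (b + circ r p)).
  assert (inD : forall u p, 0 <= u <= 1 -> Cmod (zz u p - a) <= r).
  { intros u p Hu. unfold zz. replace (z0 + RtoC u * (b + circ r p) - a) with (- (RtoC (1 - u) * b) + RtoC u * circ r p) by (unfold b; rewrite RtoC_minus; ring).
    triangle. rewrite Cmod_opp, !Cmod_mult, !Cmod_R, circ_mod, !Rabs_pos_eq by lra. nra. }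
  set (k := fun p => Ci * circ r p / (b + circ r p)).
  assert (kc : cont k). { intros p. specialize (cc0 p). unfold k. cc. apply off. }
  assert (fc : forall u, 0 <= u <= 1 -> cont (fun p => f (zz u p))).
  { intros u Hu p. specialize (cc0 p). apply (cC_comp f (zz u)); [unfold zz; cc|]. eapply dC_continuous, Hf, inD; auto. }
  assert (E1 : forall p, a + circ r p = zz 1%R p) by (intros p; unfold zz, b; ring).
  assert (cont1 : cont (fun p => f (a + circ r p) * k p)).
  { intros p. apply (continuous_ext (fun p => f (zz 1%R p) * k p)); [intros q; rewrite E1; reflexivity|]. apply cC_mult; [apply fc; lra|apply kc]. }
  split; [|exact cont1].
  assert (Inv : forall d, 0 < d <= 1 -> CI (fun p => f (a + circ r p) * k p) 0 (2 * PI) = CI (fun p => f (zz d p) * k p) 0 (2 * PI)).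
  { intros d Hd.
    assert (G := green (fun u p => f (zz u p) * k p) (fun u p => f (zz u p) / RtoC u) (fun u p => f' (zz u p) * (Ci * circ r p)) d 1 0 (2 * PI) ltac:(lra) ltac:(lra)).
    rewrite CI_minus in G by (intros p; apply cC_mult; [apply fc; lra|apply kc]).
    rewrite (CI_ext (fun u => f (zz u (2 * PI)%R) / RtoC u - f (zz u 0%R) / RtoC u) (fun _ => 0)) in G by (intros; unfold zz; rewrite circ_period; ring).
    rewrite CI_zero in G. rewrite (CI_ext _ (fun p => f (zz 1%R p) * k p)) by (intros; rewrite E1; reflexivity).
    match goal with |- ?x = ?y => transitivity (x - y + y); [ring|] end. rewrite G; [ring| | |].
    - intros u p Hu _. eapply dR_eq; [apply (dR_mult (fun u => f (zz u p))); [apply (dR_comp f (fun u => zz u p)); [apply Hf, inD; lra|]|apply dR_const]|].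
      + unfold zz. apply (dR_plus (fun _ => z0)); [apply dR_const|apply ray_dR].
      + cbv beta. unfold k. field. apply off.
    - intros u p Hu _. assert (un : RtoC u <> 0) by (apply RtoC_neq; lra). unfold Cdiv. 
      eapply dR_eq; [apply (dR_mult (fun p => f (zz u p))); [apply (dR_comp f (zz u)); [apply Hf, inD; lra|]|apply dR_const]|].
      + unfold zz. apply (dR_plus (fun _ => z0)); [apply dR_const|]. apply (dR_mult (fun _ => RtoC u)); [apply dR_const|]. apply (dR_plus (fun _ => b)); [apply dR_const|apply circ_dR].
      + cbv beta. field. exact un.
    - intros u p Hu. assert (cp : continuous (fun q : R * R => circ r (snd q)) (u, p)) by (apply (cC_compR (circ r) (fun q : R * R => snd q)); [apply cR_snd|apply cc0]).
      apply cC_mult; [|cc]. apply (cC_comp f' (fun q : R * R => zz (fst q) (snd q))); [unfold zz; cc|]. apply Hf, inD. simpl. lra. }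
  set (I := CI (fun p => f (a + circ r p) * k p) 0 (2 * PI)) in *.
  assert (W := winding b r Hb). fold k in W.
  destruct (dC_eps f z0 (f' z0)) with (eps := 1%R) as [d0 [d0p Hd0]]; [apply Hf; lra|lra|].
  set (K := ((1 + Cmod (f' z0)) * (2 * r) * (r / (r - Cmod b)) * (2 * PI))%R).
  assert (Kp : 0 <= K). { unfold K. assert (0 <= r / (r - Cmod b)) by (apply Rmult_le_pos; [lra|left; apply Rinv_0_lt_compat; lra]). set (q := (r / (r - Cmod b))%R) in *; clearbody q. generalize (Cmod_ge_0 (f' z0)). intros. pos. }
  change (I = 2 * RtoC PI * Ci * f z0). cut (I - 2 * RtoC PI * Ci * f z0 = 0). { intros H. transitivity (I - 2 * RtoC PI * Ci * f z0 + 2 * RtoC PI * Ci * f z0); [ring|]. rewrite H. ring. }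
  apply Cmod_eq_0. apply Rle_antisym; [|apply Cmod_ge_0]. apply Cmod_le_limit. intros eps He. rewrite Rplus_0_l.
  set (d := Rmin 1 (Rmin (d0 / (4 * r)) (eps / (K + 1)))).
  assert (dp : 0 < d). { apply Rmin_glb_lt; [lra|]. apply Rmin_glb_lt; apply Rdiv_lt_0_compat; lra. }
  assert (d1 : d <= 1) by apply Rmin_l.
  assert (d2 : d <= d0 / (4 * r)) by (eapply Rle_trans; [apply Rmin_r|apply Rmin_l]).
  assert (d3 : d <= eps / (K + 1)) by (eapply Rle_trans; [apply Rmin_r|apply Rmin_r]).
  rewrite (Inv d) by lra. rewrite <- W. rewrite <- (Cmult_comm (f z0)), <- CI_scal by exact kc.
  rewrite <- CI_minus; [|intros p; apply cC_mult; [apply fc; lra|apply kc]|intros p; apply cC_mult; [apply cC_const|apply kc]].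
  apply Rle_trans with (d * K)%R.
  - replace (d * K)%R with ((d * ((1 + Cmod (f' z0)) * (2 * r)) * (r / (r - Cmod b))) * (2 * PI - 0))%R by (unfold K; ring).
    apply CI_norm_const; [lra| |].
    + intros p. apply cC_minus; (apply cC_mult; [|apply kc]); [apply fc; lra|apply cC_const].
    + intros p _. replace (f (zz d p) * k p - f z0 * k p) with ((f (zz d p) - f z0) * k p) by ring. rewrite Cmod_mult.
      assert (hb : Cmod (RtoC d * (b + circ r p)) <= d * (2 * r)).
      { rewrite Cmod_mult, Cmod_R, Rabs_pos_eq by lra. apply Rmult_le_compat_l; [lra|]. triangle. rewrite circ_mod; lra. }
      assert (hs : Cmod (RtoC d * (b + circ r p)) < d0).
      { eapply Rle_lt_trans; [exact hb|]. apply Rle_lt_trans with (d0 / (4 * r) * (2 * r))%R; [apply Rmult_le_compat_r; lra|]. replace (d0 / (4 * r) * (2 * r))%R with (d0 / 2)%R by (field; lra). lra. }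
      specialize (Hd0 _ hs). fold (zz d p) in Hd0. set (h := RtoC d * (b + circ r p)) in *.
      apply Rmult_le_compat; try apply Cmod_ge_0.
      * replace (f (zz d p) - f z0) with ((f (zz d p) - f z0 - h * f' z0) + h * f' z0) by ring.
        triangle. rewrite Cmod_mult.
        apply Rle_trans with (Cmod h * (1 + Cmod (f' z0)))%R; [lra|].
        replace (d * ((1 + Cmod (f' z0)) * (2 * r)))%R with ((d * (2 * r)) * (1 + Cmod (f' z0)))%R by ring.
        apply Rmult_le_compat_r; [generalize (Cmod_ge_0 (f' z0)); lra|exact hb].
      * unfold k. rewrite Cmod_div by apply off. rewrite Cmod_mult, Cmod_Ci, Rmult_1_l, circ_mod by lra.
        apply Rmult_le_compat_l; [lra|]. apply Rinv_le_contravar; [lra|]. generalize (circ_away b r 1 p Hb ltac:(lra)). rewrite Cmult_1_l. auto.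
  - apply Rle_trans with (eps / (K + 1) * (K + 1))%R; [apply Rmult_le_compat; lra|]. right. field. lra.
Qed.

Lemma locally_Cdisc (a z : C) r0 : Cmod (z - a) < r0 -> locally z (fun y : C => (Cmod (y - a) < r0)).
Proof.
  intros H. assert (C : continuous (fun y : C => Cmod (y - a)) z) by cc.
  assert (e : 0 < r0 - Cmod (z - a)) by lra.
  generalize (proj1 (filterlim_locally _ _) C (mkposreal _ e)). apply filter_imp. intros y Hy.
  change (Rabs (Cmod (y - a) - Cmod (z - a)) < r0 - Cmod (z - a)) in Hy. apply Rabs_def2 in Hy. lra.
Qed.

Lemma dC_locally_zero (f : C -> C) z l d : 0 < d -> (forall h, Cmod h < d -> f (z + h)%C = 0) -> dC f z l -> l = 0.
Proof.
  intros Hd Hf Hl. apply Cmod_eq_0. apply Rle_antisym; [|apply Cmod_ge_0]. apply Cmod_le_limit. intros eps He. rewrite Rplus_0_l.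
  destruct (dC_eps _ _ _ Hl eps He) as [d' [d'p H]]. set (m := (Rmin d d' / 2)%R).
  assert (mp : 0 < m) by (unfold m; generalize (Rmin_glb_lt d d' 0 Hd d'p); lra).
  assert (m1 : m < d) by (unfold m in *; generalize (Rmin_l d d'); lra). assert (m2 : m < d') by (unfold m in *; generalize (Rmin_r d d'); lra).
  specialize (H (RtoC m)). rewrite Cmod_R, Rabs_pos_eq in H by lra. specialize (H m2).
  rewrite Hf in H by (rewrite Cmod_R, Rabs_pos_eq; lra).
  replace (f z) with (f (z + 0)) in H by (f_equal; ring). rewrite Hf in H by (rewrite Cmod_0; lra).
  replace (0 - 0 - RtoC m * l) with (- (RtoC m * l)) in H by ring. rewrite Cmod_opp, Cmod_mult, Cmod_R, Rabs_pos_eq in H by lra.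
  apply Rmult_le_reg_l with m; lra.
Qed.

(** Near [a] the quotient is identically zero, so that no singularity appears. *)
Lemma divide_step (f f' : C -> C) (a : C) r r0 : 0 < r -> 0 < r0 -> holo (fun z => (Cmod (z - a) <= r)) f f' -> (forall z, Cmod (z - a) < r0 -> f z = 0) ->
  exists g', holo (fun z => (Cmod (z - a) <= r)) (fun z => f z / (z - a)) g'.
Proof.
  intros rp Hr0 Hf Hz. exists (fun z => f' z / (z - a) - f z / ((z - a) * (z - a))).
  intros z Dz. destruct (Rlt_dec (Cmod (z - a)) r0) as [L|L].
  - assert (Z : forall y, Cmod (y - a) <= r -> Cmod (y - a) < r0 -> f' y / (y - a) - f y / ((y - a) * (y - a)) = 0).
    { intros y D1 D2. rewrite (dC_locally_zero f y (f' y) (r0 - Cmod (y - a))); [rewrite Hz by auto; unfold Cdiv; ring|lra| |apply Hf; auto].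
      intros h Hh. apply Hz. replace (y + h - a) with ((y - a) + h) by ring. eapply Rle_lt_trans; [apply Cmod_triangle|]. lra. }
    rewrite Z by auto. split.
    + apply dC_intro_eps. intros eps He. exists (r0 - Cmod (z - a))%R. split; [lra|]. intros h Hh.
      rewrite (Hz (z + h)), (Hz z); auto.
      * replace (0 / (z + h - a) - 0 / (z - a) - h * 0) with (RtoC 0) by (unfold Cdiv; ring). rewrite Cmod_0. apply Rmult_le_pos; [lra|apply Cmod_ge_0].
      * replace (z + h - a) with ((z - a) + h) by ring. eapply Rle_lt_trans; [apply Cmod_triangle|]. lra.
    + destruct (Req_dec (Cmod (z - a)) 0) as [E0|E0].
      * apply (continuous_ext_loc _ (fun _ => RtoC 0)); [|apply cC_const].
        generalize (locally_Cdisc a z (Rmin r r0) ltac:(rewrite E0; apply Rmin_glb_lt; auto)). apply filter_imp. intros y Hy. symmetry. apply Z.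
        -- left. eapply Rlt_le_trans; [exact Hy|apply Rmin_l].
        -- eapply Rlt_le_trans; [exact Hy|apply Rmin_r].
      * assert (N : z - a <> 0) by (intros Q; apply E0; rewrite Q; apply Cmod_0).
        destruct (Hf z Dz) as [F1 F2]. assert (F0 := dC_continuous _ _ _ F1). cc. apply Cmult_neq_0; exact N.
  - assert (N : z - a <> 0) by (intros Q; apply L; rewrite Q, Cmod_0; auto).
    destruct (Hf z Dz) as [F1 F2]. assert (F0 := dC_continuous _ _ _ F1). split.
    + unfold Cdiv at 1. eapply dC_eq; [apply dC_mult; [exact F1|apply (dC_comp Cinv (fun z => z - a)); [apply Cinv_dC; exact N|apply dC_minus; [apply dC_id|apply dC_const]]]|]. cbv beta. field. exact N.
    + cc. apply Cmult_neq_0; exact N.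
Qed.

Fixpoint divn (f : C -> C) (a : C) (n : nat) : C -> C :=
  match n with O => f | S n => fun z => divn f a n z / (z - a) end.

(** Unique continuation: the maximum principle for f(z) / (z-a)^n, n large. *)
Lemma vanish_on_disc (f f' : C -> C) (a : C) r r0 : 0 < r -> 0 < r0 -> holo (fun z => (Cmod (z - a) <= r)) f f' -> 
  (forall z, Cmod (z - a) < r0 -> f z = 0) -> forall z, Cmod (z - a) < r -> f z = 0.
Proof.
  intros rp r0p Hf Hz z0 Hz0. assert (HP := PI_RGT_0).
  destruct (Rlt_dec (Cmod (z0 - a)) r0) as [L|L]; [auto|].
  assert (H : forall n, (exists g', holo (fun z => (Cmod (z - a) <= r)) (divn f a n) g') /\ (forall z, Cmod (z - a) < r0 -> divn f a n z = 0)).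
  { induction n as [|n [[g' Hg] Hn]]; [split; [exists f'|]; auto|]. split.
    - apply (divide_step _ g' a r r0); auto.
    - intros z Hzz. simpl. rewrite Hn by auto. unfold Cdiv. ring. }
  set (y := Cmod (z0 - a)) in *. assert (yp : 0 < y) by lra.
  assert (M0 : forall n, Cmod (divn f a n z0) = (Cmod (f z0) / y ^ n)%R).
  { induction n as [|n IH]; simpl; [field|]. rewrite Cmod_div.
    - rewrite IH. fold y. field. split; [apply pow_nonzero|]; lra.
    - intros Q. unfold y in yp. rewrite Q, Cmod_0 in yp. lra. }
  assert (MC : forall n p, Cmod (divn f a n (a + circ r p)) = (Cmod (f (a + circ r p)%C) / r ^ n)%R).
  { intros n p. assert (E : a + circ r p - a = circ r p) by ring. induction n as [|n IH]; simpl; [field|]. rewrite E, Cmod_div.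
    - rewrite IH, circ_mod by lra. field. split; [apply pow_nonzero|]; lra.
    - intros Q. generalize (circ_mod r p ltac:(lra)). rewrite Q, Cmod_0. lra. }
  set (k := fun p => Ci * circ r p / (a - z0 + circ r p)).
  set (g := fun p => (Cmod (f (a + circ r p)%C) * Cmod (k p))%R).
  destruct (cauchy_formula f f' a z0 r Hf Hz0) as [_ Cf]. fold k in Cf.
  set (G := RInt g 0 (2 * PI)).
  assert (Gi : is_RInt g 0 (2 * PI) G).
  { apply (RInt_correct (V := R_CompleteNormedModule)), (ex_RInt_continuous (V := R_CompleteNormedModule)). intros p _.
    apply (continuous_ext (fun p => Cmod (f (a + circ r p) * k p))); [intros; apply Cmod_mult|]. apply (cC_Cmod (fun p => f (a + circ r p) * k p)), Cf. }
  assert (Bn : forall n, 2 * PI * Cmod (f z0) <= G * (y / r) ^ n).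
  { intros n. destruct (H n) as [[g' Hg] _]. destruct (cauchy_formula _ _ a z0 r Hg Hz0) as [Fn Cn]. fold k in Fn, Cn.
    assert (Q := is_RInt_norm_le _ (fun p => scal (/ r ^ n)%R (g p)) 0 (2 * PI) _ (scal (/ r ^ n)%R G) ltac:(lra) (CI_correct _ _ _ Cn) (is_RInt_scal (V := R_NormedModule) g _ _ _ _ Gi)).
    rewrite Fn in Q. rewrite !Cmod_mult, !Cmod_R, Cmod_Ci, M0, !Rabs_pos_eq in Q by lra.
    assert (yn : 0 < y ^ n) by (apply pow_lt; auto). assert (rn : 0 < r ^ n) by (apply pow_lt; auto).
    unfold Rdiv. rewrite Rpow_mult_distr, pow_inv. apply Rmult_le_reg_r with (/ y ^ n)%R; [apply Rinv_0_lt_compat; auto|].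
    replace (G * (y ^ n * / r ^ n) * / y ^ n)%R with (/ r ^ n * G)%R by (field; lra).
    eapply Rle_trans; [|apply Q]. { right; unfold Rdiv; ring. }
    intros p _. rewrite Cmod_mult, MC. unfold g, scal. simpl. unfold mult. simpl. right. fold (k p). unfold Rdiv. ring. }
  apply Cmod_eq_0. apply Rle_antisym; [|apply Cmod_ge_0]. apply Rnot_lt_le. intros Fp.
  assert (Gp : 0 < G). { generalize (Bn 0%nat). simpl. nra. }
  assert (q1 : Rabs (y / r) < 1).
  { rewrite Rabs_pos_eq by (left; apply Rdiv_lt_0_compat; lra). apply Rmult_lt_reg_r with r; [lra|]. unfold Rdiv. rewrite Rmult_assoc, Rinv_l; lra. }
  destruct (pow_lt_1_zero (y / r) q1 (2 * PI * Cmod (f z0) / G)) as [N HN].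
  { apply Rdiv_lt_0_compat; [|auto]. apply Rmult_lt_0_compat; lra. }
  specialize (HN N ltac:(lia)). generalize (Rle_abs ((y / r) ^ N)). intros A. specialize (Bn N).
  apply Rmult_lt_compat_l with (r := G) in HN; [|auto]. replace (G * (2 * PI * Cmod (f z0) / G))%R with (2 * PI * Cmod (f z0))%R in HN by (field; lra). nra.
Qed.

(** Continuation along the segment [0, 1], by a chain of overlapping discs. *)
Lemma vanish_along_segment (f f' : C -> C) rho r0 : 0 < rho -> 0 < r0 ->
  (forall x, 0 <= x <= 1 -> holo (fun z => (Cmod (z - RtoC x) <= rho)) f f') ->
  (forall z, Cmod (z - 1) < r0 -> f z = 0) -> f 0 = 0.
Proof.
  intros Hr Hr0 Hf Hz.
  destruct (archimed_cor1 (rho / 2) ltac:(lra)) as [N [HN1 HN2]].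
  assert (Np : 0 < INR N) by (apply lt_0_INR; lia).
  assert (C : forall k, (k <= N)%nat -> forall z, Cmod (z - RtoC (1 - INR k / INR N)) < Rmin r0 (rho / 2) -> f z = 0).
  { induction k as [|k IH]; intros Hk z Hzk.
    - apply Hz. simpl INR in Hzk. replace (1 - 0 / INR N)%R with 1%R in Hzk by (field; lra). eapply Rlt_le_trans; [exact Hzk|apply Rmin_l].
    - assert (Lk : 0 <= 1 - INR k / INR N <= 1).
      { assert (K1 : INR k <= INR N) by (apply le_INR; lia). assert (0 <= INR k / INR N <= 1); [|lra]. split.
        - apply Rmult_le_pos; [apply pos_INR|left; apply Rinv_0_lt_compat; auto].
        - apply Rmult_le_reg_r with (INR N); auto. unfold Rdiv. rewrite Rmult_assoc, Rinv_l; lra. }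
      apply (vanish_on_disc f f' (RtoC (1 - INR k / INR N)) rho (Rmin r0 (rho / 2))); auto.
      + apply Rmin_glb_lt; lra.
      + intros z' Hz'. apply IH; auto. lia.
      + replace (z - RtoC (1 - INR k / INR N)) with ((z - RtoC (1 - INR (S k) / INR N)) + - RtoC (/ INR N)).
        2:{ rewrite S_INR, !RtoC_minus. unfold Rdiv. rewrite !RtoC_mult, RtoC_plus. ring. }
        eapply Rle_lt_trans; [apply Cmod_triangle|]. rewrite Cmod_opp, Cmod_R, Rabs_pos_eq by (left; apply Rinv_0_lt_compat; auto).
        generalize (Rmin_r r0 (rho / 2)). lra. }
  apply (C N ltac:(lia)). replace (1 - INR N / INR N)%R with 0%R by (field; lra). replace (0 - 0) with (RtoC 0) by ring. rewrite Cmod_0. apply Rmin_glb_lt; lra.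
Qed.

Implicit Types (lam : C).

(** ** Holomorphic dependence of the integrals *)

Lemma ray_dC_dR (g : C -> C) z h u l : dC g (z + RtoC u * h) l -> dR (fun u => g (z + RtoC u * h)) u (h * l).
Proof.
  intros H. apply (dR_comp g (fun u => z + RtoC u * h)); auto.
  eapply dR_eq; [apply (dR_plus (fun _ => z)); [apply dR_const|apply ray_dR]|]. ring.
Qed.

(** The bound on the second derivative gives the quadratic remainder, and a Lipschitz bound for
    the derivative. *)
Lemma II_holo (F F1 F2 : C -> R -> C) z r M : 0 < r ->
  (forall h t, Cmod h <= r -> dC (fun z => F z t) (z + h) (F1 (z + h)%C t) /\ dC (fun z => F1 z t) (z + h) (F2 (z + h)%C t)) ->
  (forall h, Cmod h <= r -> dom (F (z + h)%C) M /\ dom (F1 (z + h)%C) M) ->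
  (forall h t, Cmod h <= r -> Cmod (F2 (z + h)%C t) <= M / (1 + t * t)) ->
  dC (fun z => II (F z)) z (II (F1 z)) /\ continuous (fun z => II (F1 z)) z.
Proof.
  intros Hr HD Hdom HB.
  assert (HF0 : dom (F1 z) M). { replace z with (z + 0) by ring. apply Hdom. rewrite Cmod_0. lra. }
  assert (Mp := dom_pos _ _ HF0).
  assert (sc : forall h u, Cmod h <= r -> 0 <= u <= 1 -> Cmod (RtoC u * h) <= r).
  { intros h u Hh Hu. rewrite Cmod_mult, Cmod_R, Rabs_pos_eq by lra. generalize (Cmod_ge_0 h). nra. }
  assert (E0 : forall h, z + RtoC 0 * h = z) by (intros; ring). assert (E1 : forall h, z + RtoC 1 * h = z + h) by (intros; ring).
  split.
  - apply (II_dC F (F1 z) z r M M M Hr); auto. { intros h Hh. apply Hdom; auto. }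
    intros h t Hh.
    assert (T := taylor2 (fun u => F (z + RtoC u * h) t) (fun u => h * F1 (z + RtoC u * h) t) (fun u => h * (h * F2 (z + RtoC u * h) t)) (M / (1 + t * t) * (Cmod h * Cmod h))).
    cbv beta in T. rewrite E0, E1 in T. replace (M * (Cmod h * Cmod h) / (1 + t * t))%R with (M / (1 + t * t) * (Cmod h * Cmod h))%R by (unfold Rdiv; ring).
    apply T.
    + intros u Hu. apply (ray_dC_dR (fun z => F z t)). apply HD; auto.
    + intros u Hu. eapply dR_eq; [apply (dR_mult (fun _ => h) (fun u => F1 (z + RtoC u * h) t)); [apply dR_const|]|].
      * apply (ray_dC_dR (fun z => F1 z t)). apply HD; auto.
      * cbv beta. ring.
    + intros u Hu. rewrite !Cmod_mult. assert (B := HB (RtoC u * h) t (sc h u Hh Hu)). generalize (Cmod_ge_0 h). intros C.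
      replace (M / (1 + t * t) * (Cmod h * Cmod h))%R with (Cmod h * (Cmod h * (M / (1 + t * t))))%R by ring.
      apply Rmult_le_compat_l; auto. apply Rmult_le_compat_l; auto.
  - assert (L : forall h, Cmod h <= r -> Cmod (II (F1 (z + h)%C) - II (F1 z)) <= Cmod h * M * PI).
    { intros h Hh. apply (II_diff_bound _ _ M M); auto; [apply Hdom; auto|]. intros t.
      assert (T := mean_value_const (fun u => F1 (z + RtoC u * h) t) (fun u => h * F2 (z + RtoC u * h) t) (Cmod h * M / (1 + t * t)) 0 1 ltac:(lra)).
      cbv beta in T. rewrite E0, E1 in T. replace (Cmod h * M / (1 + t * t))%R with (Cmod h * M / (1 + t * t) * (1 - 0))%R by ring. apply T.
      + intros u Hu. apply (ray_dC_dR (fun z => F1 z t)). apply HD; auto.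
      + intros u Hu. rewrite Cmod_mult. unfold Rdiv. rewrite Rmult_assoc. apply Rmult_le_compat_l; [apply Cmod_ge_0|]. apply HB; auto. }
    apply continuous_C_eps. intros eps He.
    assert (HP := PI_RGT_0). assert (MP : 0 <= M * PI) by (apply Rmult_le_pos; lra).
    generalize (locally_Cdisc z z (Rmin r (eps / (M * PI + 1))) ltac:(replace (z - z) with (RtoC 0) by ring; rewrite Cmod_0; apply Rmin_glb_lt; [lra|apply Rdiv_lt_0_compat; lra])).
    apply filter_imp. intros y Hy.
    assert (y1 : Cmod (y - z) < r) by (eapply Rlt_le_trans; [exact Hy|apply Rmin_l]).
    assert (y2 : Cmod (y - z) < eps / (M * PI + 1)) by (eapply Rlt_le_trans; [exact Hy|apply Rmin_r]).
    specialize (L (y - z) ltac:(lra)). replace (z + (y - z)) with y in L by (symmetry; apply Cplus_minus_cancel).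
    eapply Rle_lt_trans; [exact L|]. rewrite Rmult_assoc. apply Rle_lt_trans with (Cmod (y - z) * (M * PI + 1))%R; [apply Rmult_le_compat_l; [apply Cmod_ge_0|lra]|].
    replace eps with (eps / (M * PI + 1) * (M * PI + 1))%R by (field; lra). apply Rmult_lt_compat_r; lra.
Qed.

(** [FF] along a complex line of arguments, and its first two derivatives. *)
Definition FP sg xi0 eta0 p q lam (t : R) : C := FF sg (xi0 + lam * p) (eta0 + lam * q) t.
Definition FP1 sg xi0 eta0 p q lam (t : R) : C := p * AA1 (vline sg t) (xi0 + lam * p) * AA (- vline sg t) (eta0 + lam * q) + q * (AA (vline sg t) (xi0 + lam * p) * AA1 (- vline sg t) (eta0 + lam * q)).
Definition FP2 sg xi0 eta0 p q lam (t : R) : C :=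
  p * p * (qq (vline sg t) (xi0 + lam * p) * (AA (vline sg t) (xi0 + lam * p) * AA (- vline sg t) (eta0 + lam * q))) +
  2 * p * q * (AA1 (vline sg t) (xi0 + lam * p) * AA1 (- vline sg t) (eta0 + lam * q)) +
  q * q * (qq (- vline sg t) (eta0 + lam * q) * (AA (vline sg t) (xi0 + lam * p) * AA (- vline sg t) (eta0 + lam * q))).

Lemma path_dC a b lam : dC (fun lam => a + lam * b) lam b.
Proof. eapply dC_eq; [apply dC_plus; [apply dC_const|apply dC_mult; [apply dC_id|apply dC_const]]|]. cbv beta. ring. Qed.

Lemma FP_dC sg xi0 eta0 p q lam t : Rabs sg < 3/4 ->
  dC (fun lam => FP sg xi0 eta0 p q lam t) lam (FP1 sg xi0 eta0 p q lam t) /\ dC (fun lam => FP1 sg xi0 eta0 p q lam t) lam (FP2 sg xi0 eta0 p q lam t).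
Proof.
  intros Hs.
  assert (S := vline_strip sg t Hs). assert (S' := strip_opp _ S).
  assert (A0 := dC_comp (AA (vline sg t)) (fun lam => xi0 + lam * p) lam _ _ (AA_dC _ _ S) (path_dC xi0 p lam)).
  assert (A1 := dC_comp (AA1 (vline sg t)) (fun lam => xi0 + lam * p) lam _ _ (AA1_dC _ _ S) (path_dC xi0 p lam)).
  assert (B0 := dC_comp (AA (- vline sg t)) (fun lam => eta0 + lam * q) lam _ _ (AA_dC _ _ S') (path_dC eta0 q lam)).
  assert (B1 := dC_comp (AA1 (- vline sg t)) (fun lam => eta0 + lam * q) lam _ _ (AA1_dC _ _ S') (path_dC eta0 q lam)).
  split.
  - eapply dC_eq; [exact (dC_mult _ _ _ _ _ A0 B0)|]. unfold FP1. cbv beta. ring.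
  - eapply dC_eq; [exact (dC_plus _ _ _ _ _ (dC_mult _ _ _ _ _ (dC_mult _ _ _ _ _ (dC_const p lam) A1) B0) (dC_mult _ _ _ _ _ (dC_const q lam) (dC_mult _ _ _ _ _ A0 B1)))|].
    unfold FP2, qq. cbv beta. ring.
Qed.

Lemma qq_le sg xi t B : Rabs sg < 3/4 -> Cmod xi <= B -> Cmod (qq (vline sg t) xi) <= (4 + B * B) * (1 + Rabs t) /\ Cmod (qq (- vline sg t) xi) <= (4 + B * B) * (1 + Rabs t).
Proof.
  intros Hs HB. assert (C0 := Cmod_ge_0 xi).
  assert (V : Cmod (vline sg t) <= 3/4 + Rabs t).
  { unfold vline. triangle. rewrite Cmod_mult, Cmod_Ci, !Cmod_R. lra. }
  assert (G : forall w, Cmod w = Cmod (vline sg t) -> Cmod (qq w xi) <= (4 + B * B) * (1 + Rabs t)).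
  { intros w Hw. unfold qq. triangle. rewrite Cmod_opp, !Cmod_mult, Cmod_R, Cmod_Ci, Hw, Rabs_pos_eq by lra.
    generalize (Rabs_pos t). intros. assert (Cmod xi * Cmod xi <= B * B) by (apply Rmult_le_compat; auto). assert (0 <= B * B * Rabs t) by (apply Rmult_le_pos; nra). nra. }
  split; apply G; auto. apply Cmod_opp.
Qed.

Lemma FP_holo sg xi0 eta0 p q c R0 Y0 d lam r : Rabs sg < 3/4 -> 0 < c <= R0 -> 0 < d -> 0 <= Y0 -> 0 < r ->
  (forall h, Cmod h <= r -> box c R0 Y0 d (xi0 + (lam + h) * p) (eta0 + (lam + h) * q)) ->
  dC (fun lam => II (FP sg xi0 eta0 p q lam)) lam (II (FP1 sg xi0 eta0 p q lam)) /\ continuous (fun lam => II (FP1 sg xi0 eta0 p q lam)) lam.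
Proof.
  intros Hs Hc Hd HY Hr HB. destruct (AA_product_bound sg c R0 Y0 d Hs Hc Hd HY) as [K [Kp HK]].
  set (B := (R0 + Y0)%R). set (W := (4 + B * B)%R). assert (Wp : 4 <= W) by (unfold W; nra).
  set (cp := Cmod p). set (cq := Cmod q). assert (cpp : 0 <= cp) by apply Cmod_ge_0. assert (cqp : 0 <= cq) by apply Cmod_ge_0.
  set (M := (2 * K * (1 + cp + cq + (cp * cp + 2 * cp * cq + cq * cq) * W))%R).
  assert (bd : forall xi eta, box c R0 Y0 d xi eta -> Cmod xi <= B /\ Cmod eta <= B).
  { intros xi eta [B1 [B2 [B3 [B4 _]]]]. unfold B. split; (eapply Rle_trans; [apply Cmod_le_sum|]); rewrite (Rabs_pos_eq (Re _)) by lra; lra. }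
  assert (IK : forall t, K / ((1 + t * t) * (1 + t * t)) <= K / (1 + t * t)) by (intros t; apply inv_sqr_sqr; auto).
  assert (c2 : 0 <= cp * cp + 2 * cp * cq + cq * cq) by nra.
  assert (c3 : 0 <= (cp * cp + 2 * cp * cq + cq * cq) * W) by (apply Rmult_le_pos; lra).
  assert (K3 : 0 <= K * ((cp * cp + 2 * cp * cq + cq * cq) * W)) by (apply Rmult_le_pos; lra).
  assert (Kcp : 0 <= K * cp) by (apply Rmult_le_pos; lra). assert (Kcq : 0 <= K * cq) by (apply Rmult_le_pos; lra).
  apply (II_holo (FP sg xi0 eta0 p q) (FP1 sg xi0 eta0 p q) (FP2 sg xi0 eta0 p q) lam r M Hr).
  - intros h t _. apply FP_dC; auto.
  - intros h Hh. specialize (HB h Hh). set (X := xi0 + (lam + h) * p) in *. set (Y := eta0 + (lam + h) * q) in *.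
    assert (cA : cont (fun t => AA (vline sg t) X) /\ cont (fun t => AA1 (vline sg t) X)) by (apply AA_AA1_cont; auto).
    assert (cB : cont (fun t => AA (- vline sg t) Y) /\ cont (fun t => AA1 (- vline sg t) Y)).
    { assert (Q := AA_AA1_cont (- sg) Y ltac:(rewrite Rabs_Ropp; auto)). destruct Q as [Q1 Q2].
      split; intros t.
      - apply (continuous_ext (fun t => AA (RtoC (- sg) + Ci * RtoC (- t)) Y)); [intros; f_equal; unfold vline; ceq; ring|].
        apply (cC_compR (fun t => AA (RtoC (- sg) + Ci * RtoC t) Y) (fun t => - t)%R); [cc|apply Q1].
      - apply (continuous_ext (fun t => AA1 (RtoC (- sg) + Ci * RtoC (- t)) Y)); [intros; f_equal; unfold vline; ceq; ring|].
        apply (cC_compR (fun t => AA1 (RtoC (- sg) + Ci * RtoC t) Y) (fun t => - t)%R); [cc|apply Q2]. }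
    destruct cA as [cA cA1]. destruct cB as [cB cB1].
    split.
    + apply (dom_le _ K); [|unfold M; nra]. split. { intros t. unfold FP, FF. apply cC_mult; [apply cA|apply cB]. }
      intros t. unfold FP, FF. rewrite Cmod_mult. eapply Rle_trans; [apply (HK t X Y HB); auto|apply IK].
    + apply (dom_le _ (K * (cp + cq))); [|unfold M; nra]. split.
      { intros t. unfold FP1. apply cC_plus.
        - apply cC_mult; [apply cC_mult; [apply cC_const|apply cA1]|apply cB]. - apply cC_mult; [apply cC_const|apply cC_mult; [apply cA|apply cB1]]. }
      intros t. unfold FP1. fold X Y. triangle. rewrite !Cmod_mult. fold cp cq.
      assert (T1 := HK t X Y HB _ _ (or_intror (eq_refl (AA1 (vline sg t) X))) (or_introl (eq_refl (AA (- vline sg t) Y)))).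
      assert (T2 := HK t X Y HB _ _ (or_introl (eq_refl (AA (vline sg t) X))) (or_intror (eq_refl (AA1 (- vline sg t) Y)))).
      specialize (IK t). replace (K * (cp + cq) / (1 + t * t))%R with (cp * (K / (1 + t * t)) + cq * (K / (1 + t * t)))%R by (unfold Rdiv; ring).
      rewrite Rmult_assoc. apply Rplus_le_compat; apply Rmult_le_compat_l; lra.
  - intros h t Hh. specialize (HB h Hh). set (X := xi0 + (lam + h) * p) in *. set (Y := eta0 + (lam + h) * q) in *.
    assert (T0 := HK t X Y HB _ _ (or_introl (eq_refl (AA (vline sg t) X))) (or_introl (eq_refl (AA (- vline sg t) Y)))).
    assert (T3 := HK t X Y HB _ _ (or_intror (eq_refl (AA1 (vline sg t) X))) (or_intror (eq_refl (AA1 (- vline sg t) Y)))).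
    destruct (bd X Y HB) as [bX bY]. destruct (qq_le sg X t B Hs bX) as [qX _]. destruct (qq_le sg Y t B Hs bY) as [_ qY]. fold W in qX, qY.
    set (k := (K / ((1 + t * t) * (1 + t * t)))%R) in *. assert (tp := Rabs_pos t).
    assert (k0 : 0 <= k). { apply Rmult_le_pos; auto. left. apply Rinv_0_lt_compat. generalize (sqr1_pos t); nra. }
    assert (IK2 : (1 + Rabs t) * k <= 2 * K / (1 + t * t)) by (apply inv_sqr_sqr; auto).
    apply Rle_trans with ((cp * cp + 2 * cp * cq + cq * cq) * W * ((1 + Rabs t) * k))%R.
    + unfold FP2. fold X Y. triangle. eapply Rle_trans; [apply Rplus_le_compat_r, Cmod_triangle|].
      rewrite !Cmod_mult, Cmod_R, (Rabs_pos_eq 2) by lra. fold cp cq.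
      set (a0 := (Cmod (AA (vline sg t) X) * Cmod (AA (- vline sg t) Y))%R) in *. set (a1 := (Cmod (AA1 (vline sg t) X) * Cmod (AA1 (- vline sg t) Y))%R) in *.
      assert (a00 : 0 <= a0) by (apply Rmult_le_pos; apply Cmod_ge_0).
      assert (u1 : Cmod (qq (vline sg t) X) * a0 <= W * (1 + Rabs t) * k) by (apply Rmult_le_compat; auto; apply Cmod_ge_0).
      assert (u2 : Cmod (qq (- vline sg t) Y) * a0 <= W * (1 + Rabs t) * k) by (apply Rmult_le_compat; auto; apply Cmod_ge_0).
      assert (u3 : a1 <= W * (1 + Rabs t) * k). { eapply Rle_trans; [exact T3|]. rewrite <- (Rmult_1_l k) at 1. apply Rmult_le_compat_r; nra. }
      replace ((cp * cp + 2 * cp * cq + cq * cq) * W * ((1 + Rabs t) * k))%R with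
        (cp * cp * (W * (1 + Rabs t) * k) + 2 * cp * cq * (W * (1 + Rabs t) * k) + cq * cq * (W * (1 + Rabs t) * k))%R by ring.
      apply Rplus_le_compat; [apply Rplus_le_compat|]; apply Rmult_le_compat_l; auto; nra.
    + eapply Rle_trans; [apply Rmult_le_compat_l; [exact c3|exact IK2]|]. unfold M, Rdiv. rewrite <- !Rmult_assoc. 
      apply Rmult_le_compat_r; [left; apply Rinv_0_lt_compat, sqr1_pos|]. nra.
Qed.

(** ** Continuation to the wedge *)

Lemma cos_transform_dC (g : R -> C) z : cont g -> (forall v, Cmod (g v) <= 1) ->
  dC (fun z => CI (fun v => Cexp (Ci * z * RtoC (cos v)) * g v) 0 (PI / 2)) z
    (CI (fun v => Cexp (Ci * z * RtoC (cos v)) * (Ci * RtoC (cos v) * g v)) 0 (PI / 2)).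
Proof.
  intros gc gb. assert (HP := PI_RGT_0). apply (dC_quad _ _ _ (exp (Cmod z) * exp 1 * (PI / 2 - 0)) 1); [lra|]. intros h Hh.
  assert (c1 : forall z, cont (fun v => Cexp (Ci * z * RtoC (cos v)) * g v)) by (intros w v; cc; apply gc).
  assert (c2 : cont (fun v => Cexp (Ci * z * RtoC (cos v)) * (Ci * RtoC (cos v) * g v))) by (intros v; cc; apply gc).
  rewrite <- (CI_scal _ _ _ h c2), <- CI_minus; auto. rewrite <- CI_minus.
  2:{ intros v. apply cC_minus; apply c1. } 2:{ intros v. apply cC_mult; [apply cC_const|apply c2]. }
  replace (exp (Cmod z) * exp 1 * (PI / 2 - 0) * (Cmod h * Cmod h))%R with (exp (Cmod z) * exp 1 * (Cmod h * Cmod h) * (PI / 2 - 0))%R by ring.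
  apply CI_norm_const; [lra| |].
  - intros v. apply cC_minus; [apply cC_minus; apply c1|apply cC_mult; [apply cC_const|apply c2]].
  - intros v _. set (w := Ci * h * RtoC (cos v)).
    replace (Cexp (Ci * (z + h) * RtoC (cos v)) * g v - Cexp (Ci * z * RtoC (cos v)) * g v - h * (Cexp (Ci * z * RtoC (cos v)) * (Ci * RtoC (cos v) * g v)))
      with (Cexp (Ci * z * RtoC (cos v)) * (Cexp w - 1 - w) * g v).
    2:{ replace (Ci * (z + h) * RtoC (cos v)) with (Ci * z * RtoC (cos v) + w) by (unfold w; ring). rewrite Cexp_plus. unfold w. ring. }
    assert (cb : Rabs (cos v) <= 1) by (apply Rabs_le, COS_bound).
    assert (B : forall z, Cmod (Ci * z * RtoC (cos v)) <= Cmod z).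
    { intros y. rewrite !Cmod_mult, Cmod_Ci, Cmod_R. generalize (Cmod_ge_0 y). nra. }
    assert (Bw := B h). fold w in Bw. assert (W0 := Cmod_ge_0 w).
    rewrite !Cmod_mult, Cmod_Cexp. rewrite <- (Rmult_1_r (exp (Cmod z) * exp 1 * (Cmod h * Cmod h))).
    apply Rmult_le_compat; auto using Cmod_ge_0. { apply Rmult_le_pos; [left; apply exp_pos|apply Cmod_ge_0]. }
    rewrite Rmult_assoc. apply Rmult_le_compat; [left; apply exp_pos|apply Cmod_ge_0| |].
    + apply exp_le. eapply Rle_trans; [apply Re_le_Cmod|apply B].
    + eapply Rle_trans; [apply Cexp_taylor2|]. rewrite Rmult_comm. apply Rmult_le_compat; [left; apply exp_pos|nra| |nra].
      apply exp_le, Rmax_lub; [lra|]. eapply Rle_trans; [apply Re_le_Cmod|lra].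
Qed.

Lemma sin2_bound (v : R) : 0 <= sin v * sin v <= 1.
Proof. generalize (sin2_cos2 v). unfold Rsqr. nra. Qed.

Lemma NN_holo : exists NN', forall z, 0 < Re z -> dC NN z (NN' z) /\ continuous NN' z.
Proof.
  set (S1 := fun z => CI (fun v => Cexp (Ci * z * RtoC (cos v)) * (Ci * RtoC (cos v) * RtoC (sin v * sin v))) 0 (PI / 2)).
  exists (fun z => - Ci * S1 z - - Lap (fun v => RtoC (exp v) * kw v) z). intros z Hz.
  assert (g1 : forall v, Cmod (RtoC (sin v * sin v)) <= 1) by (intros v; rewrite Cmod_R, Rabs_pos_eq; apply sin2_bound).
  assert (g2 : forall v, Cmod (Ci * RtoC (cos v) * RtoC (sin v * sin v)) <= 1).
  { intros v. rewrite !Cmod_mult, Cmod_Ci, !Cmod_R, (Rabs_pos_eq (sin v * sin v)) by apply sin2_bound.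
    assert (cb : Rabs (cos v) <= 1) by (apply Rabs_le, COS_bound). generalize (sin2_bound v) (Rabs_pos (cos v)). intros. apply Rle_trans with (1 * 1)%R; [apply Rmult_le_compat|]; lra. }
  split.
  - apply dC_minus; [|apply (Lap_dC kw 1 2 1); [apply kw_lapw|auto]].
    eapply dC_eq; [apply (dC_mult (fun _ => - Ci)); [apply dC_const|apply (cos_transform_dC (fun v => RtoC (sin v * sin v))); [intros v; cc|exact g1]]|]. unfold S1. cbv beta. ring.
  - apply cC_minus; [apply cC_mult; [apply cC_const|]|apply cC_opp].
    + eapply dC_continuous. apply (cos_transform_dC (fun v => Ci * RtoC (cos v) * RtoC (sin v * sin v))); [intros v; cc|exact g2].
    + eapply dC_continuous. apply (Lap_dC (fun v => RtoC (exp v) * kw v) _ _ _ z (lapw_exp _ _ _ _ kw_lapw) Hz).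
Qed.

(** The value is - i pi / (2 sqrt 2). *)
Definition K0 : C := Cexp (- (3 / 2) * RtoC (ln 2)) * (- 2 * Ci) * (2 * RtoC PI) / 4.
Lemma FF_value_quadrant sg xi eta : Rabs sg < 3/4 -> wedge xi eta -> 0 < Im xi -> 0 < Im eta ->
  II (FF sg xi eta) = K0 * (xi * eta) * NN ((xi * xi + eta * eta) / 2).
Proof.
  intros Hs Hw X Y. assert (Hw' := Hw). destruct Hw' as [W1 W2]. rewrite Rabs_pos_eq in W1, W2 by lra.
  set (z := (xi * xi + eta * eta) / 2).
  assert (zr : Re z = ((Re xi * Re xi - Im xi * Im xi + (Re eta * Re eta - Im eta * Im eta)) / 2)%R).
  { unfold z. replace ((xi * xi + eta * eta) / 2) with (RtoC (1/2) * (xi * xi + eta * eta)) by (rewrite <- Chalf; field). unfold Re, Im; simpl; field. }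
  assert (zi : Im z = (Re xi * Im xi + Re eta * Im eta)%R).
  { unfold z. replace ((xi * xi + eta * eta) / 2) with (RtoC (1/2) * (xi * xi + eta * eta)) by (rewrite <- Chalf; field). unfold Re, Im; simpl; field. }
  rewrite (FF_quadrant sg xi eta) by (auto; lra). rewrite <- NN_quadrant.
  - unfold K0, quad. replace (2 * z) with (xi * xi + eta * eta) by (unfold z; field).
    replace (Ci * (xi * xi + eta * eta) / 2) with (Ci * z) by (unfold z; field). field.
  - rewrite zr. nra.
  - rewrite zi. nra.
Qed.

(** The evaluation on the whole wedge, continued from the quadrant by moving the
    imaginary parts of both arguments linearly to a common positive value. *)
Lemma FF_value sg xi eta : Rabs sg < 3/4 -> wedge xi eta ->
  II (FF sg xi eta) = K0 * (xi * eta) * NN ((xi * xi + eta * eta) / 2).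
Proof.
  intros Hs [W1 W2]. set (a := Re xi) in *. set (b := Im xi) in *. set (c := Re eta) in *. set (d := Im eta) in *.
  assert (ap : 0 < a) by (generalize (Rabs_pos d); lra). assert (cp : 0 < c) by (generalize (Rabs_pos b); lra).
  (* e is the common imaginary part reached at lam = 1, m the margin in the wedge along the real path, and rho a radius such that the discs of radius 2 rho around the path keep most of that margin *)
  set (e := (Rmin a c / 2)%R). assert (ep : 0 < e) by (unfold e; generalize (Rmin_glb_lt a c 0 ap cp); lra).
  assert (ea : e < a) by (unfold e in *; generalize (Rmin_l a c); lra). assert (ec : e < c) by (unfold e in *; generalize (Rmin_r a c); lra).
  set (m := Rmin (a - Rmax (Rabs d) e) (c - Rmax (Rabs b) e)).
  assert (mp : 0 < m). { apply Rmin_glb_lt; [cut (Rmax (Rabs d) e < a); [lra|]|cut (Rmax (Rabs b) e < c); [lra|]]; apply Rmax_lub_lt; auto. }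
  assert (m1 : Rmax (Rabs d) e <= a - m) by (generalize (Rmin_l (a - Rmax (Rabs d) e) (c - Rmax (Rabs b) e)); fold m; lra).
  assert (m2 : Rmax (Rabs b) e <= c - m) by (generalize (Rmin_r (a - Rmax (Rabs d) e) (c - Rmax (Rabs b) e)); fold m; lra).
  generalize (Rmax_l (Rabs d) e) (Rmax_r (Rabs d) e) (Rmax_l (Rabs b) e) (Rmax_r (Rabs b) e). intros n1 n2 n3 n4.
  set (p := Ci * RtoC (e - b)). set (q := Ci * RtoC (e - d)).
  set (B := (Rabs (e - b) + Rabs (e - d) + 1)%R).
  assert (Bp : 1 <= B) by (unfold B; generalize (Rabs_pos (e - b)) (Rabs_pos (e - d)); lra).
  assert (pB : Cmod p <= B) by (unfold p, B; rewrite Cmod_mult, Cmod_Ci, Cmod_R; generalize (Rabs_pos (e - d)); lra).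
  assert (qB : Cmod q <= B) by (unfold q, B; rewrite Cmod_mult, Cmod_Ci, Cmod_R; generalize (Rabs_pos (e - b)); lra).
  set (rho := (m / (8 * B))%R). assert (rp : 0 < rho) by (apply Rdiv_lt_0_compat; lra).
  assert (rB : (2 * rho * B = m / 4)%R) by (unfold rho; field; lra).
  assert (near : forall u z, Cmod (z - RtoC u) <= 2 * rho ->
    let k := (Cmod (z - RtoC u) * B)%R in
    (k <= m / 4) /\ Rabs (Re (xi + z * p) - a) <= k /\ Rabs (Im (xi + z * p) - (b + u * (e - b))) <= k /\
    (Rabs (Re (eta + z * q) - c) <= k) /\ Rabs (Im (eta + z * q) - (d + u * (e - d))) <= k).
  { intros u z Hz k. assert (z0 := Cmod_ge_0 (z - RtoC u)).
    assert (kp : Cmod ((z - RtoC u) * p) <= k) by (rewrite Cmod_mult; apply Rmult_le_compat_l; auto).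
    assert (kq : Cmod ((z - RtoC u) * q) <= k) by (rewrite Cmod_mult; apply Rmult_le_compat_l; auto).
    split; [unfold k; rewrite <- rB; apply Rmult_le_compat_r; lra|].
    assert (R1 := re_le_Cmod ((z - RtoC u) * p)). assert (I1 := Im_le_Cmod ((z - RtoC u) * p)).
    assert (R2 := re_le_Cmod ((z - RtoC u) * q)). assert (I2 := Im_le_Cmod ((z - RtoC u) * q)).
    replace (Re (xi + z * p) - a)%R with (Re ((z - RtoC u) * p)) by (unfold p, a, Re; simpl; ring).
    replace (Im (xi + z * p) - (b + u * (e - b)))%R with (Im ((z - RtoC u) * p)) by (unfold p, b, Im; simpl; ring).
    replace (Re (eta + z * q) - c)%R with (Re ((z - RtoC u) * q)) by (unfold q, c, Re; simpl; ring).
    replace (Im (eta + z * q) - (d + u * (e - d)))%R with (Im ((z - RtoC u) * q)) by (unfold q, d, Im; simpl; ring).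
    repeat split; lra. }
  assert (conv : forall x u, 0 <= u <= 1 -> Rabs (x + u * (e - x)) <= Rmax (Rabs x) e).
  { intros x u Hu. replace (x + u * (e - x))%R with ((1 - u) * x + u * e)%R by ring. eapply Rle_trans; [apply Rabs_triang|].
    rewrite !Rabs_mult, (Rabs_pos_eq (1 - u)), (Rabs_pos_eq u), (Rabs_pos_eq e) by lra. generalize (Rmax_l (Rabs x) e) (Rmax_r (Rabs x) e). nra. }
  assert (BOX : forall u z, 0 <= u <= 1 -> Cmod (z - RtoC u) <= 2 * rho -> box (m / 2) (a + c + m) (a + c + m) (m / 2) (xi + z * p) (eta + z * q)).
  { intros u z Hu Hz. destruct (near u z Hz) as [k0 [k1 [k2 [k3 k4]]]]. set (k := (Cmod (z - RtoC u) * B)%R) in *.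
    assert (cb := conv b u Hu). assert (cd := conv d u Hu).
    assert (I1 : Rabs (Im (xi + z * p)) <= Rmax (Rabs b) e + k).
    { replace (Im (xi + z * p)) with ((Im (xi + z * p) - (b + u * (e - b))) + (b + u * (e - b)))%R by ring. eapply Rle_trans; [apply Rabs_triang|]. lra. }
    assert (I2 : Rabs (Im (eta + z * q)) <= Rmax (Rabs d) e + k).
    { replace (Im (eta + z * q)) with ((Im (eta + z * q) - (d + u * (e - d))) + (d + u * (e - d)))%R by ring. eapply Rle_trans; [apply Rabs_triang|]. lra. }
    apply Rabs_le_between in k1. apply Rabs_le_between in k3.
    unfold box. repeat split; lra. }
  assert (zpos : forall x y, box (m / 2) (a + c + m) (a + c + m) (m / 2) x y -> 0 < Re ((x * x + y * y) / 2)).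
  { intros x y [B1 [B2 [_ [_ [B5 B6]]]]]. replace ((x * x + y * y) / 2) with (RtoC (1/2) * (x * x + y * y)) by (rewrite <- Chalf; field).
    replace (Re (RtoC (1/2) * (x * x + y * y))) with ((Re x * Re x - Im x * Im x + (Re y * Re y - Im y * Im y)) / 2)%R by (unfold Re, Im; simpl; field).
    assert (Q : forall v, (v * v = Rabs v * Rabs v)%R) by (intros v; rewrite <- Rabs_mult, Rabs_pos_eq; nra).
    rewrite (Q (Im x)), (Q (Im y)). generalize (Rabs_pos (Im x)) (Rabs_pos (Im y)). nra. }
  destruct NN_holo as [NN' HN].
  set (x := fun z => xi + z * p). set (y := fun z => eta + z * q). set (ze := fun z => (x z * x z + y z * y z) / 2).
  set (f := fun z => II (FP sg xi eta p q z) - K0 * (x z * y z * NN (ze z))).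
  set (f' := fun z => II (FP1 sg xi eta p q z) - K0 * ((p * y z + x z * q) * NN (ze z) + x z * y z * ((p * x z + x z * p + (q * y z + y z * q)) / 2 * NN' (ze z)))).
  assert (F0 : f 0 = 0).
  { apply (vanish_along_segment f f' rho (Rmin rho (e / (2 * B)))); auto.
    - apply Rmin_glb_lt; auto. apply Rdiv_lt_0_compat; lra.
    - intros u Hu z Hz. assert (bz := BOX u z Hu ltac:(lra)).
      destruct (FP_holo sg xi eta p q (m / 2) (a + c + m) (a + c + m) (m / 2) z rho Hs ltac:(lra) ltac:(lra) ltac:(lra) rp) as [D1 D2].
      { intros h Hh. apply (BOX u); auto. replace (z + h - RtoC u) with ((z - RtoC u) + h) by ring. triangle. lra. }
      destruct (HN (ze z) (zpos _ _ bz)) as [N1 N2].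
      assert (dx := path_dC xi p z). fold x in dx. assert (dy := path_dC eta q z). fold y in dy.
      assert (dz : dC ze z ((p * x z + x z * p + (q * y z + y z * q)) / 2)).
      { unfold ze, Cdiv. eapply dC_eq; [apply dC_mult; [apply dC_plus; apply dC_mult; [exact dx|exact dx|exact dy|exact dy]|apply dC_const]|]. cbv beta. ring. }
      assert (dn := dC_comp NN ze z _ _ N1 dz). split.
      + apply dC_minus; [exact D1|]. eapply dC_eq; [apply (dC_mult (fun _ => K0)); [apply dC_const|apply dC_mult; [apply dC_mult; [exact dx|exact dy]|exact dn]]|]. cbv beta. ring.
      + assert (cx := dC_continuous _ _ _ dx). assert (cy := dC_continuous _ _ _ dy). assert (cz := dC_continuous _ _ _ dz).
        assert (cn := dC_continuous _ _ _ dn). assert (cn' : continuous (fun z => NN' (ze z)) z) by (apply (cC_comp NN' ze); auto).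
        apply cC_minus; [exact D2|]. apply cC_mult; [apply cC_const|]. apply cC_plus.
        * apply cC_mult; [|exact cn]. apply cC_plus; apply cC_mult; try apply cC_const; auto.
        * apply cC_mult; [apply cC_mult; auto|]. apply cC_mult; [|exact cn']. unfold Cdiv. apply cC_mult; [|apply cC_const].
          apply cC_plus; apply cC_plus; apply cC_mult; try apply cC_const; auto.
    - intros z Hz. assert (z1 : Cmod (z - 1) < rho) by (eapply Rlt_le_trans; [exact Hz|apply Rmin_l]).
      assert (z2 : Cmod (z - 1) < e / (2 * B)) by (eapply Rlt_le_trans; [exact Hz|apply Rmin_r]).
      assert (bz := BOX 1%R z ltac:(lra) ltac:(lra)).
      destruct (near 1%R z ltac:(lra)) as [_ [_ [k2 [_ k4]]]].
      assert (ke : Cmod (z - 1) * B <= e / 2). { replace (e / 2)%R with (e / (2 * B) * B)%R by (field; lra). apply Rmult_le_compat_r; lra. }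
      apply Rabs_le_between in k2. apply Rabs_le_between in k4.
      unfold f, FP. fold (x z) (y z). change (II (fun t => FF sg (x z) (y z) t)) with (II (FF sg (x z) (y z))). rewrite FF_value_quadrant; auto.
      + unfold ze. ring.
      + destruct bz as [_ [_ [_ [_ [B5 B6]]]]]. unfold wedge, x, y. split; lra.
      + unfold x. lra. + unfold y. lra. }
  unfold f, FP, ze, x, y in F0.
  replace (xi + 0 * p) with xi in F0 by ring. replace (eta + 0 * q) with eta in F0 by ring.
  change (II (fun t => FF sg xi eta t)) with (II (FF sg xi eta)) in F0.
  rewrite <- (Cplus_0_r (K0 * (xi * eta) * NN ((xi * xi + eta * eta) / 2))), <- F0. ring.
Qed.

(** * The sum over both rays *)

Lemma SS_conj z : Cconj (SS (Cconj z)) = SS (- z).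
Proof.
  unfold SS. rewrite <- CI_conj by (intros v; cc). apply CI_ext. intros v _. rewrite Cmult_conj, Cexp_conj, Cconj_R. f_equal. f_equal. ceq; ring.
Qed.

Lemma Lap_kw_conj z : 0 < Re z -> Cconj (Lap kw (Cconj z)) = Lap kw z.
Proof.
  intros Hz. assert (Hc : 0 < Re (Cconj z)) by exact Hz.
  destruct (Lap_dom _ _ _ _ _ kw_lapw Hc) as [M D]. unfold Lap. rewrite <- (II_conj _ _ D). apply II_ext. intros v.
  unfold kw. rewrite Cmult_conj, !Cexp_conj, Cconj_R. f_equal. f_equal. ceq; ring.
Qed.

Lemma exp_ln2_32 : Cexp (- (3 / 2) * RtoC (ln 2)) = / (2 * RtoC (sqrt 2)).
Proof.
  rewrite C32, <- RtoC_opp, <- RtoC_mult, Cexp_R, <- RtoC_mult, <- RtoC_inv.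
  - f_equal. replace (- (3 / 2) * ln 2)%R with (- (ln 2 + ln 2 / 2))%R by field. rewrite exp_Ropp, exp_plus, exp_ln by lra. do 2 f_equal.
    symmetry. apply sqrt_lem_1; [lra|left; apply exp_pos|]. rewrite exp_half_sqr. apply exp_ln. lra.
  - generalize Rlt_sqrt2_0. lra.
Qed.

Lemma K0_value : K0 = - (Ci * RtoC PI / (2 * RtoC (sqrt 2))).
Proof.
  unfold K0. rewrite exp_ln2_32. field. apply RtoC_neq. generalize Rlt_sqrt2_0. lra.
Qed.

(** The integrals Lap kw of the two rays are conjugate with opposite signs and cancel; the
    integrals SS combine to the even part. *)
Lemma two_ray_value sg xi eta : Rabs sg < 3/4 -> wedge xi eta ->
  II (FF sg xi eta) + Cconj (II (FF sg (Cconj xi) (Cconj eta))) =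
  - (RtoC PI / (2 * RtoC (sqrt 2))) * (xi * eta) * (SS ((xi * xi + eta * eta) / 2) + SS (- ((xi * xi + eta * eta) / 2))).
Proof.
  intros Hs Hw. assert (Hw' : wedge (Cconj xi) (Cconj eta)). { destruct Hw. split; simpl; rewrite Rabs_Ropp; auto. }
  rewrite !FF_value by auto. set (z := (xi * xi + eta * eta) / 2).
  assert (Ez : (Cconj xi * Cconj xi + Cconj eta * Cconj eta) / 2 = Cconj z).
  { unfold z, Cdiv. rewrite Cmult_conj, Cplus_conj, !Cmult_conj. f_equal. rewrite <- RtoC_inv by lra. rewrite Cconj_R. reflexivity. }
  assert (zr : 0 < Re z).
  { unfold z. destruct Hw as [W1 W2]. replace ((xi * xi + eta * eta) / 2) with (RtoC (1/2) * (xi * xi + eta * eta)) by (rewrite <- Chalf; field).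
    replace (Re (RtoC (1/2) * (xi * xi + eta * eta))) with ((Re xi * Re xi - Im xi * Im xi + (Re eta * Re eta - Im eta * Im eta)) / 2)%R by (unfold Re, Im; simpl; field).
    assert (Q : forall v, (v * v = Rabs v * Rabs v)%R) by (intros v; rewrite <- Rabs_mult, Rabs_pos_eq; nra).
    rewrite (Q (Im xi)), (Q (Im eta)). generalize (Rabs_pos (Im xi)) (Rabs_pos (Im eta)). nra. }
  rewrite Ez, !Cmult_conj, !Cconj_conj. unfold NN. rewrite Cminus_conj, Cmult_conj, SS_conj, Lap_kw_conj by auto.
  assert (n2 : RtoC (sqrt 2) <> 0) by (apply RtoC_neq; generalize Rlt_sqrt2_0; lra).
  assert (KC : Cconj K0 = - K0). { rewrite K0_value. rewrite <- RtoC_mult. unfold Cdiv. rewrite <- RtoC_inv by (generalize Rlt_sqrt2_0; lra). ceq; ring. }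
  rewrite KC. replace (Cconj (- Ci)) with Ci by (ceq; ring). 
  transitivity (- (Ci * K0) * (xi * eta) * (SS z + SS (- z))); [ring|]. do 2 f_equal. rewrite K0_value.
  transitivity ((Ci * Ci) * (RtoC PI / (2 * RtoC (sqrt 2)))); [field; auto|]. replace (Ci * Ci) with (- (1)) by (ceq; ring). ring.
Qed.

Theorem corollary9 (xi eta sigma : C)
  (hxi : Rabs (Im eta) < Re xi)
  (heta : Rabs (Im xi) < Re eta)
  (hsigma : Rabs (Re sigma) < 3 / 4) :
  let F := fun s : C =>
    Gamma (3 / 4 - s) * Gamma (3 / 4 + s) *
      (pcfD (2 * s - 1 / 2) ((1 - Ci) * xi)
         * pcfD (- 2 * s - 1 / 2) ((1 - Ci) * eta)
       + pcfD (2 * s - 1 / 2) ((1 + Ci) * xi)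
         * pcfD (- 2 * s - 1 / 2) ((1 + Ci) * eta)) in
  ex_vertical_integral F sigma /\
  BesselJ 1 (1 / 2 * (xi ^ 2 + eta ^ 2)) =
    Ci * RtoC (sqrt 2) * (xi ^ 2 + eta ^ 2) / (RtoC PI ^ 2 * xi * eta)
      * vertical_integral F sigma.
Proof.
  intros F. set (sg := Re sigma) in *. assert (Hw : wedge xi eta) by (split; assumption).
  assert (Hw' : wedge (Cconj xi) (Cconj eta)). { destruct Hw. split; simpl; rewrite Rabs_Ropp; auto. }
  assert (xn : xi <> 0). { intros E. generalize (Rabs_pos (Im eta)). rewrite E in hxi. simpl in hxi. lra. }
  assert (yn : eta <> 0). { intros E. generalize (Rabs_pos (Im xi)). rewrite E in heta. simpl in heta. lra. }
  set (t0 := Im sigma).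
  set (G := fun t => FF sg xi eta t + Cconj (FF sg (Cconj xi) (Cconj eta) (- t))).
  assert (FE : forall t, F (sigma + Ci * RtoC t) * Ci = Ci * G (t + t0)%R).
  { intros t. set (s := vline sg (t + t0)). assert (S := vline_strip sg (t + t0) hsigma). fold s in S. assert (S' := strip_opp _ S).
    replace (sigma + Ci * RtoC t) with s by (unfold s, vline, sg, t0; ceq; unfold Re, Im; simpl; ring).
    rewrite Cmult_comm. f_equal. unfold F.
    replace (3 / 4 + s) with (3 / 4 - - s) by ring. replace (- 2 * s - 1 / 2) with (2 * - s - 1 / 2) by ring.
    transitivity (Gamma (3 / 4 - s) * pcfD (2 * s - 1 / 2) ((1 - Ci) * xi) * (Gamma (3 / 4 - - s) * pcfD (2 * - s - 1 / 2) ((1 - Ci) * eta)) +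
      Gamma (3 / 4 - s) * pcfD (2 * s - 1 / 2) ((1 + Ci) * xi) * (Gamma (3 / 4 - - s) * pcfD (2 * - s - 1 / 2) ((1 + Ci) * eta))); [ring|].
    rewrite !AA_pcfD, !AA_conj_pcfD by auto. unfold G, FF. fold s. rewrite Cmult_conj.
    replace (vline sg (- (t + t0))) with (Cconj s) by (unfold s, vline; ceq; ring).
    replace (Cconj (- s)) with (- Cconj s) by (ceq; ring). reflexivity. }
  destruct (wedge_box _ _ Hw) as [c [R0 [Y0 [d [Hc [Hd [HY0 B]]]]]]].
  destruct (FF_dom_unif sg c R0 Y0 d hsigma Hc Hd HY0) as [K [Kp HK]]. destruct (HK xi eta B) as [D1 _]. clear HK.
  destruct (wedge_box _ _ Hw') as [c' [R0' [Y0' [d' [Hc' [Hd' [HY0' B']]]]]]].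
  destruct (FF_dom_unif sg c' R0' Y0' d' hsigma Hc' Hd' HY0') as [K' [Kp' HK']]. destruct (HK' _ _ B') as [D2 _]. clear HK'.
  set (V := II (FF sg xi eta) + Cconj (II (FF sg (Cconj xi) (Cconj eta)))).
  assert (IG : is_II G V).
  { assert (I1 := dom_is_II _ _ D1). assert (I2 := is_II_conj _ _ (fun t => cC_compR _ (fun t => - t)%R t (cR_opp (fun t => t) t (continuous_id t)) (proj1 D2 (- t)%R)) (is_II_reflect _ _ (proj1 D2) (dom_is_II _ _ D2))).
    apply (is_RInt_gen_plus (V := C_R_CompleteNormedModule) _ _ _ _ I1 I2). }
  assert (cG : cont G).
  { intros t. apply cC_plus; [apply D1|apply cC_conj]. apply (cC_compR (FF sg (Cconj xi) (Cconj eta)) (fun t => - t)%R); [cc|apply D2]. }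
  assert (IF : is_II (fun t => F (sigma + Ci * RtoC t) * Ci) (Ci * V)).
  { apply (is_II_ext (fun t => Ci * G (t + t0)%R)); [intros t; symmetry; apply FE|].
    apply is_II_scal; [|apply is_II_shift; auto]. intros t. apply (cC_compR G (fun t => t + t0)%R); [cc|apply cG]. }
  split; [exists (Ci * V); exact IF|].
  unfold vertical_integral. change (RInt_gen _ _ _) with (II (fun t => F (sigma + Ci * RtoC t) * Ci)).
  rewrite (is_II_unique _ _ IF). unfold V. rewrite two_ray_value by auto.
  replace (1 / 2 * (xi ^ 2 + eta ^ 2)) with ((xi * xi + eta * eta) / 2) by (simpl; field).
  rewrite BesselJ1_SS. set (z := (xi * xi + eta * eta) / 2). set (T := SS z + SS (- z)).
  assert (n2 : RtoC (sqrt 2) <> 0) by (apply RtoC_neq; generalize Rlt_sqrt2_0; lra).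
  assert (np : RtoC PI <> 0) by (apply RtoC_neq; generalize PI_RGT_0; lra).
  replace (xi ^ 2 + eta ^ 2) with (2 * z) by (unfold z; simpl; field).
  transitivity (- (Ci * Ci) * (z / RtoC PI) * T); [replace (Ci * Ci) with (- (1)) by (ceq; ring); ring|].
  simpl Cpow. field. auto.
Qed.
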